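(* Let $B,\Omega,K,\Psi,\boldsymbol\lambda,\boldsymbol\tau,\boldsymbol\zeta,\mathcal{S},\mathcal{C},\mathcal{H},\mathcal{M},A$ be as in the context, and let $(\boldsymbol\kappa_n)$ be vectors of nonnegative integers with $\boldsymbol\kappa_n=\boldsymbol\lambda n+O(1)$. Then for every $r\ge1$ there exist coefficients $a_{k,n}$ ($0\le k\le r-1$), each a function of $\boldsymbol\kappa_n-\boldsymbol\lambda n$ (hence bounded in $n$), such that \[ [\mathbf{z}^{\boldsymbol\kappa_n}]\frac{A(\mathbf{z})B(\mathbf{z})^n}{\prod_{j=1}^d(1-z_j)}=\frac{B(\boldsymbol\zeta)^n}{\boldsymbol\zeta^{\boldsymbol\kappa_n}}\cdot\frac{1}{n^{|\mathcal{S}|/2}}\left(\sum_{k=0}^{r-1}a_{k,n}n^{-k/2}+O(n^{-r/2})\right). \] Moreover $a_{0,n}=a_0$ does not depend on $n$ and \[ a_0=\frac{A(\boldsymbol\zeta)}{\prod_{j\in\mathcal{S}}(1-\zeta_j)}\cdot\frac{1}{\sqrt{(2\pi)^d\det(\mathcal{H})}}\int_{(0,+\infty)^{|\mathcal{C}|}}e^{-\mathbf{u}^T\mathcal{M}\mathbf{u}/2}\,d\mathbf{u}, \] and if $\mathcal{C}=\emptyset$ then $a_{k,n}=0$ for every odd $k$.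
   Context: $B(z_1,\dots,z_d)$ is a power series with nonnegative coefficients, of full rank (the real span of $\{\mathbf{n}-\mathbf{m}:\mathbf{n},\mathbf{m}\in S_B\}$ has dimension $d$, where $S_B=\{\mathbf{n}:[\mathbf{z}^{\mathbf{n}}]B\neq0\}$), aperiodic (there is no $q\ge2$, nonnegative integers $p_1,\dots,p_d$ not all divisible by $q$, and integer $r$ with $\{\mathbf{p}^T\mathbf{n}:\mathbf{n}\in S_B\}\subseteq r+q\mathbb{Z}_{\ge0}$), convergent on a neighborhood $\Omega$ of $\mathbf{0}$. $K(\mathbf{t})=\log B(e^{t_1},\dots,e^{t_d})$, $\Psi=\{\mathbf{t}\in\mathbb{R}^d:e^{\mathbf{t}}\in\Omega\}$. $\boldsymbol\lambda$ is a vector of positive reals such that $K(\mathbf{t})-\boldsymbol\lambda^T\mathbf{t}$ does not tend to its infimum on the boundary of $\Psi$; $\boldsymbol\tau$ is the unique point of $\Psi$ where it is minimal and $\boldsymbol\zeta=e^{\boldsymbol\tau}$. It is assumed $\zeta_j\le1$ for all $j$; $\mathcal{S}=\{j:\zeta_j<1\}$, $\mathcal{C}=\{j:\zeta_j=1\}$. $\mathcal{H}$ is the Hessian of $K$ at $\boldsymbol\tau$ and $\mathcal{M}$ the submatrix of $\mathcal{H}^{-1}$ with rows and columns in $\mathcal{C}$. $A(\mathbf{z})$ is a power series analytic on the torus $\{|z_j|=\zeta_j\}$ with $A(\boldsymbol\zeta)\neq0$. Notation $\boldsymbol\zeta^{\boldsymbol\kappa}=\prod_j\zeta_j^{\kappa_j}$;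 empty integral equals $1$. *)

(* Defs.v *)
From HB Require Import structures.
From mathcomp Require Import all_boot all_order all_algebra.
From mathcomp Require Import all_classical all_reals all_analysis.
From mathcomp Require Export complex.

Set Implicit Arguments.
Unset Strict Implicit.
Unset Printing Implicit Defensive.

Import Order.TTheory GRing.Theory Num.Theory.
Import numFieldNormedType.Exports.
Local Open Scope classical_set_scope.
Local Open Scope ring_scope.

Section Defs.
Variable R : realType.

Definition mi (d : nat) := {ffun 'I_d -> nat}.

Definition mzero d : mi d := [ffun _ => 0%N].
Definition msub d (p m : mi d) : mi d := [ffun i => (m i - p i)%N].

Definition msum_le (V : nmodType) d (m : mi d) (F : mi d -> V) : V :=
  \sum_(p : {ffun 'I_d -> 'I_((\max_(i < d) m i).+1)} | [forall i, (p i <= m i)%N])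
     F [ffun i => nat_of_ord (p i)].

(* formal power series in d variables = coefficient functions;
   Cauchy product, powers, and the coefficient extraction
   [z^kappa] F(z) / prod_j (1 - z_j) = sum_{m <= kappa} [z^m] F(z) *)
Definition ps_mul (V : pzRingType) d (F G : mi d -> V) : mi d -> V :=
  fun m => msum_le m (fun p => F p * G (msub p m)).
Definition ps_one (V : pzRingType) d : mi d -> V :=
  fun m => if m == mzero d then 1 else 0.
Definition ps_pow (V : pzRingType) d (G : mi d -> V) (n : nat) : mi d -> V :=
  iter n (ps_mul G) (@ps_one V d).
Definition coef_div_prod (V : pzRingType) d (F : mi d -> V) (k : mi d) : V :=
  msum_le k F.

Definition mono d (x : 'rV[R]_d) (m : mi d) : R := \prod_(i < d) x 0 i ^+ m i.

Definition ps_val_nn d (b : mi d -> R) (x : 'rV[R]_d) : R :=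
  fine (\esum_(m in [set: mi d]) (b m * mono x m)%:E).

Definition ps_val_C d (a : mi d -> R[i]) (x : 'rV[R]_d) : R[i] :=
  limn ((fun N : nat =>
    \sum_(p : {ffun 'I_d -> 'I_N.+1})
       a [ffun i => nat_of_ord (p i)] * real_complex R (mono x [ffun i => nat_of_ord (p i)]))
     : nat -> R[i]^o).

Definition full_rank d (b : mi d -> R) : Prop :=
  exists P Q : 'I_d -> mi d,
    (forall k, b (P k) != 0 /\ b (Q k) != 0) /\
    \rank (\matrix_(k < d, i < d) ((P k i)%:R - (Q k i)%:R : R)) = d.

Definition aperiodic d (b : mi d -> R) : Prop :=
  ~ exists (q : nat) (p : 'I_d -> nat) (r : int),
      [/\ (2 <= q)%N, ~~ [forall i, (q %| p i)%N] &
          forall n : mi d, b n != 0 ->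
            exists k : nat, ((\sum_(i < d) p i * n i)%N)%:Z = r + (q * k)%N%:Z].

Definition converges_on d (b : mi d -> R) (Om : set 'rV[R]_d) : Prop :=
  forall x, Om x ->
    (\esum_(m in [set: mi d]) (b m * \prod_(i < d) `|x 0 i| ^+ m i)%:E < +oo)%E.

Definition vexp d (t : 'rV[R]_d) : 'rV[R]_d := map_mx expR t.

Definition Kfun d (b : mi d -> R) (t : 'rV[R]_d) : R := ln (ps_val_nn b (vexp t)).

Definition Psi d (Om : set 'rV[R]_d) : set 'rV[R]_d := [set t | Om (vexp t)].

Definition dotv d (u v : 'rV[R]_d) : R := \sum_(i < d) u 0 i * v 0 i.

Definition partial d (j : 'I_d) (f : 'rV[R]_d -> R) (t : 'rV[R]_d) : R :=
  derive1 (fun s : R => f (t + s *: delta_mx 0 j)) 0.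
Definition hessian d (f : 'rV[R]_d -> R) (t : 'rV[R]_d) : 'M[R]_d :=
  \matrix_(i, j) partial i (partial j f) t.

Definition no_inf_on_boundary d (phi : 'rV[R]_d -> R) (P : set 'rV[R]_d) : Prop :=
  ~ exists (s : nat -> 'rV[R]_d) (p : 'rV[R]_d),
      [/\ forall k, P (s k), s @ \oo --> p, (closure P `\` interior P) p &
          (fun k => (phi (s k))%:E) @ \oo --> ereal_inf [set (phi t)%:E | t in P]].

(* A analytic on the torus |z_j| = zeta_j: absolutely convergent on a
   polydisc of radii zeta_j + eps *)
Definition analytic_on_torus d (a : mi d -> R[i]) (zeta : 'rV[R]_d) : Prop :=
  exists2 eps : R, 0 < eps &
    (\esum_(m in [set: mi d])
        (complex.Re `|a m| * \prod_(i < d) (zeta 0 i + eps) ^+ m i)%:E < +oo)%E.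

Definition subsq d (M : 'M[R]_d) (C : {set 'I_d}) : 'M[R]_#|C| :=
  \matrix_(i, j) M (enum_val i) (enum_val j).

Definition quadf n (M : 'M[R]_n) (u : 'I_n -> R) : R :=
  \sum_(i < n) \sum_(j < n) u i * M i j * u j.

Definition ocons n (x : R) (u : 'I_n -> R) : 'I_n.+1 -> R :=
  fun i => match unlift ord0 i with Some j => u j | None => x end.

(* integral over (0,+oo)^n, as iterated Lebesgue integrals
   (equal to the product-measure integral by Tonelli for f >= 0);
   for n = 0 it is f evaluated at the empty vector *)
Fixpoint int_pos_orthant (n : nat) : (('I_n -> R) -> \bar R) -> \bar R :=
  match n with
  | 0%N => fun f => f (fun _ => 0)
  | m.+1 => fun f : ('I_m.+1 -> R) -> \bar R =>
      (\int[lebesgue_measure]_(x in `]0%R : R, +oo[%classic)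
          int_pos_orthant (fun u => f (ocons x u)))%E
  end.

End Defs.

(* Main.v *)
(** Put zeta = e^tau and tilt the coefficients of B to the probability weights
    p_m = b_m zeta^m / B(zeta); their mean is lambda because tau is a minimum,
    and their covariance is the Hessian H. Let u = n^{-1/2} and let v be the
    indicator of C. Cauchy's formula on the torus |z_j| = zeta_j e^{-u v_j},
    which passes beside the poles z_j = 1, turns the coefficient into an integral
    over the box |s_j| <= pi / u of A psi^n e^{-delta.w} / prod_j (1 - zeta_j e^{w_j}),
    where w = u y, y = -v + i s, delta = kappa - lambda n and
    psi(w) = sum_m p_m e^{(m - lambda).w}. Near the origin
    psi^n = e^{yHy/2} (1 + rho)^n with rho = O(u^3 |y|^3), and every factor expands
    in powers of u, the k-th coefficient being polynomially bounded in y and of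
    parity (-1)^k; away from the origin |psi| stays below a constant < 1 by full
    rank and aperiodicity. Integrating term by term gives the expansion, and the
    odd terms vanish by symmetry when there is no pole. In the leading term
    1 / (-y_j) = int_0^oo e^{x y_j} dx turns the poles into the orthant integral
    of the Gaussian with matrix H^{-1}.

    Infinite sums and integrals over R^d are limits of finite sums along one
    fixed ultrafilter: such a limit exists for every bounded sequence and is a
    ring morphism, so neither convergence nor measurability has to be proved. *)

Require Import Defs.
From HB Require Import structures.
From mathcomp Require Import all_boot all_order all_algebra.
From mathcomp Require Import all_classical all_reals all_analysis.
From mathcomp Require Import complex ring lra.
Import Order.TTheory GRing.Theory Num.Theory.
Import numFieldNormedType.Exports.
Local Open Scope classical_set_scope.

Local Open Scope ring_scope.
Local Open Scope complex_scope.

Set Implicit Arguments.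
Unset Strict Implicit.
Unset Printing Implicit Defensive.


(** The poles are passed at distance of order u = n^{-1/2}, the scale of the fluctuations
    themselves. Then Re y_j = -1 on C, so |1/(1 - e^{w_j})| is at most 2/u, while psi^n changes only
    by a bounded factor near the origin. Each pole contributes u^{-1}, the substitution w = u y
    contributes u^d, and u^{d - |C|} = n^{-|S|/2}. The coefficients must be fixed before [kappa], so
    every expansion carries delta as an argument [dl], with bounds uniform over |dl_j| <= b. A limit
    of grid sums along an ultrafilter is not known to be a Lebesgue integral. Domination by one
    integrable weight gives it linearity and exchange with series. A fundamental theorem in one
    variable, and the vanishing of the integral of a derivative, give the contour shifts, the shears
    and the Gaussian constant. The Lebesgue integral of the statement meets the grid integral only
    through antiderivatives in one real variable. *)

(** * The modulus of complex numbers with values in the reals *)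

Section ComplexModulus.
Variable R : realType.
Notation C := R[i].
Implicit Types z w : C.

(** The norm of [R[i]] takes its values in [R[i]], whose order is partial; estimates are carried out
    in [R]. *)
Definition cn z : R := complex.Re `|z|.

Lemma cnE z : `|z| = (cn z)%:C.
Proof. by rewrite /cn normc_def. Qed.

Lemma cn_ge0 z : 0 <= cn z.
Proof. by rewrite -ler0c -cnE normr_ge0. Qed.

Lemma cn_real (x : R) : cn x%:C = `|x|.
Proof. by rewrite /cn normc_def /= expr0n /= addr0 sqrtr_sqr. Qed.

Lemma cn0 : cn 0 = 0. Proof. by rewrite (cn_real 0) normr0. Qed.
Lemma cn1 : cn 1 = 1. Proof. by rewrite (cn_real 1) normr1. Qed.

Lemma cn_eq0 z : (cn z == 0) = (z == 0).
Proof. by rewrite -(inj_eq (@complexI R)) -cnE normr_eq0. Qed.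

Lemma cn_gt0 z : (0 < cn z) = (z != 0).
Proof. by rewrite lt_def cn_eq0 cn_ge0 andbT. Qed.

Lemma cnD z w : cn (z + w) <= cn z + cn w.
Proof. by rewrite -lecR rmorphD /= -!cnE ler_normD. Qed.

Lemma cnN z : cn (- z) = cn z.
Proof. by apply: complexI; rewrite -!cnE normrN. Qed.

Lemma cnB z w : cn (z - w) <= cn z + cn w.
Proof. by rewrite -(cnN w) cnD. Qed.

Lemma cnBC z w : cn (z - w) = cn (w - z).
Proof. by rewrite -cnN opprB. Qed.

Lemma cnM z w : cn (z * w) = cn z * cn w.
Proof. by apply: complexI; rewrite rmorphM /= -!cnE normrM. Qed.

Lemma cnV z : cn z^-1 = (cn z)^-1.
Proof. by apply: complexI; rewrite fmorphV /= -!cnE normfV. Qed.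

Lemma cnX z n : cn (z ^+ n) = cn z ^+ n.
Proof. by elim: n => [|n IH]; rewrite ?cn1 // !exprS cnM IH. Qed.

Lemma cn_sum (I : Type) (r : seq I) (P : pred I) (F : I -> C) :
  cn (\sum_(i <- r | P i) F i) <= \sum_(i <- r | P i) cn (F i).
Proof.
elim/big_rec2: _ => [|i x y _ IH]; first by rewrite cn0.
by apply: le_trans (cnD _ _) _; rewrite lerD2l.
Qed.

Lemma cn_prod (I : Type) (r : seq I) (P : pred I) (F : I -> C) :
  cn (\prod_(i <- r | P i) F i) = \prod_(i <- r | P i) cn (F i).
Proof. exact: (big_morph _ cnM cn1). Qed.

Lemma cn_sub z w : cn z - cn w <= cn (z - w).
Proof. by rewrite lerBlDr; have := cnD (z - w) w; rewrite subrK. Qed.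

Lemma cn_Re z : `|complex.Re z| <= cn z.
Proof.
case: z => x y; rewrite /cn normc_def /= -sqrtr_sqr ler_wsqrtr //.
by rewrite lerDl sqr_ge0.
Qed.

Lemma cn_Im z : `|complex.Im z| <= cn z.
Proof.
case: z => x y; rewrite /cn normc_def /= -sqrtr_sqr ler_wsqrtr //.
by rewrite lerDr sqr_ge0.
Qed.

Lemma cn_conj z : cn z^* = cn z.
Proof. by rewrite /cn normcJ. Qed.

Lemma cn_i : cn 'i = 1.
Proof. by rewrite /cn normc_def /= expr0n add0r expr1n sqrtr1. Qed.

Lemma ReD z w : complex.Re (z + w) = complex.Re z + complex.Re w.
Proof. by case: z; case: w. Qed.
Lemma ReN z : complex.Re (- z) = - complex.Re z.
Proof. by case: z. Qed.
Lemma ImD z w : complex.Im (z + w) = complex.Im z + complex.Im w.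
Proof. by case: z; case: w. Qed.
Lemma ImN z : complex.Im (- z) = - complex.Im z.
Proof. by case: z. Qed.
Lemma Re_realM (x : R) z : complex.Re (x%:C * z) = x * complex.Re z.
Proof. by case: z => a b /=; rewrite mul0r subr0. Qed.
Lemma Im_realM (x : R) z : complex.Im (x%:C * z) = x * complex.Im z.
Proof. by case: z => a b /=; rewrite mul0r addr0. Qed.
Lemma Re_iM (x : R) : complex.Re ('i * x%:C : C) = 0.
Proof. by rewrite mulrC Re_realM mulr0. Qed.

Lemma Im_iM (x : R) : complex.Im ('i * x%:C : C) = x.
Proof. by rewrite mulrC Im_realM mulr1. Qed.

Lemma Re_sum (I : Type) (r : seq I) (P : pred I) (F : I -> C) :
  complex.Re (\sum_(i <- r | P i) F i) = \sum_(i <- r | P i) complex.Re (F i).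
Proof. exact: (big_morph _ ReD). Qed.
Lemma complex_eq z w : complex.Re z = complex.Re w -> complex.Im z = complex.Im w -> z = w.
Proof. by case: z => a b; case: w => c d /= -> ->. Qed.

Lemma cn_le_ReIm z : cn z <= `|complex.Re z| + `|complex.Im z|.
Proof.
rewrite {1}[z]complexE; apply: le_trans (cnD _ _) _.
by rewrite cnM cn_i mul1r !cn_real.
Qed.

Lemma cn_sqr z : cn z ^+ 2 = complex.Re (z * z^*).
Proof. by rewrite -sqr_normc cnE -rmorphXn. Qed.

Lemma cn_sqrE z : cn z ^+ 2 = complex.Re z ^+ 2 + complex.Im z ^+ 2.
Proof. by rewrite cn_sqr; case: z => x y /=; ring. Qed.

End ComplexModulus.

(** * Limits of bounded sequences along an ultrafilter *)

Section UltraLimit.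
Variable R : realType.
Notation C := R[i].

(** It refines the eventual filter, so a sequence that converges in the usual sense keeps its
    limit. *)
Definition ultra : set_system nat :=
  projT1 (cid (ultraFilterLemma (@eventually_filter))).

Instance ultra_ultra : UltraFilter ultra.
Proof. by rewrite /ultra; case: cid => G []. Qed.

Lemma ultra_eventually (P : set nat) (N : nat) :
  (forall n, (N <= n)%N -> P n) -> ultra P.
Proof.
move=> h; rewrite /ultra; case: cid => G [GU] /= sub; apply: sub.
by exists N => // n /= /h.
Qed.

(** The ultrafilter limit as a Dedekind cut: the levels that lie below [u] on a set of the
    ultrafilter. *)
Definition usup (u : nat -> R) : R := sup [set x | ultra [set n | x <= u n]].
Definition culim (u : nat -> C) : C :=
  usup (fun n => complex.Re (u n)) +i* usup (fun n => complex.Im (u n)).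
Definition ucvg (u : nat -> C) (l : C) :=
  forall e : R, 0 < e -> ultra [set n | cn (u n - l) < e].
Definition cbounded (T : Type) (u : T -> C) := exists K : R, forall n, cn (u n) <= K.

Lemma usupP (u : nat -> R) (K : R) : (forall n, `|u n| <= K) ->
  forall e, 0 < e -> ultra [set n | `|u n - usup u| < e].
Proof.
move=> uK e e0; set A := [set x | ultra [set n | x <= u n]].
have A0 : A (- K).
  by apply: (@ultra_eventually _ 0) => n _ /=; have := uK n; rewrite ler_norml => /andP[].
have AK x : A x -> x <= K.
  move=> Ax; have [n /=] := filter_ex Ax => /le_trans; apply.
  by have := uK n; rewrite ler_norml => /andP[].
have hs : has_sup A by split; [exists (- K)|exists K].
have [x Ax xs] := sup_adherent e0 hs.
have h1 : ultra [set n | usup u - e < u n].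
  by apply: filterS Ax => n /=; apply: lt_le_trans.
have h2 : ultra [set n | u n < usup u + e].
  (* The ultrafilter contains this set or its complement; the complement would put [usup u + e]
     among the levels below [u]. *)
  have [|] := in_ultra_setVsetC [set n | u n < usup u + e] ultra_ultra => // h.
  have : A (usup u + e) by apply: filterS h => n /= /negP; rewrite -leNgt.
  by move=> /(ub_le_sup hs.2); rewrite gerDl leNgt e0.
apply: filterS (filterI h1 h2) => n /= [a b].
by rewrite ltr_norml; apply/andP; split; lra.
Qed.

Lemma culimP (u : nat -> C) : cbounded u -> ucvg u (culim u).
Proof.
move=> [K uK] e e0; have e2 : 0 < e / 2 by lra.
have h1 := @usupP (fun n => complex.Re (u n)) K (fun n => le_trans (cn_Re _) (uK n)) _ e2.
have h2 := @usupP (fun n => complex.Im (u n)) K (fun n => le_trans (cn_Im _) (uK n)) _ e2.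
apply: filterS (filterI h1 h2) => n /= [a b].
by apply: le_lt_trans (cn_le_ReIm _) _; rewrite ReD ImD ReN ImN /=; lra.
Qed.

Lemma ucvg_unique (u : nat -> C) l l' : ucvg u l -> ucvg u l' -> l = l'.
Proof.
move=> h h'; apply/eqP; rewrite -subr_eq0 -cn_eq0 eq_le cn_ge0 andbT leNgt.
apply/negP => p; set e := cn (l - l') in p; have e2 : 0 < e / 2 by lra.
have [n /= [a b]] := filter_ex (filterI (h _ e2) (h' _ e2)).
have : e <= cn (u n - l) + cn (u n - l').
  by rewrite addrC /e (_ : l - l' = (u n - l') - (u n - l)) ?cnB //; ring.
by lra.
Qed.

Lemma ucvg_lim (u : nat -> C) l :
  (forall e, 0 < e -> exists N, forall n, (N <= n)%N -> cn (u n - l) < e) -> ucvg u l.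
Proof. by move=> h e /h [N hN]; exact: (@ultra_eventually _ N). Qed.

Lemma ucvg_cst l : ucvg (fun=> l) l.
Proof. by apply: ucvg_lim => e e0; exists 0%N => n _; rewrite subrr cn0. Qed.

Lemma ucvgD (u v : nat -> C) l m : ucvg u l -> ucvg v m -> ucvg (fun n => u n + v n) (l + m).
Proof.
move=> h k e e0; have e2 : 0 < e / 2 by lra.
apply: filterS (filterI (h _ e2) (k _ e2)) => n /= [a b].
rewrite (_ : _ - _ = (u n - l) + (v n - m)); last by ring.
by apply: le_lt_trans (cnD _ _) _; lra.
Qed.

Lemma ucvgM (u v : nat -> C) l m : ucvg u l -> ucvg v m -> ucvg (fun n => u n * v n) (l * m).
Proof.
move=> h k e e0; have l0 := cn_ge0 l; have m0 := cn_ge0 m.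
pose e1 := e / (2 * (1 + cn m)); pose e2 := e / (2 * (cn l + 1)).
have e10 : 0 < e1 by rewrite /e1 divr_gt0 //; lra.
have e20 : 0 < e2 by rewrite /e2 divr_gt0 //; lra.
apply: filterS (filterI (filterI (h _ e10) (h _ ltr01)) (k _ e20)) => n /= [[a a'] b].
rewrite (_ : _ - _ = (u n - l) * m + u n * (v n - m)); last by ring.
apply: le_lt_trans (cnD _ _) _; rewrite !cnM.
have un : cn (u n) <= cn l + 1 by have := cn_sub (u n) l; lra.
have p1 : cn (u n - l) * cn m <= e1 * cn m by rewrite ler_wpM2r // ltW.
have p2 : cn (u n) * cn (v n - m) <= (cn l + 1) * cn (v n - m).
  by rewrite ler_wpM2r ?cn_ge0.
have p3 : (cn l + 1) * cn (v n - m) < (cn l + 1) * e2 by rewrite ltr_pM2l //; lra.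
have p4 : (cn l + 1) * e2 = e / 2 by rewrite /e2; field; lra.
have p5 : e1 * cn m <= e / 2.
  rewrite /e1 mulrAC ler_pdivrMr; last by lra.
  by nra.
by lra.
Qed.

Lemma ucvgZ (c : C) (u : nat -> C) l : ucvg u l -> ucvg (fun n => c * u n) (c * l).
Proof. by move=> h; apply: ucvgM h; apply: ucvg_cst. Qed.

Lemma ucvg_ext (u v : nat -> C) l : (forall n, u n = v n) -> ucvg u l -> ucvg v l.
Proof. by move=> /funext ->. Qed.

Lemma ucvg_norm_le (u : nat -> C) l (K : R) N :
  ucvg u l -> (forall n, (N <= n)%N -> cn (u n) <= K) -> cn l <= K.
Proof.
move=> h uK; rewrite leNgt; apply/negP => lt; have e0 : 0 < cn l - K by lra.
have [n /= [a b]] := filter_ex (filterI (h _ e0) (ultra_eventually uK)).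
have := cn_sub l (u n); rewrite cnBC; lra.
Qed.

Lemma ucvg_conj (u : nat -> C) l : ucvg u l -> ucvg (fun n => (u n)^*) l^*.
Proof.
by move=> h e /h; apply: filterS => n /=; rewrite -rmorphB /= cn_conj.
Qed.

End UltraLimit.

(** * The complex exponential and its Taylor remainder *)

Section ComplexExponential.
Variable R : realType.
Notation C := R[i].
Implicit Types z w : C.

(* Locked: otherwise unification unfolds cexp and sees its product. *)
Definition cexp z : C :=
  locked ((expR (complex.Re z))%:C * (cos (complex.Im z) +i* sin (complex.Im z))).

Lemma cexpE z : cexp z =
  (expR (complex.Re z))%:C * (cos (complex.Im z) +i* sin (complex.Im z)).
Proof. by rewrite /cexp -lock. Qed.

Lemma cexpD z w : cexp (z + w) = cexp z * cexp w.
Proof.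
rewrite !cexpE ReD ImD expRD cosD sinD; apply: complex_eq; rewrite /=; ring.
Qed.

Lemma cexp_real (x : R) : cexp x%:C = (expR x)%:C.
Proof. by rewrite !cexpE /= cos0 sin0 -[1 +i* 0]/(1 : C) mulr1. Qed.

Lemma cexp0 : cexp 0 = 1.
Proof. by rewrite (cexp_real 0) expR0. Qed.

Lemma cn_cexp z : cn (cexp z) = expR (complex.Re z).
Proof.
rewrite !cexpE cnM cn_real ger0_norm ?expR_ge0 //.
by rewrite /cn normc_def /= cos2Dsin2 sqrtr1 mulr1.
Qed.

Lemma cexp_neq0 z : cexp z != 0.
Proof. by rewrite -cn_gt0 cn_cexp expR_gt0. Qed.

Lemma cexpN z : cexp (- z) = (cexp z)^-1.
Proof.
apply: (mulfI (cexp_neq0 z)); rewrite -cexpD subrr cexp0 divff //.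
exact: cexp_neq0.
Qed.

Lemma cexp_sum (I : Type) (r : seq I) (P : pred I) (F : I -> C) :
  cexp (\sum_(i <- r | P i) F i) = \prod_(i <- r | P i) cexp (F i).
Proof. exact: (big_morph _ cexpD cexp0). Qed.

Lemma cexpM_natl n z : cexp (n%:R * z) = cexp z ^+ n.
Proof.
elim: n => [|n IH]; first by rewrite mul0r cexp0.
by rewrite -natr1 mulrDl mul1r cexpD IH exprSr.
Qed.

Lemma cexp_conj z : cexp z^* = (cexp z)^*.
Proof.
rewrite !cexpE; case: z => x y /=; rewrite cosN sinN.
by apply: complex_eq; rewrite /=; ring.
Qed.

Lemma ndecr_is_derive (f f' : R -> R) : (forall x : R, is_derive x 1 f (f' x)) ->
  (forall x, 0 < x -> 0 <= f' x) -> forall x, 0 <= x -> f 0 <= f x.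
Proof.
move=> fd f0 x x0; apply: (@ger0_derive1_ndecry R f 0) => //.
- move=> y; rewrite in_itv /= andbT => y0.
  by rewrite derive1E derive_val f0.
- apply: continuous_subspaceT => y; apply: differentiable_continuous.
  exact/derivable1_diffP.
Qed.

Let expl (r : nat) z : C := cexp z - \sum_(k < r) z ^+ k / (k`!)%:R.

(** Along the ray t z, differentiation lowers the order of the remainder by one and multiplies the
    test vector [o] by [z]. The real functions t -> Re (o * remainder) are thus closed under
    differentiation, which permits an induction on the order. *)
Let expl_derive (o z : C) (r : nat) (t : R) :
  is_derive t 1 (fun t : R => complex.Re (o * expl r.+1 (t%:C * z)))
    (complex.Re (o * z * expl r (t%:C * z))).
Proof.
pose P r (o : C) (t : R) := \sum_(k < r) (complex.Re (o * z ^+ k) / (k`!)%:R) * t ^+ k.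
have splitE r' o' t' : complex.Re (o' * expl r' (t'%:C * z)) =
    expR (t' * complex.Re z) * (complex.Re o' * cos (t' * complex.Im z)
      - complex.Im o' * sin (t' * complex.Im z)) - P r' o' t'.
  rewrite mulrBr ReD ReN; congr (_ - _).
    by rewrite !cexpE Re_realM Im_realM; case: (o') => a b /=; ring.
  rewrite mulr_sumr Re_sum; apply: eq_bigr => k _.
  rewrite exprMn -rmorphXn /= -[(k`!)%:R](rmorph_nat (real_complex R)) -fmorphV /=.
  rewrite (_ : o' * ((t' ^+ k)%:C * z ^+ k * (k`!%:R^-1)%:C) =
    (t' ^+ k / (k`!)%:R)%:C * (o' * z ^+ k)); last first.
    by rewrite rmorphM /=; ring.
  by rewrite Re_realM; ring.
rewrite (_ : (fun t => _) = (fun t' : R => expR (t' * complex.Re z) * (complex.Re o * cos (t' * complex.Im z)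
      - complex.Im o * sin (t' * complex.Im z)) - P r.+1 o t')); last first.
  by apply: funext => t'; rewrite splitE.
rewrite splitE.
have dP : is_derive t 1 (fun t => P r.+1 o t) (P r (o * z) t).
  have dX k : is_derive t (1 : R) (fun t : R => complex.Re (o * z ^+ k) / (k`!)%:R * t ^+ k)
      (complex.Re (o * z ^+ k) / (k`!)%:R * (k%:R * t ^+ k.-1)).
    set c := _ / _; rewrite (_ : (fun t => _) = c *: ((@id R) ^+ k)); last first.
      by apply: funext => t'; rewrite scalrfctE exprfctE.
    apply: is_derive_eq; rewrite /GRing.scale /= /GRing.scale /=.
    by rewrite mulr1.
  rewrite (_ : (fun t => _) = \sum_(k < r.+1) (fun t => (complex.Re (o * z ^+ k) / (k`!)%:R) * t ^+ k)); last first.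
    by apply: funext => t'; rewrite fct_sumE.
  have dS := is_derive_sum (fun k : 'I_r.+1 => dX k).
  apply: (DeriveDef (@ex_derive _ _ _ _ _ _ _ dS)); rewrite derive_val.
  rewrite big_ord_recl /P /= mul0r mulr0 add0r.
  apply: eq_bigr => k _; rewrite /bump /= add1n /= factS natrM exprS mulrA.
  have k0 : (k.+1)%:R != 0 :> R by rewrite pnatr_eq0.
  have f0 : (k`!)%:R != 0 :> R by rewrite pnatr_eq0 -lt0n fact_gt0.
  by field; rewrite f0 nat1r.
have d1 : is_derive t (1 : R) (fun t' : R => expR (t' * complex.Re z) *
   (complex.Re o * cos (t' * complex.Im z) - complex.Im o * sin (t' * complex.Im z)))
   (expR (t * complex.Re z) * (complex.Re (o * z) * cos (t * complex.Im z)
      - complex.Im (o * z) * sin (t * complex.Im z))).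
  apply: is_derive_eq; rewrite /GRing.scale /= /GRing.scale /=.
  by case: (o) (z) => a b [x y] /=; ring.
exact: is_deriveB d1 dP.
Qed.

(** Induction on [r]: the bound minus the function vanishes at t = 0, and its derivative is
    nonnegative by the previous order. *)
Let expl_bound (z : C) (r : nat) (o : C) (t : R) : 0 <= t ->
  complex.Re (o * expl r (t%:C * z)) <= cn o * cn z ^+ r * t ^+ r * expR (t * cn z).
Proof.
elim: r o t => [|r IH] o t t0.
  rewrite /expl big_ord0 subr0 expr0 !mulr1.
  apply: le_trans (ler_norm _) _; apply: le_trans (cn_Re _) _.
  rewrite cnM cn_cexp Re_realM ler_wpM2l ?cn_ge0 // ler_expR ler_wpM2l //.
  exact: le_trans (ler_norm _) (cn_Re _).
pose D t := cn o * cn z ^+ r.+1 * t ^+ r.+1 * expR (t * cn z)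
  - complex.Re (o * expl r.+1 (t%:C * z)).
have D0 : D 0 = 0.
  have z0 : (0 : R)%:C * z = 0 by rewrite (rmorph0 (real_complex R)) mul0r.
  rewrite /D /expl big_ord_recl z0 cexp0 expr0 divr1 big1 => [|i _]; last first.
    by rewrite exprS !mul0r.
  rewrite (_ : o * _ = 0); last by rewrite addr0 subrr mulr0.
  by rewrite expr0n /= mulr0 mul0r subr0.
suff : D 0 <= D t by rewrite D0 subr_ge0.
apply: (@ndecr_is_derive D (fun t => cn o * cn z ^+ r.+1 * (r.+1%:R * t ^+ r + t ^+ r.+1 * cn z) * expR (t * cn z)
   - complex.Re (o * z * expl r (t%:C * z)))) => // x.
  apply: is_deriveB (expl_derive o z r x).
  pose c := cn o * cn z ^+ r.+1; rewrite -/c.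
  have dX : is_derive x (1 : R) (fun t : R => t ^+ r.+1) (r.+1%:R * x ^+ r).
    rewrite (_ : (fun t => _) = (@id R) ^+ r.+1); last by rewrite exprfctE.
    by apply: is_derive_eq; rewrite /GRing.scale /= mulr1.
  have dE : is_derive x (1 : R) (fun t : R => expR (t * cn z)) (expR (x * cn z) * cn z).
    by apply: is_derive_eq; rewrite /GRing.scale /= /GRing.scale /=; ring.
  rewrite (_ : (fun t => _) = (fun t => c * (t ^+ r.+1 * expR (t * cn z)))); last first.
    by apply: funext => t'; rewrite mulrA.
  apply: (is_derive_eq (is_deriveZ c (is_deriveM dX dE))).
  by rewrite /GRing.scale /=; ring.
move=> x0; rewrite subr_ge0; apply: le_trans (IH _ _ (ltW x0)) _.
rewrite cnM ler_wpM2r ?expR_ge0 // exprS.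
have a0 := cn_ge0 o; have b0 := cn_ge0 z; have b1 : 0 <= cn z ^+ r by rewrite exprn_ge0.
have c0 : 0 <= x ^+ r by rewrite exprn_ge0 // ltW.
have -> : cn o * cn z * cn z ^+ r * x ^+ r = cn o * (cn z * cn z ^+ r) * x ^+ r by ring.
rewrite ler_wpM2l ?mulr_ge0 // -natr1 mulrDl mul1r -addrA addrC -addrA lerDl.
by rewrite !addr_ge0 ?mulr_ge0 // ?exprn_ge0 // ltW.
Qed.

Lemma cexp_taylor (r : nat) z :
  cn (cexp z - \sum_(k < r) z ^+ k / (k`!)%:R) <= cn z ^+ r * expR (cn z).
Proof.
set F := _ - _; have [F0|F0] := ltP 0 (cn F); last first.
  by apply: le_trans F0 _; rewrite mulr_ge0 ?expR_ge0 // exprn_ge0 ?cn_ge0.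
(* Tested against its own conjugate, the remainder has its squared modulus as real part; one factor
   then cancels. *)
have := @expl_bound z r F^* 1 ler01.
rewrite (rmorph1 (real_complex R)) !mul1r [F^* * _]mulrC -[expl r z]/F -cn_sqr.
rewrite cn_conj expr1n mulr1 expr2 -mulrA.
by rewrite ler_pM2l.
Qed.

End ComplexExponential.


(** * Integrals as limits of grid sums *)

Section GridIntegral.
Variable R : realType.
Notation C := R[i].

(* The midpoints of the cells make the grid symmetric under s |-> - s. *)
Definition gpt (N : nat) (p : nat) : R := (p%:R + 2^-1) / N.+1%:R - N.+1%:R.
Definition gsize (N : nat) : nat := (2 * N.+1 ^ 2)%N.

(** An integrable envelope. Domination by a multiple of the product [W] takes the place of
    integrability, because the grid sums of [W] are bounded uniformly in the mesh. *)
Definition w1 (x : R) : R := (1 + `|x|) ^- 2.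
Definition W d (s : 'I_d -> R) : R := \prod_(j < d) w1 (s j).

Definition rsum d (N : nat) (g : ('I_d -> R) -> C) : C :=
  (N.+1%:R ^- d)%:C * \sum_(p : {ffun 'I_d -> 'I_(gsize N)}) g (fun j => gpt N (p j)).
Definition integ d (g : ('I_d -> R) -> C) : C := culim (fun N => rsum N g).

Definition rsum1 (N : nat) (g : R -> C) : C :=
  (N.+1%:R^-1)%:C * \sum_(p < gsize N) g (gpt N p).
Definition integ1 (g : R -> C) : C := culim (fun N => rsum1 N g).

Definition dominated d (K : R) (g : ('I_d -> R) -> C) := forall s, cn (g s) <= K * W s.

Lemma w1_gt0 x : 0 < w1 x.
Proof. by rewrite /w1 invr_gt0 exprn_gt0 // ltr_pwDl. Qed.

Lemma W_gt0 d (s : 'I_d -> R) : 0 < W s.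
Proof. by apply: prodr_gt0 => j _; apply: w1_gt0. Qed.

Lemma dominated_ge0 d K (g : ('I_d -> R) -> C) : dominated K g -> 0 <= K.
Proof.
move=> /(_ (fun=> 0)) /(le_trans (cn_ge0 _)).
by rewrite pmulr_lge0 // W_gt0.
Qed.

Lemma gpt_S N p : gpt N p.+1 = gpt N p + N.+1%:R^-1.
Proof. by rewrite /gpt -natr1; field; rewrite nat1r pnatr_eq0. Qed.

(** A bounded primitive of [w1]; its telescoping sums control the grid sums of [w1]. *)
Definition bump1 (x : R) : R := x / (1 + `|x|).

Lemma bump1_le1 x : `|bump1 x| <= 1.
Proof.
rewrite /bump1 normrM normfV (ger0_norm (_ : 0 <= 1 + `|x|)) ?addr_ge0 //.
by rewrite ler_pdivrMr ?ltr_pwDl // mul1r lerDr.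
Qed.

(** A step of length at most 1 multiplies 1 + |x| by at most 2, whence the factor 2 in front of the
    increment of the primitive. *)
Lemma w1_bump1 x h : 0 < h -> h <= 1 -> h * w1 x <= 2 * (bump1 (x + h) - bump1 x).
Proof.
move=> h0 h1; rewrite /w1 /bump1.
have p1 : 0 < 1 + `|x| by rewrite ltr_pwDl.
have p2 : 0 < 1 + `|x + h| by rewrite ltr_pwDl.
rewrite -subr_ge0.
rewrite (_ : _ - _ = (2 * ((x + h) * (1 + `|x|) - x * (1 + `|x + h|)) * (1 + `|x|) - h * (1 + `|x + h|))
   / ((1 + `|x|) ^+ 2 * (1 + `|x + h|))); last first.
  by field; rewrite !gt_eqF.
apply: divr_ge0; last by rewrite ltW // mulr_gt0 // exprn_gt0.
have [x0|x0] := lerP 0 x; have [y0|y0] := lerP 0 (x + h).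
- by rewrite !ger0_norm //; nra.
- lra.
- rewrite ltr0_norm // ger0_norm //; nra.
- rewrite !ltr0_norm //; nra.
Qed.

Lemma telescope_grid (T : zmodType) N (G : R -> T) :
  \sum_(p < gsize N) (G (gpt N p + N.+1%:R^-1) - G (gpt N p)) =
  G (gpt N (gsize N)) - G (gpt N 0).
Proof.
under eq_bigr do rewrite -gpt_S.
by rewrite -(big_mkord xpredT (fun p => G (gpt N p.+1) - G (gpt N p))) telescope_sumr.
Qed.

Lemma invS_gt0 N : 0 < N.+1%:R^-1 :> R. Proof. by rewrite invr_gt0. Qed.
Lemma invS_le1 N : N.+1%:R^-1 <= 1 :> R.
Proof. by rewrite invf_le1 // ler1n. Qed.

Lemma sum_w1 N : N.+1%:R^-1 * \sum_(p < gsize N) w1 (gpt N p) <= 4.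
Proof.
rewrite mulr_sumr; apply: le_trans (_ : \sum_(p < gsize N)
  2 * (bump1 (gpt N p + N.+1%:R^-1) - bump1 (gpt N p)) <= _).
  by apply: ler_sum => p _; apply: w1_bump1; rewrite ?invS_gt0 ?invS_le1.
rewrite -mulr_sumr telescope_grid.
have := bump1_le1 (gpt N (gsize N)); have := bump1_le1 (gpt N 0).
by rewrite !ler_norml => /andP[a b] /andP[e f]; lra.
Qed.

Lemma sum_prod_grid (V : comPzRingType) d N (f : 'I_d -> R -> V) :
  \sum_(p : {ffun 'I_d -> 'I_(gsize N)}) \prod_(j < d) f j (gpt N (p j)) =
  \prod_(j < d) \sum_(p < gsize N) f j (gpt N p).
Proof. by rewrite bigA_distr_bigA. Qed.

Lemma sum_W d N :
  N.+1%:R ^- d * \sum_(p : {ffun 'I_d -> 'I_(gsize N)}) W (fun j => gpt N (p j)) <= 4 ^+ d.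
Proof.
rewrite /W (sum_prod_grid N (fun=> w1)) prodr_const card_ord -exprVn -exprMn.
rewrite lerXn2r ?nnegrE ?sum_w1 //; apply: mulr_ge0; first exact/ltW/invS_gt0.
by apply: sumr_ge0 => p _; rewrite ltW ?w1_gt0.
Qed.

Lemma rsum_bound d K (g : ('I_d -> R) -> C) N : dominated K g -> cn (rsum N g) <= K * 4 ^+ d.
Proof.
move=> gK; rewrite /rsum cnM cn_real ger0_norm ?invr_ge0 ?exprn_ge0 //.
apply: le_trans (_ : K * (N.+1%:R ^- d * \sum_(p : {ffun 'I_d -> 'I_(gsize N)}) W (fun j => gpt N (p j))) <= _).
  rewrite mulrCA ler_wpM2l ?invr_ge0 ?exprn_ge0 //.
  apply: le_trans (cn_sum _ _ _) _; rewrite mulr_sumr.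
  by apply: ler_sum => p _.
by rewrite ler_wpM2l ?sum_W // (dominated_ge0 gK).
Qed.

Lemma integ_ucvg d K (g : ('I_d -> R) -> C) : dominated K g -> ucvg (fun N => rsum N g) (integ g).
Proof. by move=> gK; apply: culimP; exists (K * 4 ^+ d) => N; apply: rsum_bound. Qed.

Lemma integ_unique d K (g : ('I_d -> R) -> C) l : dominated K g ->
  ucvg (fun N => rsum N g) l -> integ g = l.
Proof. by move=> /integ_ucvg h k; apply: ucvg_unique h k. Qed.

Lemma integ_bound d K (g : ('I_d -> R) -> C) : dominated K g -> cn (integ g) <= K * 4 ^+ d.
Proof.
move=> gK; apply: (@ucvg_norm_le _ _ _ _ 0 (integ_ucvg gK)) => N _.
exact: rsum_bound.
Qed.

Lemma dominatedD d K L (f g : ('I_d -> R) -> C) :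
  dominated K f -> dominated L g -> dominated (K + L) (fun s => f s + g s).
Proof.
move=> fK gL s; apply: le_trans (cnD _ _) _; rewrite mulrDl.
by rewrite lerD.
Qed.

Lemma dominatedZ d K (c : C) (g : ('I_d -> R) -> C) :
  dominated K g -> dominated (cn c * K) (fun s => c * g s).
Proof. by move=> gK s; rewrite cnM -mulrA ler_wpM2l ?cn_ge0. Qed.

Lemma dominated_le d K L (f : ('I_d -> R) -> C) : dominated K f -> K <= L -> dominated L f.
Proof. by move=> fK KL s; apply: le_trans (fK s) _; rewrite ler_wpM2r // ltW // W_gt0. Qed.

Lemma integD d K L (f g : ('I_d -> R) -> C) : dominated K f -> dominated L g ->
  integ (fun s => f s + g s) = integ f + integ g.
Proof.
move=> fK gL; apply: (integ_unique (dominatedD fK gL)).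
apply: ucvg_ext (ucvgD (integ_ucvg fK) (integ_ucvg gL)) => N.
by rewrite /rsum -mulrDr big_split.
Qed.

Lemma integZ d K (c : C) (g : ('I_d -> R) -> C) : dominated K g ->
  integ (fun s => c * g s) = c * integ g.
Proof.
move=> gK; apply: (integ_unique (dominatedZ c gK)).
apply: ucvg_ext (ucvgZ c (integ_ucvg gK)) => N.
by rewrite /rsum mulrCA mulr_sumr.
Qed.

Lemma integB d K L (f g : ('I_d -> R) -> C) : dominated K f -> dominated L g ->
  integ (fun s => f s - g s) = integ f - integ g.
Proof.
move=> fK gL; have := integD fK (dominatedZ (-1) gL).
rewrite (integZ (-1) gL) mulN1r => <-; congr integ; apply: funext => s.
by rewrite mulN1r.
Qed.

Lemma integ_sum d r (F : nat -> ('I_d -> R) -> C) : (forall k, (k < r)%N -> exists K, dominated K (F k)) ->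
  integ (fun s => \sum_(k < r) F k s) = \sum_(k < r) integ (F k) /\
  exists K, dominated K (fun s => \sum_(k < r) F k s).
Proof.
elim: r => [|r IH] h.
  have d0 : dominated 0 (fun s : 'I_d -> R => \sum_(k < 0) F k s).
    by move=> s; rewrite big_ord0 cn0 mul0r.
  split; last by exists 0.
  rewrite big_ord0; have := integ_bound d0; rewrite mul0r => b.
  by apply/eqP; rewrite -cn_eq0 eq_le b cn_ge0.
have [|e [K dK]] := IH; first by move=> k kr; apply: h; rewrite ltnS ltnW.
have [L dL] := h r (ltnSn r).
rewrite big_ord_recr /= -e -(integD dK dL) (_ : (fun s => _) = (fun s => \sum_(i < r) F i s + F r s)).
  by split=> //; exists (K + L); apply: dominatedD.
by apply: funext => s; rewrite big_ord_recr.
Qed.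

Lemma gpt_rev N (p : 'I_(gsize N)) : gpt N (rev_ord p) = - gpt N p.
Proof.
rewrite /gpt /= natrB; last by rewrite ltn_ord.
rewrite /gsize natrM natrX -natr1.
by field; rewrite nat1r pnatr_eq0.
Qed.

Lemma integ_opp d (g : ('I_d -> R) -> C) : integ (fun s => g (fun j => - s j)) = integ g.
Proof.
congr culim; apply: funext => N; rewrite /rsum; congr (_ * _).
pose r (p : {ffun 'I_d -> 'I_(gsize N)}) := [ffun j => rev_ord (p j)].
have rK : involutive r by move=> p; apply/ffunP => j; rewrite !ffunE rev_ordK.
rewrite [RHS](reindex_inj (inv_inj rK)); apply: eq_bigr => p _.
by congr g; apply: funext => j; rewrite ffunE gpt_rev.
Qed.

Lemma integ_conj d K (g : ('I_d -> R) -> C) : dominated K g ->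
  integ (fun s => (g s)^*) = (integ g)^*.
Proof.
move=> gK; have gK' : dominated K (fun s => (g s)^*) by move=> s; rewrite cn_conj.
apply: (integ_unique gK'); apply: ucvg_ext (ucvg_conj (integ_ucvg gK)) => N.
by rewrite /rsum rmorphM rmorph_sum /= oppr0.
Qed.

Lemma rsum1_bound K (g : R -> C) N : (forall x, cn (g x) <= K * w1 x) -> cn (rsum1 N g) <= K * 4.
Proof.
move=> gK; have K0 : 0 <= K.
  by have := le_trans (cn_ge0 _) (gK 0); rewrite pmulr_lge0 // w1_gt0.
rewrite /rsum1 cnM cn_real ger0_norm ?invr_ge0 //.
apply: le_trans (_ : K * (N.+1%:R^-1 * \sum_(p < gsize N) w1 (gpt N p)) <= _).
  rewrite mulrCA ler_wpM2l ?invr_ge0 //.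
  by apply: le_trans (cn_sum _ _ _) _; rewrite mulr_sumr; apply: ler_sum.
by rewrite ler_wpM2l ?sum_w1.
Qed.

Lemma integ1_ucvg K (g : R -> C) : (forall x, cn (g x) <= K * w1 x) ->
  ucvg (fun N => rsum1 N g) (integ1 g).
Proof. by move=> gK; apply: culimP; exists (K * 4) => N; apply: rsum1_bound. Qed.

Lemma ucvg_prod d (u : 'I_d -> nat -> C) (l : 'I_d -> C) : (forall j, ucvg (u j) (l j)) ->
  ucvg (fun N => \prod_(j < d) u j N) (\prod_(j < d) l j).
Proof.
elim: d u l => [|d IH] u l h.
  by rewrite big_ord0; apply: ucvg_ext (ucvg_cst _) => N; rewrite big_ord0.
rewrite big_ord_recl; apply: ucvg_ext (ucvgM (h ord0) (IH _ _ (fun j => h (lift ord0 j)))) => N.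
by rewrite big_ord_recl.
Qed.

Lemma integ_prod d (K : 'I_d -> R) (f : 'I_d -> R -> C) :
  (forall j x, cn (f j x) <= K j * w1 x) ->
  integ (fun s => \prod_(j < d) f j (s j)) = \prod_(j < d) integ1 (f j).
Proof.
move=> fK; have fd : dominated (\prod_j K j) (fun s => \prod_(j < d) f j (s j)).
  move=> s; rewrite cn_prod /W -big_split /=; apply: ler_prod => j _.
  by rewrite cn_ge0 fK.
apply: (integ_unique fd).
apply: ucvg_ext (ucvg_prod (fun j => integ1_ucvg (fK j))) => N.
rewrite /rsum /rsum1 big_split /= prodr_const card_ord -sum_prod_grid.
by rewrite -exprVn rmorphXn.
Qed.

Lemma natS_large (X : R) : exists N, forall n, (N <= n)%N -> X <= n%:R.
Proof.
have [N hN] : exists N : nat, X <= N%:R.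
  exists (Num.truncn `|X|).+1; apply: le_trans (ler_norm _) _.
  by apply: ltW; rewrite -truncn_le_nat.
by exists N => n Nn; apply: le_trans hN _; rewrite ler_nat.
Qed.

Lemma small_invS (A e : R) : 0 < e -> exists N, forall n, (N <= n)%N -> A / n.+1%:R < e.
Proof.
move=> e0; have [N hN] := natS_large (A / e); exists N => n Nn.
rewrite ltr_pdivrMr // mulrC -ltr_pdivrMr //.
by apply: le_lt_trans (hN n Nn) _; rewrite ltr_nat.
Qed.

(** The error of each cell is charged to the increment of a bounded function [Phi]. The charges
    telescope, so the total error is at most 2 B times the mesh. No continuity of [g] is involved,
    which admits truncated integrands. *)
Lemma integ1_FTC K (G g : R -> C) (Phi : R -> R) (B : R) (L L' : C) :
  (forall x, cn (g x) <= K * w1 x) ->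
  (forall x h, 0 < h -> h <= 1 -> cn (G (x + h) - G x - h%:C * g x) <= h * (Phi (x + h) - Phi x)) ->
  (forall x, `|Phi x| <= B) ->
  (forall e, 0 < e -> exists X, forall x, X <= x -> cn (G x - L) < e /\ cn (G (- x) - L') < e) ->
  integ1 g = L - L'.
Proof.
move=> gK hG PB lim; apply: (ucvg_unique (integ1_ucvg gK)); apply: ucvg_lim => e e0.
have e3 : 0 < e / 3 by rewrite divr_gt0.
have [X hX] := lim _ e3; have [N1 hN1] := natS_large (X + 1).
have [N2 hN2] := small_invS (2 * B) e3.
exists (maxn N1 N2) => n; rewrite geq_max => /andP[n1 n2].
set h : R := n.+1%:R^-1; have h0 : 0 < h := invS_gt0 n; have h1 : h <= 1 := invS_le1 n.
have nh : n.+1%:R = h^-1 by rewrite /h invrK.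
have big : X + 1 <= n.+1%:R by apply: le_trans (hN1 n n1) _; rewrite ler_nat.
have eR : gpt n (gsize n) = n.+1%:R + h / 2.
  by rewrite /gpt /gsize natrM natrX -/h nh; field; rewrite gt_eqF.
have eL : gpt n 0 = - (n.+1%:R - h / 2).
  by rewrite /gpt add0r -/h nh; field; rewrite gt_eqF.
rewrite (_ : rsum1 n g - (L - L') = (G (gpt n (gsize n)) - L) - (G (gpt n 0) - L') -
   \sum_(p < gsize n) (G (gpt n p + h) - G (gpt n p) - h%:C * g (gpt n p))); last first.
  rewrite sumrB telescope_grid /rsum1 mulr_sumr.
  ring.
apply: le_lt_trans (cnB _ _) _; apply: le_lt_trans (lerD (cnB _ _) (cn_sum _ _ _)) _.
have s3 : \sum_(p < gsize n) cn (G (gpt n p + h) - G (gpt n p) - h%:C * g (gpt n p)) < e / 3.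
  apply: le_lt_trans (_ : \sum_(p < gsize n) h * (Phi (gpt n p + h) - Phi (gpt n p)) < _).
    by apply: ler_sum => p _; apply: hG.
  rewrite -mulr_sumr telescope_grid; apply: le_lt_trans _ (hN2 n n2).
  rewrite -/h mulrC; apply: ler_wpM2r; first exact: ltW.
  have := PB (gpt n (gsize n)); have := PB (gpt n 0).
  by rewrite !ler_norml => /andP[? ?] /andP[? ?]; lra.
have [s1 _] := hX (gpt n (gsize n)) ltac:(rewrite eR; lra).
have [_ s2] := hX (n.+1%:R - h / 2) ltac:(lra).
by rewrite eL; lra.
Qed.

Definition sadd d (s : 'I_d -> R) (k : 'I_d) (h : R) : 'I_d -> R :=
  fun j => s j + (if j == k then h else 0).

Lemma W_sadd d (s : 'I_d -> R) k h : 0 <= h -> h <= 1 -> W (sadd s k h) <= 4 * W s.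
Proof.
move=> h0 h1; rewrite /W (bigD1 k) //= [X in _ <= _ * X](bigD1 k) //= mulrA.
rewrite [X in _ * X <= _](_ : _ = \prod_(i < d | i != k) w1 (s i)); last first.
  by apply: eq_bigr => j jk; rewrite /sadd (negbTE jk) addr0.
rewrite ler_wpM2r //; first by apply: prodr_ge0 => j _; rewrite ltW ?w1_gt0.
rewrite /sadd eqxx /w1 -[4](_ : 2^-1 ^- 2 = _); last by field.
rewrite -invfM -exprMn lef_pV2 ?posrE ?exprn_gt0 ?mulr_gt0 ?ltr_pwDl //.
rewrite lerXn2r ?nnegrE ?mulr_ge0 ?addr_ge0 //.
have := ler_normD (s k + h) (- h); rewrite addrK normrN (ger0_norm h0).
have := normr_ge0 (s k + h); lra.
Qed.

(* Integration by parts: translating the grid by one step in the direction k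
   is a cyclic shift of the index, up to the boundary, where g is small. *)
Lemma integ_deriv d (k : 'I_d) K (g g' : ('I_d -> R) -> C) :
  (forall s, cn (g s) <= K * (w1 (s k) * W s)) -> dominated K g' ->
  (forall s h, 0 < h -> h <= 1 ->
     cn (g (sadd s k h) - g s - h%:C * g' s) <= K * h ^+ 2 * W s) ->
  integ g' = 0.
Proof.
move=> gK g'K hg; apply: (integ_unique g'K).
have K0 := dominated_ge0 g'K.
apply: ucvg_lim => e e0; have [N0 hN] := small_invS (6 * K * 4 ^+ d) e0.
exists N0 => n /hN; rewrite subr0; apply: le_lt_trans.
set h : R := n.+1%:R^-1; have h0 : 0 < h := invS_gt0 n; have h1 : h <= 1 := invS_le1 n.
have nh : n.+1%:R = h^-1 by rewrite /h invrK.
pose x (p : {ffun 'I_d -> 'I_(gsize n)}) : 'I_d -> R := fun j => gpt n (p j).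
pose sg (p : {ffun 'I_d -> 'I_(gsize n)}) := [ffun j => if j == k then ordS (p j) else p j].
have sgI : injective sg.
  move=> p q /ffunP e'; apply/ffunP => j; have := e' j; rewrite !ffunE.
  by case: ifP => // _; apply: ordS_inj.
have step p : cn (g (sadd (x p) k h) - g (x (sg p))) <= K * h ^+ 2 * (4 * W (x p) + W (x (sg p))).
  have [/eqP last|nl] := boolP ((p k).+1 == gsize n); last first.
    rewrite (_ : sadd (x p) k h = x (sg p)) ?subrr ?cn0.
      by rewrite mulr_ge0 ?addr_ge0 ?mulr_ge0 ?exprn_ge0 // ltW // W_gt0.
    apply: funext => j; rewrite /x /sadd /sg !ffunE; case: eqP => [->|_]; last by rewrite addr0.
    rewrite /= modn_small ?gpt_S // ltn_neqAle nl /=.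
    by rewrite ltn_ord.
  (* At either end of the grid |s_k| is about 1/h, so the extra weight [w1 (s k)] assumed for [g] is
     at most h^2. *)
  have wb (s : 'I_d -> R) : n.+1%:R <= 1 + `|s k| -> cn (g s) <= K * h ^+ 2 * W s.
    move=> sn; apply: le_trans (gK s) _; rewrite -mulrA ler_wpM2l //.
    rewrite ler_wpM2r ?(ltW (W_gt0 _)) // /w1 /h exprVn lef_pV2 ?posrE ?exprn_gt0 ?ltr_pwDl //.
    by rewrite lerXn2r ?nnegrE ?addr_ge0.
  apply: le_trans (cnB _ _) _; rewrite mulrDr; apply: lerD.
    apply: le_trans (wb _ _) _.
      rewrite /sadd eqxx /x -gpt_S last /gpt /gsize natrM natrX -/h nh.
      apply: le_trans (_ : 1 + ((2 * h^-1 ^+ 2 + 2^-1) * h - h^-1) <= _); last by rewrite lerD2l ler_norm.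
      rewrite [X in 1 + X](_ : _ = h^-1 + h / 2); last by field; rewrite gt_eqF.
      by lra.
    by rewrite ler_wpM2l ?W_sadd ?mulr_ge0 ?exprn_ge0 // ltW.
  apply: wb; rewrite /x /sg ffunE eqxx /= last modnn /gpt add0r -/h nh.
  apply: le_trans (_ : 1 - (2^-1 * h - h^-1) <= _); first by lra.
  by rewrite lerD2l -normrN ler_norm.
pose S := \sum_p W (x p).
have SS : \sum_p W (x (sg p)) = S by rewrite /S [RHS](reindex_inj sgI).
have S4 : h ^+ d * S <= 4 ^+ d by rewrite -[h ^+ d]/(n.+1%:R^-1 ^+ d) exprVn; apply: sum_W.
(* As [sg] is a permutation, the sums of g over [x (sg p)] and over [x p] agree. So h times the sum
   of [g'] equals two error sums of order h^2 per grid point, and division by h leaves O(h). *)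
have -> : rsum n g' = ((h ^+ d)%:C * (h^-1)%:C) * (\sum_p (g (sadd (x p) k h) - g (x (sg p)))
   - \sum_p (g (sadd (x p) k h) - g (x p) - h%:C * g' (x p))).
  rewrite !sumrB [\sum_p g (x (sg p))](_ : _ = \sum_p g (x p)); last by rewrite [RHS](reindex_inj sgI).
  rewrite -mulr_sumr /rsum -[N in (N ^- d)%:C]/n.+1%:R.
  rewrite -[(n.+1%:R ^- d)](_ : h ^+ d = _); last by rewrite /h exprVn.
  rewrite [X in _ = _ * X](_ : _ = h%:C * \sum_i g' (x i)); last by ring.
  rewrite -mulrA; congr (_ * _).
  by rewrite mulrA -rmorphM /= mulVf ?gt_eqF // mul1r.
rewrite cnM -rmorphM /= cn_real ger0_norm ?mulr_ge0 ?invr_ge0 ?exprn_ge0 ?(ltW h0) //.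
apply: le_trans (_ : h ^+ d * h^-1 * (K * h ^+ 2 * (4 * S + S) + K * h ^+ 2 * S) <= _).
  rewrite ler_wpM2l ?mulr_ge0 ?invr_ge0 ?exprn_ge0 ?(ltW h0) //.
  apply: le_trans (cnB _ _) _; apply: lerD.
    apply: le_trans (cn_sum _ _ _) _.
    rewrite -{2}SS /S mulr_sumr -big_split /= mulr_sumr.
    by apply: ler_sum => p _.
  apply: le_trans (cn_sum _ _ _) _; rewrite /S mulr_sumr.
  by apply: ler_sum => p _; apply: hg.
rewrite -/h (_ : h ^+ d * h^-1 * _ = 6 * K * h * (h ^+ d * S)); last by field; rewrite gt_eqF.
rewrite [X in _ <= X](_ : _ = 6 * K * h * 4 ^+ d); last by ring.
by rewrite ler_wpM2l // !mulr_ge0 // ltW.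
Qed.

End GridIntegral.

(** * Invariance of Gaussian integrals under displacement of one coordinate *)

Section GaussianFlow.
Variable R : realType.
Notation C := R[i].

Definition norm1 d (s : 'I_d -> R) : R := 1 + \sum_(j < d) `|s j|.
Definition nsq d (s : 'I_d -> R) : R := \sum_(j < d) s j ^+ 2.

Lemma norm1_ge1 d (s : 'I_d -> R) : 1 <= norm1 s.
Proof. by rewrite /norm1 lerDl sumr_ge0. Qed.

Lemma norm1_ge0 d (s : 'I_d -> R) : 0 <= norm1 s.
Proof. exact: le_trans ler01 (norm1_ge1 s). Qed.

Lemma nsq_ge0 d (s : 'I_d -> R) : 0 <= nsq s.
Proof. by apply: sumr_ge0 => j _; rewrite sqr_ge0. Qed.

Lemma coord_le_norm1 d (s : 'I_d -> R) j : 1 + `|s j| <= norm1 s.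
Proof.
by rewrite /norm1 lerD2l (bigD1 j) //= lerDl sumr_ge0.
Qed.

Lemma norm1_coord_sqr d (s : 'I_d -> R) j : (1 + `|s j|) ^+ 2 <= norm1 s ^+ 2.
Proof.
apply: lerXn2r; rewrite ?nnegrE; last exact: coord_le_norm1.
  by rewrite addr_ge0.
exact: norm1_ge0.
Qed.

Lemma norm1_mono d (s : 'I_d -> R) m n : (m <= n)%N -> norm1 s ^+ m <= norm1 s ^+ n.
Proof. by move=> mn; rewrite ler_weXn2l ?norm1_ge1. Qed.

Lemma norm1X_ge1 d (s : 'I_d -> R) m : 1 <= norm1 s ^+ m.
Proof. by rewrite exprn_ege1 ?norm1_ge1. Qed.

Lemma norm1_W d (s : 'I_d -> R) : 1 <= norm1 s ^+ (2 * d) * W s.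
Proof.
rewrite exprM -[X in _ ^+ X](card_ord d) -prodr_const /W -big_split /=.
elim/big_ind: _ => [//|a b a1 b1|j _]; first by rewrite mulr_ege1.
rewrite /w1 ler_pdivlMr ?exprn_gt0 ?ltr_pwDl // mul1r.
exact: norm1_coord_sqr.
Qed.

Lemma norm1_w1 d (s : 'I_d -> R) k : 1 <= norm1 s ^+ 2 * w1 (s k).
Proof.
rewrite /w1 ler_pdivlMr ?exprn_gt0 ?ltr_pwDl // mul1r.
exact: norm1_coord_sqr.
Qed.

Lemma expX_bound (c : R) M : 0 < c -> exists2 K, 0 <= K & forall x, 0 <= x ->
  (1 + x) ^+ M * expR (- (c * x)) <= K.
Proof.
move=> c0; exists ((M.+1)`!%:R * c ^- M.+1 * expR c).
  by rewrite !mulr_ge0 ?expR_ge0 ?invr_ge0 ?exprn_ge0 ?ler0n ?ltW.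
move=> x x0; have x1 : 0 <= 1 + x by lra.
have f0 : 0 < (M.+1)`!%:R :> R by rewrite ltr0n fact_gt0.
have h1 : (c * (1 + x)) ^+ M.+1 <= (M.+1)`!%:R * expR (c * (1 + x)).
  rewrite -ler_pdivrMl //; apply: le_trans (expR_ge1Dxn M _).
    by rewrite mulrC lerDr ler01.
  by rewrite mulr_ge0 // ltW.
have h2 : (1 + x) ^+ M <= (1 + x) ^+ M.+1 by rewrite ler_weXn2l // lerDl.
have cM : 0 < c ^+ M.+1 by rewrite exprn_gt0.
rewrite expRN ler_pdivrMr ?expR_gt0 //; apply: le_trans h2 _.
rewrite -!mulrA -expRD (_ : c + c * x = c * (1 + x)); last by ring.
rewrite mulrCA mulrC ler_pdivlMr // mulrC.
by rewrite -exprMn.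
Qed.

Lemma norm1_nsq d (s : 'I_d -> R) : norm1 s <= (1 + d%:R) * (1 + nsq s).
Proof.
have h : norm1 s <= 1 + (d%:R + nsq s).
  rewrite /norm1 lerD2l /nsq -[X in X%:R](card_ord d) -sumr_const -big_split /=.
  apply: ler_sum => j _; rewrite -(real_normK (num_real (s j))).
  have := normr_ge0 (s j); nra.
apply: le_trans h _; have := nsq_ge0 s; have := ler0n R d; nra.
Qed.

Lemma norm1_gauss d (c : R) M : 0 < c -> exists2 K, 0 <= K & forall s : 'I_d -> R,
  norm1 s ^+ M * expR (- (c * nsq s)) <= K.
Proof.
move=> c0; have [K K0 hK] := expX_bound M c0.
have D0 : 0 <= (1 + d%:R) ^+ M :> R by rewrite exprn_ge0 // addr_ge0.
exists ((1 + d%:R) ^+ M * K); first by rewrite mulr_ge0.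
move=> s; apply: le_trans (_ : ((1 + d%:R) * (1 + nsq s)) ^+ M * expR (- (c * nsq s)) <= _).
  rewrite ler_wpM2r ?expR_ge0 // lerXn2r ?nnegrE ?norm1_ge0 ?norm1_nsq //.
  by rewrite mulr_ge0 ?addr_ge0 ?nsq_ge0.
by rewrite exprMn -mulrA ler_wpM2l // hK // nsq_ge0.
Qed.

(** The second form carries the additional [w1 (s k)] that integration by parts in direction k
    demands. *)
Lemma gauss_weight d (c : R) M : 0 < c -> exists2 K, 0 <= K & forall s : 'I_d -> R,
  (norm1 s ^+ M * expR (- (c * nsq s)) <= K * W s) /\
  (forall k, norm1 s ^+ M * expR (- (c * nsq s)) <= K * (w1 (s k) * W s)).
Proof.
move=> c0; have [K K0 hK] := norm1_gauss d (M + (2 + 2 * d)) c0.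
have both (s : 'I_d -> R) k : norm1 s ^+ M * expR (- (c * nsq s)) <= K * (w1 (s k) * W s).
  apply: le_trans (_ : norm1 s ^+ M * expR (- (c * nsq s)) *
      ((norm1 s ^+ 2 * w1 (s k)) * (norm1 s ^+ (2 * d) * W s)) <= _).
    rewrite ler_peMr ?mulr_ge0 ?exprn_ge0 ?norm1_ge0 ?expR_ge0 //.
    rewrite -[1]mulr1; apply: ler_pM => //; [exact: norm1_w1|exact: norm1_W].
  have := hK s; rewrite (exprD _ M) (exprD _ 2) => h.
  rewrite [X in X <= _](_ : _ = norm1 s ^+ M * (norm1 s ^+ 2 * norm1 s ^+ (2 * d)) * expR (- (c * nsq s))
     * (w1 (s k) * W s)); last by ring.
  by rewrite ler_wpM2r // mulr_ge0 // ltW ?w1_gt0 ?W_gt0.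
exists K => // s; split => //.
apply: le_trans (_ : norm1 s ^+ M * expR (- (c * nsq s)) * (norm1 s ^+ (2 * d) * W s) <= _).
  by rewrite ler_peMr ?norm1_W ?mulr_ge0 ?exprn_ge0 ?norm1_ge0 ?expR_ge0.
rewrite [X in X <= _](_ : _ = norm1 s ^+ M * norm1 s ^+ (2 * d) * expR (- (c * nsq s)) * W s); last by ring.
rewrite ler_wpM2r ?(ltW (W_gt0 _)) //; apply: le_trans (hK s).
rewrite ler_wpM2r ?expR_ge0 // -exprD norm1_mono // leq_add2l.
by rewrite leq_addl.
Qed.

Lemma norm1_sadd d (s : 'I_d -> R) k h : 0 <= h -> h <= 1 -> norm1 s <= 2 * norm1 (sadd s k h).
Proof.
move=> h0 h1; rewrite /norm1 (bigD1 k) //= [X in _ <= _ * (_ + X)](bigD1 k) //=.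
rewrite {1}/sadd eqxx [X in _ <= _ * (_ + (_ + X))](eq_bigr (fun j => `|s j|)); last first.
  by move=> j jk; rewrite /sadd (negbTE jk) addr0.
have : 0 <= \sum_(j < d | j != k) `|s j| by apply: sumr_ge0.
have := ler_normD (s k + h) (- h); rewrite addrK normrN (ger0_norm h0).
have := normr_ge0 (s k + h); lra.
Qed.

Lemma expR1_le3 : expR 1 <= 3 :> R.
Proof.
have e1 : expR 1 = (expR (- 1))^-1 :> R by rewrite expRN invrK.
have e2 : expR (-1) = expR (- 8^-1) ^+ 8 :> R.
  by rewrite -expRM_natl; congr expR; field.
have e3 : 7 / 8 <= expR (- 8^-1) :> R by apply: le_trans (expR_ge1Dx _); lra.
have e4 : (7 / 8) ^+ 8 <= expR (- 8^-1) ^+ 8 :> R by rewrite lerXn2r ?nnegrE ?expR_ge0 //; lra.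
rewrite e1 -[3]invrK lef_pV2 ?posrE ?expR_gt0 ?invr_gt0 //.
by rewrite e2; lra.
Qed.

(** No smallness of [b] is available in the flow, where it grows with s. For |b| > 1 the three terms
    are bounded one by one, and this is why the moduli at both ends appear on the right. *)
Lemma cexp_quadratic (a b : C) :
  cn (cexp (a + b) - cexp a - b * cexp a) <=
  3 * cn b ^+ 2 * (expR (complex.Re a) + expR (complex.Re (a + b))).
Proof.
have -> : cexp (a + b) - cexp a - b * cexp a = cexp a * (cexp b - 1 - b).
  by rewrite cexpD; ring.
rewrite cnM cn_cexp ReD expRD.
set x := expR _; have x0 : 0 <= x by rewrite expR_ge0.
rewrite (_ : _ * (x + _) = x * (3 * cn b ^+ 2 * (1 + expR (complex.Re b)))); last by ring.
rewrite ler_wpM2l //; have b0 := cn_ge0 b; have e0 := expR_ge0 (complex.Re b).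
have [b1|b1] := lerP (cn b) 1; last first.
  apply: le_trans (cnB _ _) _; apply: le_trans (lerD (cnB _ _) (lexx _)) _.
  rewrite cn1 cn_cexp; set e := expR _ in e0 *; set B := cn b ^+ 2.
  have B1 : 1 <= B by rewrite exprn_ege1 // ltW.
  have Bb : cn b <= B by rewrite /B expr2 ler_peMl // ltW.
  by nra.
have := cexp_taylor 2 b.
rewrite !big_ord_recr big_ord0 /= expr0 expr1 !divr1 add0r opprD addrA => h.
apply: le_trans h _; rewrite -mulrA mulrCA ler_wpM2l ?exprn_ge0 //.
have : expR (cn b) <= expR 1 by rewrite ler_expR.
have := expR1_le3.
lra.
Qed.

Lemma cn_natr n : cn (n%:R : C) = n%:R.
Proof. by rewrite -(rmorph_nat (real_complex R)) cn_real ger0_norm. Qed.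

Lemma half_square_bound (a K : R) (w : C) : `|a| <= K -> cn (2^-1 * a%:C * w ^+ 2) <= K * cn w ^+ 2.
Proof.
move=> aK; rewrite (cnM _ (w ^+ 2)) cnX (cnM 2^-1) cnV cn_natr cn_real.
rewrite ler_wpM2r ?exprn_ge0 ?cn_ge0 //.
by have := normr_ge0 a; lra.
Qed.

(** Over N + 1 equal steps the increments add up to O(1/N). *)
Lemma quadratic_increments_cst (f : R -> C) (K : R) :
  (forall t h, 0 <= t -> 0 < h -> t + h <= 1 -> cn (f (t + h) - f t) <= K * h ^+ 2) ->
  f 1 = f 0.
Proof.
move=> hf; have K0 : 0 <= K.
  by have := le_trans (cn_ge0 _) (hf 0 1 (lexx _) ltr01 _); rewrite expr1n mulr1 add0r; apply.
apply/eqP; rewrite -subr_eq0 -cn_eq0 eq_le cn_ge0 andbT leNgt.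
apply/negP => e0; have [N hN] := small_invS K e0.
have := hN N (leqnn N); apply/negP; rewrite -leNgt.
set h : R := N.+1%:R^-1; have h0 : 0 < h := invS_gt0 R N.
have nh : N.+1%:R * h = 1 by rewrite /h divff // pnatr_eq0.
have -> : f 1 - f 0 = \sum_(p < N.+1) (f (p%:R * h + h) - f (p%:R * h)).
  rewrite (eq_bigr (fun p : 'I_N.+1 => f (p.+1%:R * h) - f (p%:R * h))).
    rewrite -(big_mkord xpredT (fun p => f (p.+1%:R * h) - f (p%:R * h))).
    by rewrite telescope_sumr // nh mul0r.
  by move=> p _; rewrite -natr1 mulrDl mul1r.
apply: le_trans (cn_sum _ _ _) _.
apply: le_trans (_ : \sum_(p < N.+1) K * h ^+ 2 <= _).
  apply: ler_sum => p _; apply: hf => //; first by rewrite mulr_ge0 // ltW.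
  rewrite (_ : p%:R * h + h = p.+1%:R * h); last by rewrite -natr1; ring.
  rewrite -[X in _ <= X]nh; apply: ler_wpM2r; first exact: ltW.
  by rewrite ler_nat.
rewrite sumr_const card_ord (_ : K * h ^+ 2 *+ N.+1 = K * h) //.
by rewrite -[RHS]mulr1 -nh -mulr_natl; ring.
Qed.

Section Flow.
Variables (d : nat) (H : 'M[R]_d) (k : 'I_d) (x : 'I_d -> R) (o : 'I_d -> C) (ell : ('I_d -> R) -> C).
Hypothesis Hsym : forall i j, H i j = H j i.

Definition bilin (z w : 'I_d -> C) : C := \sum_(i < d) \sum_(j < d) z i * (H i j)%:C * w j.
Definition qexp (z : 'I_d -> C) : C := 2^-1 * bilin z z + \sum_(j < d) (x j)%:C * z j.

(* Contour shifts (ell constant) and shears (ell linear) are both instances. *)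
Definition flow (t : R) (s : 'I_d -> R) : 'I_d -> C :=
  fun j => 'i * (s j)%:C + o j + (if j == k then t%:C * ell s else 0).

(** The partial derivative of [qexp] in direction k. *)
Let D (z : 'I_d -> C) : C := \sum_(j < d) (H k j)%:C * z j + (x k)%:C.

Definition cadd (z : 'I_d -> C) (c : C) : 'I_d -> C := fun j => z j + (if j == k then c else 0).

Lemma bilinDl z z' w : bilin (fun j => z j + z' j) w = bilin z w + bilin z' w.
Proof.
rewrite /bilin -big_split; apply: eq_bigr => i _; rewrite -big_split; apply: eq_bigr => j _ /=.
by ring.
Qed.

Lemma bilinC z w : bilin z w = bilin w z.
Proof.
rewrite /bilin exchange_big; apply: eq_bigr => i _; apply: eq_bigr => j _ /=.
by rewrite Hsym; ring.
Qed.

Let bilin_delta c w : bilin (fun j => if j == k then c else 0) w = c * \sum_(j < d) (H k j)%:C * w j.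
Proof.
rewrite /bilin (bigD1 k) //= eqxx [X in _ + X]big1 ?addr0 => [|i ik]; last first.
  by rewrite big1 // => j _; rewrite (negbTE ik) !mul0r.
by rewrite mulr_sumr; apply: eq_bigr => j _; rewrite mulrA.
Qed.

Let sum_delta c (f : 'I_d -> C) : \sum_(j < d) f j * (if j == k then c else 0) = f k * c.
Proof.
rewrite (bigD1 k) //= eqxx big1 ?addr0 // => j jk.
by rewrite (negbTE jk) mulr0.
Qed.

Lemma qexp_cadd z c : qexp (cadd z c) = qexp z + (c * D z + 2^-1 * (H k k)%:C * c ^+ 2).
Proof.
rewrite /qexp /cadd bilinDl (bilinC z) (bilinC (fun j => if j == k then c else 0)) !bilinDl.
rewrite (bilinC z (fun j => if _ then _ else _)) !bilin_delta sum_delta.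
under [\sum_(j < d) (x j)%:C * _]eq_bigr do rewrite mulrDr.
rewrite big_split /= sum_delta /D.
by field.
Qed.

Variables (c A L : R).
Hypotheses (c0 : 0 < c) (L0 : 0 <= L).
Hypothesis ell_bound : forall s, cn (ell s) <= L * norm1 s.
Hypothesis ell_sadd : forall s h, ell (sadd s k h) = ell s.
Hypothesis flow_decay : forall t s, 0 <= t -> t <= 2 -> complex.Re (qexp (flow t s)) <= A - c * nsq s.

Let flow_t t h s : flow (t + h) s = cadd (flow t s) (h%:C * ell s).
Proof.
apply: funext => j; rewrite /flow /cadd; case: eqP => _; last by rewrite !addr0.
by rewrite rmorphD /=; ring.
Qed.

Let flow_s t h s : flow t (sadd s k h) = cadd (flow t s) ('i * h%:C).
Proof.
apply: funext => j; rewrite /flow /cadd ell_sadd /sadd; case: eqP => _; rewrite ?rmorphD /=; first ring.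
by rewrite (rmorph0 (real_complex R)); ring.
Qed.

Let D_bound : exists2 K, 1 <= K & forall t s, 0 <= t -> t <= 2 ->
  cn (D (flow t s)) <= K * norm1 s /\ cn (ell s) <= K * norm1 s /\ `|H k k| <= K.
Proof.
pose O := \sum_(j < d) cn (o j); have O0 : 0 <= O by apply: sumr_ge0 => j _; apply: cn_ge0.
have Oj j : cn (o j) <= O by rewrite /O (bigD1 j) //= lerDl sumr_ge0 // => i _; apply: cn_ge0.
pose S := \sum_(j < d) `|H k j|; have S0 : 0 <= S by apply: sumr_ge0.
exists (1 + S * (1 + O + 2 * L) + `|x k| + L + S).
  by have := normr_ge0 (x k); rewrite -!addrA lerDl !addr_ge0 ?mulr_ge0 // ?addr_ge0 // mulr_ge0.
move=> t s t0 t2; have N1 := norm1_ge1 s; have N0 := norm1_ge0 s.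
have P0 : 0 <= S * (1 + O + 2 * L) by rewrite mulr_ge0 // !addr_ge0 // mulr_ge0.
have X0 := normr_ge0 (x k).
split; last split.
- have zj j : cn (flow t s j) <= (1 + O + 2 * L) * norm1 s.
    rewrite /flow; apply: le_trans (cnD _ _) _; apply: le_trans (lerD (cnD _ _) (lexx _)) _.
    rewrite cnM cn_i mul1r cn_real.
    have h1 : `|s j| <= norm1 s by have := coord_le_norm1 s j; lra.
    have h2 : cn (o j) <= O * norm1 s by apply: le_trans (Oj j) _; rewrite ler_peMr.
    have h3 : cn (if j == k then t%:C * ell s else 0) <= 2 * L * norm1 s.
      case: ifP => _; last by rewrite cn0 !mulr_ge0.
      rewrite cnM cn_real ger0_norm // -mulrA; apply: ler_pM => //; exact: cn_ge0.
    by lra.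
  rewrite /D; apply: le_trans (cnD _ _) _; rewrite cn_real.
  have h : cn (\sum_(j < d) (H k j)%:C * flow t s j) <= S * (1 + O + 2 * L) * norm1 s.
    apply: le_trans (cn_sum _ _ _) _; rewrite -mulrA /S mulr_suml; apply: ler_sum => j _.
    by rewrite cnM cn_real ler_wpM2l.
  have p1 := ler_peMr X0 N1.
  have : 0 <= (1 + L + S) * norm1 s by rewrite mulr_ge0 // !addr_ge0.
  by lra.
- by apply: le_trans (ell_bound s) _; rewrite ler_wpM2r //; lra.
- have SK : `|H k k| <= S by rewrite /S (bigD1 k) //= lerDl sumr_ge0.
  by apply: le_trans SK _; rewrite lerDr !addr_ge0.
Qed.

Let g t s := cexp (qexp (flow t s)).

Let g_bound t s : 0 <= t -> t <= 2 -> cn (g t s) <= expR A * expR (- (c * nsq s)).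
Proof. by move=> t0 t2; rewrite cn_cexp -expRD ler_expR flow_decay. Qed.

Let g' t s := ell s * D (flow t s) * g t s.

(** One estimate for two kinds of increment: [l] is |ell s| for a step in t and 1 for a step in
    s_k. *)
Let poly_bound (K N h a l e1 e2 ea eb : R) : 1 <= K -> 1 <= N -> 0 <= h -> h <= 1 ->
  0 <= a -> a <= K * N -> 0 <= l -> l <= K * N -> 0 <= ea -> ea <= e1 -> 0 <= eb -> eb <= e2 ->
  3 * (h * (l * a) + K * h ^+ 2 * l ^+ 2) ^+ 2 * (ea + eb) + K * h ^+ 2 * l ^+ 2 * ea <=
  K ^+ 6 * h ^+ 2 * N ^+ 4 * (13 * (e1 + e2)).
Proof.
move=> K1 N1 h0 h1 a0 aK l0 lK ea0 ea1 eb0 eb1.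
have la : l * a <= K ^+ 2 * N ^+ 2 by rewrite -exprMn expr2; apply: ler_pM.
have ll : l ^+ 2 <= K ^+ 2 * N ^+ 2 by rewrite -exprMn lerXn2r ?nnegrE // (le_trans l0).
have K0 : 0 <= K by lra. have N0 : 0 <= N by lra.
have N2 : 0 <= N ^+ 2 by rewrite exprn_ge0.
have K3 : K ^+ 2 <= K ^+ 3 by rewrite ler_weXn2l.
have p1 : h * (l * a) + K * h ^+ 2 * l ^+ 2 <= 2 * (K ^+ 3 * N ^+ 2) * h.
  have q1 : h * (l * a) <= K ^+ 3 * N ^+ 2 * h.
    rewrite mulrC; apply: ler_wpM2r => //; apply: le_trans la _; exact: ler_wpM2r.
  have q2 : K * h ^+ 2 * l ^+ 2 <= K ^+ 3 * N ^+ 2 * h.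
    apply: le_trans (_ : K * h ^+ 2 * (K ^+ 2 * N ^+ 2) <= _).
      by rewrite ler_wpM2l ?mulr_ge0 ?exprn_ge0.
    rewrite [X in X <= _](_ : _ = K ^+ 3 * N ^+ 2 * (h * h)); last by ring.
    by rewrite ler_wpM2l ?mulr_ge0 ?exprn_ge0 // ler_piMr.
  lra.
have p0 : 0 <= h * (l * a) + K * h ^+ 2 * l ^+ 2 by rewrite addr_ge0 ?mulr_ge0 ?exprn_ge0.
have p2 : (h * (l * a) + K * h ^+ 2 * l ^+ 2) ^+ 2 <= 4 * K ^+ 6 * h ^+ 2 * N ^+ 4.
  rewrite (_ : 4 * _ * _ * _ = (2 * (K ^+ 3 * N ^+ 2) * h) ^+ 2); last by ring.
  by rewrite lerXn2r ?nnegrE // (le_trans p0).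
have p3 : K * h ^+ 2 * l ^+ 2 <= K ^+ 6 * h ^+ 2 * N ^+ 4.
  apply: le_trans (_ : K * h ^+ 2 * (K ^+ 2 * N ^+ 2) <= _).
    by rewrite ler_wpM2l ?mulr_ge0 ?exprn_ge0.
  rewrite [X in X <= _](_ : _ = K ^+ 3 * N ^+ 2 * h ^+ 2); last by ring.
  rewrite [X in _ <= X](_ : _ = K ^+ 6 * N ^+ 4 * h ^+ 2); last by ring.
  by rewrite ler_wpM2r ?exprn_ge0 //; apply: ler_pM; rewrite ?exprn_ge0 // ler_weXn2l.
set P := K ^+ 6 * h ^+ 2 * N ^+ 4 in p3 *.
rewrite (_ : 4 * K ^+ 6 * h ^+ 2 * N ^+ 4 = 4 * P) in p2; last by rewrite /P; ring.
have P0 : 0 <= P by rewrite /P !mulr_ge0 ?exprn_ge0.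
have q1 : 3 * (h * (l * a) + K * h ^+ 2 * l ^+ 2) ^+ 2 * (ea + eb) <= 12 * P * (e1 + e2).
  apply: ler_pM; [by rewrite mulr_ge0 ?exprn_ge0|by rewrite addr_ge0| |exact: lerD].
  by move: p2; set Y := (_ + _) ^+ 2; lra.
have q2 : K * h ^+ 2 * l ^+ 2 * ea <= P * e1.
  by apply: ler_pM => //; rewrite ?mulr_ge0 ?exprn_ge0.
have : 0 <= P * e2 by rewrite mulr_ge0 // (le_trans eb0).
lra.
Qed.

(** A change of t and a change of s_k both displace coordinate k, at the rates [ell s] and 'i. Since
    [ell] does not depend on s_k, the t-derivative of the integrand is the s_k-derivative of -'i *
    ell times the integrand, and the integral of the latter vanishes. The integral therefore has
    increments of order h^2 in t, and is constant. *)
Lemma integ_flow : integ (fun s => cexp (qexp (flow 1 s))) = integ (fun s => cexp (qexp (flow 0 s))).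
Proof.
have [K K1 hK] := D_bound; have K0 : 0 <= K by lra.
pose E (s : 'I_d -> R) := expR A * expR (- (c * nsq s)).
have E0 s : 0 <= E s by rewrite mulr_ge0 ?expR_ge0.
have [Q Q0 hQ] := gauss_weight d 5 c0.
have EW s : norm1 s ^+ 5 * E s <= expR A * Q * W s.
  by rewrite /E mulrCA -mulrA ler_wpM2l ?expR_ge0 //; case: (hQ s).
have EW' s : norm1 s ^+ 5 * E s <= expR A * Q * (w1 (s k) * W s).
  by rewrite /E mulrCA -mulrA ler_wpM2l ?expR_ge0 //; case: (hQ s) => _ /(_ k).
have AQ0 : 0 <= expR A * Q by rewrite mulr_ge0 ?expR_ge0.
have gd t : 0 <= t -> t <= 2 -> dominated (expR A * Q) (g t).
  move=> t0 t2 s; apply: le_trans (g_bound s t0 t2) _; apply: le_trans (EW s).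
  by rewrite ler_peMl ?norm1X_ge1 //; apply: E0.
have g'b t s : 0 <= t -> t <= 2 -> cn (g' t s) <= K ^+ 2 * (norm1 s ^+ 5 * E s).
  move=> t0 t2; have [h1 [h2 _]] := hK t s t0 t2.
  rewrite /g' !cnM mulrA; apply: ler_pM; rewrite ?mulr_ge0 ?cn_ge0 ?g_bound //.
  apply: le_trans (_ : (K * norm1 s) * (K * norm1 s) <= _); first by apply: ler_pM; rewrite ?cn_ge0.
  rewrite -expr2 exprMn ler_wpM2l ?exprn_ge0 // norm1_mono //.
have g'd t : 0 <= t -> t <= 2 -> dominated (K ^+ 2 * (expR A * Q)) (g' t).
  by move=> t0 t2 s; apply: le_trans (g'b t s t0 t2) _; rewrite -[X in _ <= X]mulrA ler_wpM2l ?exprn_ge0.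
have g'0 t : 0 <= t -> t <= 2 -> integ (g' t) = 0.
  move=> t0 t2; pose G s := - 'i * ell s * g t s.
  (* 2080 = 16 * 130 exceeds 13 * (1 + 32 * 4): the 13 is that of [poly_bound], while 32 = 2^5 and 4
     compare [norm1] and [W] at the shifted point with their values at s. *)
  pose K2 := K ^+ 7 * 16 * (expR A * Q) * 130.
  have K72 : K ^+ 2 * (expR A * Q) <= K2.
    rewrite /K2; have : K ^+ 2 <= K ^+ 7 by rewrite ler_weXn2l.
    have : 0 <= K ^+ 2 by rewrite exprn_ge0.
    by nra.
  apply: (@integ_deriv _ _ k K2 G); last 2 first.
  - exact: dominated_le (g'd t t0 t2) K72.
  - move=> s h h0 h1; have [a1 [a2 a3]] := hK t s t0 t2.
    set dlt := 'i * h%:C * D (flow t s) + 2^-1 * (H k k)%:C * ('i * h%:C) ^+ 2.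
    have ge : g t (sadd s k h) = cexp (qexp (flow t s) + dlt) by rewrite /g flow_s qexp_cadd.
    rewrite [X in cn X](_ : _ = - 'i * ell s * (cexp (qexp (flow t s) + dlt) - g t s - dlt * g t s)
       + - 'i * ell s * (2^-1 * (H k k)%:C * ('i * h%:C) ^+ 2 * g t s)); last first.
      rewrite /G ell_sadd ge /g' /dlt.
      have ii : 'i * 'i = -1 :> C by rewrite -expr2 sqr_i.
      have -> : h%:C * (ell s * D (flow t s) * g t s) = - ('i * 'i) * (h%:C * ell s * D (flow t s) * g t s).
        by rewrite ii; ring.
      by ring.
    have ce := cexp_quadratic (qexp (flow t s)) dlt.
    rewrite -!(cn_cexp (_ (flow t s))) -/(g t s) -!(cn_cexp (_ + _)) -ge in ce.
    have ih : cn ('i * h%:C) = h by rewrite cnM cn_i mul1r cn_real gtr0_norm.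
    have dltb : cn dlt <= h * (1 * cn (D (flow t s))) + K * h ^+ 2 * 1 ^+ 2.
      rewrite /dlt; apply: le_trans (cnD _ _) _; apply: lerD.
        by rewrite cnM ih mul1r.
      by apply: le_trans (half_square_bound _ a3) _; rewrite ih expr1n mulr1.
    have N4 : norm1 s <= 2 * norm1 (sadd s k h) by apply: norm1_sadd => //; exact: ltW.
    have := @poly_bound K (norm1 s) h (cn (D (flow t s))) 1 (E s) (E (sadd s k h)) (cn (g t s)) (cn (g t (sadd s k h)))
       K1 (norm1_ge1 s) (ltW h0) h1 (cn_ge0 _) a1 ler01 _ (cn_ge0 _) (g_bound s t0 t2) (cn_ge0 _) (g_bound _ t0 t2).
    rewrite (_ : (1 <= K * norm1 s)); last by rewrite -[1]mulr1; apply: ler_pM => //; exact: norm1_ge1.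
    move=> /(_ isT) pb.
    have cil w : cn (- 'i * ell s * w) = cn (ell s) * cn w by rewrite !cnM cnN cn_i mul1r.
    apply: le_trans (cnD _ _) _; rewrite !cil -mulrDr.
    have tot : cn (cexp (qexp (flow t s) + dlt) - g t s - dlt * g t s) +
       cn (2^-1 * (H k k)%:C * ('i * h%:C) ^+ 2 * g t s) <=
       K ^+ 6 * h ^+ 2 * norm1 s ^+ 4 * (13 * (E s + E (sadd s k h))).
      apply: le_trans pb; apply: lerD.
        rewrite -ge; apply: le_trans ce _; rewrite ler_wpM2r ?addr_ge0 ?cn_ge0 //.
        by rewrite ler_wpM2l // lerXn2r ?nnegrE ?cn_ge0 // (le_trans (cn_ge0 _) dltb).
      rewrite (cnM _ (g t s)) ler_wpM2r ?cn_ge0 //.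
      by apply: le_trans (half_square_bound _ a3) _; rewrite ih expr1n mulr1.
    apply: le_trans (_ : K * norm1 s * (K ^+ 6 * h ^+ 2 * norm1 s ^+ 4 * (13 * (E s + E (sadd s k h)))) <= _).
      apply: ler_pM => //; rewrite ?cn_ge0 ?addr_ge0 ?cn_ge0 //.
    have e1 := EW s.
    have e2 : norm1 s ^+ 5 * E (sadd s k h) <= 32 * (expR A * Q * (4 * W s)).
      apply: le_trans (_ : (2 * norm1 (sadd s k h)) ^+ 5 * E (sadd s k h) <= _).
        by rewrite ler_wpM2r ?E0 // lerXn2r ?nnegrE ?norm1_ge0 ?mulr_ge0 ?norm1_ge0.
      rewrite exprMn -[X in X <= _]mulrA (_ : 2 ^+ 5 = 32); last by ring.
      rewrite ler_wpM2l //; apply: le_trans (EW _) _.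
      by rewrite ler_wpM2l // W_sadd // ltW.
    rewrite (_ : K * norm1 s * _ = K ^+ 7 * h ^+ 2 * (13 * (norm1 s ^+ 5 * E s + norm1 s ^+ 5 * E (sadd s k h)))); last by ring.
    rewrite (_ : K2 * h ^+ 2 * W s = K ^+ 7 * h ^+ 2 * (2080 * (expR A * Q * W s))); last by rewrite /K2; ring.
    rewrite ler_wpM2l ?mulr_ge0 ?exprn_ge0 ?(ltW h0) //.
    have : 0 <= expR A * Q * W s by rewrite mulr_ge0 // ltW ?W_gt0.
    lra.
  - move=> s; have [_ [a2 _]] := hK t s t0 t2.
    rewrite /G !cnM cnN cn_i mul1r.
    apply: le_trans (_ : K * norm1 s * E s <= _).
      by apply: ler_pM; rewrite ?cn_ge0 // g_bound.
    apply: le_trans (_ : K * (norm1 s ^+ 5 * E s) <= _).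
      by rewrite -mulrA ler_wpM2l // ler_wpM2r ?E0 // -{1}[norm1 s]expr1 norm1_mono.
    apply: le_trans (ler_wpM2l K0 (EW' s)) _.
    rewrite [X in X <= _]mulrA ler_wpM2r ?mulr_ge0 ?(ltW (w1_gt0 _)) ?(ltW (W_gt0 _)) //.
    apply: le_trans K72; rewrite ler_wpM2r // -{1}[K]expr1 ler_weXn2l //.
pose f t := integ (g t); rewrite -[LHS]/(f 1) -[RHS]/(f 0).
pose K3 := K ^+ 6 * (26 * (expR A * Q)).
apply: (@quadratic_increments_cst f (K3 * 4 ^+ d)) => t h t0 h0 th1.
have t2 : t <= 2 by lra. have th0 : 0 <= t + h by lra. have th2 : t + h <= 2 by lra.
have h1 : h <= 1 by lra.
have -> : f (t + h) - f t = integ (fun s => g (t + h) s - g t s - h%:C * g' t s).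
  have := integB (dominatedD (gd _ th0 th2) (dominatedZ (-1) (gd _ t0 t2))) (dominatedZ h%:C (g'd t t0 t2)).
  rewrite (integZ _ (g'd t t0 t2)) g'0 // mulr0 subr0.
  rewrite (integD (gd _ th0 th2) (dominatedZ (-1) (gd _ t0 t2))) (integZ _ (gd _ t0 t2)) mulN1r => <-.
  by congr integ; apply: funext => s; rewrite mulN1r.
rewrite mulrAC; apply: integ_bound => s.
have [a1 [a2 a3]] := hK t s t0 t2.
set dlt := h%:C * ell s * D (flow t s) + 2^-1 * (H k k)%:C * (h%:C * ell s) ^+ 2.
have ge : g (t + h) s = cexp (qexp (flow t s) + dlt) by rewrite /g flow_t qexp_cadd.
rewrite [X in cn X](_ : _ = (cexp (qexp (flow t s) + dlt) - g t s - dlt * g t s)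
   + 2^-1 * (H k k)%:C * (h%:C * ell s) ^+ 2 * g t s); last first.
  by rewrite ge /g' /dlt; ring.
have ce := cexp_quadratic (qexp (flow t s)) dlt.
rewrite -!(cn_cexp (_ (flow t s))) -/(g t s) -!(cn_cexp (_ + _)) -ge in ce.
have half : cn (2^-1 * (H k k)%:C * (h%:C * ell s) ^+ 2) <= K * h ^+ 2 * cn (ell s) ^+ 2.
  apply: le_trans (half_square_bound _ a3) _.
  by rewrite cnM cn_real (gtr0_norm h0) exprMn mulrA.
have dltb : cn dlt <= h * (cn (ell s) * cn (D (flow t s))) + K * h ^+ 2 * cn (ell s) ^+ 2.
  rewrite /dlt; apply: le_trans (cnD _ _) _; apply: lerD => //.
  by rewrite cnM cnM cn_real (gtr0_norm h0) mulrA.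
have pb := @poly_bound K (norm1 s) h (cn (D (flow t s))) (cn (ell s)) (E s) (E s) (cn (g t s)) (cn (g (t + h) s))
   K1 (norm1_ge1 s) (ltW h0) h1 (cn_ge0 _) a1 (cn_ge0 _) a2 (cn_ge0 _) (g_bound s t0 t2) (cn_ge0 _) (g_bound s th0 th2).
apply: le_trans (cnD _ _) _; rewrite (cnM _ (g t s)).
apply: le_trans (_ : K ^+ 6 * h ^+ 2 * norm1 s ^+ 4 * (13 * (E s + E s)) <= _).
  apply: le_trans pb; apply: lerD.
    rewrite -ge; apply: le_trans ce _; rewrite ler_wpM2r ?addr_ge0 ?cn_ge0 //.
    by rewrite ler_wpM2l // lerXn2r ?nnegrE ?cn_ge0 // (le_trans (cn_ge0 _) dltb).
  by rewrite ler_wpM2r ?cn_ge0.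
rewrite (_ : _ * (13 * _) = K ^+ 6 * h ^+ 2 * (26 * (norm1 s ^+ 4 * E s))); last by ring.
rewrite (_ : K3 * h ^+ 2 * W s = K ^+ 6 * h ^+ 2 * (26 * (expR A * Q * W s))); last by rewrite /K3; ring.
rewrite ler_wpM2l ?mulr_ge0 ?exprn_ge0 ?(ltW h0) // ler_wpM2l //.
by apply: le_trans (EW s); rewrite ler_wpM2r ?E0 // norm1_mono.
Qed.

End Flow.
End GaussianFlow.

(** * The Gaussian integral in one and in several variables *)

Section Gaussian.
Variable R : realType.
Notation C := R[i].

Lemma gauss_primitive_mvt (x y : R) : 0 <= x -> x <= y ->
  exists2 c, x <= c <= y &
    gauss_integral_proof.integral0_gauss y - gauss_integral_proof.integral0_gauss x
    = gauss_fun c * (y - x).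
Proof.
move=> x0 xy; have ig b : lebesgue_measure.-integrable `[0%R, b] (EFin \o @gauss_fun R).
  apply: continuous_compact_integrable; first exact: segment_compact.
  by apply: continuous_subspaceT; exact: continuous_gauss_fun.
have [z||c] := @MVT_segment R (@gauss_integral_proof.integral0_gauss R) (@gauss_fun R) x y xy.
- rewrite in_itv /= => /andP[xz zy].
  have z0 : 0 < z by apply: le_lt_trans xz.
  have [] := @continuous_FTC1 R (@gauss_fun R) (BLeft 0) z (z + 1) _ (ig _) _ _.
  + by rewrite ltrDl.
  + by rewrite /= lte_fin.
  + by move=> ?; exact: continuous_gauss_fun.
  by move=> df <-; rewrite derive1E; apply: DeriveDef.
- have cw : {within `[0, y], continuous (@gauss_integral_proof.integral0_gauss R)}.
    by apply: parameterized_integral_continuous => //; exact: le_trans xy.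
  apply: continuous_subspaceW cw => t /=; rewrite !in_itv /= => /andP[xt ->].
  by rewrite (le_trans x0 xt).
- by rewrite in_itv /= => cxy e; exists c.
Qed.

Lemma gauss_fun_decr (x y : R) : 0 <= x -> x <= y -> gauss_fun y <= gauss_fun x.
Proof.
move=> x0 xy; rewrite /gauss_fun ler_expR lerN2 lerXn2r ?nnegrE //.
exact: le_trans xy.
Qed.

Lemma gauss_fun_even (x : R) : gauss_fun (- x) = gauss_fun x.
Proof. by rewrite /gauss_fun sqrrN. Qed.

Lemma gauss_primitive_bounds (x y : R) : 0 <= x -> x <= y ->
  let I := @gauss_integral_proof.integral0_gauss R in
  (y - x) * gauss_fun y <= I y - I x /\ I y - I x <= (y - x) * gauss_fun x.
Proof.
move=> x0 xy /=; have [c /andP[xc cy] ->] := gauss_primitive_mvt x0 xy.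
have yx : 0 <= y - x by lra.
rewrite [gauss_fun c * _]mulrC; split; rewrite ler_wpM2l //; apply: gauss_fun_decr => //.
exact: le_trans xc.
Qed.

Lemma cvg_integral0_gauss : forall e : R, 0 < e -> exists X, forall x, X <= x ->
  `|gauss_integral_proof.integral0_gauss x - Num.sqrt pi / 2| < e.
Proof.
move=> e e0.
have cv : @gauss_integral_proof.integral0_gauss R x @[x --> +oo] --> Num.sqrt (pi / 4).
  rewrite (_ : gauss_integral_proof.integral0_gauss =
     fun x => Num.sqrt (gauss_integral_proof.integral0_gauss x ^+ 2)); last first.
    by apply/funext => r; rewrite sqrtr_sqr ger0_norm // gauss_integral_proof.integral0_gauss_ge0.
  apply: continuous_cvg; first exact: sqrt_continuous.
  exact: gauss_integral_proof.cvg_integral0_gauss_sqr.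
have sq : Num.sqrt (pi / 4) = Num.sqrt pi / 2 :> R.
  rewrite sqrtrM ?pi_ge0 // sqrtrV // (_ : 4 = 2 ^+ 2); last by rewrite expr2 -natrM.
  by rewrite sqrtr_sqr ger0_norm.
move: cv; rewrite sq => /cvgrPdist_lt /(_ e e0) [M [_ hM]].
exists (M + 1) => x Mx; rewrite distrC; apply: hM => /=; lra.
Qed.

(** The odd extension of the primitive of the Gaussian, so that one antiderivative serves the whole
    line. *)
Let P (x : R) := if 0 <= x then gauss_integral_proof.integral0_gauss x
  else - gauss_integral_proof.integral0_gauss (- x).
(** The total variation of [gauss_fun] up to x: it rises to 1 and then falls. The left endpoint rule
    errs by at most the mesh times the variation. *)
Let Phi (x : R) := if 0 <= x then 2 - gauss_fun x else gauss_fun x.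

Let integral0_gauss0 : gauss_integral_proof.integral0_gauss 0 = 0 :> R.
Proof. by rewrite /gauss_integral_proof.integral0_gauss set_itv1 Rintegral_set1. Qed.

Let P_incr (x y : R) : x <= y -> `|P y - P x - (y - x) * gauss_fun x| <= (y - x) * (Phi y - Phi x).
Proof.
move=> xy; rewrite /P /Phi ler_norml.
have [x0|x0] := lerP 0 x; have [y0|y0] := lerP 0 y.
- have [] := gauss_primitive_bounds x0 xy; lra.
- lra.
- have y1 := @gauss_primitive_bounds 0 y (lexx _) y0.
  have x1 := @gauss_primitive_bounds 0 (- x) (lexx _) ltac:(lra).
  move: y1 x1 => /= [p1 p2] [p3 p4].
  rewrite !subr0 integral0_gauss0 !subr0 gauss_fun_even in p1 p2 p3 p4.
  have g0 : gauss_fun 0 = 1 :> R by rewrite /gauss_fun expr0n /= oppr0 expR0.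
  rewrite g0 in p2 p4.
  have a1 := gauss_fun_le1 x; have a2 := gauss_fun_le1 y.
  have a3 := gauss_fun_ge0 x; have a4 := gauss_fun_ge0 y.
  by apply/andP; split; nra.
- have [] := @gauss_primitive_bounds (- y) (- x) ltac:(lra) ltac:(lra).
  by rewrite !gauss_fun_even => p1 p2; apply/andP; split; lra.
Qed.

Lemma gauss_w1 (a : R) : 0 < a -> exists K, forall x, cn (expR (- (a * x ^+ 2 / 2)))%:C <= K * w1 x.
Proof.
move=> a0; have [K K0 hK] := @expX_bound R (a / 2) 1 ltac:(lra).
exists (2 * K) => x; rewrite cn_real ger0_norm ?expR_ge0 // /w1.
rewrite ler_pdivlMr ?exprn_gt0 ?ltr_pwDl //.
have := hK (x ^+ 2) (sqr_ge0 _); rewrite expr1.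
rewrite (_ : a / 2 * x ^+ 2 = a * x ^+ 2 / 2); last by ring.
set e := expR _ => h; have e0 : 0 <= e by rewrite expR_ge0.
have h2 : (1 + `|x|) ^+ 2 <= 2 * (1 + x ^+ 2).
  by rewrite -(real_normK (num_real x)); have := sqr_ge0 (1 - `|x|); lra.
apply: le_trans (_ : e * (2 * (1 + x ^+ 2)) <= _); first by rewrite ler_wpM2l.
by lra.
Qed.

Lemma gauss1d (a : R) : 0 < a ->
  integ1 (fun x : R => (expR (- (a * x ^+ 2 / 2)))%:C) = (Num.sqrt (2 * pi / a))%:C.
Proof.
move=> a0; have [K hK] := gauss_w1 a0.
(* The scaling x -> k x reduces the integrand to [gauss_fun]. *)
pose k := Num.sqrt (a / 2); have k0 : 0 < k by rewrite sqrtr_gt0; lra.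
have k2 : k ^+ 2 = a / 2 by rewrite sqr_sqrtr //; lra.
have gk x : expR (- (a * x ^+ 2 / 2)) = gauss_fun (k * x).
  by rewrite /gauss_fun exprMn k2; congr expR; ring.
have kn : k != 0 by rewrite gt_eqF.
pose L := Num.sqrt pi / 2 / k.
rewrite (@integ1_FTC _ K (fun x => (P (k * x) / k)%:C) _ (fun x => Phi (k * x)) 2 L%:C (- L)%:C).
- rewrite -rmorphB /=; congr (_%:C); rewrite /L opprK.
  rewrite (_ : 2 * pi / a = pi / k ^+ 2); last by rewrite k2; field; rewrite gt_eqF.
  rewrite sqrtrM ?pi_ge0 // sqrtrV ?exprn_ge0 ?ltW // sqrtr_sqr gtr0_norm //.
  by field.
- exact: hK.
- move=> x h h0 h1; rewrite gk -!rmorphM -!rmorphB /= cn_real.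
  have := @P_incr (k * x) (k * (x + h)) ltac:(rewrite ler_pM2l //; lra).
  rewrite (_ : k * (x + h) - k * x = k * h); last by ring.
  move=> H; rewrite (_ : _ - _ - _ = (P (k * (x + h)) - P (k * x) - k * h * gauss_fun (k * x)) / k); last by field.
  rewrite normrM (gtr0_norm (_ : 0 < k^-1)) ?invr_gt0 // ler_pdivrMr //.
  apply: le_trans H _; rewrite le_eqVlt; apply/orP; left; apply/eqP; ring.
- move=> x; rewrite /Phi ler_norml; have := gauss_fun_le1 (k * x); have := gauss_fun_ge0 (k * x).
  by case: ifP => _; lra.
- move=> e e0; have ek : 0 < e * k by rewrite mulr_gt0.
  have [X hX] := cvg_integral0_gauss ek.
  exists ((`|X| + 1) / k) => x; rewrite ler_pdivrMr // => Xx.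
  have X0 := normr_ge0 X; have Xn := ler_norm X.
  have kx : X <= k * x by rewrite mulrC; lra.
  have kx0 : 0 < k * x by rewrite mulrC; lra.
  have hh := hX _ kx.
  have eq1 : `|P (k * x) / k - L| < e.
    rewrite /P (ltW kx0) /L -mulrBl normrM (gtr0_norm (_ : 0 < k^-1)) ?invr_gt0 //.
    by rewrite ltr_pdivrMr.
  split; rewrite -rmorphB cn_real //.
  rewrite (_ : P (k * - x) = - P (k * x)); last first.
    by rewrite /P mulrN (ltW kx0) oppr_ge0 leNgt kx0 opprK.
  by rewrite (_ : _ - - L = - (P (k * x) / k - L)) ?normrN //; ring.
Qed.

(** Positive definiteness with an explicit constant, the form in which the decay estimates use
    it. *)
Definition gform d (H : 'M[R]_d) := (forall i j, H i j = H j i) /\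
  exists2 c, 0 < c & forall s, c * nsq s <= quadf H s.

Lemma gform_diag_gt0 d (H : 'M[R]_d) k : gform H -> 0 < H k k.
Proof.
move=> [_ [c c0 hc]]; apply: lt_le_trans c0 _; pose e (i : 'I_d) : R := (i == k)%:R.
have eE i : i != k -> e i = 0 by rewrite /e => /negbTE ->.
have ek : e k = 1 by rewrite /e eqxx.
have := hc e; rewrite /nsq /quadf (bigD1 k) //= [X in _ + X]big1 => [|i /eE ->]; last by rewrite expr0n.
rewrite (bigD1 k) //= [X in _ <= _ + X]big1 => [|i /eE ->]; last by rewrite big1 // => j _; rewrite !mul0r.
rewrite (bigD1 k) //= [X in _ <= _ + X + _]big1 => [|i /eE ->]; last by rewrite mulr0.
by rewrite ek expr1n !addr0 mul1r !mulr1.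
Qed.

Definition gaussZ d (H : 'M[R]_d) : C := integ (fun s => (expR (- (quadf H s / 2)))%:C).

Lemma sumC (I : Type) (r : seq I) (Q : pred I) (F : I -> R) :
  \sum_(i <- r | Q i) (F i)%:C = (\sum_(i <- r | Q i) F i)%:C.
Proof. by rewrite rmorph_sum. Qed.

Lemma qexp_iE d (H : 'M[R]_d) x (s v : 'I_d -> R) : (forall i j, H i j = H j i) ->
  qexp H x (fun j => 'i * (s j)%:C + (v j)%:C) =
  ((quadf H v - quadf H s) / 2 + \sum_j x j * v j)%:C +
  'i * (\sum_j (\sum_i v i * H i j + x j) * s j)%:C.
Proof.
move=> Hs; have bE (a b : 'I_d -> R) : bilin H (fun j => (a j)%:C) (fun j => (b j)%:C) =
    (\sum_j (\sum_i a i * H i j) * b j)%:C.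
  rewrite /bilin exchange_big -sumC; apply: eq_bigr => j _.
  by rewrite mulr_suml -sumC; apply: eq_bigr => i _; rewrite !rmorphM.
have qE (a : 'I_d -> R) : quadf H a = \sum_j (\sum_i a i * H i j) * a j.
  by rewrite /quadf exchange_big; apply: eq_bigr => j _; rewrite mulr_suml.
have bI (a : 'I_d -> R) w : bilin H (fun j => 'i * (a j)%:C) w = 'i * bilin H (fun j => (a j)%:C) w.
  rewrite /bilin mulr_sumr; apply: eq_bigr => i _; rewrite mulr_sumr; apply: eq_bigr => j _.
  by rewrite !mulrA.
have bD z (a b : 'I_d -> C) : bilin H z (fun j => a j + b j) = bilin H z a + bilin H z b.
  by rewrite (bilinC Hs) bilinDl !(bilinC Hs z).
have bI' (a : 'I_d -> R) z : bilin H z (fun j => 'i * (a j)%:C) = 'i * bilin H z (fun j => (a j)%:C).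
  by rewrite (bilinC Hs) bI (bilinC Hs).
rewrite /qexp bilinDl !bD !bI !bI' !bE -!qE.
have -> : \sum_(j < d) (x j)%:C * ('i * (s j)%:C + (v j)%:C) =
   'i * (\sum_j x j * s j)%:C + (\sum_j x j * v j)%:C.
  rewrite -!sumC mulr_sumr -big_split; apply: eq_bigr => j _ /=; rewrite !rmorphM /=; ring.
have -> : \sum_j (\sum_i v i * H i j + x j) * s j = \sum_j (\sum_i v i * H i j) * s j + \sum_j x j * s j.
  by rewrite -big_split; apply: eq_bigr => j _; rewrite mulrDl.
have sv : \sum_j (\sum_i s i * H i j) * v j = \sum_j (\sum_i v i * H i j) * s j.
  transitivity (\sum_j \sum_i s i * H i j * v j); first by apply: eq_bigr => j _; rewrite mulr_suml.
  rewrite exchange_big; apply: eq_bigr => j _ /=; rewrite mulr_suml; apply: eq_bigr => i _.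
  by rewrite (Hs j i); ring.
rewrite ?sv; set A := \sum_j (\sum_i v i * H i j) * s j; set B := \sum_j x j * s j.
set D := \sum_j x j * v j; set q1 := quadf H v; set q2 := quadf H s.
have ii : 'i * 'i = -1 :> C by rewrite -expr2 sqr_i.
rewrite [(_ + D)%:C]rmorphD /= [((q1 - q2) / 2)%:C]rmorphM rmorphB /= fmorphV rmorph_nat.
rewrite [(A + B)%:C]rmorphD /=.
rewrite (_ : 'i * ('i * q2%:C) = - q2%:C) ?mulrA ?ii ?mulN1r //.
by field.
Qed.

Lemma quadf_bound d (H : 'M[R]_d) (u : 'I_d -> R) (V : R) : (forall j, `|u j| <= V) ->
  quadf H u <= (\sum_i \sum_j `|H i j|) * V ^+ 2.
Proof.
move=> uV; rewrite /quadf mulr_suml; apply: ler_sum => i _; rewrite mulr_suml; apply: ler_sum => j _.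
apply: le_trans (ler_norm _) _; rewrite !normrM mulrAC mulrC ler_wpM2l // expr2.
by apply: ler_pM.
Qed.

(** A real displacement of the contour in one coordinate is the flow with constant [ell]. *)
Let gauss_translate1 d (H : 'M[R]_d) x (v v' : 'I_d -> R) k : gform H ->
  (forall j, j != k -> v' j = v j) ->
  integ (fun s => cexp (qexp H x (fun j => 'i * (s j)%:C + (v' j)%:C))) =
  integ (fun s => cexp (qexp H x (fun j => 'i * (s j)%:C + (v j)%:C))).
Proof.
move=> [Hs [c c0 hc]] vv.
pose dl := v' k - v k; pose ell := fun _ : 'I_d -> R => dl%:C.
pose u (t : R) j := v j + (if j == k then t * dl else 0).
have flowE t s : flow k (fun j => (v j)%:C) ell t s = fun j => 'i * (s j)%:C + (u t j)%:C.
  apply: funext => j; rewrite /flow /u /ell -addrA; congr (_ + _).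
  by case: eqP => _; rewrite ?addr0 // [RHS]rmorphD /= [(t * dl)%:C]rmorphM.
pose V := \sum_j `|v j| + 2 * `|dl|.
have uV t : 0 <= t -> t <= 2 -> forall j, `|u t j| <= V.
  move=> t0 t2 j; rewrite /u; apply: le_trans (ler_normD _ _) _; apply: lerD.
    by rewrite (bigD1 j) //= lerDl sumr_ge0.
  by case: ifP => _; rewrite ?normr0 ?mulr_ge0 // normrM (ger0_norm t0) ler_wpM2r.
have V0 : 0 <= V by rewrite addr_ge0 ?sumr_ge0 ?mulr_ge0.
have := @integ_flow R d H k x (fun j => (v j)%:C) ell Hs (c / 2)
  ((\sum_i \sum_j `|H i j|) * V ^+ 2 / 2 + (\sum_j `|x j|) * V) `|dl| ltac:(lra) (normr_ge0 _).
rewrite (_ : (fun s => cexp (qexp H x (flow k _ ell 1 s))) = fun s => cexp (qexp H x (fun j => 'i * (s j)%:C + (v' j)%:C))); last first.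
  apply: funext => s; rewrite flowE; do 2 f_equal; apply: funext => j; congr (_ + _%:C).
  rewrite /u; case: eqP => [->|/eqP /vv ->]; last by rewrite addr0.
  by rewrite mul1r /dl addrC subrK.
rewrite (_ : (fun s => cexp (qexp H x (flow k _ ell 0 s))) = fun s => cexp (qexp H x (fun j => 'i * (s j)%:C + (v j)%:C))); last first.
  apply: funext => s; rewrite flowE; do 2 f_equal; apply: funext => j; congr (_ + _%:C).
  by rewrite /u mul0r; case: ifP => _; rewrite addr0.
apply => //.
- by move=> s; rewrite /ell cn_real ler_peMr ?norm1_ge1.
- move=> t s t0 t2; rewrite flowE qexp_iE // ReD -['i * _]mulrC Re_realM /= mulr0 addr0.
  have h1 := quadf_bound H (uV t t0 t2).
  have h2 : \sum_j x j * u t j <= (\sum_j `|x j|) * V.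
    rewrite mulr_suml; apply: ler_sum => j _; apply: le_trans (ler_norm _) _.
    by rewrite normrM ler_wpM2l // uV.
  by have := hc s; lra.
Qed.

Lemma gauss_translate d (H : 'M[R]_d) x (v v' : 'I_d -> R) : gform H ->
  integ (fun s => cexp (qexp H x (fun j => 'i * (s j)%:C + (v' j)%:C))) =
  integ (fun s => cexp (qexp H x (fun j => 'i * (s j)%:C + (v j)%:C))).
Proof.
move=> gH; pose w (m : nat) (j : 'I_d) := if (j < m)%N then v' j else v j.
have step m : integ (fun s => cexp (qexp H x (fun j => 'i * (s j)%:C + (w m j)%:C))) =
  integ (fun s => cexp (qexp H x (fun j => 'i * (s j)%:C + (v j)%:C))).
  elim: m => [|m <-] //; case: (ltnP m d) => md.
    apply: (gauss_translate1 _ (k := Ordinal md)) => // j jm; rewrite /w ltnS leq_eqVlt.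
    by rewrite (negbTE (_ : (j : nat) != m)).
  congr integ; apply: funext => s; do 2 f_equal; apply: funext => j; rewrite /w.
  by rewrite !(leq_trans (ltn_ord j)) // ltnW.
rewrite -(step d); congr integ; apply: funext => s; do 2 f_equal; apply: funext => j.
by rewrite /w ltn_ord.
Qed.

Lemma dominated_gauss d (H : 'M[R]_d) : gform H ->
  exists K, dominated K (fun s => (expR (- (quadf H s / 2)))%:C).
Proof.
move=> [Hs [c c0 hc]]; have [K K0 hK] := @gauss_weight R d (c / 2) 0 ltac:(lra).
exists K => s; case: (hK s) => + _; rewrite expr0 mul1r; apply: le_trans.
by rewrite cn_real ger0_norm ?expR_ge0 // ler_expR; have := hc s; lra.
Qed.

Lemma gauss_linear d (H : 'M[R]_d) x v : gform H -> H \in unitmx ->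
  integ (fun s => cexp (qexp H x (fun j => 'i * (s j)%:C + (v j)%:C))) =
  (expR (- (quadf (invmx H) x / 2)))%:C * gaussZ H.
Proof.
move=> gH Hu; have Hs := gH.1.
(* The critical point of the exponent: shifting the contour there removes the imaginary cross term,
   and the exponent takes the value -x H^{-1} x / 2. *)
pose w (j : 'I_d) := - \sum_i x i * invmx H i j.
rewrite (@gauss_translate d H x w v) //.
have wH j : \sum_i w i * H i j = - x j.
  have := congr1 (fun M : 'rV[R]_d => M 0 j) (mulmxA (\row_i x i) (invmx H) H).
  rewrite mulVmx // mulmx1 !mxE => ->; rewrite -sumrN; apply: eq_bigr => i _.
  by rewrite /w mulNr; congr (- (_ * _)); rewrite mxE; apply: eq_bigr => k _; rewrite mxE.
have [K dK] := dominated_gauss gH; rewrite /gaussZ -(integZ _ dK).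
congr integ; apply: funext => s; rewrite qexp_iE // [X in 'i * X%:C]big1 => [|j _]; last first.
  by rewrite wH addNr mul0r.
rewrite (rmorph0 (real_complex R)) mulr0 addr0 cexp_real -rmorphM -expRD.
congr (expR _)%:C.
have -> : quadf H w = - \sum_j x j * w j.
  rewrite /quadf exchange_big -sumrN; apply: eq_bigr => j _.
  by rewrite -mulr_suml wH mulNr.
have -> : quadf (invmx H) x = - \sum_j x j * w j.
  rewrite /quadf exchange_big -sumrN; apply: eq_bigr => j _.
  by rewrite -mulr_suml /w mulrN opprK mulrC.
by lra.
Qed.

Section Shear.
Variables (d : nat) (k : 'I_d) (x : 'I_d -> R).
Hypothesis xk : x k = 0.

Definition shear_mx : 'M[R]_d := \matrix_(i, j) ((i == j)%:R + (i == k)%:R * x j).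
Definition shear (s : 'I_d -> R) : 'I_d -> R :=
  fun j => s j + (if j == k then \sum_i x i * s i else 0).

Lemma quadf_mx (M : 'M[R]_d) (u : 'I_d -> R) :
  quadf M u = ((\row_j u j) *m M *m (\row_j u j)^T) 0 0.
Proof.
rewrite mxE /quadf exchange_big; apply: eq_bigr => j _; rewrite !mxE mulr_suml.
by apply: eq_bigr => i _; rewrite !mxE.
Qed.

Lemma row_shear (s : 'I_d -> R) : \row_j shear s j = (\row_j s j) *m shear_mx^T.
Proof.
apply/rowP => i; rewrite !mxE /shear; under [RHS]eq_bigr do rewrite !mxE mulrDr.
rewrite big_split /=; congr (_ + _).
  rewrite (bigD1 i) //= eqxx mulr1 big1 ?addr0 // => j ji.
  by rewrite eq_sym (negbTE ji) mulr0.
case: eqP => _; last by rewrite big1 // => j _; rewrite mul0r mulr0.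
by apply: eq_bigr => j _; rewrite mul1r mulrC.
Qed.

Lemma quadf_shear (M : 'M[R]_d) s : quadf M (shear s) = quadf (shear_mx^T *m M *m shear_mx) s.
Proof. by rewrite !quadf_mx row_shear trmx_mul trmxK !mulmxA. Qed.

Lemma shear_mxE (M : 'M[R]_d) i j : (shear_mx^T *m M *m shear_mx) i j =
  M i j + M i k * x j + x i * (M k j + M k k * x j).
Proof.
have r (N : 'M[R]_d) a b : (N *m shear_mx) a b = N a b + N a k * x b.
  rewrite mxE; under eq_bigr do rewrite mxE mulrDr.
  rewrite big_split /= (bigD1 b) //= eqxx mulr1 big1 ?addr0 => [|l lb]; last first.
    by rewrite (negbTE lb) mulr0.
  rewrite (bigD1 k) //= eqxx mul1r big1 ?addr0 // => l lk.
  by rewrite (negbTE lk) mul0r mulr0.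
have l (N : 'M[R]_d) a b : (shear_mx^T *m N) a b = N a b + x a * N k b.
  rewrite mxE; under eq_bigr do rewrite !mxE mulrDl.
  rewrite big_split /= (bigD1 a) //= eqxx mul1r big1 ?addr0 => [|l la]; last first.
    by rewrite (negbTE la) mul0r.
  rewrite (bigD1 k) //= eqxx mul1r big1 ?addr0 // => l lk.
  by rewrite (negbTE lk) !mul0r.
by rewrite r !l; ring.
Qed.

Lemma det_shear : \det shear_mx = 1.
Proof.
rewrite (expand_det_row _ k) (bigD1 k) //= big1 ?addr0 => [|j jk].
  rewrite mxE !eqxx xk mulr0 addr0 mul1r /cofactor -signr_odd addnn odd_double expr0 mul1r.
  rewrite (_ : row' _ _ = 1%:M) ?det1 //; apply/matrixP => a b; rewrite !mxE.
  by rewrite (inj_eq lift_inj) [lift k a == k]eq_sym (negbTE (neq_lift _ _)) mul0r addr0.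
suff -> : cofactor shear_mx k j = 0 by rewrite mulr0.
rewrite /cofactor; case: (unliftP k j) => [i ji|jk']; last by rewrite jk' eqxx in jk.
rewrite (expand_det_row _ i) big1 ?mulr0 // => b _.
by rewrite !mxE -ji (negbTE (neq_lift _ _)) (negbTE jk) mul0r addr0 mul0r.
Qed.

(** Since [x k = 0], the linear form takes the same value before and after the shear. So s is
    recovered by a subtraction, and coercivity survives uniformly along the flow. *)
Lemma nsq_shear t s : 0 <= t -> t <= 2 ->
  nsq s <= (2 + 8 * (\sum_j `|x j|) ^+ 2) * nsq (fun j => s j + (if j == k then t * \sum_i x i * s i else 0)).
Proof.
move=> t0 t2; pose u j := s j + (if j == k then t * \sum_i x i * s i else 0).
rewrite -/u; set X := \sum_j _.
have X0 : 0 <= X by apply: sumr_ge0.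
have xs : \sum_i x i * s i = \sum_i x i * u i.
  apply: eq_bigr => i _; rewrite /u; case: eqP => [->|_]; last by rewrite addr0.
  by rewrite xk !mul0r.
pose q := Num.sqrt (nsq u).
have uq j : `|u j| <= q.
  by rewrite -sqrtr_sqr ler_wsqrtr // /nsq (bigD1 j) //= lerDl sumr_ge0 // => i _; rewrite sqr_ge0.
have q2 : q ^+ 2 = nsq u by rewrite sqr_sqrtr ?nsq_ge0.
have w2 : (\sum_i x i * u i) ^+ 2 <= X ^+ 2 * nsq u.
  rewrite -q2 -exprMn -(real_normK (num_real (\sum_i _))) lerXn2r ?nnegrE ?mulr_ge0 ?sqrtr_ge0 //.
  apply: le_trans (ler_norm_sum _ _ _) _; rewrite /X mulr_suml; apply: ler_sum => j _.
  by rewrite normrM ler_wpM2l.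
have -> : nsq s = \sum_(j < d) (u j - (if j == k then t * \sum_i x i * s i else 0)) ^+ 2.
  by apply: eq_bigr => j _; rewrite /u addrK.
(* (a - b)^2 <= 2 a^2 + 2 b^2 in coordinate k. With t^2 <= 4 and the bound on the linear form this
   produces the 8. *)
apply: le_trans (_ : \sum_(j < d) (2 * u j ^+ 2 + (if j == k then 2 * (t * \sum_i x i * s i) ^+ 2 else 0)) <= _).
  apply: ler_sum => j _; case: ifP => _; last by rewrite subr0 addr0; have := sqr_ge0 (u j); lra.
  set a := u j; set b := t * _; have := sqr_ge0 (a + b); nra.
rewrite big_split /= -big_mkcond big_pred1_eq -mulr_sumr -/(nsq u) xs.
set w := \sum_i _ in w2 *; have w0 := sqr_ge0 w.
have t4 : t ^+ 2 <= 4 by nra.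
rewrite exprMn; have : t ^+ 2 * w ^+ 2 <= 4 * (X ^+ 2 * nsq u) by apply: ler_pM; rewrite ?sqr_ge0.
by lra.
Qed.

Lemma gform_shear (H : 'M[R]_d) : gform H -> gform (shear_mx^T *m H *m shear_mx).
Proof.
move=> [Hs [c c0 hc]]; split.
  by move=> i j; rewrite !shear_mxE (Hs j i) (Hs i k) (Hs j k); ring.
have D0 : 0 < 2 + 8 * (\sum_j `|x j|) ^+ 2 by have := sqr_ge0 (\sum_j `|x j|); lra.
exists (c / (2 + 8 * (\sum_j `|x j|) ^+ 2)); first by rewrite divr_gt0.
move=> s; rewrite -quadf_shear mulrAC ler_pdivrMr //.
have e1 : (fun j => s j + (if j == k then 1 * \sum_i x i * s i else 0)) = shear s.
  by apply: funext => j; rewrite /shear mul1r.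
have := @nsq_shear 1 s ler01 ltac:(lra); rewrite e1.
move=> h; apply: le_trans (ler_wpM2l (ltW c0) h) _.
by rewrite mulrCA mulrC ler_wpM2r ?(ltW D0).
Qed.

(** The substitution that adds t sum_i x_i s_i to s_k is the flow with an imaginary linear [ell];
    [x k = 0] makes [ell] independent of s_k. It is the only linear change of variables that the
    determinant formula requires. *)
Lemma gaussZ_shear (H : 'M[R]_d) : gform H -> gaussZ (shear_mx^T *m H *m shear_mx) = gaussZ H.
Proof.
move=> gH; have [Hs [c c0 hc]] := gH.
pose ell (s : 'I_d -> R) : C := 'i * (\sum_i x i * s i)%:C.
pose u t (s : 'I_d -> R) j := s j + (if j == k then t * \sum_i x i * s i else 0).
have flowE t s : flow k (fun=> 0) ell t s = fun j => 'i * (u t s j)%:C + ((fun _ : 'I_d => 0 : R) j)%:C.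
  apply: funext => j; rewrite /flow /u /ell (rmorph0 (real_complex R)) !addr0; case: eqP => _; last by rewrite !addr0.
  by rewrite rmorphD rmorphM /=; ring.
have q0 : quadf H (fun=> 0) = 0.
  by rewrite /quadf big1 // => i _; rewrite big1 // => j _; rewrite mulr0.
have qE t s : qexp H (fun=> 0) (flow k (fun=> 0) ell t s) = (- (quadf H (u t s) / 2))%:C.
  rewrite flowE qexp_iE // q0 sub0r (eq_bigr (fun=> 0)); last by move=> j _; rewrite mulr0.
  rewrite big1_eq addr0 [X in 'i * X%:C]big1 => [|j _].
    by rewrite (rmorph0 (real_complex R)) mulr0 addr0 mulNr.
  by rewrite big1 ?addr0 ?mul0r // => i _; rewrite mul0r.
have D0 : 0 < 2 + 8 * (\sum_j `|x j|) ^+ 2 by have := sqr_ge0 (\sum_j `|x j|); lra.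
have := @integ_flow R d H k (fun=> 0) (fun=> 0) ell Hs (c / (2 + 8 * (\sum_j `|x j|) ^+ 2) / 2)
  0 (\sum_j `|x j|) _ (sumr_ge0 _ _).
rewrite (_ : (fun s => cexp (qexp H _ (flow k _ ell 1 s))) = fun s => (expR (- (quadf (shear_mx^T *m H *m shear_mx) s / 2)))%:C); last first.
  apply: funext => s; rewrite qE cexp_real -quadf_shear (_ : u 1 s = shear s) //; apply: funext => j.
  by rewrite /u /shear mul1r.
rewrite (_ : (fun s => cexp (qexp H _ (flow k _ ell 0 s))) = fun s => (expR (- (quadf H s / 2)))%:C); last first.
  apply: funext => s; rewrite qE cexp_real (_ : u 0 s = s) //; apply: funext => j.
  by rewrite /u mul0r; case: ifP => _; rewrite addr0.
apply => //; first by rewrite !divr_gt0.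
- move=> s; rewrite /ell cnM cn_i mul1r cn_real; apply: le_trans (ler_norm_sum _ _ _) _.
  rewrite mulr_suml; apply: ler_sum => j _; rewrite normrM ler_wpM2l //.
  by have := coord_le_norm1 s j; lra.
- move=> s h; rewrite /ell; congr ('i * _%:C); apply: eq_bigr => j _; rewrite /sadd.
  by case: eqP => [->|_]; rewrite ?addr0 // xk !mul0r.
- move=> t s t0 t2; rewrite qE /=.
  have h1 := hc (u t s); have h2 := @nsq_shear t s t0 t2; rewrite -/(u t s) in h2.
  suff : c / (2 + 8 * (\sum_j `|x j|) ^+ 2) * nsq s <= c * nsq (u t s) by lra.
  rewrite mulrAC ler_pdivrMr //; apply: le_trans (ler_wpM2l (ltW c0) h2) _.
  by rewrite mulrCA mulrC.
Qed.

End Shear.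

Lemma prod_sqrt (I : Type) (r : seq I) (F : I -> R) : (forall i, 0 <= F i) ->
  \prod_(i <- r) Num.sqrt (F i) = Num.sqrt (\prod_(i <- r) F i).
Proof.
move=> F0; elim: r => [|i r IH]; first by rewrite !big_nil sqrtr1.
by rewrite !big_cons sqrtrM // IH.
Qed.

Let gaussZ_diag d (H : 'M[R]_d) : gform H -> (forall i j, i != j -> H i j = 0) ->
  0 < \det H /\ gaussZ H = (Num.sqrt ((2 * pi) ^+ d / \det H))%:C.
Proof.
move=> [Hs [c c0 hc]] Hd.
have qE s : quadf H s = \sum_j H j j * s j ^+ 2.
  apply: eq_bigr => i _; rewrite (bigD1 i) //= big1 ?addr0 => [|j ji]; first by ring.
  by rewrite Hd 1?eq_sym // mulr0 mul0r.
have Hp j : 0 < H j j by apply: gform_diag_gt0; split=> //; exists c.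
have dE : \det H = \prod_j H j j.
  rewrite -[H](_ : diag_mx (\row_j H j j) = _); first by rewrite det_diag; apply: eq_bigr => j _; rewrite !mxE eqxx.
  by apply/matrixP => i j; rewrite !mxE; case: eqVneq => [->|/Hd ->].
have D0 : 0 < \det H by rewrite dE; apply: prodr_gt0.
split=> //; rewrite /gaussZ.
have [K hK] := choice (fun j => gauss_w1 (Hp j)).
transitivity (\prod_(j < d) integ1 (fun y : R => (expR (- (H j j * y ^+ 2 / 2)))%:C)).
  rewrite -(integ_prod hK); congr integ; apply: funext => s.
  rewrite -rmorph_prod /= -expR_sum; congr (expR _)%:C; rewrite qE mulr_suml -sumrN.
  by [].
under eq_bigr do rewrite gauss1d //.
rewrite -rmorph_prod /= prod_sqrt => [|j]; last by rewrite divr_ge0 ?mulr_ge0 ?pi_ge0 ?ltW.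
by rewrite big_split /= prodr_const card_ord prodfV -dE.
Qed.

(** Symmetric Gaussian elimination: m counts the trailing coordinates that may still be coupled to
    one another. Each shear clears one row and column and preserves both the determinant and the
    integral, down to the diagonal case. *)
Let gaussZ_elim d m (H : 'M[R]_d) : gform H ->
  (forall i j : 'I_d, i != j -> (i < d - m)%N || (j < d - m)%N -> H i j = 0) ->
  0 < \det H /\ gaussZ H = (Num.sqrt ((2 * pi) ^+ d / \det H))%:C.
Proof.
elim: m H => [|m IH] H gH Hd.
  by apply: gaussZ_diag => // i j ij; apply: Hd => //; rewrite subn0 ltn_ord.
case: (ltnP m d) => md; last first.
  apply: IH => // i j ij; rewrite (_ : (d - m)%N = 0%N) //.
  by apply/eqP; rewrite subn_eq0.
have kd : (d - m.+1 < d)%N by rewrite ltn_subrL /= (leq_trans _ md).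
pose k := Ordinal kd; have dm : (d - m)%N = k.+1 by rewrite /= subnSK.
have [Hs [c c0 hc]] := gH.
have Hk : 0 < H k k by apply: gform_diag_gt0.
(* The multipliers that clear row and column k; the pivot H k k is positive. *)
pose x j := if j == k then 0 else - H k j / H k k.
have xk : x k = 0 by rewrite /x eqxx.
rewrite -(gaussZ_shear xk gH).
have := IH _ (gform_shear xk gH) _; rewrite !det_mulmx det_tr det_shear // mul1r mulr1.
apply => i j ij; rewrite dm !ltnS => hij; rewrite shear_mxE.
have e1 a b : a = k -> a != b -> H a b + H a k * x b + x a * (H k b + H k k * x b) = 0.
  move=> -> kb; rewrite /x eqxx eq_sym (negbTE kb); field; exact: lt0r_neq0.
have sy a b : H a b + H a k * x b + x a * (H k b + H k k * x b) = H b a + H b k * x a + x b * (H k a + H k k * x a).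
  by rewrite (Hs a b) (Hs a k) (Hs k b); ring.
have e2 (a b : 'I_d) : (a < k)%N -> a != b -> H a b + H a k * x b + x a * (H k b + H k k * x b) = 0.
  move=> ak ab; have ank : a != k by rewrite -val_eqE /= neq_ltn ak.
  have z1 : H a k = 0 by apply: Hd => //; rewrite -/k; apply/orP; left.
  have z2 : x a = 0 by rewrite /x (negbTE ank) Hs z1 oppr0 mul0r.
  by rewrite (Hd a b) // ?ak // z1 z2 !mul0r !addr0.
have le_or (a b : 'I_d) : (a <= k)%N -> a != b -> H a b + H a k * x b + x a * (H k b + H k k * x b) = 0.
  rewrite leq_eqVlt => /orP[/eqP ak|]; last exact: e2.
  by apply: e1; apply: val_inj.
by case/orP: hij => h; [exact: le_or|rewrite sy; apply: le_or; rewrite 1?eq_sym].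
Qed.

Lemma gaussZE d (H : 'M[R]_d) : gform H ->
  0 < \det H /\ gaussZ H = (Num.sqrt ((2 * pi) ^+ d / \det H))%:C.
Proof. by move=> gH; apply: (@gaussZ_elim d d) => // i j _; rewrite subnn. Qed.

End Gaussian.

(** * Absolutely convergent sums over multi-indices *)

Section MultiSums.
Variable R : realType.
Notation C := R[i].

Definition box d (N : nat) : seq (mi d) :=
  [seq [ffun i => nat_of_ord (p i)] | p : {ffun 'I_d -> 'I_N.+1}].
Definition mle d (p m : mi d) : bool := [forall i, (p i <= m i)%N].

Lemma mem_box d N (m : mi d) : (m \in box d N) = [forall i, (m i <= N)%N].
Proof.
apply/mapP/forallP => [[p _ ->] i|h]; first by rewrite ffunE -ltnS ltn_ord.
exists [ffun i => inord (m i)]; first by rewrite mem_enum.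
apply/ffunP => i.
by rewrite !ffunE inordK // ltnS.
Qed.

Lemma box_uniq d N : uniq (box d N).
Proof.
rewrite map_inj_uniq ?enum_uniq // => p q /ffunP e; apply/ffunP => i.
by apply/val_inj; have := e i; rewrite !ffunE.
Qed.

Lemma big_box (V : nmodType) d N (F : mi d -> V) :
  \sum_(m <- box d N) F m = \sum_(p : {ffun 'I_d -> 'I_N.+1}) F [ffun i => nat_of_ord (p i)].
Proof. by rewrite big_map big_enum. Qed.

Lemma big_box_cond (V : nmodType) d N M (P Q : pred (mi d)) (F : mi d -> V) :
  (forall m, (m \in box d N) && P m = (m \in box d M) && Q m) ->
  \sum_(m <- box d N | P m) F m = \sum_(m <- box d M | Q m) F m.
Proof.
move=> h; rewrite -big_filter -[RHS]big_filter; apply: perm_big; apply: uniq_perm.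
- by rewrite filter_uniq ?box_uniq.
- by rewrite filter_uniq ?box_uniq.
by move=> m; rewrite !mem_filter andbC h andbC.
Qed.

Lemma mem_box_mono d N M (m : mi d) : (N <= M)%N -> m \in box d N -> m \in box d M.
Proof.
move=> NM; rewrite !mem_box => /forallP h; apply/forallP => i.
exact: leq_trans (h i) NM.
Qed.

Lemma big_box_widen (V : nmodType) d N M (F : mi d -> V) : (N <= M)%N ->
  \sum_(m <- box d N) F m = \sum_(m <- box d M | m \in box d N) F m.
Proof.
move=> NM; apply: (@big_box_cond V d N M xpredT) => m; rewrite andbT.
by case h: (m \in box d N); rewrite ?andbF // (mem_box_mono NM h).
Qed.

Lemma big_box_split (V : nmodType) d N M (F : mi d -> V) : (N <= M)%N ->
  \sum_(m <- box d M) F m = \sum_(m <- box d N) F m + \sum_(m <- box d M | m \notin box d N) F m.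
Proof. by move=> NM; rewrite (bigID (fun m => m \in box d N)) /= -big_box_widen. Qed.

Definition mmax d (m : mi d) : nat := \max_(i < d) m i.

Lemma le_mmax d (m : mi d) i : (m i <= mmax m)%N.
Proof. exact: leq_bigmax. Qed.

Lemma mmaxP d (m : mi d) : m \in box d (mmax m).
Proof. by rewrite mem_box; apply/forallP => i; apply: le_mmax. Qed.

Lemma msum_leE (V : nmodType) d N (m : mi d) (F : mi d -> V) : (mmax m <= N)%N ->
  msum_le m F = \sum_(p <- box d N | mle p m) F p.
Proof.
move=> mN; transitivity (\sum_(p <- box d (mmax m) | mle p m) F p).
  rewrite /msum_le big_map big_enum_cond; apply: eq_bigl => p.
  by rewrite /mle; apply: eq_forallb => i; rewrite ffunE.
apply: big_box_cond => p; case h: (mle p m); rewrite ?andbF // !andbT !mem_box.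
have pm i : (p i <= mmax m)%N by apply: leq_trans (le_mmax m i); move/forallP: h.
by rewrite (introT forallP pm) (introT forallP (fun i => leq_trans (pm i) mN)).
Qed.

Definition boxsum (V : nmodType) d N (F : mi d -> V) : V := \sum_(m <- box d N) F m.
Definition summable d (K : R) (F : mi d -> C) := forall N, boxsum N (fun m => cn (F m)) <= K.
Definition csum d (F : mi d -> C) : C := culim (fun N => boxsum N F).

Lemma boxsum_mono d N M (c : mi d -> R) : (N <= M)%N -> (forall m, 0 <= c m) ->
  boxsum N c <= boxsum M c.
Proof.
by move=> NM c0; rewrite /boxsum (big_box_split _ NM) lerDl sumr_ge0.
Qed.

Lemma summable_le d K (F G : mi d -> C) : (forall m, cn (F m) <= cn (G m)) -> summable K G -> summable K F.
Proof. by move=> h s N; apply: le_trans (s N); apply: ler_sum. Qed.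

Lemma summable_ge0 d K (F : mi d -> C) : summable K F -> 0 <= K.
Proof. by move=> /(_ 0%N); apply: le_trans; apply: sumr_ge0 => m _; apply: cn_ge0. Qed.

Lemma cn_boxsum d N (F : mi d -> C) : cn (boxsum N F) <= boxsum N (fun m => cn (F m)).
Proof. exact: cn_sum. Qed.

Lemma csum_ucvg d K (F : mi d -> C) : summable K F -> ucvg (fun N => boxsum N F) (csum F).
Proof. by move=> s; apply: culimP; exists K => N; apply: le_trans (cn_boxsum _ _) (s N). Qed.

Lemma csum_unique d K (F : mi d -> C) l : summable K F -> ucvg (fun N => boxsum N F) l -> csum F = l.
Proof. by move=> /csum_ucvg h k; apply: ucvg_unique h k. Qed.

Lemma csum_bound d K (F : mi d -> C) : summable K F -> cn (csum F) <= K.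
Proof.
move=> s; apply: (@ucvg_norm_le _ _ _ _ 0 (csum_ucvg s)) => N _.
exact: le_trans (cn_boxsum _ _) (s N).
Qed.

Lemma summableD d K L (F G : mi d -> C) : summable K F -> summable L G -> summable (K + L) (fun m => F m + G m).
Proof.
move=> sF sG N; apply: le_trans (lerD (sF N) (sG N)).
by rewrite /boxsum -big_split; apply: ler_sum => m _; apply: cnD.
Qed.

Lemma summableZ d K (a : C) (F : mi d -> C) : summable K F -> summable (cn a * K) (fun m => a * F m).
Proof.
move=> sF N; apply: le_trans (ler_wpM2l (cn_ge0 a) (sF N)).
by rewrite /boxsum mulr_sumr; apply: ler_sum => m _; rewrite cnM.
Qed.

Lemma csumD d K L (F G : mi d -> C) : summable K F -> summable L G ->
  csum (fun m => F m + G m) = csum F + csum G.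
Proof.
move=> sF sG; apply: (csum_unique (summableD sF sG)).
by apply: ucvg_ext (ucvgD (csum_ucvg sF) (csum_ucvg sG)) => N; rewrite /boxsum big_split.
Qed.

Lemma csumZ d K a (F : mi d -> C) : summable K F -> csum (fun m => a * F m) = a * csum F.
Proof.
move=> sF; apply: (csum_unique (summableZ a sF)).
by apply: ucvg_ext (ucvgZ a (csum_ucvg sF)) => N; rewrite /boxsum mulr_sumr.
Qed.

Lemma csumB d K L (F G : mi d -> C) : summable K F -> summable L G ->
  csum (fun m => F m - G m) = csum F - csum G.
Proof.
move=> sF sG; have := csumD sF (summableZ (-1) sG).
rewrite (csumZ _ sG) mulN1r => <-; congr csum; apply: funext => m.
by rewrite mulN1r.
Qed.

Lemma csum_sum d r (F : nat -> mi d -> C) : (forall k, (k < r)%N -> exists K, summable K (F k)) ->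
  csum (fun m => \sum_(k < r) F k m) = \sum_(k < r) csum (F k) /\
  exists K, summable K (fun m => \sum_(k < r) F k m).
Proof.
elim: r => [|r IH] h.
  have s0 : summable 0 (fun m : mi d => \sum_(k < 0) F k m).
    by move=> N; rewrite /boxsum big1 // => m _; rewrite big_ord0 cn0.
  split; last by exists 0.
  by apply/eqP; rewrite big_ord0 -cn_eq0 eq_le cn_ge0 csum_bound.
have [|e [K sK]] := IH; first by move=> k kr; apply: h; rewrite ltnS ltnW.
have [L sL] := h r (ltnSn r).
rewrite big_ord_recr /= -e -(csumD sK sL) (_ : (fun m => _) = (fun m => \sum_(i < r) F i m + F r m)).
  by split=> //; exists (K + L); apply: summableD.
by apply: funext => m; rewrite big_ord_recr.
Qed.

Lemma csum_finite d N0 (F : mi d -> C) : (forall m, m \notin box d N0 -> F m = 0) ->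
  csum F = boxsum N0 F.
Proof.
move=> F0; have e N : (N0 <= N)%N -> boxsum N F = boxsum N0 F.
  by move=> h; rewrite /boxsum (big_box_split _ h) [X in _ + X]big1 ?addr0.
have s : summable (boxsum N0 (fun m => cn (F m))) F.
  move=> N; apply: le_trans (boxsum_mono (leq_maxl N N0) (fun m => cn_ge0 (F m))) _.
  rewrite /boxsum (big_box_split _ (leq_maxr N N0)) [X in _ + X]big1 ?addr0 // => m /F0 ->.
  exact: cn0.
by apply: (csum_unique s); apply: ucvg_lim => e0 e00; exists N0 => n /e ->; rewrite subrr cn0.
Qed.

(** [N0] depends on the majorant [c] alone: there the box sums of [c] come within e of their
    supremum. This uniformity in [F] is what the exchange of sum and integral rests on. *)
Lemma csum_tail d (c : mi d -> R) (K : R) : (forall m, 0 <= c m) -> (forall N, boxsum N c <= K) ->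
  forall e, 0 < e -> exists N0, forall N, (N0 <= N)%N -> forall F : mi d -> C,
    (forall m, cn (F m) <= c m) -> cn (csum F - boxsum N F) <= e.
Proof.
move=> c0 cK e e0; pose S := [set x | exists N, x = boxsum N c].
have hs : has_sup S by split; [exists (boxsum 0 c), 0%N|exists K => x [N ->]].
have [x [N0 ->] xs] := sup_adherent e0 hs.
exists N0 => N NN F Fc; have sF : summable K F.
  by move=> M; apply: le_trans (cK M); apply: ler_sum => m _; apply: Fc.
have := ucvgD (csum_ucvg sF) (ucvg_cst (- boxsum N F)).
move/(@ucvg_norm_le _ _ _ e N); apply => M NM.
rewrite /boxsum (big_box_split _ NM) addrAC subrr add0r.
apply: le_trans (cn_sum _ _ _) _.
apply: le_trans (_ : \sum_(m <- box d M | m \notin box d N) c m <= _); first by apply: ler_sum.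
have : boxsum M c <= sup S by apply: (ub_le_sup hs.2); exists M.
rewrite /boxsum (big_box_split _ NM) -!/(boxsum _ _).
by have := boxsum_mono NN c0; lra.
Qed.

Lemma csum_integ d (c : mi d -> R) (K : R) (F : mi d -> ('I_d -> R) -> C) :
  (forall m, 0 <= c m) -> (forall N, boxsum N c <= K) -> (forall m s, cn (F m s) <= c m * W s) ->
  dominated K (fun s => csum (fun m => F m s)) /\
  integ (fun s => csum (fun m => F m s)) = csum (fun m => integ (F m)).
Proof.
move=> c0 cK Fc.
have sF s : summable (K * W s) (fun m => F m s).
  move=> N; apply: le_trans (_ : boxsum N (fun m => c m * W s) <= _); first by apply: ler_sum.
  by rewrite /boxsum -mulr_suml ler_wpM2r ?cK // ltW // W_gt0.
have dc : dominated K (fun s => csum (fun m => F m s)) by move=> s; apply: csum_bound.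
have dF m : dominated (c m) (F m) by [].
have dS N : dominated K (fun s => boxsum N (fun m => F m s)).
  by move=> s; apply: le_trans (cn_boxsum _ _) (sF s N).
have iS N : integ (fun s => boxsum N (fun m => F m s)) = boxsum N (fun m => integ (F m)).
  rewrite /boxsum; elim: (box d N) => [|m r IH].
    rewrite big_nil; have z : dominated 0 (fun s : 'I_d -> R => \sum_(m <- [::]) F m s).
      by move=> s; rewrite big_nil cn0 mul0r.
    by apply/eqP; rewrite -cn_eq0 eq_le cn_ge0 (le_trans (integ_bound z)) // mul0r.
  rewrite big_cons -IH -(@integD _ _ (c m) (\sum_(m <- r) c m)) //.
    by congr integ; apply: funext => s; rewrite big_cons.
  move=> s; rewrite mulr_suml; apply: le_trans (cn_sum _ _ _) _.
  by apply: ler_sum => p _; apply: Fc.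
split=> //; apply/esym.
have si : summable (K * 4 ^+ d) (fun m => integ (F m)).
  move=> N; apply: le_trans (_ : boxsum N (fun m => c m * 4 ^+ d) <= _).
    by apply: ler_sum => m _; apply: integ_bound.
  by rewrite /boxsum -mulr_suml ler_wpM2r ?cK ?exprn_ge0.
apply: (csum_unique si); apply: ucvg_lim => e e0.
have e1 : 0 < e / (2 * 4 ^+ d) by rewrite divr_gt0 ?mulr_gt0 ?exprn_gt0.
have [N0 hN] := csum_tail c0 cK e1; exists N0 => N NN.
rewrite -iS -(integB (dS N) dc).
apply: le_lt_trans (_ : e / (2 * 4 ^+ d) * 4 ^+ d < _); last first.
  rewrite (_ : _ * _ = e / 2); last by field; rewrite expf_neq0.
  by lra.
apply: integ_bound => s; rewrite cnBC.
have Wp := W_gt0 s; have W0 : (W s)%:C != 0.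
  by rewrite -cn_gt0 cn_real normr_gt0 gt_eqF.
(* Division by W s brings the terms under the fixed majorant [c], so that one [N0] serves all s. *)
have := hN N NN (fun m => (W s)^-1%:C * F m s) _.
rewrite (csumZ _ (sF s)) /boxsum -mulr_sumr -mulrBr cnM cn_real gtr0_norm ?invr_gt0 //.
rewrite ler_pdivrMl // mulrC; apply => m.
by rewrite cnM cn_real gtr0_norm ?invr_gt0 // ler_pdivrMl // mulrC.
Qed.

End MultiSums.

Ltac case_if := repeat match goal with |- context [if ?c then _ else _] =>
  let h := fresh "h" in case: (boolP c) => h; rewrite -?ltNge -?leNgt in h end.

(** * Fourier coefficients on the torus and Cauchy products *)

Section Torus.
Variable R : realType.
Notation C := R[i].

Definition clamp (a x : R) : R := if x < - a then - a else if a < x then a else x.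

(** Composition with [clamp] turns [E] into a primitive of the truncated integrand away from a and
    -a. The unit steps of [Phi] at these two points pay for the cells that straddle the jumps. *)
Lemma integ1_segment (a M : R) (E E' : R -> C) : 0 < a -> 0 <= M ->
  (forall x, cn (E' x) <= M) ->
  (forall x h, 0 <= h -> h <= 1 -> cn (E (x + h) - E x - h%:C * E' x) <= M * h ^+ 2) ->
  integ1 (fun x => if `|x| <= a then E' x else 0) = E a - E (- a).
Proof.
move=> a0 M0 E'M EM.
have lip x h : 0 <= h -> h <= 1 -> cn (E (x + h) - E x) <= 2 * M * h.
  move=> h0 h1; have := EM x h h0 h1; have := cn_sub (E (x + h) - E x) (h%:C * E' x).
  rewrite cnM cn_real (ger0_norm h0) => p1 p2.
  have p3 : h * cn (E' x) <= h * M by rewrite ler_wpM2l.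
  have p4 : M * h ^+ 2 <= M * h by rewrite ler_wpM2l // expr2 ler_piMr.
  lra.
pose Phi x := 3 * M * (clamp a x + (if a < x then 1 else 0) + (if - a <= x then 1 else 0)).
have cl x : - a <= clamp a x <= a.
  by rewrite /clamp; case_if; apply/andP; split; lra.
rewrite (@integ1_FTC _ (M * (1 + a) ^+ 2) (fun x => E (clamp a x)) _ Phi (3 * M * (a + 2)) (E a) (E (- a))) //.
- move=> x; case: ifP => xa; last by rewrite cn0 mulr_ge0 ?mulr_ge0 ?exprn_ge0 ?addr_ge0 ?(ltW a0) ?(ltW (w1_gt0 _)).
  apply: le_trans (E'M x) _; rewrite -mulrA ler_peMr // /w1 ler_pdivlMr ?exprn_gt0 ?ltr_pwDl // mul1r.
  by rewrite lerXn2r ?nnegrE ?addr_ge0 ?(ltW a0) // lerD2l.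
- move=> x h h0 h1; rewrite /Phi -mulrBr.
  have Mh : 0 <= M * h by rewrite mulr_ge0 // ltW.
  have [xa|xa] := ltP x (- a).
    rewrite (_ : `|x| <= a = false); last by apply/negbTE; rewrite -ltNge ltr_normr; apply/orP; right; lra.
    rewrite mulr0 subr0; have cx : clamp a x = - a by rewrite /clamp; case_if; lra.
    have [xh|xh] := ltP (x + h) (- a).
      have -> : clamp a (x + h) = - a by rewrite /clamp; case_if; lra.
      by rewrite cx subrr cn0 mulr_ge0 ?(ltW h0) // !mulr_ge0 //; case_if; lra.
    set t := clamp a (x + h) + a; have t0 : 0 <= t <= h.
      by rewrite /t /clamp; case_if; apply/andP; split; lra.
    rewrite cx (_ : clamp a (x + h) = - a + t); last by rewrite /t; ring.
    have /andP[t1 t2] := t0.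
    apply: le_trans (lip (- a) t t1 ltac:(lra)) _.
    rewrite (_ : a < x = false) ?addr0; last by apply/negbTE; rewrite -leNgt; lra.
    have : M * t <= M * h by rewrite ler_wpM2l.
    have : 0 <= M * h * t by rewrite mulr_ge0.
    by case_if; lra.
  have [ax|ax] := ltP a x.
    rewrite (_ : `|x| <= a = false); last by apply/negbTE; rewrite -ltNge ltr_normr ax.
    have -> : clamp a x = a by rewrite /clamp; case_if; lra.
    have -> : clamp a (x + h) = a by rewrite /clamp; case_if; lra.
    rewrite mulr0 subr0 subrr cn0; apply: mulr_ge0; first exact: ltW.
    by rewrite mulr_ge0 ?mulr_ge0 //; case_if; lra.
  rewrite (_ : `|x| <= a); last by rewrite ler_norml; apply/andP; split; lra.
  have cx : clamp a x = x by rewrite /clamp; case_if; lra.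
  rewrite cx (_ : - a <= x + h); last by lra.
  have [xh|xh] := ltP a (x + h); last first.
    have -> : clamp a (x + h) = x + h by rewrite /clamp; case_if; lra.
    apply: le_trans (EM x h (ltW h0) h1) _; rewrite addr0.
    have q : 0 <= M * h * h by rewrite mulr_ge0 // ltW.
    lra.
  have -> : clamp a (x + h) = x + (a - x) by rewrite /clamp; case_if; lra.
  apply: le_trans (cnB _ _) _; rewrite cnM cn_real (gtr0_norm h0).
  have p1 := lip x (a - x) ltac:(lra) ltac:(lra).
  have p2 : h * cn (E' x) <= h * M by rewrite ler_wpM2l // ltW.
  have p3 : M * (a - x) <= M * h by rewrite ler_wpM2l //; lra.
  have p4 : 0 <= M * (a - x) by rewrite mulr_ge0 //; lra.
  have p5 : 0 <= h * (M * (a - x)) by rewrite mulr_ge0 // ltW.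
  by lra.
- move=> x; rewrite /Phi normrM ger0_norm ?mulr_ge0 // ler_wpM2l ?mulr_ge0 //.
  have := cl x; rewrite ler_norml => /andP[c1 c2]; case_if; apply/andP; split; lra.
- move=> e e0; exists a => x ax.
  have -> : clamp a x = a by rewrite /clamp; case_if; lra.
  have -> : clamp a (- x) = - a by rewrite /clamp; case_if; lra.
  by rewrite !subrr cn0.
Qed.

Lemma cexp_2pi_int (k : int) : cexp ('i * (2 * pi * k%:~R)%:C) = 1 :> C.
Proof.
have h n : cexp ('i * (2 * pi * n%:R)%:C) = 1 :> C.
  rewrite (_ : _ * _ = n%:R * ('i * (2 * pi)%:C)); last by rewrite [(_ * n%:R)%:C]rmorphM /= rmorph_nat; ring.
  rewrite cexpM_natl (_ : cexp _ = 1) ?expr1n //.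
  rewrite cexpE [_ * (2 * pi)%:C]mulrC Re_realM Im_realM /= mulr0 mulr1 expR0.
  by rewrite mulr_natl cos2pi sin2pi mul1r.
case: k => n; first exact: h.
rewrite NegzE rmorphN /= mulrN rmorphN /= mulrN cexpN.
by rewrite (_ : (n.+1%:Z)%:~R = n.+1%:R :> R) // h invr1.
Qed.

Lemma integ1_trig (L : R) (k : int) : 0 < L ->
  integ1 (fun x => if `|x| <= pi * L then cexp ('i * (k%:~R * x / L)%:C) else 0) =
  (if k == 0 then 2 * pi * L else 0)%:C.
Proof.
move=> L0; have pL : 0 < pi * L by rewrite mulr_gt0 ?pi_gt0.
have [->|k0] := eqVneq k 0.
  rewrite (_ : (fun x => _) = fun x => if `|x| <= pi * L then 1 else 0); last first.
    apply: funext => x; case: ifP => // _.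
    by rewrite mul0r mul0r (rmorph0 (real_complex R)) mulr0 cexp0.
  rewrite (@integ1_segment _ 1 (fun x => x%:C) (fun=> 1)) //.
  - by rewrite -rmorphB /= ; congr (_%:C); ring.
  - by move=> x; rewrite cn1.
  - move=> x h h0 h1; rewrite mulr1 -!rmorphB cn_real (_ : x + h - x - h = 0); last by ring.
    by rewrite normr0 mul1r exprn_ge0.
set w : R := k%:~R / L; have w0 : w != 0 by apply: mulf_neq0; [rewrite intr_eq0|rewrite invr_eq0 gt_eqF].
have wC : 'i * w%:C != 0 :> C by rewrite -cn_gt0 cnM cn_i mul1r cn_real normr_gt0.
have wE (x : R) : (k%:~R * x / L)%:C = w%:C * x%:C :> C.
  by rewrite -rmorphM; congr (_%:C); rewrite /w; ring.
under [X in integ1 X]funext do rewrite wE mulrA.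
rewrite (@integ1_segment _ (1 + `|w| * expR `|w|) (fun x => cexp ('i * w%:C * x%:C) / ('i * w%:C)) (fun x => cexp ('i * w%:C * x%:C))) //.
- rewrite -mulrBl (_ : 'i * w%:C * (pi * L)%:C = 'i * w%:C * (- (pi * L))%:C + 'i * (2 * pi * k%:~R)%:C).
    by rewrite cexpD cexp_2pi_int mulr1 subrr mul0r.
  rewrite -!mulrA -mulrDr -!rmorphM -rmorphD; congr (_ * _%:C); rewrite /w /=; field.
  by rewrite gt_eqF.
- move=> x; rewrite -mulrA -rmorphM cn_cexp mulrC Re_realM /= mulr0 expR0 lerDl.
  by rewrite mulr_ge0 // expR_ge0.
- move=> x h h0 h1; rewrite rmorphD /= mulrDr cexpD.
  set e := cexp (_ * x%:C); set z := 'i * w%:C * h%:C.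
  have e1 : cn e = 1 by rewrite /e -mulrA -rmorphM cn_cexp mulrC Re_realM /= mulr0 expR0.
  have zz : h%:C * e = e / ('i * w%:C) * z by rewrite /z mulrA divfK // mulrC.
  rewrite zz (_ : _ - _ - _ = e / ('i * w%:C) * (cexp z - 1 - z)); last by ring.
  rewrite !cnM e1 cnV cnM cn_i !mul1r cn_real.
  have := cexp_taylor 2 z.
  rewrite !big_ord_recr big_ord0 /= expr0 expr1 !divr1 add0r opprD addrA.
  have -> : cn z = `|w| * h by rewrite /z !cnM cn_i mul1r !cn_real (ger0_norm h0).
  have wp : 0 < `|w| by rewrite normr_gt0.
  move=> tz; rewrite ler_pdivrMl //; apply: le_trans tz _.
  rewrite exprMn [X in _ <= X](_ : _ = `|w| ^+ 2 * h ^+ 2 * expR `|w| + `|w| * h ^+ 2); last by ring.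
  apply: le_trans (_ : `|w| ^+ 2 * h ^+ 2 * expR `|w| <= _).
    by rewrite ler_wpM2l ?mulr_ge0 ?exprn_ge0 // ler_expR ler_piMr // ltW.
  by rewrite lerDl mulr_ge0 ?exprn_ge0.
Qed.

Variable d : nat.
Variable L : R.
Hypothesis L0 : 0 < L.

Definition inbox (s : 'I_d -> R) : bool := [forall j, `|s j| <= pi * L].
Definition onbox (h : ('I_d -> R) -> C) (s : 'I_d -> R) : C := if inbox s then h s else 0.
(** The mean over the torus, parametrised by the angles s / L; L will be the square root of n. *)
Definition tor (h : ('I_d -> R) -> C) : C := ((2 * pi * L) ^- d)%:C * integ (onbox h).
Definition chi (k : 'I_d -> int) (s : 'I_d -> R) : C := cexp ('i * (\sum_j (k j)%:~R * s j / L)%:C).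

Lemma inbox_W s : inbox s -> 1 <= (1 + pi * L) ^+ (2 * d) * W s.
Proof.
move=> /forallP h; rewrite exprM -[X in _ ^+ X](card_ord d) -prodr_const /W -big_split /=.
elim/big_ind: _ => [//|x y x1 y1|j _]; first by rewrite mulr_ege1.
have pL : 0 <= pi * L by rewrite mulr_ge0 ?pi_ge0 ?ltW.
rewrite /w1 ler_pdivlMr ?exprn_gt0 ?ltr_pwDl // mul1r.
by apply: lerXn2r; rewrite ?nnegrE ?addr_ge0 // lerD2l h.
Qed.

Lemma onbox_dominated (B : R) h : (forall s, inbox s -> cn (h s) <= B) -> 0 <= B ->
  dominated (B * (1 + pi * L) ^+ (2 * d)) (onbox h).
Proof.
move=> hB B0 s; rewrite /onbox; case: ifP => [si|_]; last first.
  rewrite cn0 !mulr_ge0 ?exprn_ge0 ?(ltW (W_gt0 _)) // addr_ge0 // mulr_ge0 ?pi_ge0 //.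
  exact: ltW.
apply: le_trans (hB s si) _; rewrite -mulrA ler_peMr // inbox_W //.
Qed.

Lemma cn_chi k s : cn (chi k s) = 1.
Proof. by rewrite /chi cn_cexp mulrC Re_realM /= mulr0 expR0. Qed.

Lemma tor_chi k : tor (chi k) = (if [forall j, k j == 0] then 1 else 0).
Proof.
rewrite /tor.
pose f j x : C := if `|x| <= pi * L then cexp ('i * ((k j)%:~R * x / L)%:C) else 0.
have -> : onbox (chi k) = fun s => \prod_j f j (s j).
  apply: funext => s; rewrite /onbox; case: ifP => [/forallP h|/negbT].
    rewrite /chi -sumC mulr_sumr cexp_sum; apply: eq_bigr => j _.
    by rewrite /f h.
  rewrite negb_forall => /existsP[j hj]; apply/esym/eqP.
  by rewrite prodf_seq_eq0; apply/hasP; exists j; rewrite ?mem_index_enum //= /f (negbTE hj).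
have pL : 0 < pi * L by rewrite mulr_gt0 ?pi_gt0.
rewrite (@integ_prod _ _ (fun=> (1 + pi * L) ^+ 2)) => [|j x]; last first.
  rewrite /f; case: ifP => xa; last by rewrite cn0 mulr_ge0 ?exprn_ge0 ?addr_ge0 ?(ltW pL) ?(ltW (w1_gt0 _)).
  rewrite cn_cexp mulrC Re_realM /= mulr0 expR0.
  rewrite /w1 ler_pdivlMr ?exprn_gt0 ?ltr_pwDl // mul1r.
  by apply: lerXn2r; rewrite ?nnegrE ?addr_ge0 ?(ltW pL) // lerD2l.
under eq_bigr do rewrite integ1_trig //.
have p0 : 2 * pi * L != 0 by rewrite -mulrA mulf_neq0 ?gt_eqF.
case: ifP => [/forallP h|/negbT].
  under eq_bigr do rewrite h.
  by rewrite prodr_const card_ord -rmorphXn -rmorphM /= mulVf ?expf_neq0.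
rewrite negb_forall => /existsP[j hj].
by rewrite (bigD1 j) //= (negbTE hj) (rmorph0 (real_complex R)) mul0r mulr0.
Qed.

Lemma chiD k l s : chi (fun j => k j + l j) s = chi k s * chi l s.
Proof.
rewrite /chi -cexpD -mulrDr -rmorphD -big_split; congr (cexp (_ * _%:C)).
by apply: eq_bigr => j _ /=; rewrite rmorphD /=; ring.
Qed.

Definition mz (m : mi d) : 'I_d -> int := fun j => (m j)%:Z.

(** Here [h] is known through its Fourier coefficients alone: those of [F] at nonnegative
    frequencies and zero at all others. Products can be formed without writing [h] as a series. *)
Definition has_coef (h : ('I_d -> R) -> C) (F : mi d -> C) :=
  (exists B, forall s, cn (h s) <= B) /\
  forall k : 'I_d -> int, tor (fun s => h s * chi (fun j => - k j) s) =
    if [forall j, 0 <= k j] then F [ffun j => `|k j|%N] else 0.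

Definition fser (F : mi d -> C) (s : 'I_d -> R) : C := csum (fun m => F m * chi (mz m) s).

Lemma fser_summable K F s : summable K F -> summable K (fun m => F m * chi (mz m) s).
Proof. by apply: summable_le => m; rewrite cnM cn_chi mulr1. Qed.

Lemma has_coef_one : has_coef (fun=> 1) (@ps_one C d).
Proof.
split; first by exists 1 => s; rewrite cn1.
move=> k; rewrite (_ : (fun s => _) = chi (fun j => - k j)); last by apply: funext => s; rewrite mul1r.
rewrite tor_chi /ps_one.
have -> : [forall j, - k j == 0] = [forall j, 0 <= k j] && ([ffun j => `|k j|%N] == Defs.mzero d).
  apply/forallP/andP => [h|[_ /eqP/ffunP h] j].
    split; first by apply/forallP => j; have := h j; rewrite oppr_eq0 => /eqP ->.
    by apply/eqP/ffunP => j; rewrite !ffunE; have := h j; rewrite oppr_eq0 => /eqP ->.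
  by have := h j; rewrite !ffunE => /eqP; rewrite absz_eq0 oppr_eq0.
by case: [forall j, 0 <= k j].
Qed.

(** Only the factor [F] is expanded. Exchanging its series with the torus mean shifts the frequency
    of [h] by m, and the vanishing of its other frequencies cuts the sum down to m <= k, which
    leaves the Cauchy product. *)
Lemma has_coef_mul K (F : mi d -> C) h G : summable K F -> has_coef h G ->
  has_coef (fun s => fser F s * h s) (ps_mul F G).
Proof.
move=> sF [[B hB] hG].
have B0 : 0 <= B by apply: le_trans (hB (fun=> 0)); apply: cn_ge0.
split.
  exists (K * B) => s; rewrite cnM; apply: ler_pM; rewrite ?cn_ge0 //.
  exact: csum_bound (fser_summable s sF).
move=> k; pose Q := (1 + pi * L) ^+ (2 * d).
have pL : 0 <= pi * L by rewrite mulr_ge0 ?pi_ge0 ?ltW.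
have Q0 : 0 <= Q by rewrite exprn_ge0 // addr_ge0.
pose T m s := F m * onbox (fun s => h s * (chi (fun j => - k j) s * chi (mz m) s)) s.
have dT m : dominated (B * Q) (onbox (fun s => h s * (chi (fun j => - k j) s * chi (mz m) s))).
  by apply: onbox_dominated => // s _; rewrite !cnM !cn_chi !mulr1.
have [||m s|_ e] := @csum_integ R d (fun m => cn (F m) * (B * Q)) (K * (B * Q)) T.
- by move=> m; rewrite !mulr_ge0 ?cn_ge0.
- by move=> N; rewrite /boxsum -mulr_suml ler_wpM2r ?mulr_ge0 // (sF N).
- by rewrite /T cnM -mulrA ler_wpM2l ?cn_ge0 // (dT m s).
rewrite /tor (_ : onbox _ = fun s => csum (fun m => T m s)); last first.
  apply: funext => s; rewrite /onbox /T; case: ifP => si; last first.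
    by rewrite (@csum_finite _ _ 0) ?/boxsum ?big1 // => m _; rewrite /onbox si mulr0.
  rewrite -mulrA mulrC /fser -(csumZ _ (fser_summable s sF)).
  congr csum; apply: funext => m; rewrite /onbox si.
  by move: (chi _ s) (chi (mz m) s) => x y; ring.
have hE m : tor (fun s => h s * (chi (fun j => - k j) s * chi (mz m) s)) =
    if [forall j, 0 <= k j - (m j)%:Z] then G [ffun j => `|k j - (m j)%:Z|%N] else 0.
  rewrite -hG; congr tor; apply: funext => s; rewrite -chiD; congr (_ * chi _ s).
  by apply: funext => j; rewrite /mz opprB addrC.
rewrite e -(@csumZ _ _ (K * (B * Q) * 4 ^+ d)); last first.
  move=> N; apply: le_trans (_ : boxsum N (fun m => cn (F m) * ((B * Q) * 4 ^+ d)) <= _).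
    apply: ler_sum => m _; rewrite /T (integZ _ (dT m)) cnM ler_wpM2l ?cn_ge0 //.
    exact: integ_bound (dT m).
  have BQ : 0 <= B * Q * 4 ^+ d by apply: mulr_ge0; [exact: mulr_ge0|exact: exprn_ge0].
  by rewrite /boxsum -mulr_suml -[X in _ <= X]mulrA ler_wpM2r //; exact: sF.
pose kk : mi d := [ffun j => `|k j|%N].
have term m : ((2 * pi * L) ^- d)%:C * integ (T m) =
    if [forall j, 0 <= k j] && mle m kk then F m * G (msub m kk) else 0.
  rewrite /T (integZ _ (dT m)) mulrCA -/(tor _).
  rewrite hE.
  have -> : [forall j, 0 <= k j - (m j)%:Z] = [forall j, 0 <= k j] && mle m kk.
    apply/forallP/andP => [h1|[/forallP h1 /forallP h2] j].
      have kp j : 0 <= k j by have := h1 j; rewrite subr_ge0; apply: le_trans.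
      split; first exact/forallP.
      apply/forallP => j; rewrite ffunE -lez_nat gez0_abs //; have := h1 j.
      by rewrite subr_ge0.
    by have := h2 j; rewrite ffunE -lez_nat gez0_abs // subr_ge0.
  case: ifP => [/andP[/forallP h1 /forallP h2]|_]; last by rewrite mulr0.
  congr (_ * G _); apply/ffunP => j; rewrite !ffunE.
  have := h2 j; rewrite ffunE => h3.
  by rewrite -[k j]gez0_abs // subzn // absz_nat.
rewrite (_ : (fun m => _) = fun m => if [forall j, 0 <= k j] && mle m kk then F m * G (msub m kk) else 0); last first.
  by apply: funext => m; rewrite term.
case: ifP => /= hk; last by rewrite (@csum_finite _ _ 0) ?/boxsum ?big1.
rewrite (@csum_finite _ _ (mmax kk)); last first.
  move=> m hm; case: ifP => // /forallP hp; case/negP: hm; rewrite mem_box; apply/forallP => i.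
  exact: leq_trans (hp i) (le_mmax kk i).
rewrite /ps_mul (msum_leE _ (leqnn _)) /boxsum -/kk [RHS]big_mkcond /=.
by [].
Qed.

Lemma has_coef_pow K (F : mi d -> C) n : summable K F -> has_coef (fun s => fser F s ^+ n) (ps_pow F n).
Proof.
move=> sF; elim: n => [|n IH]; first exact: has_coef_one.
have := has_coef_mul sF IH; rewrite (_ : (fun s => _) = fun s => fser F s ^+ n.+1) //.
by apply: funext => s; rewrite exprS.
Qed.

End Torus.

(** * Cauchy's formula for the coefficient *)

Section Coefficients.
Variable R : realType.
Notation C := R[i].

Definition wt d (z : 'I_d -> C) (m : mi d) : C := \prod_(j < d) z j ^+ m j.
Definition lin d (w : 'I_d -> C) (m : mi d) : C := \sum_(j < d) (m j)%:R * w j.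
Definition evl d (F : mi d -> C) (w : 'I_d -> C) : C := csum (fun m => F m * cexp (lin w m)).

Lemma cexp_lin d (w : 'I_d -> C) (m : mi d) : cexp (lin w m) = \prod_(j < d) cexp (w j) ^+ m j.
Proof. by rewrite /lin cexp_sum; apply: eq_bigr => j _; rewrite cexpM_natl. Qed.

Lemma wtM d (z w : 'I_d -> C) m : wt (fun j => z j * w j) m = wt z m * wt w m.
Proof. by rewrite /wt -big_split; apply: eq_bigr => j _; rewrite exprMn. Qed.

Lemma wt_msub d (z : 'I_d -> C) (p m : mi d) : mle p m -> wt z p * wt z (msub p m) = wt z m.
Proof.
move=> /forallP h; rewrite /wt -big_split; apply: eq_bigr => j _ /=.
by rewrite ffunE -exprD subnKC.
Qed.

Lemma ps_mul_wt d (z : 'I_d -> C) (a b : C) (F G : mi d -> C) :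
  ps_mul (fun m => a * wt z m * F m) (fun m => b * wt z m * G m) =
  fun m => a * b * wt z m * ps_mul F G m.
Proof.
apply: funext => m; rewrite /ps_mul !(msum_leE _ (leqnn _)) mulr_sumr.
apply: eq_bigr => p pm; rewrite -(wt_msub z pm); ring.
Qed.

Lemma ps_pow_wt d (z : 'I_d -> C) (c : C) (G : mi d -> C) n :
  ps_pow (fun m => c * wt z m * G m) n = fun m => c ^+ n * wt z m * ps_pow G n m.
Proof.
elim: n => [|n IH].
  apply: funext => m; rewrite /ps_pow /= /ps_one; case: eqP => [->|_]; last by rewrite mulr0.
  by rewrite /wt big1 ?mul1r // => j _; rewrite ffunE.
by rewrite -[LHS]/(ps_mul _ (ps_pow _ n)) IH ps_mul_wt; apply: funext => m; rewrite exprS.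
Qed.

Lemma msum_le_rev (V : nmodType) d (k : mi d) (F : mi d -> V) :
  msum_le k (fun p => F (msub p k)) = msum_le k F.
Proof.
rewrite !(msum_leE _ (leqnn _)) -big_filter -[RHS]big_filter -(big_map (fun p => msub p k) xpredT F).
set r := [seq p <- box d (mmax k) | mle p k]; apply: perm_big.
have inr p : (p \in r) = mle p k.
  rewrite mem_filter; case h: (mle p k) => //=; rewrite mem_box; apply/forallP => i.
  by apply: leq_trans (le_mmax k i); move/forallP: h.
have subm p : mle (msub p k) k by apply/forallP => i; rewrite ffunE leq_subr.
have invo p : mle p k -> msub (msub p k) k = p.
  by move=> /forallP h; apply/ffunP => i; rewrite !ffunE subKn.
have ur : uniq r by rewrite filter_uniq ?box_uniq.
apply: uniq_perm => // [|p].
  rewrite map_inj_in_uniq // => p q; rewrite !inr => hp hq e.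
  by rewrite -(invo p hp) e invo.
rewrite inr; apply/mapP/idP => [[q _ ->] //|hp].
by exists (msub p k); rewrite ?inr // invo.
Qed.

Lemma summable_geo d (x : 'I_d -> C) : (forall j, cn (x j) < 1) ->
  summable (\prod_j (1 - cn (x j))^-1) (wt x).
Proof.
move=> x1 N; rewrite /boxsum big_box.
rewrite (eq_bigr (fun p : {ffun 'I_d -> 'I_N.+1} => \prod_j cn (x j) ^+ p j)); last first.
  by move=> p _; rewrite /wt cn_prod; apply: eq_bigr => j _; rewrite cnX ffunE.
rewrite -(bigA_distr_bigA (fun j (i : 'I_N.+1) => cn (x j) ^+ i)).
apply: ler_prod => j _; have xj := x1 j; have x0 := cn_ge0 (x j).
rewrite sumr_ge0 => [|i _]; last by rewrite exprn_ge0.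
rewrite -div1r ler_pdivlMr; last by lra.
have := subrX1 (cn (x j)) N.+1; have := exprn_ge0 N.+1 x0; nra.
Qed.

Lemma csum_geo d (x : 'I_d -> C) : (forall j, cn (x j) < 1) ->
  csum (wt x) = \prod_j (1 - x j)^-1.
Proof.
move=> x1; apply: (csum_unique (summable_geo x1)).
have x1' j : 1 - x j != 0.
  by rewrite subr_eq0; apply: contraTneq (x1 j) => <-; rewrite cn1 ltxx.
have u : ucvg (fun N => \prod_j ((1 - x j)^-1 - (1 - x j)^-1 * x j ^+ N.+1)) (\prod_j (1 - x j)^-1).
  apply: ucvg_prod => j.
  have z : ucvg (fun N => x j ^+ N.+1) 0.
    apply: ucvg_lim => e e0.
    have : (cn (x j)) ^+ n @[n --> \oo] --> (0 : R).
      by apply: cvg_expr; rewrite ger0_norm ?cn_ge0.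
    move=> /cvgrPdist_lt /(_ e e0) [N _ hN]; exists N => n nN.
    have := hN n.+1; rewrite /= sub0r normrN ger0_norm ?exprn_ge0 ?cn_ge0 // subr0 cnX.
    by apply; exact: leqW.
  have := ucvgD (ucvg_cst (1 - x j)^-1) (ucvgZ (- (1 - x j)^-1) z); rewrite mulr0 addr0.
  by apply: ucvg_ext => N; rewrite mulNr.
apply: ucvg_ext u => N; rewrite /boxsum big_box.
rewrite (eq_bigr (fun p : {ffun 'I_d -> 'I_N.+1} => \prod_j x j ^+ p j)); last first.
  by move=> p _; rewrite /wt; apply: eq_bigr => j _; rewrite ffunE.
rewrite -(bigA_distr_bigA (fun j (i : 'I_N.+1) => x j ^+ i)); apply: eq_bigr => j _.
apply: (mulfI (x1' j)); rewrite mulrBr mulrA divff // mul1r.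
by rewrite -[LHS]opprB subrX1 -mulNr opprB.
Qed.

Definition ypt d (v s : 'I_d -> R) : 'I_d -> C := fun j => - (v j)%:C + 'i * (s j)%:C.

(** All radii z_j e^{-u v_j} are below 1, so on this torus 1 / prod_j (1 - z_j) is the absolutely
    convergent series with all coefficients 1, and enters as one more factor of the Cauchy
    product. *)
Lemma coef_formula d (z v : 'I_d -> R) (u : R) (a b : mi d -> C) (B : C) (Ka Kb : R) (kap : mi d) n :
  0 < u -> (forall j, 0 < z j) -> (forall j, z j * expR (- (u * v j)) < 1) -> (forall j, 0 <= v j) -> B != 0 ->
  summable Ka (fun m => wt (fun j => (z j)%:C) m * a m) ->
  summable Kb (fun m => B^-1 * wt (fun j => (z j)%:C) m * b m) ->
  wt (fun j => (z j)%:C) kap * B ^- n * coef_div_prod (ps_mul a (ps_pow b n)) kap =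
  ((2 * pi / u) ^- d)%:C * integ (onbox u^-1 (fun s => let w := fun j => u%:C * ypt v s j in
    evl (fun m => wt (fun j => (z j)%:C) m * a m) w *
    evl (fun m => B^-1 * wt (fun j => (z j)%:C) m * b m) w ^+ n *
    \prod_j (1 - (z j)%:C * cexp (w j))^-1 * cexp (- lin w kap))).
Proof.
move=> u0 z0 zv v0 Bn sa sb.
pose zt j : C := (z j)%:C * cexp (- (u * v j)%:C).
have ztE m : wt zt m = wt (fun j => (z j)%:C) m * cexp (- (\sum_j (m j)%:R * (u * v j))%:C).
  rewrite /zt wtM; congr (_ * _); rewrite /wt -sumC -sumrN cexp_sum; apply: eq_bigr => j _.
  by rewrite -cexpM_natl mulrN [X in cexp (- X) = _](_ : _ = ((m j)%:R * (u * v j))%:C) // [RHS]rmorphM /= rmorph_nat.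
have ch m : 0 <= \sum_j (m j)%:R * (u * v j).
  by apply: sumr_ge0 => j _; rewrite mulr_ge0 // mulr_ge0 // ltW.
have tilt1 (m : mi d) : cn (cexp (- (\sum_j (m j)%:R * (u * v j))%:C)) <= 1.
  by rewrite cn_cexp -rmorphN /= -[X in _ <= X]expR0 ler_expR oppr_le0 ch.
have sa' : summable Ka (fun m => 1 * wt zt m * a m).
  apply: summable_le sa => m; rewrite mul1r ztE !cnM mulrAC ler_piMr ?mulr_ge0 ?cn_ge0 //.
have sb' : summable Kb (fun m => B^-1 * wt zt m * b m).
  apply: summable_le sb => m; rewrite ztE !cnM [cn B^-1 * _]mulrA mulrAC ler_piMr ?mulr_ge0 ?cn_ge0 //.
have zt1 j : cn (zt j) < 1.
  by rewrite /zt cnM cn_real gtr0_norm // cn_cexp -rmorphN.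
have sg : summable (\prod_j (1 - cn (zt j))^-1) (fun m => 1 * wt zt m * 1).
  by move=> N; under [X in boxsum _ X]funext do rewrite mul1r mulr1; apply: summable_geo.
have ui : 0 < u^-1 by rewrite invr_gt0.
have hc := has_coef_mul ui sg (has_coef_mul ui sa' (has_coef_pow ui n sb')).
rewrite ps_pow_wt !ps_mul_wt in hc.
have [_ /(_ (mz kap))] := hc.
rewrite (_ : [forall j, 0 <= mz kap j]); last exact/forallP.
rewrite (_ : [ffun j => `|mz kap j|%N] = kap); last by apply/ffunP => j; rewrite ffunE.
have -> : ps_mul (fun=> 1) (ps_mul a (ps_pow b n)) kap = coef_div_prod (ps_mul a (ps_pow b n)) kap.
  rewrite /coef_div_prod -[RHS]msum_le_rev /ps_mul !(msum_leE _ (leqnn _)).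
  by apply: eq_bigr => p _; rewrite mul1r.
(* [E] undoes the part e^{-u v.kappa} of the radii, so that the prefactor is z^kappa itself. *)
move=> e; pose E := cexp ((\sum_j (kap j)%:R * (u * v j))%:C).
transitivity (E * (1 * (1 * B^-1 ^+ n) * wt zt kap * coef_div_prod (ps_mul a (ps_pow b n)) kap)).
  rewrite ztE !mul1r exprVn cexpN -/E; have E0 : E != 0 by exact: cexp_neq0.
  by field; rewrite E0 expf_neq0.
rewrite -e /tor mulrCA; congr (_ * _).
pose h s := let w := fun j => u%:C * ypt v s j in
    evl (fun m => wt (fun j => (z j)%:C) m * a m) w *
    evl (fun m => B^-1 * wt (fun j => (z j)%:C) m * b m) w ^+ n *
    \prod_j (1 - (z j)%:C * cexp (w j))^-1 * cexp (- lin w kap).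
have linE s (m : mi d) : lin (fun j => u%:C * ypt v s j) m =
    - (\sum_j (m j)%:R * (u * v j))%:C + 'i * (\sum_j (mz m j)%:~R * s j / u^-1)%:C.
  rewrite /lin -!sumC -sumrN mulr_sumr -big_split; apply: eq_bigr => j _ /=.
  by rewrite /ypt /mz invrK !rmorphM /= rmorph_nat; ring.
have hE s : h s = E * (fser u^-1 (fun m => 1 * wt zt m * 1) s *
   (fser u^-1 (fun m => 1 * wt zt m * a m) s * fser u^-1 (fun m => B^-1 * wt zt m * b m) s ^+ n) * chi u^-1 (fun j => - mz kap j) s).
  have ek : cexp (- lin (fun j => u%:C * ypt v s j) kap) = E * chi u^-1 (fun j => - mz kap j) s.
    rewrite /E /chi -cexpD linE opprD opprK; congr (cexp (_ + _)); rewrite -mulrN -rmorphN -sumrN.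
    by congr (_ * _%:C); apply: eq_bigr => j _; rewrite rmorphN /= !mulNr.
  have ser (c : C) (F : mi d -> C) : evl (fun m => c * wt (fun j => (z j)%:C) m * F m) (fun j => u%:C * ypt v s j) =
      fser u^-1 (fun m => c * wt zt m * F m) s.
    rewrite /evl /fser; congr csum; apply: funext => m; rewrite ztE linE cexpD /chi.
    by move: (cexp (- _)) (cexp ('i * _)) => x y; ring.
  have geo : \prod_j (1 - (z j)%:C * cexp (u%:C * ypt v s j))^-1 = fser u^-1 (fun m => 1 * wt zt m * 1) s.
    rewrite -ser /evl -(@csum_geo _ (fun j => (z j)%:C * cexp (u%:C * ypt v s j))).
      by congr csum; apply: funext => m; rewrite wtM cexp_lin mul1r mulr1.
    move=> j; rewrite cnM cn_real gtr0_norm // cn_cexp Re_realM /ypt ReD ReN -['i * _]mulrC Re_realM /=.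
    by rewrite mulr0 addr0 mulrN.
  have sera : evl (fun m => wt (fun j => (z j)%:C) m * a m) (fun j => u%:C * ypt v s j) =
      fser u^-1 (fun m => 1 * wt zt m * a m) s.
    by rewrite -ser; congr evl; apply: funext => m; rewrite mul1r.
  rewrite /h /= geo ek sera ser.
  by move: (chi _ _ _) (fser _ _ _) (fser _ _ _) (fser _ _ _) => x1 x2 x3 x4; ring.
have db : exists K, dominated K (onbox u^-1 (fun s => fser u^-1 (fun m => 1 * wt zt m * 1) s *
   (fser u^-1 (fun m => 1 * wt zt m * a m) s * fser u^-1 (fun m => B^-1 * wt zt m * b m) s ^+ n) * chi u^-1 (fun j => - mz kap j) s)).
  have [[Bd hB] _] := hc; exists (Bd * (1 + pi * u^-1) ^+ (2 * d)); apply: onbox_dominated => //.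
    by move=> s _; rewrite cnM cn_chi mulr1.
  by apply: le_trans (hB (fun=> 0)); apply: cn_ge0.
have [K dK] := db; rewrite -(integZ E dK); congr integ; apply: funext => s.
by rewrite /onbox; case: ifP => _; rewrite ?mulr0 //= -/(h s) hE.
Qed.

End Coefficients.

(** * Agreement with the sums of the statement; exponential margins *)

Section SumLinks.
Variable R : realType.
Notation C := R[i].

(** Every finite set of multi-indices lies in a box, so the supremum over finite sets is the limit
    of the box sums. *)
Lemma esum_csum d (c : mi d -> R) : (forall m, 0 <= c m) ->
  (\esum_(m in [set: mi d]) (c m)%:E < +oo)%E ->
  (forall N, boxsum N c <= fine (\esum_(m in [set: mi d]) (c m)%:E)%E) /\
  csum (fun m => (c m)%:C) = (fine (\esum_(m in [set: mi d]) (c m)%:E)%E)%:C.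
Proof.
move=> c0 fin; set S := fine _.
have eS : (\esum_(m in [set: mi d]) (c m)%:E)%E = S%:E.
  by rewrite fineK // ge0_fin_numE //; apply: esum_ge0 => m _; rewrite lee_fin.
have bE N : (\sum_(m \in [set` box d N]) (c m)%:E)%E = (boxsum N c)%:E.
  by rewrite -fsbig_seq ?box_uniq // sumEFin.
have bS N : boxsum N c <= S.
  rewrite -lee_fin -eS -bE; apply: esum_ge; exists [set` box d N]; last exact: lexx.
  by split=> //; exact: finite_seq.
split=> //; have sc : summable S (fun m => (c m)%:C).
  by move=> N; apply: le_trans (bS N); apply: ler_sum => m _; rewrite cn_real ger0_norm.
have near e : 0 < e -> exists N0, forall N, (N0 <= N)%N -> cn (csum (fun m => (c m)%:C) - (boxsum N c)%:C) <= e.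
  move=> e0; have [N0 hN] := csum_tail c0 bS e0; exists N0 => N /hN h.
  have eb : boxsum N (fun m => (c m)%:C) = (boxsum N c)%:C by exact: sumC.
  rewrite -eb; apply: h => m.
  by rewrite cn_real ger0_norm.
have [l lE] : exists l, l = csum (fun m => (c m)%:C) by eexists.
rewrite -lE in near *.
have bl N : boxsum N c <= complex.Re l.
  rewrite leNgt; apply/negP => lt; have e0 : 0 < (boxsum N c - complex.Re l) / 2 by lra.
  have [N0 hN] := near _ e0; have := hN _ (leq_maxl N0 N); have := cn_Re (l - (boxsum (maxn N0 N) c)%:C).
  rewrite ReD ReN /= => h1 h2; have := boxsum_mono (leq_maxr N0 N) c0.
  have := ler_norm (- (complex.Re l - boxsum (maxn N0 N) c)); rewrite normrN; lra.
have Sl : S <= complex.Re l.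
  rewrite -lee_fin -eS; apply: ge_ereal_sup => _ [X [finX _] <-].
  have [r rX] : exists r : seq (mi d), X = [set` r] by apply/finite_seqP.
  pose N := \max_(m <- r) mmax m.
  apply: le_trans (_ : (\sum_(m \in [set` box d N]) (c m)%:E <= _)%E); last by rewrite bE lee_fin.
  apply: lee_fsum_nneg_subset => //; first exact: finite_seq.
    move=> m; rewrite rX !inE /= => mr; apply: mem_box_mono (mmaxP m).
    exact: leq_bigmax_seq.
  by move=> m _; rewrite lee_fin.
have lS : complex.Re l <= S.
  rewrite leNgt; apply/negP => lt; have e0 : 0 < (complex.Re l - S) / 2 by lra.
  have [N0 hN] := near _ e0; have := hN _ (leqnn N0); have := cn_Re (l - (boxsum N0 c)%:C).
  by rewrite ReD ReN /= => h1 h2; have := bS N0; have := ler_norm (complex.Re l - boxsum N0 c); lra.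
apply: complex_eq => /=; first by apply/eqP; rewrite eq_le lS Sl.
apply/eqP; rewrite -normr_eq0 eq_le normr_ge0 andbT leNgt; apply/negP => e0.
have e2 : 0 < `|complex.Im l| / 2 by lra.
have [N0 hN] := near _ e2; have := hN _ (leqnn N0); have := cn_Im (l - (boxsum N0 c)%:C).
by rewrite ImD ImN /= oppr0 addr0; lra.
Qed.

Lemma mono_wt d (x : 'rV[R]_d) m : (mono x m)%:C = wt (fun j => (x 0 j)%:C) m :> C.
Proof. by rewrite /mono /wt rmorph_prod; apply: eq_bigr => j _; rewrite rmorphXn. Qed.

(** The box sums converge in the ordinary sense by [csum_tail], so both limits are the same
    number. *)
Lemma ps_val_C_csum d (a : mi d -> C) (x : 'rV[R]_d) (K : R) :
  summable K (fun m => wt (fun j => (x 0 j)%:C) m * a m) ->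
  ps_val_C a x = csum (fun m => wt (fun j => (x 0 j)%:C) m * a m).
Proof.
move=> s; rewrite /ps_val_C; apply: (@cvg_lim (R[i]^o)); first exact: norm_hausdorff.
apply/cvgrPdist_lt => e e0.
have eR : e = (complex.Re e)%:C by rewrite RRe_real // ger0_real // ltW.
have e1 : 0 < complex.Re e by rewrite -ltcR -eR.
have e2 : 0 < complex.Re e / 2 by lra.
have [N0 hN] := csum_tail (fun m => cn_ge0 (wt (fun j => (x 0 j)%:C) m * a m)) s e2.
exists N0 => // N /= NN; rewrite cnE eR ltcR.
rewrite (_ : \sum_p _ = boxsum N (fun m => wt (fun j => (x 0 j)%:C) m * a m)); last first.
  by rewrite /boxsum big_box; apply: eq_bigr => p _; rewrite -mono_wt mulrC.
by apply: le_lt_trans (hN N NN _ (fun m => lexx _)) _; lra.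
Qed.

Definition mabs d (m : mi d) : R := \sum_(j < d) (m j)%:R.

Lemma mabs_ge0 d (m : mi d) : 0 <= mabs m.
Proof. by apply: sumr_ge0. Qed.

(** Enlarged radii are traded for an exponential weight in the total degree; the later moment bounds
    are paid from this weight. *)
Lemma exp_margin d (z : 'I_d -> R) (eps : R) : (forall j, 0 < z j) -> 0 < eps ->
  exists2 e, 0 < e & forall m : mi d,
    (\prod_j z j ^+ m j) * expR (e * mabs m) <= \prod_j (z j + eps) ^+ m j.
Proof.
move=> z0 e0; pose Z := 1 + \sum_j z j.
have Z0 : 0 < Z by rewrite ltr_pwDl // sumr_ge0 // => j _; rewrite ltW.
have p0 : 0 < 1 + eps / Z by rewrite addr_gt0 // divr_gt0.
(* z_j (1 + eps / Z) <= z_j + eps because z_j <= Z; the summand 1 in Z keeps it positive even for d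
   = 0. *)
exists (ln (1 + eps / Z)); first by rewrite ln_gt0 // ltrDl divr_gt0.
move=> m; rewrite /mabs mulr_sumr expR_sum -big_split /=; apply: ler_prod => j _.
rewrite mulr_ge0 ?exprn_ge0 ?expR_ge0 ?(ltW (z0 j)) //= [ln _ * _]mulrC expRM_natl lnK ?posrE // -exprMn.
apply: lerXn2r; rewrite ?nnegrE.
- by rewrite mulr_ge0 // ltW.
- by rewrite addr_ge0 // ltW.
rewrite mulrDr mulr1 lerD2l mulrCA ger_pMr // ler_pdivrMr // mul1r.
rewrite ?ler_wpM2l ?(ltW e0) //.
apply: le_trans (_ : \sum_j z j <= _); last by rewrite /Z lerDr ler01.
by rewrite (bigD1 j) //= lerDl sumr_ge0 // => i _; rewrite ltW.
Qed.

End SumLinks.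

(** * Calculus of expansions in powers of n^{-1/2} *)

Section LocalExpansions.
Variable R : realType.
Notation C := R[i].
Variables (d : nat) (v : 'I_d -> R) (eps : R).
Hypothesis v01 : forall j, 0 <= v j <= 1.
Hypothesis eps0 : 0 < eps.

Definition un (n : nat) : R := (Num.sqrt n%:R)^-1.
(** A region in which |u y_j| <= 2 eps: [un n <= eps] takes care of the real part of y_j, the last
    condition of its imaginary part. *)
Definition near_origin (n : nat) (s : 'I_d -> R) :=
  [/\ (0 < n)%N, un n <= eps & forall j, un n * `|s j| <= eps].

Notation fam := (nat -> ('I_d -> R) -> ('I_d -> R) -> C).
Notation coef := (('I_d -> R) -> ('I_d -> C) -> C).

Lemma un_gt0 n : (0 < n)%N -> 0 < un n.
Proof. by move=> n0; rewrite invr_gt0 sqrtr_gt0 ltr0n. Qed.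

Lemma un_ge0 n : 0 <= un n.
Proof. by rewrite invr_ge0 sqrtr_ge0. Qed.

Lemma un_le1 n : (0 < n)%N -> un n <= 1.
Proof.
move=> n0; rewrite invf_le1 ?sqrtr_gt0 ?ltr0n //.
by apply: le_trans (_ : Num.sqrt 1 <= _); [rewrite sqrtr1|rewrite ler_wsqrtr ?ler1n].
Qed.

Lemma un_sqr n : (0 < n)%N -> n%:R * un n ^+ 2 = 1.
Proof.
move=> n0; rewrite exprVn sqr_sqrtr ?ler0n // divff //.
by rewrite pnatr_eq0 -lt0n.
Qed.

Lemma unC_neq0 n : (0 < n)%N -> (un n)%:C != 0 :> C.
Proof. by move=> n0; rewrite -cn_gt0 cn_real normr_gt0 gt_eqF // un_gt0. Qed.

Lemma cn_un n : cn (un n)%:C = un n.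
Proof. by rewrite cn_real ger0_norm // un_ge0. Qed.

Lemma cn_ypt s j : cn (ypt v s j) <= norm1 s.
Proof.
have /andP[v0 v1] := v01 j; apply: le_trans (cnD _ _) _; rewrite cnN cnM cn_i mul1r !cn_real.
by rewrite ger0_norm //; have := coord_le_norm1 s j; lra.
Qed.

Lemma near_ypt n s j : near_origin n s -> un n * cn (ypt v s j) <= 2 * eps.
Proof.
move=> [n0 ue /(_ j) se]; have /andP[v0 v1] := v01 j; have u0 := un_ge0 n.
apply: le_trans (_ : un n * (v j + `|s j|) <= _).
  rewrite ler_wpM2l //; apply: le_trans (cnD _ _) _; rewrite cnN cnM cn_i mul1r !cn_real.
  by rewrite ger0_norm.
have : un n * v j <= un n by rewrite ler_piMr.
by lra.
Qed.

Definition dbound (c : R) (dl : 'I_d -> R) := forall j, `|dl j| <= c.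
Definition pbound (P : coef) := forall c, exists K M, 0 <= K /\ forall dl s, dbound c dl ->
  cn (P dl (ypt v s)) <= K * norm1 s ^+ M.
Definition has_parity (sg : C) (P : coef) := forall dl y, P dl (fun j => - y j) = sg * P dl y.
Definition nbound (r : nat) (F : fam) := forall c, exists K M, 0 <= K /\ forall n dl s, dbound c dl -> near_origin n s ->
  cn (F n dl s) <= K * un n ^+ r * norm1 s ^+ M.

(* [xp r sg F]: F has an expansion in powers of n^{-1/2} up to order r, whose
   k-th coefficient is a polynomially bounded function of y of parity
   sg (-1)^k. The recursion makes closure under products a one-line identity. *)
Fixpoint xp (r : nat) (sg : C) (F : fam) : Prop :=
  match r with
  | 0 => nbound 0 F
  | r'.+1 => exists P : coef, [/\ has_parity sg P, pbound P &
      xp r' (- sg) (fun n dl s => (F n dl s - P dl (ypt v s)) / (un n)%:C)]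
  end.

(** Even expansions with constant leading coefficient [p], a value that [xp] would leave
    unspecified. After its removal and division by u, the sign has become -1. *)
Definition xp1 r (F : fam) (p : C) := xp r (- 1) (fun n dl s => (F n dl s - p) / (un n)%:C).

Lemma nbound_ext r F G : (forall n dl s, near_origin n s -> F n dl s = G n dl s) -> nbound r F -> nbound r G.
Proof.
move=> e h c; have [K [M [K0 hK]]] := h c; exists K, M; split=> // n dl s dc ns.
by rewrite -e // hK.
Qed.

Lemma xp_ext r sg F G : (forall n dl s, near_origin n s -> F n dl s = G n dl s) -> xp r sg F -> xp r sg G.
Proof.
elim: r sg F G => [|r IH] sg F G e /=; first exact: nbound_ext.
move=> [P [p1 p2 p3]]; exists P; split=> //; apply: IH p3 => n dl s ns.
by rewrite e.
Qed.

Lemma nboundD r F G : nbound r F -> nbound r G -> nbound r (fun n dl s => F n dl s + G n dl s).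
Proof.
move=> hF hG c; have [K [M [K0 hK]]] := hF c; have [K' [M' [K0' hK']]] := hG c.
exists (K + K'), (M + M')%N; split; first exact: addr_ge0.
move=> n dl s dc ns; apply: le_trans (cnD _ _) _; rewrite !mulrDl; apply: lerD.
  apply: le_trans (hK _ _ _ dc ns) _; rewrite ler_wpM2l ?mulr_ge0 ?exprn_ge0 ?un_ge0 //.
  by rewrite norm1_mono // leq_addr.
apply: le_trans (hK' _ _ _ dc ns) _; rewrite ler_wpM2l ?mulr_ge0 ?exprn_ge0 ?un_ge0 //.
by rewrite norm1_mono // leq_addl.
Qed.

Lemma nboundM r q F G : nbound r F -> nbound q G -> nbound (r + q) (fun n dl s => F n dl s * G n dl s).
Proof.
move=> hF hG c; have [K [M [K0 hK]]] := hF c; have [K' [M' [K0' hK']]] := hG c.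
exists (K * K'), (M + M')%N; split; first exact: mulr_ge0.
move=> n dl s dc ns; rewrite cnM !exprD.
apply: le_trans (ler_pM (cn_ge0 _) (cn_ge0 _) (hK _ _ _ dc ns) (hK' _ _ _ dc ns)) _.
by rewrite le_eqVlt; apply/orP; left; apply/eqP; ring.
Qed.

Lemma nbound_un r : nbound r (fun n _ _ => (un n)%:C ^+ r).
Proof.
move=> c; exists 1, 0%N; split=> // n dl s _ _.
by rewrite cnX cn_un expr0 mulr1 mul1r.
Qed.

Lemma nbound_le q r F : (q <= r)%N -> nbound r F -> nbound q F.
Proof.
move=> qr hF c; have [K [M [K0 hK]]] := hF c; exists K, M; split=> // n dl s dc ns.
apply: le_trans (hK _ _ _ dc ns) _; have [n0 _ _] := ns.
rewrite ler_wpM2r ?exprn_ge0 ?norm1_ge0 // ler_wpM2l //.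
by apply: ler_wiXn2l; rewrite ?un_ge0 ?un_le1.
Qed.

Lemma nbound_coef P : pbound P -> nbound 0 (fun _ dl s => P dl (ypt v s)).
Proof.
move=> h c; have [K [M [K0 hK]]] := h c; exists K, M; split=> // n dl s dc _.
by rewrite expr0 mulr1 hK.
Qed.

Lemma pboundD P Q : pbound P -> pbound Q -> pbound (fun dl y => P dl y + Q dl y).
Proof.
move=> hF hG c; have [K [M [K0 hK]]] := hF c; have [K' [M' [K0' hK']]] := hG c.
exists (K + K'), (M + M')%N; split; first exact: addr_ge0.
move=> dl s dc; apply: le_trans (cnD _ _) _; rewrite !mulrDl; apply: lerD.
  by apply: le_trans (hK _ _ dc) _; rewrite ler_wpM2l // norm1_mono // leq_addr.
by apply: le_trans (hK' _ _ dc) _; rewrite ler_wpM2l // norm1_mono // leq_addl.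
Qed.

Lemma pboundM P Q : pbound P -> pbound Q -> pbound (fun dl y => P dl y * Q dl y).
Proof.
move=> hF hG c; have [K [M [K0 hK]]] := hF c; have [K' [M' [K0' hK']]] := hG c.
exists (K * K'), (M + M')%N; split; first exact: mulr_ge0.
move=> dl s dc; rewrite cnM exprD.
apply: le_trans (ler_pM (cn_ge0 _) (cn_ge0 _) (hK _ _ dc) (hK' _ _ dc)) _.
by rewrite le_eqVlt; apply/orP; left; apply/eqP; ring.
Qed.

Lemma pbound_cst (p : C) : pbound (fun _ _ => p).
Proof.
move=> c; exists (cn p), 0%N; split; first exact: cn_ge0.
by move=> dl s _; rewrite expr0 mulr1.
Qed.

Lemma xp_small r sg F : nbound r F -> xp r sg F.
Proof.
elim: r sg F => [|r IH] sg F h //=; exists (fun _ _ => 0); split.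
- by move=> dl y; rewrite mulr0.
- exact: pbound_cst.
- apply: IH => c; have [K [M [K0 hK]]] := h c; exists K, M; split=> // n dl s dc ns.
  have [n0 _ _] := ns; rewrite subr0 cnM cnV cn_un ler_pdivrMr ?un_gt0 //.
  by apply: le_trans (hK _ _ _ dc ns) _; rewrite exprS le_eqVlt; apply/orP; left; apply/eqP; ring.
Qed.

Lemma xp_bounded r sg F : xp r sg F -> nbound 0 F.
Proof.
elim: r sg F => [|r IH] sg F //= [P [_ pP /IH h]].
apply: (@nbound_ext 0 (fun n dl s => P dl (ypt v s) + (un n)%:C ^+ 1 * ((F n dl s - P dl (ypt v s)) / (un n)%:C))).
  move=> n dl s [n0 _ _]; rewrite expr1 mulrC divfK ?unC_neq0 //; ring.
apply: nboundD; first exact: nbound_coef.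
by apply: (@nbound_le 0 (1 + 0)) => //; apply: nboundM => //; apply: nbound_un.
Qed.

Lemma xp_le q r sg F : (q <= r)%N -> xp r sg F -> xp q sg F.
Proof.
elim: r q sg F => [|r IH] [|q] sg F //; first by move=> _; apply: xp_bounded.
by move=> qr /= [P [p1 p2 p3]]; exists P; split=> //; apply: IH p3.
Qed.

Lemma xp0 r sg : xp r sg (fun _ _ _ => 0).
Proof.
apply: xp_small => c; exists 0, 0%N; split=> // n dl s _ _.
by rewrite cn0 !mul0r.
Qed.

Lemma xp_coef r sg P : has_parity sg P -> pbound P -> xp r sg (fun _ dl s => P dl (ypt v s)).
Proof.
case: r => [|r] h1 h2; first exact: nbound_coef.
by exists P; split=> //; apply: xp_ext (xp0 r (- sg)) => n dl s _; rewrite subrr mul0r.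
Qed.

Lemma xp_cst r (p : C) : xp r 1 (fun _ _ _ => p).
Proof.
apply: (@xp_coef r 1 (fun _ _ => p)); last exact: pbound_cst.
by move=> dl y; rewrite mul1r.
Qed.

Lemma xpD r sg F G : xp r sg F -> xp r sg G -> xp r sg (fun n dl s => F n dl s + G n dl s).
Proof.
elim: r sg F G => [|r IH] sg F G /=; first exact: nboundD.
move=> [P [p1 p2 p3]] [Q [q1 q2 q3]]; exists (fun dl y => P dl y + Q dl y); split.
- by move=> dl y; rewrite p1 q1 mulrDr.
- exact: pboundD.
- by apply: xp_ext (IH _ _ _ p3 q3) => n dl s _; rewrite -mulrDl; congr (_ / _); ring.
Qed.

Lemma xpM r sg tg F G : xp r sg F -> xp r tg G -> xp r (sg * tg) (fun n dl s => F n dl s * G n dl s).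
Proof.
elim: r sg tg F G => [|r IH] sg tg F G hF hG; first exact: nboundM hF hG.
move: (hF) (hG) => /= [P [p1 p2 p3]] [Q [q1 q2 q3]]; exists (fun dl y => P dl y * Q dl y); split.
- by move=> dl y; rewrite p1 q1; ring.
- exact: pboundM.
have hG' := xp_le (leqnSn r) hG.
(* F G - P Q = P (G - Q) + (F - P) G. Here P is its own expansion, and G is needed to order r
   only. *)
have := xpD (IH _ _ _ _ (xp_coef r p1 p2) q3) _.
rewrite mulrN => /(_ _ (_ : xp r (- (sg * tg)) _)).
move/(_ (fun n dl s => (F n dl s - P dl (ypt v s)) / (un n)%:C * G n dl s)).
have := IH _ _ _ _ p3 hG'; rewrite mulNr => h /(_ h).
apply: xp_ext => n dl s [n0 _ _]; field; exact: unC_neq0.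
Qed.

Lemma xpN r sg F : xp r sg F -> xp r sg (fun n dl s => - F n dl s).
Proof.
move=> h; have := xpM (xp_cst r (-1)) h; rewrite mul1r; apply: xp_ext => n dl s _.
by rewrite mulN1r.
Qed.

Lemma xp_shift r sg F : xp r sg F -> xp r.+1 (- sg) (fun n dl s => (un n)%:C * F n dl s).
Proof.
move=> h; exists (fun _ _ => 0); split.
- by move=> dl y; rewrite mulr0.
- exact: pbound_cst.
rewrite opprK; apply: xp_ext h => n dl s [n0 _ _].
by rewrite subr0 mulrAC divff ?mul1r // unC_neq0.
Qed.

Lemma xp_un r sg F : xp r sg F -> xp r (- sg) (fun n dl s => (un n)%:C * F n dl s).
Proof. by move=> /xp_shift; apply: xp_le. Qed.

Lemma xp_unX r sg k F : xp r sg F -> xp r ((-1) ^+ k * sg) (fun n dl s => (un n)%:C ^+ k * F n dl s).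
Proof.
elim: k => [|k IH] h.
  by rewrite expr0 mul1r; apply: xp_ext h => n dl s _; rewrite mul1r.
have := xp_un (IH h); rewrite exprS mulN1r mulNr; apply: xp_ext => n dl s _.
by rewrite exprS mulrA.
Qed.

Lemma xpX r sg F k : xp r sg F -> xp r (sg ^+ k) (fun n dl s => F n dl s ^+ k).
Proof.
move=> h; elim: k => [|k IH]; first exact: xp_cst.
by rewrite exprS; apply: xp_ext (xpM h IH) => n dl s _; rewrite exprS.
Qed.

Lemma xp_sum r sg N (F : nat -> fam) : (forall k, (k < N)%N -> xp r sg (F k)) ->
  xp r sg (fun n dl s => \sum_(k < N) F k n dl s).
Proof.
elim: N => [|N IH] h; first by apply: xp_ext (xp0 r sg) => n dl s _; rewrite big_ord0.
have hN := xpD (IH (fun k kN => h k (ltnW kN : (k < N.+1)%N))) (h N (ltnSn N)).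
by apply: xp_ext hN => n dl s _; rewrite big_ord_recr.
Qed.

Lemma xp1_xp r F p : xp1 r F p -> xp r.+1 1 F.
Proof.
move=> h; exists (fun _ _ => p); split=> //; last exact: pbound_cst.
by move=> dl y; rewrite mul1r.
Qed.

Lemma xp1_ext r F G p : (forall n dl s, near_origin n s -> F n dl s = G n dl s) -> xp1 r F p -> xp1 r G p.
Proof. by move=> e; apply: xp_ext => n dl s ns; rewrite e. Qed.

Lemma xp1_cst r p : xp1 r (fun _ _ _ => p) p.
Proof. by apply: xp_ext (xp0 r _) => n dl s _; rewrite subrr mul0r. Qed.

Lemma xp1M r F G p q : xp1 r F p -> xp1 r G q -> xp1 r (fun n dl s => F n dl s * G n dl s) (p * q).
Proof.
move=> hF hG; have hG1 := xp_le (leqnSn r) (xp1_xp hG).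
have h1 := xpM hF hG1; have h2 := xpM (xp_cst r p) hG.
rewrite mulr1 in h1; rewrite mul1r in h2.
apply: xp_ext (xpD h1 h2) => n dl s [n0 _ _]; field; exact: unC_neq0.
Qed.

Lemma xp1_prod (I : Type) (t : seq I) (Q : pred I) r (F : I -> fam) (p : I -> C) :
  (forall i, Q i -> xp1 r (F i) (p i)) ->
  xp1 r (fun n dl s => \prod_(i <- t | Q i) F i n dl s) (\prod_(i <- t | Q i) p i).
Proof.
move=> h; elim: t => [|i t IH].
  by rewrite big_nil; apply: xp1_ext (xp1_cst r 1) => n dl s _; rewrite big_nil.
rewrite big_cons; case: ifP => Qi.
  by apply: xp1_ext (xp1M (h i Qi) IH) => n dl s _; rewrite big_cons Qi.
by apply: xp1_ext IH => n dl s _; rewrite big_cons Qi.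
Qed.

(** F^{-1} - p^{-1} = - (F - p) F^{-1} / p, so an expansion of F^{-1} to order q yields the next
    order. The lower bound on |F| makes F^{-1} bounded and starts the induction. *)
Lemma xp1V r F p (c : R) : 0 < c -> p != 0 -> (forall n dl s, near_origin n s -> c <= cn (F n dl s)) ->
  xp1 r F p -> xp1 r (fun n dl s => (F n dl s)^-1) p^-1.
Proof.
move=> c0 p0 Fc; have Fn n dl s : near_origin n s -> F n dl s != 0.
  by move=> ns; rewrite -cn_gt0 (lt_le_trans c0) ?Fc.
have main q : xp1 q F p -> xp q 1 (fun n dl s => (F n dl s)^-1) -> xp1 q (fun n dl s => (F n dl s)^-1) p^-1.
  move=> h1 h2; have := xpM (xpM h1 h2) (xp_cst q (- p^-1)); rewrite !mulr1.
  apply: xp_ext => n dl s ns; have f0 := Fn n dl s ns; have [n0 _ _] := ns.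
  by have u0 := unC_neq0 n0; field; rewrite ?u0 ?f0 ?p0.
elim: r => [|r IH] hF; apply: (main _ hF).
  move=> a; exists c^-1, 0%N; split; first by rewrite invr_ge0 ltW.
  move=> n dl s _ ns; rewrite cnV !expr0 !mulr1 lef_pV2 ?posrE ?Fc //.
  exact: lt_le_trans (Fc n dl s ns).
by apply: xp1_xp; apply: IH; apply: xp_le hF.
Qed.

Lemma xp_intro r sg (P : nat -> coef) F : (forall k, has_parity ((-1) ^+ k * sg) (P k)) -> (forall k, pbound (P k)) ->
  nbound r (fun n dl s => F n dl s - \sum_(k < r) P k dl (ypt v s) * (un n)%:C ^+ k) -> xp r sg F.
Proof.
move=> p1 p2 h.
have hs : xp r sg (fun n dl s => \sum_(k < r) P k dl (ypt v s) * (un n)%:C ^+ k).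
  apply: (@xp_sum r sg r (fun k n dl s => P k dl (ypt v s) * (un n)%:C ^+ k)) => k _.
  have := xp_unX k (xp_coef r (p1 k) (p2 k)).
  rewrite mulrA -exprD addnn -mul2n exprM sqrrN expr1n expr1n mul1r.
  by apply: xp_ext => n dl s _; rewrite mulrC.
by apply: xp_ext (xpD (xp_small sg h) hs) => n dl s _; rewrite subrK.
Qed.

Lemma xp_elim r sg F : xp r sg F -> exists P : nat -> coef,
  [/\ forall k, has_parity ((-1) ^+ k * sg) (P k), forall k, pbound (P k) &
     nbound r (fun n dl s => F n dl s - \sum_(k < r) P k dl (ypt v s) * (un n)%:C ^+ k)].
Proof.
elim: r sg F => [|r IH] sg F.
  move=> h; exists (fun _ _ _ => 0); split.
  - by move=> k dl y; rewrite mulr0.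
  - by move=> k; exact: pbound_cst.
  - by apply: nbound_ext h => n dl s _; rewrite big_ord0 subr0.
move=> /= [Q [q1 q2 /IH[P [p1 p2 p3]]]].
exists (fun k => if k is k'.+1 then P k' else Q); split.
- case=> [|k]; first by rewrite expr0 mul1r.
  by rewrite exprS mulN1r mulNr -mulrN.
- by case.
have := nboundM (nbound_un 1) p3; apply: nbound_ext => n dl s [n0 _ _].
rewrite big_ord_recl expr0 mulr1 expr1 mulrBr mulrC divfK ?unC_neq0 // opprD addrA; congr (_ - _).
by rewrite mulr_sumr; apply: eq_bigr => k _; rewrite /bump /= exprS; ring.
Qed.

Lemma xp1_elim r F p : (0 < r)%N -> xp1 r F p -> exists P : nat -> coef,
  [/\ forall k, has_parity ((-1) ^+ k) (P k), forall k, pbound (P k), forall dl y, P 0%N dl y = p &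
     nbound r (fun n dl s => F n dl s - \sum_(k < r) P k dl (ypt v s) * (un n)%:C ^+ k)].
Proof.
case: r => // r _ h; have [P [p1 p2 p3]] := xp_elim (xp_le (leqnSn r) h).
exists (fun k => if k is k'.+1 then P k' else fun _ _ => p); split=> //.
- case=> [|k] dl y; first by rewrite mul1r.
  by rewrite p1 exprSr.
- by case=> [|k] //; exact: pbound_cst.
have := nboundM (nbound_un 1) p3; apply: nbound_ext => n dl s [n0 _ _].
rewrite big_ord_recl expr0 mulr1 expr1 mulrBr mulrC divfK ?unC_neq0 // opprD addrA; congr (_ - _).
by rewrite mulr_sumr; apply: eq_bigr => k _; rewrite /bump /= exprS; ring.
Qed.

(** Z itself may grow polynomially, but u Z stays bounded near the origin, so the exponential in the
    Taylor remainder is harmless. Each term u^k Z^{k+1} has sign -1. *)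
Lemma xp1_exp r (Z : fam) (c : R -> R) : xp r (-1) Z ->
  (forall b n dl s, dbound b dl -> near_origin n s -> cn ((un n)%:C * Z n dl s) <= c b) ->
  xp1 r (fun n dl s => cexp ((un n)%:C * Z n dl s)) 1.
Proof.
move=> hZ hc; have bZ := xp_bounded hZ.
have h1 : xp r (-1) (fun n dl s => \sum_(k < r) (un n)%:C ^+ k * Z n dl s ^+ k.+1 / (k.+1`!)%:R).
  apply: (@xp_sum r (-1) r (fun k n dl s => (un n)%:C ^+ k * Z n dl s ^+ k.+1 / (k.+1`!)%:R)) => k _.
  have := xpM (xp_unX k (xpX k.+1 hZ)) (xp_cst r ((k.+1`!)%:R)^-1).
  rewrite mulr1 exprS mulrCA -exprD addnn -mul2n exprM sqrrN expr1n expr1n mulr1.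
  by [].
have h2 : nbound r (fun n dl s => (cexp ((un n)%:C * Z n dl s) - \sum_(k < r.+1) ((un n)%:C * Z n dl s) ^+ k / (k`!)%:R) / (un n)%:C).
  move=> b; have [K [M [K0 hK]]] := bZ b.
  exists (K ^+ r.+1 * expR (c b)), (M * r.+1)%N; split.
    by rewrite mulr_ge0 ?expR_ge0 ?exprn_ge0.
  move=> n dl s db ns; have [n0 _ _] := ns; rewrite cnM cnV cn_un ler_pdivrMr ?un_gt0 //.
  apply: le_trans (cexp_taylor _ _) _.
  apply: le_trans (_ : cn ((un n)%:C * Z n dl s) ^+ r.+1 * expR (c b) <= _).
    by rewrite ler_wpM2l ?exprn_ge0 ?cn_ge0 // ler_expR hc.
  rewrite cnM cn_un exprMn; have := hK _ _ _ db ns; rewrite expr0 mulr1 => h.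
  have h' : cn (Z n dl s) ^+ r.+1 <= K ^+ r.+1 * norm1 s ^+ (M * r.+1).
    by rewrite exprM -exprMn lerXn2r ?nnegrE ?cn_ge0 // mulr_ge0 // exprn_ge0 // norm1_ge0.
  apply: le_trans (_ : un n ^+ r.+1 * (K ^+ r.+1 * norm1 s ^+ (M * r.+1)) * expR (c b) <= _).
    by rewrite ler_wpM2r ?expR_ge0 // ler_wpM2l ?exprn_ge0 ?un_ge0.
  by rewrite exprS le_eqVlt; apply/orP; left; apply/eqP; rewrite exprS; ring.
apply: xp_ext (xpD (xp_small (-1) h2) h1) => n dl s [n0 _ _].
have u0 := unC_neq0 n0; rewrite big_ord_recl expr0 divr1 opprD addrA mulrBl.
set S := \sum_(k < r) (un n)%:C ^+ k * _ / _.
rewrite [X in _ - X + S](_ : _ = S) ?subrK // /S.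
rewrite mulr_suml; apply: eq_bigr => k _; rewrite lift0 exprMn exprS.
by field; rewrite u0 andbT pnatr_eq0 -lt0n fact_gt0.
Qed.

End LocalExpansions.

(** * Binomial remainders and Taylor expansion by moments *)

Section MomentExpansions.
Variable R : realType.
Notation C := R[i].

(** Induction on n by Pascal's rule. The bound is in powers of n |z| because n rho is of order u
    |y|^3; the growth (1 + |z|)^n is left to be absorbed by the Gaussian. *)
Lemma binomial_remainder (z : C) n r :
  cn ((1 + z) ^+ n - \sum_(j < r) 'C(n, j)%:R * z ^+ j) <= (n%:R * cn z) ^+ r * (1 + cn z) ^+ n.
Proof.
have z0 := cn_ge0 z.
elim: n r => [|n IH] [|r].
- by rewrite big_ord0 subr0 !expr0 cn1 mulr1.
- rewrite big_ord_recl bin0 !expr0 mul1r big1 ?addr0 ?subrr ?cn0.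
    by rewrite mul0r expr0n mul0r.
  by move=> i _; rewrite lift0 bin0n mul0r.
- rewrite big_ord0 subr0 expr0 mul1r cnX lerXn2r ?nnegrE ?cn_ge0 ?addr_ge0 //.
  by apply: le_trans (cnD _ _) _; rewrite cn1.
have -> : (1 + z) ^+ n.+1 - \sum_(j < r.+1) 'C(n.+1, j)%:R * z ^+ j =
   ((1 + z) ^+ n - \sum_(j < r.+1) 'C(n, j)%:R * z ^+ j) +
   z * ((1 + z) ^+ n - \sum_(j < r) 'C(n, j)%:R * z ^+ j).
  rewrite [\sum_(j < r.+1) 'C(n.+1, j)%:R * _]big_ord_recl [\sum_(j < r.+1) 'C(n, j)%:R * _]big_ord_recl.
  rewrite !bin0 (eq_bigr (fun j : 'I_r => 'C(n, j.+1)%:R * z ^+ j.+1 + z * ('C(n, j)%:R * z ^+ j))); last first.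
    by move=> j _; rewrite lift0 binS natrD exprS; ring.
  rewrite big_split /= -mulr_sumr exprS.
  rewrite (eq_bigr (fun j : 'I_r => 'C(n, lift ord0 j)%:R * z ^+ lift ord0 j)); last by move=> j _; rewrite lift0.
  by ring.
apply: le_trans (cnD _ _) _; rewrite cnM.
apply: le_trans (lerD (IH r.+1) (ler_wpM2l z0 (IH r))) _.
have p1 : 0 <= (1 + cn z) ^+ n by rewrite exprn_ge0 // addr_ge0.
rewrite [X in X <= _](_ : _ = n%:R ^+ r * n.+1%:R * cn z ^+ r.+1 * (1 + cn z) ^+ n); last first.
  by rewrite !exprMn !exprS -natr1; ring.
rewrite exprMn; apply: ler_pM; rewrite ?mulr_ge0 ?exprn_ge0 ?addr_ge0 //.
  rewrite ler_wpM2r ?exprn_ge0 // exprSr ler_wpM2r // lerXn2r ?nnegrE // ler_nat //.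
by rewrite exprS ler_peMl // lerDl.
Qed.

(** Centred at [lam] for psi; the value 0 of [lam] serves the series of A and the characteristic
    function. *)
Definition linl d (lam : 'I_d -> R) (w : 'I_d -> C) (m : mi d) : C :=
  \sum_(j < d) ((m j)%:R - (lam j)%:C) * w j.
Definition evls d (lam : 'I_d -> R) (c : mi d -> C) (w : 'I_d -> C) : C :=
  csum (fun m => c m * cexp (linl lam w m)).

Definition lnorm d (lam : 'I_d -> R) : R := \sum_j `|lam j|.

Lemma lnorm_ge0 d (lam : 'I_d -> R) : 0 <= lnorm lam.
Proof. by apply: sumr_ge0. Qed.

Variable d : nat.
Variables (lam : 'I_d -> R) (e0 : R).
Hypothesis e00 : 0 < e0.
Notation Lam := (lnorm lam).

Lemma linl_bound (w : 'I_d -> C) (b : R) m : (forall j, cn (w j) <= b) ->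
  cn (linl lam w m) <= b * (mabs R m + Lam).
Proof.
move=> wb; apply: le_trans (cn_sum _ _ _) _; rewrite /mabs /lnorm -big_split mulr_sumr.
apply: ler_sum => j _; rewrite cnM mulrC; apply: ler_pM; rewrite ?cn_ge0 //.
by apply: le_trans (cnB _ _) _; rewrite cn_natr cn_real.
Qed.

(** One half of the exponential margin absorbs the power; the other half stays available for the
    exponential in the Taylor remainder. *)
Lemma moment_bound k : exists2 K, 0 <= K & forall m : mi d,
  (mabs R m + Lam) ^+ k * expR (e0 / 2 * (mabs R m + Lam)) <= K * expR (e0 * mabs R m).
Proof.
have Lam0 := lnorm_ge0 lam.
have e2 : 0 < e0 / 2 by rewrite divr_gt0.
have [K K0 hK] := expX_bound k e2.
exists ((1 + Lam) ^+ k * K * expR (e0 / 2 * Lam)).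
  by rewrite !mulr_ge0 ?expR_ge0 ?exprn_ge0 ?addr_ge0.
move=> m; have m0 := mabs_ge0 R m; have := hK _ m0; set x := mabs R m in m0 *.
rewrite expRN ler_pdivrMr ?expR_gt0 // => h.
have -> : e0 * x = e0 / 2 * x + e0 / 2 * x by field.
have -> : e0 / 2 * (x + Lam) = e0 / 2 * x + e0 / 2 * Lam by ring.
rewrite !expRD; set E := expR (e0 / 2 * x); set F := expR (e0 / 2 * Lam).
have E0 : 0 <= E by rewrite expR_ge0. have F0 : 0 <= F by rewrite expR_ge0.
apply: le_trans (_ : ((1 + Lam) * (1 + x)) ^+ k * (E * F) <= _).
  rewrite ler_wpM2r ?mulr_ge0 // lerXn2r ?nnegrE ?mulr_ge0 ?addr_ge0 //.
  have p : 0 <= Lam * x by rewrite mulr_ge0.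
  lra.
rewrite exprMn (_ : (1 + Lam) ^+ k * K * F * (E * E) = (1 + Lam) ^+ k * (K * E) * (E * F)); last by ring.
by rewrite ler_wpM2r ?mulr_ge0 // ler_wpM2l ?exprn_ge0 ?addr_ge0.
Qed.

Variables (c : mi d -> C) (Kc : R).
Hypothesis csumm : summable Kc (fun m => (expR (e0 * mabs R m))%:C * c m).

Lemma summable_moment k :
  exists2 K, 0 <= K & forall w b, 0 <= b -> (forall j, cn (w j) <= b) ->
    summable (K * b ^+ k) (fun m => c m * linl lam w m ^+ k).
Proof.
have Lam0 := lnorm_ge0 lam.
have [K K0 hK] := moment_bound k; exists (K * Kc); first by rewrite mulr_ge0 ?(summable_ge0 csumm).
move=> w' b' b0 wb N.
apply: le_trans (_ : boxsum N (fun m => K * b' ^+ k * cn ((expR (e0 * mabs R m))%:C * c m)) <= _); last first.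
  by rewrite /boxsum -mulr_sumr mulrAC ler_wpM2r ?exprn_ge0 // ler_wpM2l // csumm.
apply: ler_sum => m _; rewrite !cnM cnX cn_real ger0_norm ?expR_ge0 // mulrC [X in _ <= X]mulrA ler_wpM2r ?cn_ge0 //.
apply: le_trans (_ : (b' * (mabs R m + Lam)) ^+ k <= _).
  by rewrite lerXn2r ?nnegrE ?cn_ge0 ?linl_bound // mulr_ge0 // addr_ge0 // mabs_ge0.
rewrite exprMn [K * _]mulrC -mulrA ler_wpM2l ?exprn_ge0 //; apply: le_trans (hK m).
rewrite ler_peMr ?exprn_ge0 ?addr_ge0 ?mabs_ge0 // -expR0 ler_expR mulr_ge0 ?addr_ge0 ?mabs_ge0 //.
by rewrite divr_ge0 // ltW.
Qed.

Lemma evls_taylor k : exists2 K, 0 <= K & forall (w : 'I_d -> C) (b : R), 0 <= b -> b <= e0 / 2 -> (forall j, cn (w j) <= b) ->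
  (exists K', summable K' (fun m => c m * cexp (linl lam w m))) /\
  cn (evls lam c w - \sum_(i < k) (i`!)%:R^-1 * csum (fun m => c m * linl lam w m ^+ i)) <= K * b ^+ k.
Proof.
have Lam0 := lnorm_ge0 lam.
have [K K0 hK] := moment_bound k; have [K1 K10 hK1] := moment_bound 0.
have Kc0 := summable_ge0 csumm.
exists (K * Kc); first by rewrite mulr_ge0.
move=> w b b0 be wb.
have lb m : cn (linl lam w m) <= e0 / 2 * (mabs R m + Lam).
  by apply: le_trans (linl_bound m wb) _; rewrite ler_wpM2r // addr_ge0 // mabs_ge0.
have s0 : summable (K1 * Kc) (fun m => c m * cexp (linl lam w m)).
  move=> N; apply: le_trans (_ : boxsum N (fun m => K1 * cn ((expR (e0 * mabs R m))%:C * c m)) <= _); last first.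
    by rewrite /boxsum -mulr_sumr ler_wpM2l // csumm.
  apply: ler_sum => m _; rewrite !cnM cn_real ger0_norm ?expR_ge0 // mulrC [X in _ <= X]mulrA ler_wpM2r ?cn_ge0 //.
  apply: le_trans (hK1 m); rewrite expr0 mul1r cn_cexp ler_expR; apply: le_trans (lb m).
  exact: le_trans (ler_norm _) (cn_Re _).
split; first by exists (K1 * Kc).
have sk i : exists K, summable K (fun m => (i`!)%:R^-1 * (c m * linl lam w m ^+ i)).
  have [K2 _ /(_ w b b0 wb) h] := summable_moment i.
  by eexists; apply: summableZ h.
have [e [K3 s3]] := @csum_sum R d k (fun i m => (i`!)%:R^-1 * (c m * linl lam w m ^+ i)) (fun i _ => sk i).
have -> : \sum_(i < k) (i`!)%:R^-1 * csum (fun m => c m * linl lam w m ^+ i) =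
   csum (fun m => \sum_(i < k) (i`!)%:R^-1 * (c m * linl lam w m ^+ i)).
  rewrite e; apply: eq_bigr => i _; have [K2 _ /(_ w b b0 wb) h] := summable_moment i.
  by rewrite (csumZ _ h).
rewrite /evls -(csumB s0 s3); apply: csum_bound => N.
apply: le_trans (_ : boxsum N (fun m => K * b ^+ k * cn ((expR (e0 * mabs R m))%:C * c m)) <= _); last first.
  by rewrite /boxsum -mulr_sumr mulrAC ler_wpM2r ?exprn_ge0 // ler_wpM2l // csumm.
apply: ler_sum => m _.
have -> : c m * cexp (linl lam w m) - \sum_(i < k) (i`!)%:R^-1 * (c m * linl lam w m ^+ i) =
   c m * (cexp (linl lam w m) - \sum_(i < k) linl lam w m ^+ i / (i`!)%:R).
  by rewrite mulrBr; congr (_ - _); rewrite mulr_sumr; apply: eq_bigr => i _; ring.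
rewrite !cnM cn_real ger0_norm ?expR_ge0 // mulrC [X in _ <= X]mulrA ler_wpM2r ?cn_ge0 //.
apply: le_trans (cexp_taylor _ _) _.
apply: le_trans (_ : (b * (mabs R m + Lam)) ^+ k * expR (e0 / 2 * (mabs R m + Lam)) <= _).
  apply: ler_pM; rewrite ?exprn_ge0 ?cn_ge0 ?expR_ge0 ?ler_expR //.
  by rewrite lerXn2r ?nnegrE ?cn_ge0 ?linl_bound // mulr_ge0 // addr_ge0 // mabs_ge0.
rewrite exprMn [X in _ <= X](_ : _ = b ^+ k * (K * expR (e0 * mabs R m))); last by ring.
by rewrite -[X in X <= _]mulrA ler_wpM2l ?exprn_ge0.
Qed.

Lemma linlZ (a : C) (w : 'I_d -> C) m : linl lam (fun j => a * w j) m = a * linl lam w m.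
Proof. by rewrite /linl mulr_sumr; apply: eq_bigr => j _; ring. Qed.

Lemma cn_le_sum (w : 'I_d -> C) j : cn (w j) <= \sum_i cn (w i).
Proof. by rewrite (bigD1 j) //= lerDl sumr_ge0 // => i _; apply: cn_ge0. Qed.

(** The term of degree k in the Taylor expansion of [evls]. It is homogeneous in w, which yields the
    parity and the power of u at once. *)
Definition moment k (w : 'I_d -> C) : C := (k`!)%:R^-1 * csum (fun m => c m * linl lam w m ^+ k).

Lemma momentZ k a w : moment k (fun j => a * w j) = a ^+ k * moment k w.
Proof.
have S0 : 0 <= \sum_i cn (w i) by apply: sumr_ge0 => i _; apply: cn_ge0.
have [K _ /(_ w _ S0 (cn_le_sum w)) h] := summable_moment k.
rewrite /moment (_ : (fun m => c m * linl lam (fun j => a * w j) m ^+ k) =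
  fun m => a ^+ k * (c m * linl lam w m ^+ k)); first by rewrite (csumZ (a ^+ k) h) mulrCA.
by apply: funext => m; rewrite linlZ exprMn mulrCA.
Qed.

Variables (v : 'I_d -> R) (eps : R).
Hypothesis v01 : forall j, 0 <= v j <= 1.
Hypothesis eps0 : 0 < eps.
Hypothesis epse : 4 * eps <= e0.

Lemma moment_parity k : has_parity ((-1) ^+ k) (fun _ : 'I_d -> R => moment k).
Proof.
move=> dl y; rewrite -momentZ; congr moment; apply: funext => j.
by rewrite mulN1r.
Qed.

Lemma moment_pbound k : pbound v (fun _ => moment k).
Proof.
have [K K0 h] := summable_moment k.
move=> b; exists ((k`!)%:R^-1 * K), k; split; first by rewrite mulr_ge0 ?invr_ge0.
move=> dl s _; rewrite /moment cnM cnV cn_natr -mulrA ler_wpM2l ?invr_ge0 //.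
by apply: csum_bound; apply: h; [exact: norm1_ge0|move=> j; exact: cn_ypt].
Qed.

Lemma evls_nbound r : nbound eps r (fun n (dl s : 'I_d -> R) =>
  evls lam c (fun j => (un R n)%:C * ypt v s j) - \sum_(k < r) moment k (ypt v s) * (un R n)%:C ^+ k).
Proof.
have e3 : 2 * eps <= e0 / 2.
  by have h := epse; lra.
have [K K0 hK] := evls_taylor r; move=> b.
exists (K * e0 ^+ r + K), r; split.
  by rewrite addr_ge0 // mulr_ge0 // exprn_ge0 // ltW.
move=> n dl s _ ns; set w := fun j => _.
have u0 := un_ge0 R n; have N0 := norm1_ge0 s.
(* The bound e0 / 2 makes the Taylor estimate applicable, and u * norm1 gives it the right size. *)
have wb j : cn (w j) <= Num.min (e0 / 2) (un R n * norm1 s).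
  rewrite /w cnM cn_un le_min; apply/andP; split.
    exact: le_trans (near_ypt v01 j ns) e3.
  by rewrite ler_wpM2l // cn_ypt.
have m0 : 0 <= Num.min (e0 / 2) (un R n * norm1 s) by rewrite le_min divr_ge0 ?mulr_ge0 // ltW.
have me : Num.min (e0 / 2) (un R n * norm1 s) <= e0 / 2 by rewrite ge_min lexx.
have [_] := hK w _ m0 me wb.
rewrite (eq_bigr (fun k : 'I_r => moment k (ypt v s) * (un R n)%:C ^+ k)); last first.
  by move=> k _; rewrite -/(moment k w) momentZ mulrC.
move=> h; apply: le_trans h _; apply: le_trans (_ : K * (un R n * norm1 s) ^+ r <= _).
  rewrite ler_wpM2l // lerXn2r ?nnegrE ?mulr_ge0 // ge_min lexx orbT //.
rewrite exprMn mulrDl mulrDl -[X in X <= _]add0r mulrA lerD // !mulr_ge0 ?exprn_ge0 //.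
exact: ltW.
Qed.

(** Removing q terms and dividing by u^q shifts the index by q, hence the sign (-1)^q. *)
Lemma xp_drop q r (P : nat -> ('I_d -> R) -> ('I_d -> C) -> C) F :
  (forall k, has_parity ((-1) ^+ k) (P k)) -> (forall k, pbound v (P k)) ->
  nbound eps (q + r) (fun n dl s => F n dl s - \sum_(k < q + r) P k dl (ypt v s) * (un R n)%:C ^+ k) ->
  xp v eps r ((-1) ^+ q) (fun n dl s => (F n dl s - \sum_(k < q) P k dl (ypt v s) * (un R n)%:C ^+ k) / (un R n)%:C ^+ q).
Proof.
move=> p1 p2 h; apply: (@xp_intro _ _ _ _ r _ (fun k => P (k + q)%N)) => [k|k|].
- by rewrite -exprD; apply: p1.
- exact: p2.
move=> b; have [K [M [K0 hK]]] := h b; exists K, M; split=> // n dl s db ns.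
have [n0 _ _] := ns; have u0 := unC_neq0 R n0.
rewrite (_ : _ - _ = (F n dl s - \sum_(k < q + r) P k dl (ypt v s) * (un R n)%:C ^+ k) / (un R n)%:C ^+ q); last first.
  rewrite [\sum_(k < q + r) _]big_split_ord /= opprD addrA [RHS]mulrBl; congr (_ - _).
  rewrite mulr_suml; apply: eq_bigr => k _; rewrite addnC exprD.
  by field; rewrite expf_neq0.
rewrite cnM cnV cnX cn_un ler_pdivrMr ?exprn_gt0 ?un_gt0 //.
by apply: le_trans (hK n dl s db ns) _; rewrite exprD le_eqVlt; apply/orP; left; apply/eqP; ring.
Qed.

Lemma evls_xp1 r : xp1 v eps r (fun n (_ s : 'I_d -> R) => evls lam c (fun j => (un R n)%:C * ypt v s j)) (csum c).
Proof.
have := @xp_drop 1 r (fun k _ => moment k) _ moment_parity moment_pbound (@evls_nbound (1 + r)).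
apply: xp_ext => n dl s _; rewrite big_ord1 expr0 !mulr1 expr1 /moment invr1 mul1r.
by congr ((_ - csum _) / _); apply: funext => m; rewrite expr0 mulr1.
Qed.

End MomentExpansions.

(** * Expansions of the pole factors and of the shift factor *)

Section NearField.
Variable R : realType.
Notation C := R[i].
Variables (d : nat) (v : 'I_d -> R) (eps : R).
Hypothesis v01 : forall j, 0 <= v j <= 1.
Hypothesis eps0 : 0 < eps.
Hypothesis eps16 : eps <= 1 / 16.

Lemma near_cn n (s : 'I_d -> R) j : near_origin eps n s -> cn ((un R n)%:C * ypt v s j) <= 2 * eps.
Proof. by move=> ns; rewrite cnM cn_un; apply: (near_ypt v01). Qed.

Lemma coord_parity j : has_parity (-1) (fun (_ : 'I_d -> R) y => y j).
Proof. by move=> dl y; rewrite mulN1r. Qed.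

Lemma coord_pbound j : pbound v (fun (_ : 'I_d -> R) y => y j).
Proof.
by move=> b; exists 1, 1%N; split=> // dl s _; rewrite expr1 mul1r (cn_ypt v01).
Qed.

Lemma coord_pboundX j k (a : C) : pbound v (fun (_ : 'I_d -> R) y => a * y j ^+ k).
Proof.
move=> b; exists (cn a), k; split=> [|dl s _]; first exact: cn_ge0.
rewrite cnM cnX ler_wpM2l ?cn_ge0 // lerXn2r ?nnegrE ?cn_ge0 ?norm1_ge0 //.
exact: (cn_ypt v01).
Qed.

Lemma ypt_neq0 s j : v j = 1 -> ypt v s j != 0.
Proof.
move=> v1; apply/negP => /eqP/(congr1 (@complex.Re R)); rewrite /ypt v1 /=; lra.
Qed.

Lemma expm1_ratio_ge n (s : 'I_d -> R) j : v j = 1 -> near_origin eps n s ->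
  2^-1 <= cn ((cexp ((un R n)%:C * ypt v s j) - 1) / ((un R n)%:C * ypt v s j)).
Proof.
move=> v1 ns; have [n0 _ _] := ns; have h := near_cn j ns.
have w0 : (un R n)%:C * ypt v s j != 0 by rewrite mulf_neq0 ?unC_neq0 ?ypt_neq0.
move: w0 h; set w := _ * _ => w0 h; have wp : 0 < cn w by rewrite cn_gt0.
(* With eps <= 1/16 one has |w| <= 1/8, so the quadratic error 3 |w|^2 is below |w| / 2. *)
have e1 : cn (cexp w - 1 - w) <= 2^-1 * cn w.
  have := cexp_taylor 2 w; rewrite 2!big_ord_recl big_ord0 /= expr0 expr1 !divr1 addr0 opprD addrA => /le_trans; apply.
  have : expR (cn w) <= 3.
    by apply: le_trans (expR1_le3 R); rewrite ler_expR; have := eps16; lra.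
  by move=> e3; rewrite expr2 mulrAC ler_wpM2r ?cn_ge0 //; have := eps16; nra.
rewrite cnM cnV ler_pdivlMr // -[X in X <= _](addrK (cn (cexp w - 1))).
have : cn w <= cn (cexp w - 1) + cn (cexp w - 1 - w).
  by rewrite -{1}[w](subKr (cexp w - 1)); apply: cnB.
by lra.
Qed.

(** (e^w - 1) / w = sum_k w^k / (k+1)! is regular at 0; its inverse is what remains of a pole factor
    once 1 / (- y_j) has been split off. *)
Lemma xp1_expm1_ratioV r j : v j = 1 ->
  xp1 v eps r (fun n (_ s : 'I_d -> R) => ((cexp ((un R n)%:C * ypt v s j) - 1) / ((un R n)%:C * ypt v s j))^-1) 1.
Proof.
move=> v1; rewrite -[X in xp1 _ _ _ _ X]invr1.
apply: (@xp1V _ _ _ _ _ _ _ 2^-1) => //; first by move=> n dl s ns; apply: expm1_ratio_ge.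
pose P k (_ : 'I_d -> R) (y : 'I_d -> C) := ((k.+1)`!)%:R^-1 * y j ^+ k.
have P1 k : has_parity ((-1) ^+ k) (P k).
  by move=> dl y; rewrite /P /= [in LHS]exprNn [LHS]mulrCA.
have P2 k : pbound v (P k) by apply: coord_pboundX.
have := @xp_drop R d v eps 1 r P (fun n _ s => (cexp ((un R n)%:C * ypt v s j) - 1) / ((un R n)%:C * ypt v s j)) P1 P2.
move=> h; apply: xp_ext (h _).
  by move=> n dl s _; rewrite big_ord1 /P !expr0 !mulr1 expr1 invr1.
move=> b; exists (expR 1), (1 + r)%N; split=> [|n dl s db ns]; first exact: expR_ge0.
have [n0 _ _] := ns; have w0 : (un R n)%:C * ypt v s j != 0 by rewrite mulf_neq0 ?unC_neq0 ?ypt_neq0.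
have hw := near_cn j ns.
rewrite [X in cn X](_ : _ = (cexp ((un R n)%:C * ypt v s j) - \sum_(k < (1 + r).+1) ((un R n)%:C * ypt v s j) ^+ k / (k`!)%:R) / ((un R n)%:C * ypt v s j)); last first.
  rewrite [in RHS]big_ord_recl expr0 divr1 opprD addrA [RHS]mulrBl; congr (_ - _).
  rewrite mulr_suml; apply: eq_bigr => k _; rewrite lift0 /P exprS exprMn.
  by field; rewrite pnatr_eq0 -lt0n fact_gt0 ypt_neq0 // unC_neq0.
rewrite cnM cnV ler_pdivrMr ?cn_gt0 //.
apply: le_trans (cexp_taylor _ _) _; rewrite exprSr [X in X <= _]mulrAC ler_wpM2r ?cn_ge0 //.
rewrite [X in X <= _]mulrC -mulrA -exprMn; apply: ler_pM; rewrite ?expR_ge0 ?exprn_ge0 ?cn_ge0 //.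
  by rewrite ler_expR; have := eps16; lra.
rewrite lerXn2r ?nnegrE ?cn_ge0 ?mulr_ge0 ?un_ge0 ?norm1_ge0 // cnM cn_un ler_wpM2l ?un_ge0 //.
exact: (cn_ypt v01).
Qed.

Lemma xp1_exp_coord r j :
  xp1 v eps r (fun n (_ s : 'I_d -> R) => cexp ((un R n)%:C * ypt v s j)) 1.
Proof.
apply: (@xp1_exp R d v eps r (fun n _ s => ypt v s j) (fun _ => 2 * eps)).
  by apply: (xp_coef _ _ (coord_parity j)); apply: coord_pbound.
by move=> b n dl s _; apply: near_cn.
Qed.

(** For v_j = 0 the number e^{w_j} lies on the unit circle, so |1 - z e^{w_j}| >= 1 - z > 0. *)
Lemma xp1_one_minusV r j (z : R) : v j = 0 -> 0 <= z < 1 ->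
  xp1 v eps r (fun n (_ s : 'I_d -> R) => (1 - z%:C * cexp ((un R n)%:C * ypt v s j))^-1) (1 - z%:C)^-1.
Proof.
move=> v0 /andP[z0 z1].
have z1' : 0 < 1 - z by lra.
apply: (@xp1V _ _ _ _ _ _ _ (1 - z)) => //.
- by rewrite -(rmorph1 (real_complex R)) -rmorphB -cn_gt0 cn_real normr_gt0 gt_eqF.
- move=> n dl s ns; set e := cexp _.
  have e1 : cn e = 1 by rewrite /e cn_cexp /ypt v0 /= (_ : _ - _ = 0) ?expR0 //; ring.
  have : cn (1 : C) <= cn (1 - z%:C * e) + cn (z%:C * e).
    by rewrite -{1}[1](subrK (z%:C * e)); apply: cnD.
  by rewrite cnM e1 cn_real cn1 (ger0_norm z0); lra.
- have := xpM (xp_cst v eps r (- z%:C)) (xp1_exp_coord r j); rewrite mul1r.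
  by apply: xp_ext => n dl s [n0 _ _]; have := unC_neq0 R n0 => u0; field.
Qed.

Lemma xp1_shift_factor r : xp1 v eps r
  (fun n (dl s : 'I_d -> R) => cexp (- \sum_j (dl j)%:C * ((un R n)%:C * ypt v s j))) 1.
Proof.
pose P (dl : 'I_d -> R) (y : 'I_d -> C) := - \sum_j (dl j)%:C * y j.
have h : xp v eps r (-1) (fun n dl s => P dl (ypt v s)).
  apply: xp_coef.
    by move=> dl y; rewrite /P mulN1r; congr (- _); rewrite -sumrN; apply: eq_bigr => j _; rewrite mulrN.
  move=> b; exists (\sum_(j < d) `|b|), 1%N; split; first by apply: sumr_ge0.
  move=> dl s db; rewrite /P cnN expr1 mulr_suml; apply: le_trans (cn_sum _ _ _) _.
  apply: ler_sum => j _; rewrite cnM cn_real; apply: ler_pM; rewrite ?cn_ge0 ?(cn_ypt v01) //.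
  exact: le_trans (db j) (ler_norm _).
have := @xp1_exp R d v eps r (fun n dl s => P dl (ypt v s)) (fun b => \sum_(j < d) `|b| * (2 * eps)) h.
move=> /(_ _)/xp1_ext; apply.
  by move=> n dl s _; congr cexp; rewrite /P mulrN mulr_sumr; congr (- _); apply: eq_bigr => j _; ring.
move=> b n dl s db ns; rewrite /P mulrN cnN mulr_sumr; apply: le_trans (cn_sum _ _ _) _.
apply: ler_sum => j _; rewrite mulrCA cnM cn_real; apply: ler_pM; rewrite ?cn_ge0 ?near_cn //.
exact: le_trans (db j) (ler_norm _).
Qed.

End NearField.

(** * Deviation of psi^n from the Gaussian *)

Section SaddleExpansion.
Variable R : realType.
Notation C := R[i].
Variables (d : nat) (lam : 'I_d -> R) (e0 : R).
Hypothesis e00 : 0 < e0.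
Variables (p : mi d -> C) (Kc : R).
Hypothesis psumm : summable Kc (fun m => (expR (e0 * mabs R m))%:C * p m).
Hypothesis mom0 : csum p = 1.
Hypothesis mom1 : forall w, moment lam p 1 w = 0.
Notation q := (moment lam p 2).

Lemma moment0E w : moment lam p 0 w = 1.
Proof.
rewrite /moment fact0 invr1 mul1r -mom0; congr csum.
by apply: funext => m; rewrite expr0 mulr1.
Qed.

Lemma moment2_bound : exists2 K, 0 <= K & forall w b, 0 <= b -> (forall j, cn (w j) <= b) -> cn (q w) <= K * b ^+ 2.
Proof.
have [K K0 h] := summable_moment lam e00 psumm 2.
exists (2^-1 * K); first by rewrite mulr_ge0.
move=> w b b0 wb; rewrite /moment cnM cnV cn_natr -mulrA ler_wpM2l //.
by apply: csum_bound; apply: h.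
Qed.

(** The moments of order 0 and 1 are 1 and 0, so psi and e^q have the same terms up to degree 2. *)
Lemma rho_cubic : exists2 K, 0 <= K & forall w b, 0 <= b -> b <= e0 / 2 -> b <= 1 ->
  (forall j, cn (w j) <= b) -> cn (evls lam p w * cexp (- q w) - 1) <= K * b ^+ 3.
Proof.
have [K K0 hK] := evls_taylor lam e00 psumm 3; have [K2 K20 hK2] := moment2_bound.
exists (expR K2 * (K + K2 ^+ 2 * (2 + K2))); first by rewrite mulr_ge0 ?expR_ge0 ?addr_ge0 ?mulr_ge0 ?addr_ge0 ?exprn_ge0.
move=> w b b0 be b1 wb; have [_ h] := hK w b b0 be wb.
have hq := hK2 w b b0 wb; set z := q w in hq *.
have zK : cn z <= K2 by apply: le_trans hq _; rewrite ler_piMr // expr_le1.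
have {}h : cn (evls lam p w - 1 - z) <= K * b ^+ 3.
  move: h; rewrite !big_ord_recl big_ord0 addr0 -/(moment lam p 0 w) -/(moment lam p 1 w) -/(moment lam p 2 w).
  by rewrite moment0E mom1 add0r opprD addrA.
have e1 : cn (cexp (- z)) <= expR K2.
  by rewrite cn_cexp ler_expR; apply: le_trans zK; rewrite -(cnN z); apply: le_trans (cn_Re _); exact: ler_norm.
have e2 : cn (cexp (- z) - 1 + z) <= cn z ^+ 2 * expR K2.
  have := cexp_taylor 2 (- z); rewrite 2!big_ord_recl big_ord0 /= expr0 expr1 !divr1 addr0 opprD addrA opprK cnN.
  by move=> /le_trans; apply; rewrite ler_wpM2l ?exprn_ge0 ?cn_ge0 // ler_expR.
have -> : evls lam p w * cexp (- z) - 1 = (evls lam p w - 1 - z) * cexp (- z) + ((1 + z) * (cexp (- z) - 1 + z) - z ^+ 2).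
  by ring.
apply: le_trans (cnD _ _) _; rewrite [X in _ <= X](_ : _ = expR K2 * K * b ^+ 3 + expR K2 * (K2 ^+ 2 * (2 + K2)) * b ^+ 3); last by ring.
apply: lerD.
  rewrite cnM; apply: le_trans (ler_pM (cn_ge0 _) (cn_ge0 _) h e1) _.
  by rewrite mulrC mulrA.
apply: le_trans (cnB _ _) _; rewrite cnM cnX.
have z0 := cn_ge0 z; have h1 : cn (1 + z) <= 1 + K2.
  by apply: le_trans (cnD _ _) _; rewrite cn1 lerD2l.
have h2 : cn z ^+ 2 <= K2 ^+ 2 * b ^+ 3.
  apply: le_trans (_ : (K2 * b ^+ 2) ^+ 2 <= _).
    by rewrite lerXn2r ?nnegrE // mulr_ge0 // exprn_ge0.
  rewrite exprMn ler_wpM2l ?exprn_ge0 // -exprM; apply: ler_wiXn2l => //.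
have E1 : 1 <= expR K2 by rewrite -expR0 ler_expR.
apply: le_trans (lerD (ler_pM (cn_ge0 _) (cn_ge0 _) h1 e2) (lexx _)) _.
rewrite -[X in _ + X]mul1r mulrCA [expR K2 * _]mulrC -[X in _ <= X]mulrA.
have E0 := expR_ge0 K2; have Z0 : 0 <= cn z ^+ 2 by rewrite exprn_ge0.
apply: le_trans (_ : cn z ^+ 2 * ((1 + K2) * expR K2 + expR K2) <= _).
  by rewrite mulrDr lerD2l mulrC ler_wpM2l.
rewrite [X in _ <= X](_ : _ = K2 ^+ 2 * b ^+ 3 * ((1 + K2) * expR K2 + expR K2)); last by ring.
by rewrite ler_wpM2r // addr_ge0 // mulr_ge0 // addr_ge0.
Qed.

Variables (v : 'I_d -> R) (eps : R).
Hypothesis v01 : forall j, 0 <= v j <= 1.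
Hypothesis eps0 : 0 < eps.
Hypothesis epse : 4 * eps <= e0.
Notation U n := (un R n)%:C.

Definition psi n s : C := evls lam p (fun j => U n * ypt v s j).
Definition rho n s : C := psi n s * cexp (- (U n ^+ 2 * q (ypt v s))) - 1.

Lemma xp_psi3 r : xp v eps r (-1) (fun n (_ s : 'I_d -> R) => (psi n s - 1 - U n ^+ 2 * q (ypt v s)) / U n ^+ 3).
Proof.
have := xp_drop (moment_parity lam e00 psumm) (moment_pbound lam e00 psumm v01) (@evls_nbound _ _ lam _ e00 _ _ psumm _ _ v01 epse (3 + r)).
rewrite exprS sqrrN expr1n mulr1; apply: xp_ext => n dl s _; congr (_ / _).
by rewrite !big_ord_recl big_ord0 !lift0 /= moment0E mom1 expr0 addr0 mul0r add0r mul1r opprD addrA [q _ * _]mulrC.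
Qed.

Lemma nbound_q : nbound eps 0 (fun _ (_ s : 'I_d -> R) => q (ypt v s)).
Proof. apply: (@nbound_coef _ _ _ _ (fun _ => q)); exact: (moment_pbound lam e00 psumm v01). Qed.

Lemma xp_q r : xp v eps r 1 (fun _ (_ s : 'I_d -> R) => q (ypt v s)).
Proof.
apply: (@xp_coef _ _ _ _ _ _ (fun _ => q)); last exact: (moment_pbound lam e00 psumm v01).
by have := moment_parity lam e00 psumm 2; rewrite sqrrN expr1n.
Qed.

Lemma xp_expq3 r : xp v eps r (-1) (fun n (_ s : 'I_d -> R) =>
  (cexp (- (U n ^+ 2 * q (ypt v s))) - 1 + U n ^+ 2 * q (ypt v s)) / U n ^+ 3).
Proof.
have [K2 K20 hK2] := moment2_bound; have [Kq [Mq [Kq0 hq]]] := nbound_q 0.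
have h1 : xp v eps r (-1) (fun n (_ s : 'I_d -> R) => \sum_(k < r) ((-1) ^+ k.+2 / (k.+2`!)%:R * (U n ^+ (2 * k).+1 * q (ypt v s) ^+ k.+2))).
  apply: (@xp_sum _ _ _ _ r (-1) r (fun k n (_ s : 'I_d -> R) => (-1) ^+ k.+2 / (k.+2`!)%:R * (U n ^+ (2 * k).+1 * q (ypt v s) ^+ k.+2))) => k _.
  have := xpM (xp_cst v eps r ((-1) ^+ k.+2 / (k.+2`!)%:R)) (xp_unX (2 * k).+1 (xpX k.+2 (xp_q r))).
  by rewrite expr1n mul1r exprS exprM sqrrN expr1n expr1n !mulr1.
have h2 : nbound eps r (fun n (_ s : 'I_d -> R) =>
  (cexp (- (U n ^+ 2 * q (ypt v s))) - \sum_(k < r.+2) (- (U n ^+ 2 * q (ypt v s))) ^+ k / (k`!)%:R) / U n ^+ 3).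
  (* After r + 2 terms the remainder is of order u^{2r+4}; division by u^3 leaves u^{2r+1}. *)
  apply: (@nbound_le _ _ _ r (2 * r).+1); first by rewrite mul2n -addnn -addnS leq_addr.
  move=> b; exists (Kq ^+ r.+2 * expR (K2 * (2 * eps) ^+ 2)), (Mq * r.+2)%N; split.
    by rewrite mulr_ge0 ?expR_ge0 ?exprn_ge0.
  move=> n dl s _ ns; have [n0 _ _] := ns.
  rewrite cnM cnV cnX cn_un ler_pdivrMr ?exprn_gt0 ?un_gt0 //.
  apply: le_trans (cexp_taylor _ _) _; rewrite cnN.
  have hz : cn (U n ^+ 2 * q (ypt v s)) <= K2 * (2 * eps) ^+ 2.
    rewrite -(momentZ lam e00 psumm); apply: hK2 => [|j]; first by rewrite mulr_ge0 // ltW.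
    exact: near_cn.
  apply: le_trans (_ : cn (U n ^+ 2 * q (ypt v s)) ^+ r.+2 * expR (K2 * (2 * eps) ^+ 2) <= _).
    by rewrite ler_wpM2l ?exprn_ge0 ?cn_ge0 // ler_expR.
  have d0 : dbound 0 (fun _ : 'I_d => 0 : R) by move=> j; rewrite normr0.
  have := hq n _ s d0 ns; rewrite expr0 mulr1 => hh.
  rewrite cnM cnX cn_un exprMn.
  have h' : cn (q (ypt v s)) ^+ r.+2 <= Kq ^+ r.+2 * norm1 s ^+ (Mq * r.+2).
    by rewrite exprM -exprMn lerXn2r ?nnegrE ?cn_ge0 // mulr_ge0 // exprn_ge0 // norm1_ge0.
  apply: le_trans (_ : (un R n ^+ 2) ^+ r.+2 * (Kq ^+ r.+2 * norm1 s ^+ (Mq * r.+2)) * expR (K2 * (2 * eps) ^+ 2) <= _).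
    by rewrite ler_wpM2r ?expR_ge0 // ler_wpM2l ?exprn_ge0 ?un_ge0.
  rewrite -exprM (_ : (2 * r.+2 = 3 + (2 * r).+1)%N); last by rewrite !mulnS.
  by rewrite exprD le_eqVlt; apply/orP; left; apply/eqP; ring.
apply: xp_ext (xpD (xp_small v (-1) h2) h1) => n dl s [n0 _ _].
have u0 := unC_neq0 R n0; rewrite 2!big_ord_recl !lift0 expr0 expr1 !divr1.
set S := \sum_(k < r) _ / _; set S' := \sum_(k < r) _.
have -> : S = S' * U n ^+ 3.
  rewrite /S /S' mulr_suml; apply: eq_bigr => k _; rewrite !lift0 [in LHS]exprNn [in LHS]exprMn -[in LHS]exprM.
  rewrite (_ : (2 * k.+2 = (2 * k).+1 + 3)%N); last by rewrite !mulnS [RHS]addnC.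
  by rewrite exprD; set A := (-1) ^+ _; set B := U n ^+ (_).+1; set D := _%:R^-1; set E := q _ ^+ _; ring.
by field.
Qed.

Lemma xp_rho r : xp v eps r (-1) (fun n (_ s : 'I_d -> R) => rho n s / U n ^+ 3).
Proof.
have h3 := xp_psi3 r; have h4 := xp_expq3 r; have hq := xp_q r.
(* Write psi = 1 + u^2 q + u^3 A and e^{- u^2 q} = 1 - u^2 q + u^3 B. Then rho / u^3 = (A + B) - u
   q^2 + u^2 q (B - A) + u^3 A B. *)
have a1 := xpD h3 h4.
have a2 := xpN (xp_un (xpM hq hq)); rewrite mulr1 in a2.
have a3 := xp_unX 2 (xpM hq (xpD h4 (xpN h3))); rewrite sqrrN expr1n !mul1r in a3.
have a4 := xp_unX 3 (xpM h3 h4); rewrite mulrN1 opprK mulr1 exprS sqrrN expr1n mulr1 in a4.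
apply: xp_ext (xpD (xpD a1 a2) (xpD a3 a4)) => n dl s [n0 _ _].
have u0 := unC_neq0 R n0; rewrite /rho; field; exact: u0.
Qed.

(** Turns the binomial coefficient into n^j times a polynomial in u^2. For j > n the factor with i =
    n is zero, so the formula persists. *)
Lemma bin_prod n j : (0 < n)%N ->
  ('C(n, j))%:R = n%:R ^+ j * (\prod_(i < j) (1 - i%:R * U n ^+ 2)) / (j`!)%:R :> C.
Proof.
move=> n0; have nU : n%:R * U n ^+ 2 = 1.
  by rewrite -rmorphXn -(rmorph_nat (real_complex R)) -rmorphM un_sqr // rmorph1.
have f0 : (j`!)%:R != 0 :> C by rewrite pnatr_eq0 -lt0n fact_gt0.
apply: (mulIf f0); rewrite divfK // -natrM bin_ffact.
elim: j {f0} => [|j IH]; first by rewrite ffactn0 big_ord0 expr0 mulr1.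
rewrite ffactnSr big_ord_recr /= natrM IH (exprS n%:R j).
have -> : n%:R * n%:R ^+ j * (\prod_(i < j) (1 - i%:R * U n ^+ 2) * (1 - j%:R * U n ^+ 2)) =
  n%:R ^+ j * \prod_(i < j) (1 - i%:R * U n ^+ 2) * (n%:R - j%:R * (n%:R * U n ^+ 2)) by ring.
rewrite nU mulr1; have [jn|nj] := leqP j n; first by rewrite natrB.
by rewrite -IH ffact_small // !mul0r.
Qed.

(** n^j rho^j = u^j (rho / u^3)^j, so the sum is 1 plus u times terms of sign -1. *)
Lemma xp1_binomial_sum r : xp1 v eps r (fun n (_ s : 'I_d -> R) => \sum_(j < r.+1) ('C(n, j))%:R * rho n s ^+ j) 1.
Proof.
have hc j : xp v eps r 1 (fun n (_ _ : 'I_d -> R) => \prod_(i < j) (1 - i%:R * U n ^+ 2)).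
  elim: j => [|j IH]; first by apply: xp_ext (xp_cst v eps r 1) => n dl s _; rewrite big_ord0.
  have h := xp_unX 2 (xp_cst v eps r j%:R); rewrite sqrrN expr1n mulr1 in h.
  have {}h := xpM IH (xpD (xp_cst v eps r 1) (xpN h)); rewrite mulr1 in h.
  by apply: xp_ext h => n dl s _; rewrite big_ord_recr /= [j%:R * _]mulrC.
have := @xp_sum R d v eps r (-1) r (fun k n (_ s : 'I_d -> R) => ((k.+1)`!)%:R^-1 *
  ((\prod_(i < k.+1) (1 - i%:R * U n ^+ 2)) * (U n ^+ k * (rho n s / U n ^+ 3) ^+ k.+1))).
move=> h; apply: xp_ext (h _) => [n dl s [n0 _ _]|k _].
  have u0 := unC_neq0 R n0; rewrite big_ord_recl bin0 !expr0 mulr1 addrC addKr mulr_suml.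
  apply: eq_bigr => k _; rewrite lift0 bin_prod //.
  have nU : n%:R = (U n ^+ 2)^-1.
    apply: (mulIf (_ : U n ^+ 2 != 0)); rewrite ?expf_neq0 // mulVf ?expf_neq0 //.
    by rewrite -rmorphXn -(rmorph_nat (real_complex R)) -rmorphM un_sqr // rmorph1.
  rewrite nU exprMn -!exprVn -!exprM.
  set P := \prod_(i < _) _; set f := (_`!)%:R; set X := rho n s ^+ _.
  have f0 : f != 0 by rewrite pnatr_eq0 -lt0n fact_gt0.
  have -> : (U n)^-1 ^+ (3 * k.+1) = (U n)^-1 ^+ (2 * k.+1) * (U n)^-1 ^+ k * (U n)^-1.
    by rewrite -exprD -exprSr; congr (_ ^+ _); rewrite !mulSn ; ring.
  have uk : U n ^+ k * (U n)^-1 ^+ k = 1 by rewrite -exprMn divff // expr1n.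
  transitivity (f^-1 * P * X * (U n)^-1 ^+ (2 * k.+1) * (U n)^-1 * (U n ^+ k * (U n)^-1 ^+ k)).
    by ring.
  by rewrite uk; ring.
have := xpM (xp_cst v eps r ((k.+1)`!)%:R^-1) (xpM (hc k.+1) (xp_unX k (xpX k.+1 (xp_rho r)))).
by rewrite !mul1r exprS mulrCA -exprD addnn -mul2n exprM sqrrN expr1n expr1n mulr1.
Qed.

End SaddleExpansion.

(** * The integrand near the origin *)

Section SaddleMain.
Variable R : realType.
Notation C := R[i].
Variables (d : nat) (lam : 'I_d -> R) (e0 : R).
Hypothesis e00 : 0 < e0.
Variables (p : mi d -> C) (Kp : R).
Hypothesis psumm : summable Kp (fun m => (expR (e0 * mabs R m))%:C * p m).
Hypothesis mom0 : csum p = 1.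
Hypothesis mom1 : forall w, moment lam p 1 w = 0.
Variables (H : 'M[R]_d).
Hypothesis Hsym : forall i j, H i j = H j i.
Variable cH : R.
Hypothesis cH0 : 0 < cH.
Hypothesis Hpos : forall s, cH * nsq s <= quadf H s.
Hypothesis mom2 : forall w, moment lam p 2 w = 2^-1 * bilin H w w.
Variables (al : mi d -> C) (Ka : R).
Hypothesis asumm : summable Ka (fun m => (expR (e0 * mabs R m))%:C * al m).
Variables (D : {set 'I_d}) (z : 'I_d -> R).
Hypothesis z1 : forall j, j \in D -> z j = 1.
Hypothesis z01 : forall j, j \notin D -> 0 <= z j < 1.
Definition pole_shift (j : 'I_d) : R := (j \in D)%:R.
Notation v := pole_shift.
Notation U n := (un R n)%:C.
Notation q := (moment lam p 2).

Lemma pole_shift01 j : 0 <= v j <= 1.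
Proof. by rewrite /v; case: (j \in D); rewrite /= ?lexx ler01. Qed.

Definition integrand n (dl s : 'I_d -> R) : C :=
  evls (fun _ => 0) al (fun j => U n * ypt v s j) * psi lam p v n s ^+ n *
  (\prod_j (1 - (z j)%:C * cexp (U n * ypt v s j))^-1) *
  cexp (- \sum_j (dl j)%:C * (U n * ypt v s j)).

(** The part of the integrand that does not depend on n, singular factors included; [pole_free]
    collects factors that tend to constants. *)
Definition kernel (y : 'I_d -> C) : C := cexp (q y) * \prod_(j in D) (- y j)^-1.

Definition pole_free n (dl s : 'I_d -> R) : C :=
  evls (fun _ => 0) al (fun j => U n * ypt v s j) *
  (\prod_j (if j \in D then ((cexp (U n * ypt v s j) - 1) / (U n * ypt v s j))^-1
            else (1 - (z j)%:C * cexp (U n * ypt v s j))^-1)) *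
  cexp (- \sum_j (dl j)%:C * (U n * ypt v s j)).

Definition lead : C := csum al * \prod_j (if j \in D then 1 else (1 - (z j)%:C)^-1) * 1.

Lemma ypt_pole_neq0 s j : j \in D -> ypt v s j != 0.
Proof. by move=> jD; apply: ypt_neq0; rewrite /v jD. Qed.

Lemma integrandE n dl s : (0 < n)%N ->
  U n ^+ #|D| * integrand n dl s = (1 + rho lam p v n s) ^+ n * pole_free n dl s * kernel (ypt v s).
Proof.
move=> n0; have u0 := unC_neq0 R n0.
have e1 : psi lam p v n s ^+ n = (1 + rho lam p v n s) ^+ n * cexp (q (ypt v s)).
  rewrite /rho addrC subrK exprMn -mulrA -cexpM_natl -cexpD mulrN mulrA.
  have -> : n%:R * U n ^+ 2 = 1.
    by rewrite -rmorphXn -(rmorph_nat (real_complex R)) -rmorphM un_sqr // rmorph1.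
  by rewrite mul1r addNr cexp0 mulr1.
have e2 : U n ^+ #|D| * (\prod_j (1 - (z j)%:C * cexp (U n * ypt v s j))^-1) =
  (\prod_j (if j \in D then ((cexp (U n * ypt v s j) - 1) / (U n * ypt v s j))^-1
            else (1 - (z j)%:C * cexp (U n * ypt v s j))^-1)) * \prod_(j in D) (- ypt v s j)^-1.
  rewrite -prodr_const [\prod_(_ in D) U n]big_mkcond [\prod_(_ in D) _^-1]big_mkcond -!big_split.
  apply: eq_bigr => j _ /=; case: ifP => jD; last by rewrite mul1r mulr1.
  rewrite z1 // (rmorph1 (real_complex R)) mul1r invf_div invrN -(opprB (cexp _) 1) invrN.
  have y0 := ypt_pole_neq0 s jD; have [->|x0] := eqVneq (cexp (U n * ypt v s j) - 1) 0.
    by rewrite invr0; ring.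
  by field; rewrite y0 x0.
rewrite /integrand e1 /pole_free /kernel.
transitivity (evls (fun=> 0) al (fun j => U n * ypt v s j) * ((1 + rho lam p v n s) ^+ n * cexp (q (ypt v s))) *
  (U n ^+ #|D| * (\prod_j (1 - (z j)%:C * cexp (U n * ypt v s j))^-1)) * cexp (- \sum_j (dl j)%:C * (U n * ypt v s j))); first by ring.
by rewrite e2; ring.
Qed.

Lemma kernel_bound : exists2 K, 0 <= K & forall s, cn (kernel (ypt v s)) <= K * expR (- (cH / 2 * nsq s)).
Proof.
exists (expR (quadf H (fun j => - v j) / 2)); first exact: expR_ge0.
move=> s; rewrite /kernel cnM -[X in _ <= X]mulr1; apply: ler_pM; rewrite ?cn_ge0 //.
  rewrite mom2 cn_cexp -expRD ler_expR.
  have := qexp_iE (fun _ => 0) s (fun j => - v j) Hsym.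
  rewrite /qexp big1 ?addr0; last by move=> j _; rewrite mul0r.
  rewrite (_ : (fun j => _) = ypt v s); last first.
    by apply: funext => j; rewrite /ypt addrC rmorphN.
  move=> ->; rewrite big1; last by move=> j _; rewrite mul0r.
  by have := Hpos s; rewrite /=; lra.
rewrite cn_prod; apply: prodr_ile1 => j jD; rewrite cn_ge0 cnV cnN.
have h : 1 <= cn (ypt v s j).
  apply: le_trans (cn_Re _); rewrite (_ : complex.Re _ = -1) ?normrN ?normr1 //.
  by rewrite /ypt /v jD /=; ring.
by rewrite invf_le1 // (lt_le_trans ltr01 h).
Qed.

Variable eps : R.
Hypothesis eps0 : 0 < eps.
Hypothesis eps16 : eps <= 1 / 16.
Hypothesis epse : 4 * eps <= e0.

Lemma xp1_pole_free r : xp1 v eps r pole_free lead.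
Proof.
have v01 := pole_shift01.
apply: xp1M; last exact: xp1_shift_factor.
apply: xp1M; first by apply: (evls_xp1 _ e00 asumm).
apply: xp1_prod => j _; case: ifP => jD.
  by apply: xp1_expm1_ratioV => //; rewrite /v jD.
apply: xp1_one_minusV => //; first by rewrite /v jD.
by apply: z01; rewrite jD.
Qed.

Variable Kr : R.
Hypothesis Kr0 : 0 <= Kr.
Hypothesis hrho : forall w b, 0 <= b -> b <= e0 / 2 -> b <= 1 ->
  (forall j, cn (w j) <= b) -> cn (evls lam p w * cexp (- q w) - 1) <= Kr * b ^+ 3.
Hypothesis epsK : 4 * Kr * eps <= cH / 4.

(** The first bound supplies the powers of u. The second, linear in |s|^2 with a small constant,
    keeps (1 + |rho|)^n within half of the decay e^{- cH |s|^2 / 2} of the kernel. *)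
Lemma rho_bound n s : near_origin eps n s ->
  n%:R * cn (rho lam p v n s) <= Kr * un R n * norm1 s ^+ 3 /\
  n%:R * cn (rho lam p v n s) <= cH / 4 * (1 + nsq s).
Proof.
move=> ns; have [n0 _ _] := ns; have u0 := un_ge0 R n; have v01 := pole_shift01.
have e2 : 2 * eps <= e0 / 2 by have := epse; lra.
have e3 : 2 * eps <= 1 by have := eps16; lra.
have main B : 0 <= B -> (forall j, cn (ypt v s j) <= B) ->
    cn (rho lam p v n s) <= Kr * Num.min (2 * eps) (un R n * B) ^+ 3.
  move=> B0 yB; rewrite /rho /psi -(momentZ lam e00 psumm).
  have m0 : 0 <= Num.min (2 * eps) (un R n * B).
    by rewrite le_min !mulr_ge0 // ltW.
  apply: hrho => //.
  - by rewrite ge_min e2.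
  - by rewrite ge_min e3.
  move=> j; rewrite le_min near_cn //= cnM cn_un ler_wpM2l //.
have n1 := un_sqr R n0; have nn : 0 <= n%:R :> R by [].
split.
  have N0 := norm1_ge0 s; apply: le_trans (ler_wpM2l nn (main _ N0 (cn_ypt v01 s))) _.
  apply: le_trans (_ : n%:R * (Kr * (un R n * norm1 s) ^+ 3) <= _).
    rewrite ler_wpM2l // ler_wpM2l // lerXn2r ?nnegrE ?mulr_ge0 //; last by rewrite ge_min lexx orbT.
    by rewrite le_min !mulr_ge0 // ltW.
  have -> : n%:R * (Kr * (un R n * norm1 s) ^+ 3) = Kr * (n%:R * un R n ^+ 2) * un R n * norm1 s ^+ 3 by rewrite exprMn; ring.
  by rewrite n1 mulr1.

(* B bounds every |y_j|, as |y_j|^2 <= (1 + |s_j|)^2 <= 2 + 2 |s|^2. One of the three factors of the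
   cube is then bounded by 2 eps instead, which leaves a quadratic bound. *)
have N0 := nsq_ge0 s; pose B := Num.sqrt (2 + 2 * nsq s).
have B2 : B ^+ 2 = 2 + 2 * nsq s by rewrite sqr_sqrtr // addr_ge0 ?mulr_ge0.
have yB j : cn (ypt v s j) <= B.
  rewrite -(@ler_pXn2r _ 2) ?nnegrE ?cn_ge0 ?sqrtr_ge0 // B2.
  apply: le_trans (_ : (1 + `|s j|) ^+ 2 <= _).
    rewrite lerXn2r ?nnegrE ?cn_ge0 ?addr_ge0 //.
    have /andP[v0 v1] := v01 j; apply: le_trans (cnD _ _) _; rewrite cnN cnM cn_i mul1r !cn_real.
    by rewrite ger0_norm // lerD2r.
  have : `|s j| ^+ 2 <= nsq s.
    by rewrite real_normK ?num_real // /nsq (bigD1 j) //= lerDl sumr_ge0 // => i _; rewrite sqr_ge0.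
  by have := sqr_ge0 (1 - `|s j|); rewrite !expr2; lra.
have B0 : 0 <= B by rewrite sqrtr_ge0.
apply: le_trans (ler_wpM2l nn (main _ B0 yB)) _.
have m0 : 0 <= Num.min (2 * eps) (un R n * B) by rewrite le_min !mulr_ge0 // ltW.
apply: le_trans (_ : n%:R * (Kr * (2 * eps * (un R n * B) ^+ 2)) <= _).
  rewrite ler_wpM2l // ler_wpM2l // exprS; apply: ler_pM; rewrite ?exprn_ge0 ?ge_min ?lexx //.
  by rewrite lerXn2r ?nnegrE ?mulr_ge0 // ge_min lexx orbT.
have -> : n%:R * (Kr * (2 * eps * (un R n * B) ^+ 2)) = 4 * Kr * eps * (n%:R * un R n ^+ 2) * (1 + nsq s).
  by rewrite exprMn B2; ring.
rewrite n1 mulr1.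
by rewrite ler_wpM2r // addr_ge0.
Qed.

Lemma near_main r : (0 < r)%N -> exists P : nat -> ('I_d -> R) -> ('I_d -> C) -> C,
  [/\ forall k, has_parity ((-1) ^+ k) (P k), forall k, pbound v (P k), forall dl y, P 0%N dl y = lead &
   forall b, exists2 K, 0 <= K & forall n dl s, dbound b dl -> near_origin eps n s ->
     cn (U n ^+ #|D| * integrand n dl s - \sum_(k < r) U n ^+ k * (P k dl (ypt v s) * kernel (ypt v s)))
       <= K * un R n ^+ r * W s].
Proof.
move=> r0; have v01 := pole_shift01.
have hT := xp1_binomial_sum e00 psumm mom0 mom1 v01 eps0 epse r.
have hX := xp1_pole_free r.
have [P [P1 P2 P3 P4]] := xp1_elim r0 (xp1M hT hX).
exists P; split=> // [dl y|b]; first by rewrite P3 mul1r.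
have [K1 [M1 [K10 h1]]] := P4 b.
have [K2 [M2 [K20 h2]]] := xp_bounded (xp1_xp hX) b.
have [K3 K30 h3] := kernel_bound.
pose M := maxn M1 (3 * r.+1 + M2).
have c4 : 0 < cH / 4 by rewrite divr_gt0.
have [K4 K40 h4] := @gauss_weight R d (cH / 4) M c4.
pose K := (K1 + Kr ^+ r.+1 * expR (cH / 4) * K2) * K3 * K4.
have K5 : 0 <= Kr ^+ r.+1 * expR (cH / 4) * K2 by rewrite !mulr_ge0 ?expR_ge0 ?exprn_ge0.
have K6 : 0 <= (K1 + Kr ^+ r.+1 * expR (cH / 4) * K2) * K3 by rewrite !mulr_ge0 ?addr_ge0.
exists K; first by rewrite mulr_ge0.
move=> n dl s db ns; have [n0 _ _] := ns; have u0 := un_ge0 R n.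
have [r1 r2] := rho_bound ns; have N0 := norm1_ge0 s.
have := h1 n dl s db ns; have := h2 n dl s db ns; rewrite expr0 mulr1.
have := @binomial_remainder R (rho lam p v n s) n r.+1.
rewrite integrandE //; set X := pole_free n dl s; set T := \sum_(j < r.+1) _.
set rh := rho lam p v n s in r1 r2 *; move=> hE hX' hP.
set E := _ - T in hE; set y := ypt v s; set Ky := kernel y.
have -> : (1 + rh) ^+ n * X * Ky - \sum_(k < r) U n ^+ k * (P k dl y * Ky) =
   ((T * X - \sum_(k < r) P k dl y * U n ^+ k) + E * X) * Ky.
  rewrite (_ : \sum_(k < r) U n ^+ k * (P k dl y * Ky) = (\sum_(k < r) P k dl y * U n ^+ k) * Ky); last first.
    by rewrite mulr_suml; apply: eq_bigr => k _; ring.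
  by rewrite /E; ring.
have eN : (1 + cn rh) ^+ n <= expR (cH / 4) * expR (cH / 4 * nsq s).
  rewrite -expRD; apply: le_trans (_ : expR (cn rh) ^+ n <= _).
    rewrite lerXn2r ?nnegrE ?expR_ge0 ?addr_ge0 ?cn_ge0 //; exact: expR_ge1Dx.
  rewrite -expRM_natl ler_expR -mulr_natl; lra.
set G := expR (cH / 4 * nsq s) in eN *.
have {}hE : cn E <= Kr ^+ r.+1 * expR (cH / 4) * (un R n ^+ r * norm1 s ^+ (3 * r.+1)) * G.
  apply: le_trans hE _.
  apply: le_trans (_ : (Kr * un R n * norm1 s ^+ 3) ^+ r.+1 * (expR (cH / 4) * G) <= _).
    by apply: ler_pM; rewrite ?exprn_ge0 ?mulr_ge0 ?addr_ge0 ?cn_ge0 // lerXn2r ?nnegrE ?mulr_ge0 ?cn_ge0 ?exprn_ge0.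
  rewrite 2!exprMn -[(norm1 s ^+ 3) ^+ _]exprM [X in _ <= X](_ : _ = Kr ^+ r.+1 * un R n ^+ r * norm1 s ^+ (3 * r.+1) * (expR (cH / 4) * G)); last by ring.
  rewrite ler_wpM2r ?mulr_ge0 ?expR_ge0 // ler_wpM2r ?exprn_ge0 // ler_wpM2l ?exprn_ge0 //.
  by rewrite exprS ler_piMl ?exprn_ge0 ?un_le1.
have N1 : norm1 s ^+ M1 <= norm1 s ^+ M by rewrite norm1_mono // leq_maxl.
have N2 : norm1 s ^+ (3 * r.+1) * norm1 s ^+ M2 <= norm1 s ^+ M by rewrite -exprD norm1_mono // leq_maxr.
have G1 : 1 <= G by rewrite -expR0 ler_expR mulr_ge0 ?nsq_ge0 // ltW.
have ur : 0 <= un R n ^+ r by rewrite exprn_ge0.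
rewrite cnM; apply: le_trans (_ : ((K1 + Kr ^+ r.+1 * expR (cH / 4) * K2) * un R n ^+ r * norm1 s ^+ M * G) * (K3 * expR (- (cH / 2 * nsq s))) <= _).
  apply: ler_pM; rewrite ?cn_ge0 //; last exact: h3.
  apply: le_trans (cnD _ _) _.
  rewrite [X in _ <= X](_ : _ = K1 * un R n ^+ r * norm1 s ^+ M * G + Kr ^+ r.+1 * expR (cH / 4) * K2 * un R n ^+ r * norm1 s ^+ M * G); last by ring.
  apply: lerD.
    apply: le_trans hP _; rewrite -[X in X <= _]mulr1; apply: ler_pM; rewrite ?mulr_ge0 ?exprn_ge0 //.
    by rewrite ler_wpM2l // mulr_ge0.
  rewrite cnM; apply: le_trans (ler_pM (cn_ge0 _) (cn_ge0 _) hE hX') _.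
  rewrite [X in X <= _](_ : _ = Kr ^+ r.+1 * expR (cH / 4) * K2 * un R n ^+ r * (norm1 s ^+ (3 * r.+1) * norm1 s ^+ M2) * G); last by ring.
  by rewrite ler_wpM2r ?expR_ge0 // ler_wpM2l // mulr_ge0.
have [h5 _] := h4 s.
(* Half of the decay of the kernel cancels the growth [G] of (1 + |rho|)^n. *)
have -> : expR (- (cH / 2 * nsq s)) = expR (- (cH / 4 * nsq s)) * G^-1.
  by rewrite /G -expRN -expRD; congr expR; field.
rewrite [X in X <= _](_ : _ = (K1 + Kr ^+ r.+1 * expR (cH / 4) * K2) * K3 * un R n ^+ r * (norm1 s ^+ M * expR (- (cH / 4 * nsq s))) * (G * G^-1)); last by ring.
rewrite divff ?mulr1; last by rewrite gt_eqF // (lt_le_trans ltr01 G1).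
rewrite [X in _ <= X](_ : _ = (K1 + Kr ^+ r.+1 * expR (cH / 4) * K2) * K3 * un R n ^+ r * (K4 * W s)); last by rewrite /K; ring.
by rewrite ler_wpM2l // mulr_ge0.
Qed.

End SaddleMain.

(** * From the integrand to the integral: the far region *)

Section SaddleIntegral.
Variable R : realType.
Notation C := R[i].
Variables (d : nat) (lam : 'I_d -> R) (e0 : R).
Hypothesis e00 : 0 < e0.
Variables (p : mi d -> C) (Kp : R).
Hypothesis psumm : summable Kp (fun m => (expR (e0 * mabs R m))%:C * p m).
Hypothesis mom0 : csum p = 1.
Hypothesis mom1 : forall w, moment lam p 1 w = 0.
Variables (H : 'M[R]_d).
Hypothesis Hsym : forall i j, H i j = H j i.
Variable cH : R.
Hypothesis cH0 : 0 < cH.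
Hypothesis Hpos : forall s, cH * nsq s <= quadf H s.
Hypothesis mom2 : forall w, moment lam p 2 w = 2^-1 * bilin H w w.
Variables (al : mi d -> C) (Ka : R).
Hypothesis asumm : summable Ka (fun m => (expR (e0 * mabs R m))%:C * al m).
Variables (D : {set 'I_d}) (z : 'I_d -> R).
Hypothesis z1 : forall j, j \in D -> z j = 1.
Hypothesis z01 : forall j, j \notin D -> 0 <= z j < 1.
Notation v := (pole_shift R D).
Notation U n := (un R n)%:C.
Hypothesis far : forall eps, 0 < eps -> exists gam N, 0 < gam < 1 /\
  forall n s, (N <= n)%N -> inbox (un R n)^-1 s -> ~ near_origin eps n s -> cn (psi lam p v n s) <= gam.

Lemma summable_expR_drop K (c : mi d -> C) : summable K (fun m => (expR (e0 * mabs R m))%:C * c m) -> summable K c.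
Proof.
apply: summable_le => m; rewrite cnM cn_real ger0_norm ?expR_ge0 // ler_peMl ?cn_ge0 //.
by rewrite -expR0 ler_expR mulr_ge0 ?mabs_ge0 // ltW.
Qed.

Lemma Re_ypt n s j : complex.Re (U n * ypt v s j) = - (un R n * v j).
Proof. by rewrite /ypt /=; ring. Qed.

Lemma evls_bound n s : cn (evls (fun _ => 0) al (fun j => U n * ypt v s j)) <= Ka.
Proof.
apply: csum_bound; apply: summable_le (summable_expR_drop asumm) => m.
rewrite cnM ler_piMr ?cn_ge0 // cn_cexp -expR0 ler_expR /linl Re_sum; apply: sumr_le0 => j _.
have -> : (m j)%:R - 0%:C = ((m j)%:R)%:C :> C by rewrite (rmorph0 (real_complex R)) subr0 rmorph_nat.
by rewrite Re_realM Re_ypt mulrN oppr_le0 mulr_ge0 // mulr_ge0 ?un_ge0 //; have /andP[] := pole_shift01 R D j.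
Qed.

(** A pole costs at most 2 / u because 1 - e^{-u} >= u / 2 for 0 < u <= 1. *)
Lemma poles_bound n s : (0 < n)%N ->
  cn (U n ^+ #|D| * \prod_j (1 - (z j)%:C * cexp (U n * ypt v s j))^-1) <=
  \prod_j (if j \in D then 2 else (1 - z j)^-1).
Proof.
move=> n0; rewrite -prodr_const [\prod_(_ in D) U n]big_mkcond -big_split cn_prod.
apply: ler_prod => j _ /=; rewrite cn_ge0 /=.
have u0 := un_gt0 R n0; have u1 := un_le1 R n0.
have cw : cn (cexp (U n * ypt v s j)) = expR (- (un R n * v j)) by rewrite cn_cexp Re_ypt.
have low x : cn (1 - x%:C * cexp (U n * ypt v s j)) >= 1 - `|x| * expR (- (un R n * v j)).
  have : cn (1 : C) <= cn (1 - x%:C * cexp (U n * ypt v s j)) + cn (x%:C * cexp (U n * ypt v s j)).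
    by rewrite -{1}[1](subrK (x%:C * cexp (U n * ypt v s j))); apply: cnD.
  by rewrite cn1 cnM cn_real cw; lra.
have {low} := low (z j); rewrite /pole_shift; case: ifP => jD /=.
  rewrite z1 // normr1 mul1r mulr1 cnM cnV cn_un => h.
  have : un R n / 2 <= 1 - expR (- un R n).
    have e1 := expR_ge1Dx (un R n); have E0 := expR_gt0 (un R n).
    rewrite expRN; have : (expR (un R n))^-1 <= (1 + un R n)^-1.
      by rewrite lef_pV2 ?posrE //; lra.
    have i1 : (1 + un R n)^-1 * (1 + un R n) = 1 by rewrite mulVf // gt_eqF //; lra.
    have i0 : 0 < (1 + un R n)^-1 by rewrite invr_gt0; lra.
    by nra.
  move=> h2; have h3 := le_trans h2 h; rewrite ler_pdivrMr; first by lra.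
  by apply: lt_le_trans h3; rewrite divr_gt0.
have /andP[z0 z1'] := z01 (negbT jD); rewrite mulr0 oppr0 expR0 mulr1 mul1r ger0_norm // cnV => h.
by rewrite lef_pV2 ?posrE ?(lt_le_trans _ h) //; lra.
Qed.

Lemma shift_factor_bound b n s dl : (0 < n)%N -> dbound b dl ->
  cn (cexp (- \sum_j (dl j)%:C * (U n * ypt v s j))) <= expR (d%:R * b).
Proof.
move=> n0 db; rewrite cn_cexp ler_expR ReN Re_sum -sumrN.
apply: le_trans (_ : \sum_(j < d) b <= _); last by rewrite sumr_const card_ord mulr_natl.
apply: ler_sum => j _; rewrite Re_realM Re_ypt mulrN opprK.
apply: le_trans (ler_norm _) _; rewrite normrM -[X in _ <= X]mulr1; apply: ler_pM => //.
have /andP[v0 v1] := pole_shift01 R D j; rewrite ger0_norm ?mulr_ge0 ?un_ge0 // mulr_ile1 ?un_ge0 ?un_le1 //.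
Qed.

Lemma geometric_decay M (gam : R) : 0 < gam < 1 -> exists2 K, 0 <= K & forall n, (0 < n)%N ->
  gam ^+ n * (un R n)^-1 ^+ M <= K.
Proof.
move=> /andP[g0 g1]; have c0 : 0 < - ln gam by rewrite oppr_gt0 ln_lt0 // g0.
have [K K0 hK] := @expX_bound R (- ln gam) M c0; exists K => // n n0.
apply: le_trans (hK n%:R (ler0n _ _)); rewrite mulNr opprK mulrC.
rewrite [ln gam * _]mulrC expRM_natl lnK ?posrE // ler_wpM2r ?exprn_ge0 ?(ltW g0) //.
rewrite lerXn2r ?nnegrE ?invr_ge0 ?un_ge0 // ?addr_ge0 // /un invrK.
rewrite -(@ler_pXn2r _ 2) ?nnegrE ?sqrtr_ge0 ?addr_ge0 // sqr_sqrtr //.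
have : 0 <= n%:R :> R by []. by rewrite expr2; nra.
Qed.

Lemma pbound_sum (P : nat -> ('I_d -> R) -> ('I_d -> C) -> C) r b : (forall k, pbound v (P k)) ->
  exists K M, 0 <= K /\ forall dl s, dbound b dl -> \sum_(k < r) cn (P k dl (ypt v s)) <= K * norm1 s ^+ M.
Proof.
move=> h; elim: r => [|r [K [M [K0 IH]]]].
  by exists 0, 0%N; split=> // dl s _; rewrite big_ord0 mul0r.
have [K' [M' [K'0 h']]] := h r b; exists (K + K'), (maxn M M'); split; first exact: addr_ge0.
move=> dl s db; rewrite big_ord_recr mulrDl /=; apply: lerD.
  by apply: le_trans (IH dl s db) _; rewrite ler_wpM2l // norm1_mono // leq_maxl.
by apply: le_trans (h' dl s db) _; rewrite ler_wpM2l // norm1_mono // leq_maxr.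
Qed.

Lemma un_small (eps : R) : 0 < eps -> exists N, forall n, (N <= n)%N -> (0 < n)%N /\ un R n <= eps.
Proof.
move=> e0'; have [N hN] := natS_large (eps^-1 ^+ 2); exists N.+1 => n Nn; have n0 : (0 < n)%N by apply: leq_trans Nn.
split=> //; rewrite /un -[eps]invrK lef_pV2 ?posrE ?invr_gt0 ?sqrtr_gt0 ?ltr0n //.
rewrite -[eps^-1]ger0_norm ?invr_ge0 ?(ltW e0') // -sqrtr_sqr ler_wsqrtr //.
exact: hN (ltnW Nn).
Qed.

Lemma dominated_kernel P b : pbound v P -> exists K, forall dl, dbound b dl ->
  dominated K (fun s => P dl (ypt v s) * kernel lam p D (ypt v s)).
Proof.
move=> hP; have [K [M [K0 h]]] := hP b.
have [K3 K30 h3] := kernel_bound Hsym Hpos mom2 D.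
have c2 : 0 < cH / 2 by rewrite divr_gt0.
have [K4 K40 h4] := @gauss_weight R d (cH / 2) M c2.
exists (K * K3 * K4) => dl db s; rewrite cnM; have [h5 _] := h4 s.
apply: le_trans (ler_pM (cn_ge0 _) (cn_ge0 _) (h dl s db) (h3 s)) _.
rewrite [X in X <= _](_ : _ = K * K3 * (norm1 s ^+ M * expR (- (cH / 2 * nsq s)))); last by ring.
by rewrite -[X in _ <= X]mulrA ler_wpM2l // mulr_ge0.
Qed.

(** Away from the origin the integrand and the approximating sum are bounded separately: the former
    by a power gam^n, the latter by its Gaussian decay. *)
Lemma integral_expansion r : (0 < r)%N -> exists P : nat -> ('I_d -> R) -> ('I_d -> C) -> C,
  [/\ forall k, has_parity ((-1) ^+ k) (P k), forall k, pbound v (P k), forall dl y, P 0%N dl y = lead al D z &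
   forall b, exists K N, 0 <= K /\ forall n dl, (N <= n)%N -> dbound b dl ->
     cn (U n ^+ #|D| * integ (onbox (un R n)^-1 (integrand lam p al D z n dl)) -
         \sum_(k < r) U n ^+ k * integ (fun s => P k dl (ypt v s) * kernel lam p D (ypt v s)))
       <= K * un R n ^+ r].
Proof.
move=> r0; have [Kr Kr0 hrho] := rho_cubic e00 psumm mom0 mom1.
(* 1/16 keeps the pole factors away from 0, e0 / 4 keeps |w| within the Taylor range, and the last
   term gives 4 Kr eps <= cH / 4; [Kr + 1] keeps the denominator positive. *)
pose eps := Num.min (1 / 16) (Num.min (e0 / 4) (cH / (16 * (Kr + 1)))).
have Kr1 : 0 < 16 * (Kr + 1) by rewrite mulr_gt0 // ltr_wpDl.
have eps0 : 0 < eps by rewrite !lt_min !divr_gt0.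
have eps16 : eps <= 1 / 16 by rewrite ge_min lexx.
have epse : 4 * eps <= e0.
  have : eps <= e0 / 4 by rewrite !ge_min lexx orbT.
  by lra.
have epsK : 4 * Kr * eps <= cH / 4.
  have : eps <= cH / (16 * (Kr + 1)) by rewrite !ge_min lexx !orbT.
  rewrite ler_pdivlMr // => h; have := eps0; nra.
have [P [P1 P2 P3 P4]] := near_main e00 psumm mom0 mom1 Hsym cH0 Hpos mom2 asumm z1 z01 eps0 eps16 epse Kr0 hrho epsK r0.
exists P; split=> // b.
have [K1 K10 hnear] := P4 b.
have [gam [N1 [gam01 hfar]]] := far eps0.
have [N2 hN2] := un_small eps0.
have [K2 K20 hgeo] := geometric_decay (2 * d + r) gam01.
have [K3 K30 h3] := kernel_bound Hsym Hpos mom2 D.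
have [K4 [M4 [K40 h4]]] := pbound_sum r b P2.
have c2 : 0 < cH / 2 by rewrite divr_gt0.
have [K5 K50 h5] := @gauss_weight R d (cH / 2) (r + M4) c2.
have Ka0 := summable_ge0 asumm.
pose KP : R := \prod_j (if j \in D then 2 else (1 - z j)^-1).
have KP0 : 0 <= KP.
  apply: prodr_ge0 => j _; case: ifP => // jD; rewrite invr_ge0.
  by have /andP[_ h] := z01 (negbT jD); lra.
pose KF := Ka * KP * expR (d%:R * b) * (1 + pi) ^+ (2 * d) * K2.
have pi0 := pi_ge0 R.
have Epi : 0 <= (1 + pi) ^+ (2 * d) :> R by rewrite exprn_ge0 // addr_ge0.
have KF0 : 0 <= KF.
  by have E0 := expR_ge0 (d%:R * b); rewrite /KF; do 4?[apply: mulr_ge0].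
pose KM := eps^-1 ^+ r * K4 * K3 * K5.
have KM0 : 0 <= KM by rewrite /KM !mulr_ge0 ?exprn_ge0 ?invr_ge0 // ltW.
exists ((K1 + KF + KM) * 4 ^+ d), (maxn N1 N2); split.
  by rewrite mulr_ge0 ?exprn_ge0 ?addr_ge0.
move=> n dl; rewrite geq_max => /andP[nN1 nN2] db; have [n0 ue] := hN2 n nN2.
have u0 := un_gt0 R n0; have u1 := un_le1 R n0; have ur : 0 <= un R n ^+ r by rewrite exprn_ge0 // ltW.
pose F s := U n ^+ #|D| * onbox (un R n)^-1 (integrand lam p al D z n dl) s.
pose G s := \sum_(k < r) U n ^+ k * (P k dl (ypt v s) * kernel lam p D (ypt v s)).
have Gfar s : ~ near_origin eps n s -> cn (G s) <= KM * un R n ^+ r * W s.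
  move=> ns; have [j hj] : exists j, eps < un R n * `|s j|.
    apply/existsP; rewrite -[X in is_true X]negbK negb_exists; apply/negP => /forallP h.
    by apply: ns; split=> // j; rewrite leNgt.
  (* Some u |s_j| exceeds eps; inserting this factor produces u^r at the price of a power of
     [norm1]. *)
  have h1 : 1 <= (eps^-1 * un R n * norm1 s) ^+ r.
    rewrite exprn_ege1 // -mulrA ler_pdivlMl // mulr1; apply: le_trans (ltW hj) _.
    by rewrite ler_wpM2l ?(ltW u0) //; have := coord_le_norm1 s j; lra.
  apply: le_trans (_ : K4 * norm1 s ^+ M4 * (K3 * expR (- (cH / 2 * nsq s))) <= _).
    apply: le_trans (_ : (\sum_(k < r) cn (P k dl (ypt v s))) * cn (kernel lam p D (ypt v s)) <= _); last first.
      by apply: ler_pM; rewrite ?cn_ge0 ?h4 ?h3 //; apply: sumr_ge0 => k _; apply: cn_ge0.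
    apply: le_trans (cn_sum _ _ _) _; rewrite mulr_suml; apply: ler_sum => k _.
    rewrite !cnM cnX cn_un ler_piMl ?mulr_ge0 ?cn_ge0 // exprn_ile1 // ?(ltW u0) //.
  have [h6 _] := h5 s; have N0 := norm1_ge0 s.
  apply: le_trans (_ : (eps^-1 * un R n * norm1 s) ^+ r * (K4 * norm1 s ^+ M4 * (K3 * expR (- (cH / 2 * nsq s)))) <= _).
    by rewrite ler_peMl // !mulr_ge0 ?exprn_ge0 ?expR_ge0.
  rewrite !exprMn [X in X <= _](_ : _ = eps^-1 ^+ r * K4 * K3 * un R n ^+ r * (norm1 s ^+ (r + M4) * expR (- (cH / 2 * nsq s)))); last first.
    by rewrite [norm1 s ^+ (r + M4)]exprD; ring.
  rewrite [X in _ <= X](_ : _ = eps^-1 ^+ r * K4 * K3 * un R n ^+ r * (K5 * W s)); last by rewrite /KM; ring.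
  by rewrite ler_wpM2l // !mulr_ge0 ?exprn_ge0 ?invr_ge0 // ltW.
have W0 (s : 'I_d -> R) : 0 <= W s by rewrite ltW ?W_gt0.
have Ffar s : ~ near_origin eps n s -> cn (F s) <= KF * un R n ^+ r * W s.
  move=> ns; rewrite /F /onbox; case: ifP => si; last by rewrite mulr0 cn0; apply: mulr_ge0 => //; apply: mulr_ge0.
  have hg : cn (psi lam p v n s ^+ n) <= gam ^+ n.
    by rewrite cnX lerXn2r ?nnegrE ?cn_ge0 ?hfar //; case/andP: gam01 => /ltW.
  rewrite [X in cn X](_ : _ = evls (fun=> 0) al (fun j => U n * ypt v s j) *
     (U n ^+ #|D| * \prod_j (1 - (z j)%:C * cexp (U n * ypt v s j))^-1) *
     cexp (- \sum_j (dl j)%:C * (U n * ypt v s j)) * psi lam p v n s ^+ n); last by rewrite /integrand; ring.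
  rewrite 3!cnM; apply: le_trans (_ : Ka * KP * expR (d%:R * b) * gam ^+ n <= _).
    by do 3?[apply: ler_pM; rewrite ?mulr_ge0 ?cn_ge0 ?evls_bound ?poles_bound ?shift_factor_bound //].
  have L1 : 1 <= (un R n)^-1 by rewrite invf_ge1.
  (* On the box W is at least of order u^{2d}; measuring the bound against W thus costs u^{-2d},
     which gam^n absorbs. *)
  have hW : 1 <= ((1 + pi) * (un R n)^-1) ^+ (2 * d) * W s.
    have L0 : 0 < (un R n)^-1 by rewrite invr_gt0.
    apply: le_trans (inbox_W L0 si) _; rewrite ler_wpM2r // lerXn2r ?nnegrE ?addr_ge0 ?mulr_ge0 ?(ltW L0) //.
      by rewrite addr_ge0.
    by move: L1 pi0; set L := (un R n)^-1; move: (pi : R) L => x L; lra.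
  rewrite /KF -!mulrA; do 3![rewrite ler_wpM2l ?expR_ge0 //].
  have g0 : 0 <= gam ^+ n by rewrite exprn_ge0 //; case/andP: gam01 => /ltW.
  have h7 : gam ^+ n * (un R n)^-1 ^+ (2 * d) <= K2 * un R n ^+ r.
    have := ler_wpM2r ur (hgeo n n0); rewrite exprD.
    have Lu : (un R n)^-1 ^+ r * un R n ^+ r = 1 by rewrite -exprMn mulVf ?expr1n // gt_eqF.
    by rewrite mulrA -[X in X <= _ -> _]mulrA Lu mulr1.
  have := ler_wpM2l g0 hW; rewrite mulr1 => /le_trans; apply; rewrite exprMn.
  rewrite [X in X <= _](_ : _ = (1 + pi) ^+ (2 * d) * (gam ^+ n * (un R n)^-1 ^+ (2 * d) * W s)); last by ring.
  by rewrite ler_wpM2l // mulrA ler_wpM2r.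
have main : dominated ((K1 + KF + KM) * un R n ^+ r) (fun s => F s - G s).
  move=> s; have [ns|ns] := pselect (near_origin eps n s).
    have si : inbox (un R n)^-1 s.
      apply/forallP => j; have [_ _ /(_ j)] := ns; rewrite mulrC -ler_pdivlMr // => /le_trans; apply.
      by rewrite ler_wpM2r ?invr_ge0 ?(ltW u0) //; have := pi_ge2 R; lra.
    rewrite /F /onbox si; apply: le_trans (hnear n dl s db ns) _.
    by rewrite ler_wpM2r // ler_wpM2r // -addrA lerDl addr_ge0.
  apply: le_trans (cnB _ _) _; apply: le_trans (lerD (Ffar s ns) (Gfar s ns)) _.
  by rewrite -mulrDl ler_wpM2r // -mulrDl ler_wpM2r // -addrA lerDr.
have dk k : (k < r)%N -> exists K, dominated K (fun s => U n ^+ k * (P k dl (ypt v s) * kernel lam p D (ypt v s))).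
  by have [K6 /(_ dl db) h6] := dominated_kernel b (P2 k); eexists; apply: dominatedZ h6.
have [eG [KG dG]] := integ_sum dk.
have {}eG : \sum_(k < r) U n ^+ k * integ (fun s => P k dl (ypt v s) * kernel lam p D (ypt v s)) = integ G.
  rewrite /G eG; apply: eq_bigr => k _; have [K6 /(_ dl db) h6] := dominated_kernel b (P2 k).
  by rewrite (integZ _ h6).
have eF : U n ^+ #|D| * integ (onbox (un R n)^-1 (integrand lam p al D z n dl)) = integ F.
  have dF : dominated (cn (U n ^+ #|D|)^-1 * ((K1 + KF + KM) * un R n ^+ r + KG)) (onbox (un R n)^-1 (integrand lam p al D z n dl)).
    move=> s; have := dominatedZ (U n ^+ #|D|)^-1 (dominatedD main dG) s; rewrite subrK /F mulKf //.
    by rewrite expf_neq0 // unC_neq0.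
  by rewrite (integZ _ dF).
have dF : dominated ((K1 + KF + KM) * un R n ^+ r + KG) F.
  by move=> s; have := dominatedD main dG s; rewrite subrK.
rewrite eF eG -(integB dF dG) mulrAC; exact: integ_bound main.
Qed.

End SaddleIntegral.

(** * Derivatives from explicit errors; real series *)

Section RealSeries.
Variable R : realType.
Notation C := R[i].

(** Series and grid integrals come with explicit second-order errors; this converts such errors into
    derivatives. *)
Lemma is_derive_quadratic (f : R -> R) (D K delta : R) : 0 < delta ->
  (forall s, `|s| <= delta -> `|f s - f 0 - s * D| <= K * s ^+ 2) -> is_derive (0 : R) (1 : R) f D.
Proof.
move=> d0 h; have K0 : 0 <= K.
  have := le_trans (normr_ge0 _) (h delta _); rewrite ger0_norm ?(ltW d0) // => /(_ (lexx _)).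
  by rewrite pmulr_lge0 // exprn_gt0.
have c : (fun t : R => t^-1 *: ((f \o shift 0) (t *: (1 : R)) - f 0)) @ (0 : R)^' --> D.
  apply/cvgrPdist_le => e e0; near=> t.
  have t0 : t != 0 by near: t; exact: nbhs_dnbhs_neq.
  have td : `|t| <= delta by near: t; exact: dnbhs0_le.
  have te : `|t| <= e / (K + 1).
    by near: t; apply: dnbhs0_le; rewrite divr_gt0 // ltr_wpDl.
  rewrite /= /GRing.scale /= mulr1 addr0.
  have -> : D - t^-1 * (f t - f 0) = - t^-1 * (f t - f 0 - t * D) by field.
  rewrite normrM normrN normfV ler_pdivrMl ?normr_gt0 //; apply: le_trans (h t td) _.
  rewrite -real_normK ?num_real // expr2 mulrCA mulrA -mulrA ler_wpM2l //.
  move: te; rewrite ler_pdivlMr ?ltr_wpDl // => te; have := normr_ge0 t; nra.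
apply: DeriveDef; first by apply/cvg_ex; exists D.
exact: cvg_lim c.
Unshelve. all: by end_near.
Qed.

Lemma is_derive_quadratic_at (f : R -> R) (a D K delta : R) : 0 < delta ->
  (forall s, `|s| <= delta -> `|f (a + s) - f a - s * D| <= K * s ^+ 2) -> is_derive a (1 : R) f D.
Proof.
move=> d0 h; have h0 : is_derive (0 : R) (1 : R) (fun s => f (a + s)) D.
  by apply: (is_derive_quadratic d0) => s sd; rewrite addr0; apply: h.
have dsh : is_derive a (1 : R) (fun s : R => s - a) 1.
  by have := is_deriveB (is_derive_id a (1 : R)) (is_derive_cst a a (1 : R)); rewrite subr0.
rewrite -[X in is_derive X _ _ _](_ : a - a = 0) in h0; last by rewrite subrr.
have := @is_derive1_comp R (fun s => f (a + s)) (fun s => s - a) a _ _ h0 dsh.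
rewrite mulr1 (_ : _ \o _ = f) //.
by apply: funext => x; rewrite /= addrC subrK.
Qed.

Variable d : nat.
Implicit Types c : mi d -> R.

Definition csumR c : R := complex.Re (csum (fun m => (c m)%:C)).
Definition summ c := exists K, summable K (fun m => (c m)%:C).

Lemma csumRE c : summ c -> csum (fun m => (c m)%:C) = (csumR c)%:C.
Proof.
move=> [K h]; have e : (csum (fun m => (c m)%:C))^* = csum (fun m => (c m)%:C).
  apply: ucvg_unique (csum_ucvg h); apply: ucvg_ext (ucvg_conj (csum_ucvg h)) => N.
  by rewrite /boxsum sumC /=; apply: complex_eq; rewrite /= ?oppr0.
move: e; rewrite /csumR; move: (csum _) => [x y] [e].
by apply: complex_eq => //=; lra.
Qed.

Lemma summD c c' : summ c -> summ c' -> summ (fun m => c m + c' m).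
Proof.
move=> [K h] [K' h']; exists (K + K'); rewrite (_ : (fun m => _) = fun m => (c m)%:C + (c' m)%:C); first exact: summableD.
by apply: funext => m; rewrite rmorphD.
Qed.

Lemma summZ a c : summ c -> summ (fun m => a * c m).
Proof.
move=> [K h]; eexists; rewrite (_ : (fun m => _) = fun m => a%:C * (c m)%:C); first exact: summableZ h.
by apply: funext => m; rewrite rmorphM.
Qed.

Lemma csumRD c c' : summ c -> summ c' -> csumR (fun m => c m + c' m) = csumR c + csumR c'.
Proof.
move=> [K h] [K' h']; rewrite /csumR -ReD -(csumD h h'); congr (complex.Re (csum _)).
by apply: funext => m; rewrite rmorphD.
Qed.

Lemma csumRZ a c : summ c -> csumR (fun m => a * c m) = a * csumR c.
Proof.
move=> [K h]; rewrite /csumR -Re_realM -(csumZ _ h); congr (complex.Re (csum _)).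
by apply: funext => m; rewrite rmorphM.
Qed.

Lemma summ_sum (I : Type) (r : seq I) (F : I -> mi d -> R) : (forall i, summ (F i)) ->
  summ (fun m => \sum_(i <- r) F i m).
Proof.
move=> h; elim: r => [|i r IH].
  exists 0 => N; rewrite /boxsum big1 // => m _; by rewrite big_nil cn_real normr0.
have := summD (h i) IH; rewrite (_ : (fun m => F i m + _) = fun m => \sum_(j <- i :: r) F j m) //.
by apply: funext => m; rewrite big_cons.
Qed.

Lemma csumR_sum (I : Type) (r : seq I) (F : I -> mi d -> R) : (forall i, summ (F i)) ->
  csumR (fun m => \sum_(i <- r) F i m) = \sum_(i <- r) csumR (F i).
Proof.
move=> h; elim: r => [|i r IH].
  rewrite big_nil; have -> : (fun m => \sum_(j <- [::]) F j m) = fun m => 0 * 0.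
    by apply: funext => m; rewrite big_nil mul0r.
  rewrite csumRZ ?mul0r //; exists 0 => N; rewrite /boxsum big1 // => m _; by rewrite cn_real normr0.
rewrite big_cons -IH -csumRD //; last exact: summ_sum.
by congr csumR; apply: funext => m; rewrite big_cons.
Qed.

Lemma summ_le c c' : (forall m, `|c m| <= c' m) -> summ c' -> summ c.
Proof.
move=> h [K hK]; exists K; apply: summable_le hK => m; rewrite !cn_real.
exact: le_trans (h m) (ler_norm _).
Qed.

Lemma csumR_le c c' : (forall m, `|c m| <= c' m) -> summ c' -> `|csumR c| <= csumR c'.
Proof.
move=> h s'; have s := summ_le h s'; have [K' h'] := s'; have [K hK] := s.
have c'0 m : 0 <= c' m by apply: le_trans (h m); rewrite normr_ge0.
apply: le_trans (cn_Re _) _.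
have near e : 0 < e -> cn (csum (fun m => (c m)%:C)) <= csumR c' + e.
  move=> e0; have bK N : boxsum N c' <= K'.
    apply: le_trans (h' N); apply: ler_sum => m _; rewrite cn_real; exact: ler_norm.
  have [N0 hN] := csum_tail c'0 bK e0.
  have hc m : cn (c' m)%:C <= c' m by rewrite cn_real ger0_norm.
  apply: (@ucvg_norm_le _ _ _ _ N0 (csum_ucvg hK)) => N NN.
  apply: le_trans (cn_boxsum _ _) _; apply: le_trans (_ : boxsum N c' <= _).
    by apply: ler_sum => m _; rewrite cn_real.
  have := hN N NN _ hc.
  have -> : boxsum N (fun m => (c' m)%:C) = (boxsum N c')%:C by exact: sumC.
  move=> h2; have := le_trans (cn_Re _) h2; rewrite ReD ReN /= -/(csumR c').
  by have := ler_norm (- (csumR c' - boxsum N c')); rewrite normrN; lra.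
rewrite leNgt; apply/negP => lt; have := near ((cn (csum (fun m => (c m)%:C)) - csumR c') / 2).
by lra.
Qed.

Lemma csumR_ge c N : (forall m, 0 <= c m) -> summ c -> boxsum N c <= csumR c.
Proof.
move=> c0 s; pose c1 m := if m \in box d N then c m else 0.
have e1 : csumR c1 = boxsum N c.
  rewrite /csumR (@csum_finite _ _ N) => [|m mN]; last by rewrite /c1 (negbTE mN).
  rewrite (_ : boxsum N _ = (boxsum N c)%:C) // /boxsum -sumC; apply: eq_big_seq => m mN.
  by rewrite /c1 mN.
rewrite -e1; apply: le_trans (ler_norm _) _; apply: csumR_le s => m.
by rewrite /c1; case: ifP => _; rewrite ?normr0 ?ger0_norm.
Qed.

Lemma csumR_ge_term c m : (forall m, 0 <= c m) -> summ c -> c m <= csumR c.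
Proof.
move=> c0 s; apply: le_trans (csumR_ge (mmax m) c0 s).
by rewrite /boxsum (big_rem m) ?mmaxP //= lerDl sumr_ge0.
Qed.

Lemma csumR_ge_pair c m m' : m != m' -> (forall m, 0 <= c m) -> summ c -> c m + c m' <= csumR c.
Proof.
move=> mm c0 s; apply: le_trans (csumR_ge (maxn (mmax m) (mmax m')) c0 s).
rewrite /boxsum (big_rem m) /=; last exact: (mem_box_mono (leq_maxl _ _) (mmaxP m)).
rewrite (big_rem m') /=; last first.
  by rewrite mem_rem_uniq ?box_uniq // inE eq_sym mm; exact: (mem_box_mono (leq_maxr _ _) (mmaxP m')).
by rewrite lerD2l lerDl sumr_ge0.
Qed.

End RealSeries.

(** * Derivatives of the moment generating function *)

Section LogPartition.
Variable R : realType.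
Notation C := R[i].
Variable d : nat.
Implicit Types (c : mi d -> R) (h : 'I_d -> R).

Definition pair h (m : mi d) : R := \sum_j h j * (m j)%:R.
Definition mgf c h : R := csumR (fun m => c m * expR (pair h m)).
Definition margin (e : R) c := summ (fun m => expR (e * mabs R m) * c m).
(** The Euler operator z_k d/dz_k on coefficients, which is differentiation in the logarithmic
    variable. *)
Definition tcoef (k : 'I_d) c : mi d -> R := fun m => (m k)%:R * c m.

Lemma coord_le_mabs (m : mi d) k : (m k)%:R <= mabs R m.
Proof. by rewrite /mabs (bigD1 k) //= lerDl sumr_ge0. Qed.

Lemma pair_bound h m e : (forall j, `|h j| <= e) -> `|pair h m| <= e * mabs R m.
Proof.
move=> he; apply: le_trans (ler_norm_sum _ _ _) _; rewrite /mabs mulr_sumr; apply: ler_sum => j _.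
by rewrite normrM [`|(m j)%:R|]ger0_norm // ler_wpM2r.
Qed.

Lemma expR_pair h m e : (forall j, `|h j| <= e) -> expR (pair h m) <= expR (e * mabs R m).
Proof. by move=> he; rewrite ler_expR; apply: le_trans (pair_bound m he); exact: ler_norm. Qed.

Lemma mgf_summ e c h : margin e c -> (forall j, `|h j| <= e) -> summ (fun m => c m * expR (pair h m)).
Proof.
move=> [K hK] he; exists K; apply: summable_le hK => m; rewrite !cn_real !normrM mulrC ler_wpM2r //.
by rewrite !ger0_norm ?expR_ge0 ?expR_pair.
Qed.

Lemma margin_le e e' c : 0 <= e -> e <= e' -> margin e' c -> margin e c.
Proof.
move=> e0 ee [K hK]; exists K; apply: summable_le hK => m; rewrite !cn_real !normrM ler_wpM2r //.
by rewrite !ger0_norm ?expR_ge0 // ler_expR ler_wpM2r // mabs_ge0.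
Qed.

Lemma mabsX_bound e k : 0 < e -> exists2 K, 0 <= K & forall m : mi d,
  mabs R m ^+ k * expR (e / 2 * mabs R m) <= K * expR (e * mabs R m).
Proof.
move=> e0; have [K K0 h] := @moment_bound R d (fun _ => 0) e e0 k; exists K => // m.
have L0 : lnorm (fun _ : 'I_d => 0 : R) = 0 by rewrite /lnorm big1 // => j _; rewrite normr0.
by have := h m; rewrite L0 addr0.
Qed.

Lemma margin_tcoef e c k : 0 < e -> margin e c -> margin (e / 2) (tcoef k c).
Proof.
move=> e0 [K hK]; have [K1 K10 h1] := mabsX_bound 1 e0.
exists (K1 * K) => N; apply: le_trans (_ : boxsum N (fun m => K1 * cn ((expR (e * mabs R m) * c m)%:C)) <= _); last first.
  by rewrite /boxsum -mulr_sumr ler_wpM2l // hK.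
apply: ler_sum => m _; rewrite !cn_real /tcoef !normrM !(ger0_norm (expR_ge0 _)) (ger0_norm (ler0n _ _)) mulrA [X in _ <= X]mulrA ler_wpM2r //.
by apply: le_trans (h1 m); rewrite mulrC expr1 ler_wpM2r ?expR_ge0 // coord_le_mabs.
Qed.

Lemma expR_taylor1 (x : R) : `|expR x - 1 - x| <= x ^+ 2 * expR `|x|.
Proof.
have := cexp_taylor 2 x%:C; rewrite 2!big_ord_recl big_ord0 /= expr0 expr1 !divr1 addr0 opprD addrA.
rewrite cexp_real -(rmorph1 (real_complex R)) -!rmorphB !cn_real; move=> /le_trans; apply.
by rewrite real_normK ?num_real.
Qed.

Lemma pair_sadd h k s m : pair (sadd h k s) m = pair h m + s * (m k)%:R.
Proof.
rewrite /pair /sadd (bigD1 k) //= eqxx [in RHS](bigD1 k) //=.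
rewrite (eq_bigr (fun j => h j * (m j)%:R)) => [|j jk]; last by rewrite (negbTE jk) addr0.
by ring.
Qed.

Lemma mgf_deriv_bound e c h k : 0 < e -> margin e c -> (forall j, `|h j| <= e / 4) ->
  exists K, forall s, `|s| <= e / 4 ->
   `|mgf c (sadd h k s) - mgf c h - s * mgf (tcoef k c) h| <= K * s ^+ 2.
Proof.
move=> e0 mc he; have [K2 K20 h2] := mabsX_bound 2 e0.
have sA : summ (fun m => `|c m| * expR (e * mabs R m)).
  have [K hK] := mc; exists K; apply: summable_le hK => m.
  by rewrite !cn_real !normrM normr_id mulrC.
have e4 : e / 4 <= e by lra.
exists (K2 * csumR (fun m => `|c m| * expR (e * mabs R m))) => s se.
have hs j : `|sadd h k s j| <= e.
  rewrite /sadd; case: eqP => _; last by rewrite addr0 (le_trans (he j)).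
  by apply: le_trans (ler_normD _ _) _; have := he j; lra.
have s1 := mgf_summ mc hs.
have s2 := mgf_summ mc (fun j => le_trans (he j) e4).
have s3 : summ (fun m => tcoef k c m * expR (pair h m)).
  by apply: (mgf_summ (margin_tcoef k e0 mc)) => j; apply: le_trans (he j) _; lra.
have -> : mgf c (sadd h k s) - mgf c h - s * mgf (tcoef k c) h =
  csumR (fun m => c m * expR (pair (sadd h k s) m) + (-1) * (c m * expR (pair h m)) + (- s) * (tcoef k c m * expR (pair h m))).
  rewrite csumRD ?csumRD ?csumRZ //; [by rewrite mulN1r mulNr|exact: summZ|exact: (summD s1 (summZ _ s2))|exact: summZ].
rewrite mulrAC -csumRZ //; apply: csumR_le; last exact: summZ.
move=> m; rewrite pair_sadd expRD /tcoef.
rewrite (_ : _ + _ + _ = c m * expR (pair h m) * (expR (s * (m k)%:R) - 1 - s * (m k)%:R)); last by ring.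
rewrite !normrM [`|expR _|]ger0_norm ?expR_ge0 // -mulrA [X in _ <= X]mulrCA ler_wpM2l //.
apply: le_trans (ler_pM (expR_ge0 _) (normr_ge0 _) (expR_pair m he) (expR_taylor1 _)) _.
have m0 := mabs_ge0 R m.
apply: le_trans (_ : s ^+ 2 * (mabs R m ^+ 2 * expR (e / 2 * mabs R m)) <= _); last first.
  by rewrite mulrC mulrAC ler_wpM2r ?sqr_ge0.
(* The margin is spent as one quarter on h, one quarter on s, and one half on the square of the
   total degree. *)
have -> : e / 2 * mabs R m = e / 4 * mabs R m + e / 4 * mabs R m by field.
rewrite expRD exprMn [X in X <= _](_ : _ = s ^+ 2 * ((m k)%:R ^+ 2 * (expR (e / 4 * mabs R m) * expR `|s * (m k)%:R|))); last by ring.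
rewrite ler_wpM2l ?sqr_ge0 //; apply: ler_pM; rewrite ?sqr_ge0 ?mulr_ge0 ?expR_ge0 //.
  by rewrite lerXn2r ?nnegrE // coord_le_mabs.
rewrite ler_wpM2l ?expR_ge0 // ler_expR normrM [`|(m k)%:R|]ger0_norm //; apply: ler_pM => //.
exact: coord_le_mabs.
Qed.

Lemma sadd0 h k : sadd h k 0 = h.
Proof. by apply: funext => j; rewrite /sadd; case: eqP => _; rewrite addr0. Qed.

Lemma mgf_is_derive e c h k : 0 < e -> margin e c -> (forall j, `|h j| <= e / 4) ->
  is_derive (0 : R) (1 : R) (fun s : R => mgf c (sadd h k s)) (mgf (tcoef k c) h).
Proof.
move=> e0 mc he; have [K hK] := mgf_deriv_bound k e0 mc he.
apply: (@is_derive_quadratic _ _ _ K (e / 4)); first by rewrite divr_gt0.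
by move=> s se; have := hK s se; rewrite sadd0.
Qed.

Lemma is_derive_ln_comp (f : R -> R) D : 0 < f 0 -> is_derive (0 : R) (1 : R) f D ->
  is_derive (0 : R) (1 : R) (fun s => ln (f s)) (D / f 0).
Proof.
by move=> f0 h; rewrite mulrC; apply: (@is_derive1_comp R (@ln R) f); apply: is_derive1_ln.
Qed.

Lemma is_derive_quotient (f g : R -> R) D E : g 0 != 0 -> is_derive (0 : R) (1 : R) f D -> is_derive (0 : R) (1 : R) g E ->
  is_derive (0 : R) (1 : R) (fun s => f s / g s) (D / g 0 - f 0 * E / g 0 ^+ 2).
Proof.
move=> g0 hf hg; have hV := is_deriveV g0 hg.
apply: (is_derive_eq (is_deriveM hf hV)); rewrite /GRing.scale /=; field; exact: g0.
Qed.

Lemma mgf0 c : mgf c (fun _ => 0) = csumR c.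
Proof.
congr csumR; apply: funext => m; rewrite /pair big1 ?expR0 ?mulr1 // => j _.
by rewrite mul0r.
Qed.

End LogPartition.

(** * Mean and Hessian at the saddle point *)

Section SaddlePoint.
Variable R : realType.
Notation C := R[i].
Variables (d : nat) (b : mi d -> R) (Om : set 'rV[R]_d) (tau : 'rV[R]_d).
Hypothesis b0 : forall m, 0 <= b m.
Hypothesis Om_open : open Om.
Hypothesis b_conv : converges_on b Om.
Hypothesis tauP : Psi Om tau.
Variable ms : mi d.
Hypothesis bms : b ms != 0.
Notation z := (vexp tau).
Implicit Types h : 'I_d -> R.

Definition shift h : 'rV[R]_d := tau + \row_j h j.
Definition wcoef : mi d -> R := fun m => b m * mono z m.

Lemma vexp_gt0 (t : 'rV[R]_d) j : 0 < vexp t 0 j.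
Proof. by rewrite /vexp mxE expR_gt0. Qed.

Lemma mono_gt0 (t : 'rV[R]_d) m : 0 < mono (vexp t) m.
Proof. by apply: prodr_gt0 => j _; rewrite exprn_gt0 // vexp_gt0. Qed.

Lemma wcoef_ge0 m : 0 <= wcoef m.
Proof. by rewrite mulr_ge0 // ltW // mono_gt0. Qed.

Lemma Om_ball : exists2 e, 0 < e & forall y : 'rV[R]_d, (forall j, `|z 0 j - y 0 j| < e) -> Om y.
Proof.
have /nbhs_ballP[e e0 he] : nbhs z Om by apply: open_nbhs_nbhs.
exists e => // y hy; apply: he; split=> // i j; rewrite (ord1 i); exact: hy.
Qed.

(** The domain is open, so the series converges at some point whose radii all exceed those of zeta;
    the excess becomes an exponential margin. *)
Lemma zeta_margin : exists2 e, 0 < e & margin e wcoef.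
Proof.
have [e e0 he] := Om_ball; have e2 : 0 < e / 2 by rewrite divr_gt0.
have z0 j : 0 < z 0 j by exact: vexp_gt0.
pose y : 'rV[R]_d := \row_j (z 0 j + e / 2).
have yE j : y 0 j = z 0 j + e / 2 by rewrite /y mxE.
have Oy : Om y.
  apply: he => j; rewrite yE opprD addNKr normrN gtr0_norm //; lra.
have [ex ex0 hx] := exp_margin z0 e2.
have cy0 m : 0 <= b m * \prod_j `|y 0 j| ^+ m j.
  by rewrite mulr_ge0 // prodr_ge0 // => j _; rewrite exprn_ge0.
have [hS _] := esum_csum cy0 (b_conv Oy).
exists ex => //; exists (fine (\esum_(m in [set: mi d]) (b m * \prod_j `|y 0 j| ^+ m j)%:E)%E) => N.
apply: le_trans (hS N); apply: ler_sum => m _.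
rewrite cn_real (ger0_norm (mulr_ge0 (expR_ge0 _) (wcoef_ge0 _))) /wcoef mulrCA ler_wpM2l //.
rewrite mulrC; apply: le_trans (hx m) _; rewrite le_eqVlt; apply/orP; left; apply/eqP.
apply: eq_bigr => j _; rewrite yE ger0_norm // addr_ge0 // ltW //.
Qed.

Lemma vexp_near : exists2 eta, 0 < eta & forall h, (forall j, `|h j| <= eta) -> Om (vexp (shift h)).
Proof.
have [e e0 he] := Om_ball; pose Z := 1 + \sum_j z 0 j.
have Z0 : 0 < Z by rewrite ltr_pwDl // sumr_ge0 // => j _; rewrite ltW // vexp_gt0.
have Z4 : 0 < 4 * Z by rewrite mulr_gt0.
exists (Num.min 1 (e / (4 * Z))); first by rewrite lt_min ltr01 divr_gt0.
move=> h hh; apply: he => j; have := hh j; rewrite le_min => /andP[h1 h2].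
have zj : z 0 j <= Z.
  by rewrite /Z (bigD1 j) //= addrCA lerDl addr_ge0 // sumr_ge0 // => i _; rewrite ltW // vexp_gt0.
have -> : z 0 j - vexp (shift h) 0 j = z 0 j * (1 - expR (h j)).
  by rewrite /vexp /shift !mxE expRD; ring.
have e3 : `|1 - expR (h j)| <= 3 * `|h j|.
  have := cexp_taylor 1 (h j)%:C; rewrite big_ord1 expr0 divr1 cexp_real -(rmorph1 (real_complex R)) -rmorphB !cn_real expr1 distrC.
  move=> /le_trans; apply; rewrite mulrC ler_wpM2r //; apply: le_trans (expR1_le3 R).
  by rewrite ler_expR.
rewrite normrM (gtr0_norm (vexp_gt0 _ _)).
apply: le_lt_trans (_ : Z * (3 * (e / (4 * Z))) < _).
  apply: ler_pM; rewrite ?(ltW (vexp_gt0 _ _)) //.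
  by apply: le_trans e3 _; rewrite ler_wpM2l.
have -> : Z * (3 * (e / (4 * Z))) = 3 / 4 * e by field; rewrite gt_eqF.
by lra.
Qed.

Lemma ps_val_shift h : Om (vexp (shift h)) -> ps_val_nn b (vexp (shift h)) = mgf wcoef h.
Proof.
move=> Oh.
have e m : b m * mono (vexp (shift h)) m = wcoef m * expR (pair h m).
  rewrite /wcoef /mono -mulrA; congr (_ * _); rewrite /pair expR_sum -big_split; apply: eq_bigr => j _.
  by rewrite /vexp /shift !mxE expRD exprMn /= [h j * _]mulrC expRM_natl.
have c0 m : 0 <= b m * mono (vexp (shift h)) m by rewrite mulr_ge0 // ltW // mono_gt0.
have fin : (\esum_(m in [set: mi d]) (b m * mono (vexp (shift h)) m)%:E < +oo)%E.
  have := b_conv Oh; congr (_ < _)%E; apply: eq_esum => m _; congr (_ * _)%:E.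
  by apply: eq_bigr => j _; rewrite gtr0_norm // vexp_gt0.
have [_ h2] := esum_csum c0 fin.
have := congr1 (@complex.Re R) h2; rewrite /ps_val_nn /= => <-; congr (complex.Re (csum _)).
by apply: funext => m; rewrite e.
Qed.

Lemma mgf_gt0 e h : margin e wcoef -> (forall j, `|h j| <= e) -> 0 < mgf wcoef h.
Proof.
move=> mc he; have s := mgf_summ mc he.
have c0 m : 0 <= wcoef m * expR (pair h m) by rewrite mulr_ge0 ?wcoef_ge0 ?expR_ge0.
apply: lt_le_trans (csumR_ge_term ms c0 s).
by rewrite mulr_gt0 ?expR_gt0 // mulr_gt0 ?mono_gt0 // lt_def bms b0.
Qed.

Lemma shift_sadd h k (s : R) : shift h + s *: delta_mx 0 k = shift (sadd h k s).
Proof.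
rewrite /shift -addrA; congr (_ + _); apply/rowP => j; rewrite !mxE eqxx /sadd /=.
by case: eqP => _; rewrite ?mulr1 ?mulr0.
Qed.

Lemma shift0 : shift (fun _ => 0) = tau.
Proof. by rewrite /shift; apply/rowP => j; rewrite !mxE addr0. Qed.

Lemma sadd_bound h k (s e : R) : (forall j, `|h j| <= e / 2) -> `|s| <= e / 2 -> forall j, `|sadd h k s j| <= e.
Proof.
move=> hh hs j; have hj := hh j; have n0 := normr_ge0 s; rewrite /sadd; case: eqP => _; last by rewrite addr0; lra.
by apply: le_trans (ler_normD _ _) _; lra.
Qed.

Lemma Kfun_is_derive e eta : 0 < e -> margin e wcoef -> 0 < eta -> eta <= e / 4 ->
  (forall h, (forall j, `|h j| <= eta) -> Om (vexp (shift h))) ->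
  forall h k, (forall j, `|h j| <= eta / 2) ->
  is_derive (0 : R) (1 : R) (fun s : R => Kfun b (shift h + s *: delta_mx 0 k)) (mgf (tcoef k wcoef) h / mgf wcoef h).
Proof.
move=> e0 mc eta0 etae hO h k hh.
have he4 j : `|h j| <= e / 4 by have := hh j; lra.
have he j : `|h j| <= e by have := hh j; lra.
have hd := mgf_is_derive k e0 mc he4.
have g0 : 0 < mgf wcoef (sadd h k 0) by rewrite sadd0; exact: mgf_gt0 mc he.
have := is_derive_ln_comp g0 hd; rewrite sadd0; apply: near_eq_is_derive.
near=> s; have se : `|s| <= eta / 2.
  by near: s; apply: (@nbhs0_le R R^o); rewrite divr_gt0.
by rewrite /Kfun shift_sadd ps_val_shift //; apply: hO; apply: sadd_bound.
Unshelve. all: by end_near.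
Qed.

(** The outer derivative needs the first partial derivative on a neighbourhood of tau, whence the
    nested radii eta / 4, eta / 2 and eta. *)
Lemma hessian_Kfun : exists2 e, 0 < e & margin e wcoef /\ forall i j,
  hessian (Kfun b) tau i j =
    mgf (tcoef i (tcoef j wcoef)) (fun _ => 0) / mgf wcoef (fun _ => 0) -
    mgf (tcoef j wcoef) (fun _ => 0) * mgf (tcoef i wcoef) (fun _ => 0) / mgf wcoef (fun _ => 0) ^+ 2.
Proof.
have [e e0 mc] := zeta_margin; have [eta' eta'0 hO'] := vexp_near.
exists e => //; split=> // i j.
pose eta : R := Num.min eta' (e / 8).
have eta0 : 0 < eta by rewrite lt_min eta'0 divr_gt0.
have ee : eta <= e / 8 by rewrite ge_min lexx orbT.
have ee4 : eta <= e / 4 by lra.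
have hO h : (forall j, `|h j| <= eta) -> Om (vexp (shift h)).
  by move=> hh; apply: hO' => k; apply: le_trans (hh k) _; rewrite ge_min lexx.
have e44 : eta / 4 <= eta / 2 / 2 by lra.
rewrite mxE /partial derive1E.
have e2 : 0 < e / 2 by rewrite divr_gt0.
have z4 k : `|(fun _ : 'I_d => 0 : R) k| <= e / 2 / 4 by rewrite normr0 !divr_ge0 // ltW.
have z44 k : `|(fun _ : 'I_d => 0 : R) k| <= e / 4 by rewrite normr0 !divr_ge0 // ltW.
have h1 := mgf_is_derive i e2 (margin_tcoef j e0 mc) z4.
have h2 := mgf_is_derive i e0 mc z44.
have g0 : mgf wcoef (sadd (fun _ => 0) i 0) != 0.
  by rewrite sadd0 gt_eqF // (mgf_gt0 mc) // => k; rewrite normr0 ltW.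
have := is_derive_quotient g0 h1 h2; rewrite !sadd0 => h3.
apply: (@derive_val _ _ _ _ _ _ _ (near_eq_is_derive _ h3)).
near=> s; have se : `|s| <= eta / 4.
  by near: s; apply: (@nbhs0_le R R^o); rewrite divr_gt0.
have sh k : `|sadd (fun _ => 0) i s k| <= eta / 2.
  apply: sadd_bound => [l|]; first by rewrite normr0 !divr_ge0 // ltW.
  exact: le_trans se e44.
rewrite -[in RHS]shift0 shift_sadd derive1E.
have h4 := Kfun_is_derive e0 mc eta0 ee4 hO j sh.
by rewrite (@derive_val _ _ _ _ _ _ _ h4).
Unshelve. all: by end_near.
Qed.

Variable lam : 'rV[R]_d.
Hypothesis tau_min : forall t, Psi Om t -> t != tau ->
  Kfun b tau - dotv lam tau < Kfun b t - dotv lam t.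

(** Along each coordinate axis tau is an interior minimum, so the partial derivative of K(t) - lam.t
    vanishes there. *)
Lemma mean_lam j : mgf (tcoef j wcoef) (fun _ => 0) = lam 0 j * mgf wcoef (fun _ => 0).
Proof.
have [e e0 mc] := zeta_margin; have [eta' eta'0 hO'] := vexp_near.
pose eta : R := Num.min eta' (e / 8).
have eta0 : 0 < eta by rewrite lt_min eta'0 divr_gt0.
have ee : eta <= e / 8 by rewrite ge_min lexx orbT.
have ee4 : eta <= e / 4 by lra.
have hO h : (forall j, `|h j| <= eta) -> Om (vexp (shift h)).
  by move=> hh; apply: hO' => k; apply: le_trans (hh k) _; rewrite ge_min lexx.
have g0 : 0 < mgf wcoef (fun _ => 0) by apply: (mgf_gt0 mc) => k; rewrite normr0 ltW.
pose f (s : R) := Kfun b (tau + s *: delta_mx 0 j) - lam 0 j * s.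
have dlin (x : R) : is_derive x (1 : R) (fun s : R => lam 0 j * s) (lam 0 j).
  by have := is_deriveZ (lam 0 j) (is_derive_id x (1 : R)); rewrite /GRing.scale /= mulr1.
have fd x : `|x| <= eta / 2 -> exists D, is_derive x (1 : R) f D.
  move=> xe; have hx k : `|sadd (fun _ => 0) j x k| <= eta / 2.
    rewrite /sadd; case: eqP => _; rewrite ?add0r // normr0 divr_ge0 // ltW //.
  have h := Kfun_is_derive e0 mc eta0 ee4 hO j hx.
  eexists; apply: is_deriveB (dlin x).
  have dsh : is_derive x (1 : R) (fun s : R => s - x) 1.
    by have := is_deriveB (is_derive_id x (1 : R)) (is_derive_cst x x (1 : R)); rewrite subr0.
  rewrite -[X in is_derive X _ _ _](_ : x - x = 0) in h; last by rewrite subrr.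
  have := @is_derive1_comp R (fun s => Kfun b (shift (sadd (fun _ => 0) j x) + s *: delta_mx 0 j)) (fun s => s - x) x _ _ h dsh.
  rewrite mulr1 (_ : _ \o _ = fun x0 : R => Kfun b (tau + x0 *: delta_mx 0 j)); last first.
    by apply: funext => y; rewrite /= -shift_sadd shift0 -addrA -scalerDl [x + _]addrC subrK.
  by move=> hd; exact: hd.
have min0 : is_derive (0 : R) (1 : R) f 0.
  apply: (@derive1_at_min _ f (- (eta / 2)) (eta / 2) 0).
  - by lra.
  - move=> t; rewrite in_itv /= => /andP[t1 t2]; have [|D hD] := fd t; first by rewrite ler_norml; lra.
    by case: hD.
  - by rewrite in_itv /=; lra.
  move=> t; rewrite in_itv /= => /andP[t1 t2]; have te : `|t| <= eta by rewrite ler_norml; lra.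
  rewrite /f scale0r addr0 mulr0 subr0; have [->|t0] := eqVneq t 0.
    by rewrite scale0r addr0 mulr0 subr0.
  have := @tau_min (tau + t *: delta_mx 0 j).
  have -> : dotv lam (tau + t *: delta_mx 0 j) = dotv lam tau + lam 0 j * t.
    rewrite /dotv (bigD1 j) //= [in RHS](bigD1 j) //= !mxE !eqxx mulr1.
    rewrite (eq_bigr (fun i => lam 0 i * tau 0 i)); first by ring.
    by move=> i ij; rewrite !mxE (negbTE ij) mulr0 addr0.
  have h1 : Psi Om (tau + t *: delta_mx 0 j).
    rewrite /Psi /= -[in X in Om X]shift0 shift_sadd; apply: hO => k.
    by rewrite /sadd; case: eqP => _; rewrite ?add0r // normr0 ltW.
  have h2 : tau + t *: delta_mx 0 j != tau.
    apply/eqP => /rowP/(_ j); rewrite !mxE !eqxx mulr1 => /(canRL (addKr _)).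
    by rewrite addNr => /eqP; rewrite (negbTE t0).
  by move=> /(_ h1 h2)/ltW; rewrite opprD addrA lerBlDr addrAC subrK.
have z2 (k : 'I_d) : `|0 : R| <= eta / 2 by rewrite normr0 divr_ge0 // ltW.
have h := Kfun_is_derive e0 mc eta0 ee4 hO j z2; rewrite shift0 in h.
have := is_deriveB h (dlin 0) => h3.
have [_ e1] := min0; have [_ e2] := h3; rewrite e1 in e2.
have : mgf (tcoef j wcoef) (fun=> 0) / mgf wcoef (fun=> 0) = lam 0 j by apply/eqP; rewrite -subr_eq0 -e2.
by move=> /(canRL (divfK _)); apply; rewrite gt_eqF.
Qed.

End SaddlePoint.

(** * The Hessian as a covariance matrix *)

Section Covariance.
Variable R : realType.
Notation C := R[i].
Variables (d : nat) (p : mi d -> R) (lam : 'I_d -> R) (e : R) (H : 'M[R]_d).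
Hypothesis e0 : 0 < e.
Hypothesis p0 : forall m, 0 <= p m.
Hypothesis pm : margin e p.
Hypothesis p1 : csumR p = 1.
Hypothesis pmean : forall j, csumR (tcoef j p) = lam j.
Hypothesis HE : forall i j, H i j = csumR (tcoef i (tcoef j p)) - lam i * lam j.

Lemma margin_summ e' (c : mi d -> R) : 0 < e' -> margin e' c -> summ c.
Proof.
move=> e'0 [K hK]; exists K; apply: summable_le hK => m; rewrite !cn_real normrM ler_peMl //.
by rewrite ger0_norm ?expR_ge0 // -expR0 ler_expR mulr_ge0 ?mabs_ge0 // ltW.
Qed.

Lemma csum_lin (I : Type) (r : seq I) (a : I -> C) (F : I -> mi d -> R) : (forall i, summ (F i)) ->
  csum (fun m => \sum_(i <- r) a i * (F i m)%:C) = \sum_(i <- r) a i * (csumR (F i))%:C.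
Proof.
move=> h; suff [K [hK ->]] : exists K, summable K (fun m => \sum_(i <- r) a i * (F i m)%:C) /\
  csum (fun m => \sum_(i <- r) a i * (F i m)%:C) = \sum_(i <- r) a i * (csumR (F i))%:C by [].
elim: r => [|i r [K [hK IH]]].
  exists 0; split; first by move=> N; rewrite /boxsum big1 // => m _; rewrite big_nil cn0.
  by rewrite big_nil (@csum_finite _ _ 0) => [|m _]; rewrite ?big_nil // /boxsum big1 // => m _; rewrite big_nil.
have [Ki hi] := h i; have e1 : (fun m => \sum_(j <- i :: r) a j * (F j m)%:C) =
    (fun m => a i * (F i m)%:C + \sum_(j <- r) a j * (F j m)%:C).
  by apply: funext => m; rewrite big_cons.
eexists; rewrite e1; split; first exact: (summableD (summableZ (a i) hi) hK).
by rewrite (csumD (summableZ (a i) hi) hK) (csumZ _ hi) IH big_cons csumRE.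
Qed.

Definition ctr (m : mi d) j : R := (m j)%:R - lam j.

Let s0 : summ p := margin_summ e0 pm.
Let s1 j : summ (tcoef j p).
Proof. by apply: (margin_summ _ (margin_tcoef j e0 pm)); rewrite divr_gt0. Qed.
Let s2 i j : summ (tcoef i (tcoef j p)).
Proof.
have e2 : 0 < e / 2 by rewrite divr_gt0.
by apply: (margin_summ _ (margin_tcoef i e2 (margin_tcoef j e0 pm))); rewrite divr_gt0.
Qed.

Let ctr1E j : (fun m => ctr m j * p m) = fun m => tcoef j p m + (- lam j) * p m.
Proof. by apply: funext => m; rewrite /ctr /tcoef; ring. Qed.

Let ctr2E i j : (fun m => ctr m i * ctr m j * p m) =
  fun m => tcoef i (tcoef j p) m + (- lam j) * tcoef i p m + ((- lam i) * tcoef j p m + (lam i * lam j) * p m).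
Proof. by apply: funext => m; rewrite /ctr /tcoef; ring. Qed.

Lemma summ_ctr1 j : summ (fun m => ctr m j * p m).
Proof. by rewrite ctr1E; apply: summD => //; apply: summZ. Qed.

Lemma csumR_ctr1 j : csumR (fun m => ctr m j * p m) = 0.
Proof.
rewrite ctr1E csumRD //; last exact: summZ.
by rewrite csumRZ // p1 pmean; ring.
Qed.

Lemma summ_ctr2 i j : summ (fun m => ctr m i * ctr m j * p m).
Proof. by rewrite ctr2E; apply: summD; apply: summD => //; apply: summZ. Qed.

Lemma csumR_ctr2 i j : csumR (fun m => ctr m i * ctr m j * p m) = H i j.
Proof.
rewrite ctr2E csumRD; [|by apply: summD => //; apply: summZ|by apply: summD; apply: summZ].
rewrite csumRD //; last exact: summZ.
rewrite csumRD; [|exact: summZ|exact: summZ].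
by rewrite !csumRZ // p1 !pmean HE; ring.
Qed.

Lemma covariance_sym i j : H i j = H j i.
Proof. by rewrite -!csumR_ctr2; congr csumR; apply: funext => m; rewrite [ctr m i * _]mulrC. Qed.

Lemma moment1_eq0 w : moment lam (fun m => (p m)%:C) 1 w = 0.
Proof.
rewrite /moment (_ : (fun m => _) = fun m => \sum_j w j * (ctr m j * p m)%:C).
  rewrite csum_lin => [|j]; last exact: summ_ctr1.
  by rewrite big1 ?mulr0 // => j _; rewrite csumR_ctr1 mulr0.
apply: funext => m; rewrite expr1 /linl mulr_sumr; apply: eq_bigr => j _.
by rewrite /ctr rmorphM rmorphB /= rmorph_nat; ring.
Qed.

Lemma moment2_bilin w : moment lam (fun m => (p m)%:C) 2 w = 2^-1 * bilin H w w.
Proof.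
rewrite /moment (_ : (fun m => _) = fun m => \sum_(ij : 'I_d * 'I_d) w ij.1 * w ij.2 * (ctr m ij.1 * ctr m ij.2 * p m)%:C).
  rewrite csum_lin => [|ij]; last exact: summ_ctr2.
  congr (_ * _); rewrite /bilin pair_bigA /=; apply: eq_bigr => -[i j] _ /=.
  by rewrite csumR_ctr2; ring.
apply: funext => m; rewrite -(pair_bigA _ (fun i j => w i * w j * (ctr m i * ctr m j * p m)%:C)) /=.
rewrite /linl expr2 mulr_suml mulr_sumr; apply: eq_bigr => i _; rewrite !mulr_sumr; apply: eq_bigr => j _.
by rewrite /ctr !rmorphM !rmorphB /= !rmorph_nat; ring.
Qed.

Lemma quadf_covariance s : summ (fun m => (\sum_j ctr m j * s j) ^+ 2 * p m) /\
  quadf H s = csumR (fun m => (\sum_j ctr m j * s j) ^+ 2 * p m).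
Proof.
have E : (fun m => (\sum_j ctr m j * s j) ^+ 2 * p m) =
    fun m => \sum_(ij : 'I_d * 'I_d) s ij.1 * s ij.2 * (ctr m ij.1 * ctr m ij.2 * p m).
  apply: funext => m; rewrite -(pair_bigA _ (fun i j => s i * s j * (ctr m i * ctr m j * p m))) /=.
  rewrite expr2 mulr_suml mulr_suml; apply: eq_bigr => i _; rewrite mulr_sumr mulr_suml; apply: eq_bigr => j _.
  by ring.
have hs (ij : 'I_d * 'I_d) : summ (fun m => s ij.1 * s ij.2 * (ctr m ij.1 * ctr m ij.2 * p m)).
  exact/summZ/summ_ctr2.
rewrite E; split; first exact: summ_sum.
rewrite csumR_sum // /quadf pair_bigA; apply: eq_bigr => -[i j] _ /=.
by rewrite csumRZ ?csumR_ctr2; [ring|exact: summ_ctr2].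
Qed.

(** The variance of a linear form is at least mu / 2 times the square of its difference on two
    atoms. The d differences along P k - Q k determine s, because their matrix is invertible. *)
Lemma covariance_coercive (P Q : 'I_d -> mi d) : (forall k, p (P k) != 0 /\ p (Q k) != 0) ->
  \rank (\matrix_(k < d, i < d) ((P k i)%:R - (Q k i)%:R : R)) = d ->
  exists2 c, 0 < c & forall s, c * nsq s <= quadf H s.
Proof.
move=> PQ; set D := \matrix_(k, i) _ => rD.
have uD : D \in unitmx by rewrite -row_free_unit /row_free rD.
(* Truncation at 1 makes the product a lower bound for each of its factors, hence for every weight p
   (P k) and p (Q k). *)
pose mu : R := \prod_k (Num.min 1 (Num.min (p (P k)) (p (Q k)))).
have pP k : 0 < p (P k) by rewrite lt_def (PQ k).1 p0.
have pQ k : 0 < p (Q k) by rewrite lt_def (PQ k).2 p0.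
have mu0 : 0 < mu by apply: prodr_gt0 => k _; rewrite !lt_min ltr01 pP pQ.
have muk k : mu <= p (P k) /\ mu <= p (Q k).
  have h : mu <= Num.min 1 (Num.min (p (P k)) (p (Q k))).
    rewrite /mu (bigD1 k) //= ler_piMr ?le_min ?ler01 ?(ltW (pP k)) ?(ltW (pQ k)) //.
    apply: prodr_ile1 => i _; rewrite le_min ler01 le_min !p0 /=.
    by rewrite ge_min lexx.
  by move: h; rewrite !le_min => /and3P[].
have Var s k : mu / 2 * (\sum_i D k i * s i) ^+ 2 <= quadf H s.
  have [hs ->] := quadf_covariance s; set X := fun m => \sum_j ctr m j * s j.
  have e1 : \sum_i D k i * s i = X (P k) - X (Q k).
    by rewrite /X -sumrB; apply: eq_bigr => i _; rewrite mxE /ctr; ring.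
  have F0 m : 0 <= X m ^+ 2 * p m by rewrite mulr_ge0 ?sqr_ge0.
  rewrite e1; have [PQe|PQn] := eqVneq (P k) (Q k).
    by rewrite PQe subrr expr0n mulr0; apply: le_trans (csumR_ge_term (P k) F0 hs).
  apply: le_trans (csumR_ge_pair PQn F0 hs).
  have [m1 m2] := muk k; have := sqr_ge0 (X (P k) + X (Q k)).
  have a1 : mu * X (P k) ^+ 2 <= X (P k) ^+ 2 * p (P k) by rewrite mulrC ler_wpM2l ?sqr_ge0.
  have a2 : mu * X (Q k) ^+ 2 <= X (Q k) ^+ 2 * p (Q k) by rewrite mulrC ler_wpM2l ?sqr_ge0.
  move: (X (P k)) (X (Q k)) a1 a2 => x y; rewrite !expr2 => a1 a2 a3.
  by have := mulr_ge0 (ltW mu0) a3; lra.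
pose T : R := 1 + \sum_i (\sum_k `|invmx D i k|) ^+ 2.
have T0 : 0 < T by rewrite ltr_pwDl // sumr_ge0 // => i _; rewrite sqr_ge0.
exists (mu / 2 / T); first by rewrite !divr_gt0.
move=> s; have q0 : 0 <= quadf H s.
  have [hs ->] := quadf_covariance s.
  by apply: le_trans (csumR_ge_term (Defs.mzero d) _ hs) => [|m]; rewrite mulr_ge0 ?sqr_ge0.
pose V := Num.sqrt (2 / mu * quadf H s).
have V2 : V ^+ 2 = 2 / mu * quadf H s by rewrite sqr_sqrtr // mulr_ge0 // divr_ge0 // ltW.
have xk k : `|\sum_i D k i * s i| <= V.
  rewrite -sqrtr_sqr ler_wsqrtr // mulrAC ler_pdivlMr // mulrC.
  by have := Var s k; lra.
have si i : `|s i| <= (\sum_k `|invmx D i k|) * V.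
  have -> : s i = \sum_k invmx D i k * \sum_l D k l * s l.
    transitivity ((invmx D *m (D *m (\col_l s l))) i 0); first by rewrite mulKmx // mxE.
    rewrite mxE; apply: eq_bigr => k _; rewrite mxE; congr (_ * _).
    by apply: eq_bigr => l _; congr (_ * _); rewrite mxE.
  apply: le_trans (ler_norm_sum _ _ _) _; rewrite mulr_suml; apply: ler_sum => k _.
  by rewrite normrM ler_wpM2l.
have nT : nsq s <= T * V ^+ 2.
  apply: le_trans (_ : (\sum_i (\sum_k `|invmx D i k|) ^+ 2) * V ^+ 2 <= _).
    rewrite /nsq mulr_suml; apply: ler_sum => i _; rewrite -exprMn -[s i ^+ 2]real_normK ?num_real //.
    by rewrite lerXn2r ?nnegrE // mulr_ge0 ?sqrtr_ge0 // sumr_ge0.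
  by rewrite ler_wpM2r ?sqr_ge0 // lerDr.
rewrite mulrAC ler_pdivrMr //; apply: le_trans (ler_wpM2l _ nT) _; first by rewrite divr_ge0 // ltW.
by rewrite V2 le_eqVlt; apply/orP; left; apply/eqP; field; rewrite gt_eqF.
Qed.

End Covariance.

Lemma modulus_squeeze (R : realFieldType) (x f c k : R) :
  1 - x < f -> x < (1 - c) / 2 -> f <= k + c -> k <= (1 - c) / 4 -> 1 <= c.
Proof. lra. Qed.

(** Arithmetic of the far bound. A is the Lipschitz cost of leaving the imaginary points; B is the
    exponent of the centring factor, with e^B <= 1 / (1 - B). Both losses fit between g and (1 + g)
    / 2. *)
Lemma tilted_gap (R : realFieldType) (g A B u : R) : 0 < g -> g < 1 -> 0 <= A -> 0 <= B -> 0 <= u ->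
  4 * (A + B + u) <= 1 - g -> B < 1 /\ g + A <= (1 + g) / 2 * (1 - B).
Proof.
move=> g0 g1 A0 B0 u0 h; have gB : g * B <= B by rewrite ler_piMl // ltW.
by split; lra.
Qed.

(** * The characteristic function away from the origin *)

Section CharacteristicFunction.
Variable R : realType.
Notation C := R[i].
Variables (d : nat) (p : mi d -> R) (lam : 'I_d -> R) (e : R).
Hypothesis e0 : 0 < e.
Hypothesis p0 : forall m, 0 <= p m.
Hypothesis pm : margin e p.
Hypothesis p1 : csumR p = 1.
Notation pC := (fun m => (p m)%:C).

(** Uncentred: on imaginary points the modulus is the same as with centring, and the terms are
    bounded by those of p wherever Re w_j <= 0 for all j. *)
Definition charf (w : 'I_d -> C) : C := evls (fun _ => 0) pC w.

Lemma linl0E (w : 'I_d -> C) m : linl (fun _ => 0) w m = \sum_j (m j)%:R * w j.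
Proof. by apply: eq_bigr => j _; rewrite (rmorph0 (real_complex R)) subr0. Qed.

Lemma linl0_iE (th : 'I_d -> R) m : linl (fun _ => 0) (fun j => 'i * (th j)%:C) m = 'i * (pair th m)%:C.
Proof.
rewrite linl0E /pair -sumC mulr_sumr; apply: eq_bigr => j _.
by rewrite rmorphM /= rmorph_nat; ring.
Qed.

Lemma charf_summable (w : 'I_d -> C) : (forall j, complex.Re (w j) <= 0) ->
  summable (csumR p) (fun m => pC m * cexp (linl (fun _ => 0) w m)).
Proof.
move=> w0 N; apply: le_trans (csumR_ge N p0 (margin_summ e0 pm)); apply: ler_sum => m _.
rewrite cnM cn_real ger0_norm // ler_piMr // cn_cexp -expR0 ler_expR linl0E Re_sum.
apply: sumr_le0 => j _; rewrite -[(m j)%:R](rmorph_nat (real_complex R)) Re_realM mulr_ge0_le0 //.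
Qed.

(** Only w' has to lie in the region Re <= 0; the displacement to w is paid from the exponential
    margin. *)
Lemma charf_lipschitz : exists2 K, 0 <= K & forall w w' delta, 0 <= delta <= e / 2 ->
  (forall j, complex.Re (w' j) <= 0) -> (forall j, cn (w j - w' j) <= delta) ->
  cn (charf w - charf w') <= K * delta.
Proof.
have [K1 K10 h1] := @mabsX_bound R d e 1 e0; have [Kp hp] := pm.
have Kp0 := summable_ge0 hp.
exists (K1 * Kp); first by rewrite mulr_ge0.
move=> w w' delta /andP[d0 de] w'0 ww.
pose F' m := pC m * cexp (linl (fun _ => 0) w' m).
pose G m := pC m * cexp (linl (fun _ => 0) w m) - F' m.
have sF' : summable (csumR p) F' by exact: charf_summable.
have sG : summable (K1 * Kp * delta) G.
  move=> N; apply: le_trans (_ : boxsum N (fun m => K1 * delta * cn (expR (e * mabs R m) * p m)%:C) <= _); last first.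
    by rewrite /boxsum -mulr_sumr mulrAC ler_wpM2r // ler_wpM2l // hp.
  apply: ler_sum => m _; set z := linl (fun _ => 0) (fun j => w j - w' j) m.
  have -> : G m = pC m * cexp (linl (fun _ => 0) w' m) * (cexp z - 1).
    rewrite /G /F' mulrBr mulr1 -[pC m * _ * cexp z]mulrA -cexpD; congr (_ * cexp _ - _).
    by rewrite /z !linl0E -big_split; apply: eq_bigr => j _ /=; ring.
  have zd : cn z <= delta * mabs R m.
    have := linl_bound (fun _ => 0) m ww; rewrite /lnorm big1 ?addr0 // => j _; exact: normr0.
  have w1 : cn (cexp (linl (fun _ => 0) w' m)) <= 1.
    rewrite cn_cexp -expR0 ler_expR linl0E Re_sum.
    by apply: sumr_le0 => j _; rewrite -[(m j)%:R](rmorph_nat (real_complex R)) Re_realM mulr_ge0_le0.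
  have m0 := mabs_ge0 R m.
  have z1 : cn (cexp z - 1) <= delta * (K1 * expR (e * mabs R m)).
    have := cexp_taylor 1 z; rewrite big_ord1 expr0 divr1 expr1 => /le_trans; apply.
    apply: le_trans (_ : delta * mabs R m * expR (e / 2 * mabs R m) <= _).
      apply: ler_pM; rewrite ?cn_ge0 ?expR_ge0 // ler_expR; apply: le_trans zd _.
      by rewrite ler_wpM2r.
    by rewrite -mulrA ler_wpM2l // -[X in X * _]expr1.
  rewrite 2!cnM !cn_real (ger0_norm (p0 m)) normrM (ger0_norm (p0 m)) (ger0_norm (expR_ge0 _)).
  apply: le_trans (_ : p m * 1 * (delta * (K1 * expR (e * mabs R m))) <= _).
    by apply: ler_pM; rewrite ?mulr_ge0 ?cn_ge0 // ler_wpM2l.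
  by rewrite le_eqVlt; apply/orP; left; apply/eqP; ring.
have -> : charf w - charf w' = csum G.
  rewrite /charf /evls (_ : (fun m => pC m * cexp (linl _ w m)) = fun m => F' m + G m).
    by rewrite (csumD sF' sG) addrAC subrr add0r.
  by apply: funext => m; rewrite /G addrC subrK.
exact: csum_bound.
Qed.

Lemma Re_csum (F : mi d -> C) : complex.Re (csum F) = csumR (fun m => complex.Re (F m)).
Proof.
rewrite /csumR /csum /culim /=; congr usup; apply: funext => N.
by rewrite /boxsum sumC /= Re_sum.
Qed.

(** Multiplied by the conjugate of the sum [om], every phase has real part at most 1, while the
    weighted mean is 1. The nonnegative defects add up to 0, so all of them vanish, and all atoms
    share one phase. *)
Lemma charf_modulus1 (th : 'I_d -> R) : 1 <= cn (charf (fun j => 'i * (th j)%:C)) ->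
  forall m m', p m != 0 -> p m' != 0 -> cexp ('i * (pair th m - pair th m')%:C) = 1.
Proof.
set om := charf _ => om1.
have r0 j : complex.Re ('i * (th j)%:C : C) <= 0 by rewrite Re_iM.
have sF := charf_summable r0; rewrite p1 in sF.
have omle : cn om <= 1 by exact: csum_bound sF.
have omE : cn om = 1 by apply/eqP; rewrite eq_le omle om1.
have omm : om^* * om = 1.
  by rewrite mulrC -normCK cnE omE expr1n.
pose t m := cexp ('i * (pair th m)%:C).
have ct m : cn (om^* * t m) = 1.
  by rewrite cnM cn_conj omE mul1r /t cn_cexp Re_iM expR0.
pose c m := p m * (1 - complex.Re (om^* * t m)).
have c0 m : 0 <= c m.
  by rewrite mulr_ge0 // subr_ge0 -(ct m); apply: le_trans (cn_Re _); exact: ler_norm.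
have sp := margin_summ e0 pm.
have sR : summ (fun m => complex.Re (om^* * (pC m * t m))).
  apply: (summ_le _ sp) => m; apply: le_trans (cn_Re _) _.
  by rewrite mulrCA cnM ct cn_real mulr1 ger0_norm.
have cE : c = fun m => p m + (-1) * complex.Re (om^* * (pC m * t m)).
  by apply: funext => m; rewrite /c mulrCA Re_realM; ring.
have sc : summ c by rewrite cE; apply: summD => //; apply: summZ.
have cS : csumR c = 0.
  rewrite cE csumRD //; last exact: summZ.
  rewrite csumRZ // p1 -Re_csum.
  have -> : csum (fun m => om^* * (pC m * t m)) = om^* * om.
    rewrite /om /charf /evls -(csumZ _ sF); congr csum; apply: funext => m.
    by rewrite linl0_iE.
  by rewrite omm /=; ring.
have key m : p m != 0 -> om^* * t m = 1.
  move=> pm0; have := csumR_ge_term m c0 sc; rewrite cS => cm.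
  have : c m = 0 by apply/eqP; rewrite eq_le cm c0.
  move/eqP; rewrite mulf_eq0 (negbTE pm0) /= subr_eq0 => /eqP re1.
  have := cn_sqrE (om^* * t m); rewrite ct -re1 expr1n => h.
  apply: complex_eq => //=; move: h; set x := complex.Im _ => h.
  by apply/eqP; rewrite -sqrf_eq0; apply/eqP; lra.
move=> m m' pm0 pm'0; rewrite rmorphB /= mulrBr cexpD cexpN -/(t m) -/(t m').
have om0 : om^* != 0 by rewrite -cn_gt0 cn_conj omE.
have -> : t m = t m' by apply: (mulfI om0); rewrite !key.
by rewrite divff // cexp_neq0.
Qed.

Lemma cexp_i_eq1 (x : R) : cexp ('i * x%:C) = 1 -> exists k : int, x = 2 * pi * k%:~R.
Proof.
move=> h; have pi0 : 0 < 2 * pi :> R by rewrite mulr_gt0 // pi_gt0.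
pose k := Num.floor (x / (2 * pi)); exists k.
pose y := x - 2 * pi * k%:~R.
have y0 : 0 <= y.
  by rewrite subr_ge0 -ler_pdivlMl // mulrC Num.Theory.floor_le.
have y1 : y < 2 * pi.
  have := Num.Theory.floorD1_gt (x / (2 * pi)); rewrite -/k rmorphD /= ltr_pdivrMr //.
  by rewrite /y; lra.
have cy : cos y = 1.
  have : cexp ('i * y%:C) = 1.
    by rewrite /y rmorphB /= mulrBr cexpD h mul1r cexpN cexp_2pi_int invr1.
  by move/(congr1 (@complex.Re R)); rewrite cexpE Re_realM Re_iM Im_iM expR0 mul1r.
move: y0; rewrite le_eqVlt => /orP[/eqP y0|y0]; first by apply/eqP; rewrite -subr_eq0 -/y -y0.
have s0 : 0 < sin (y / 2) by apply: sin_gt0_pi; lra.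
have := cos_mulr2n (y / 2); rewrite -[y / 2 *+ 2]mulr_natr divfK // cy => c2.
have := cos2Dsin2 (y / 2) => cs; have : 0 < sin (y / 2) ^+ 2 by rewrite exprn_gt0.
by move: c2; rewrite -[_ ^+ 2 *+ 2]mulr_natr; lra.
Qed.

Hypothesis p_full : full_rank p.
Hypothesis p_aper : aperiodic p.

(* The adjugate of the integer matrix of support differences shows that th is
   2 pi / det times an integer vector; aperiodicity removes the denominator. *)
Lemma aligned_eq0 (th : 'I_d -> R) : (forall j, `|th j| <= pi) ->
  (forall m m', p m != 0 -> p m' != 0 -> cexp ('i * (pair th m - pair th m')%:C) = 1) ->
  forall j, th j = 0.
Proof.
move=> thpi al j; have [P [Q [PQ rD]]] := p_full.
have pi0 : 0 < pi :> R by exact: pi_gt0.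
pose DZ : 'M[int]_d := \matrix_(k, i) ((P k i)%:Z - (Q k i)%:Z).
set D := \matrix_(k, i) _ in rD.
have DE : D = map_mx intr DZ by apply/matrixP => k i; rewrite !mxE rmorphB.
have uD : D \in unitmx by rewrite -row_free_unit /row_free rD.
have hk k : exists l : int, pair th (P k) - pair th (Q k) = 2 * pi * l%:~R.
  by apply: cexp_i_eq1; apply: al; case: (PQ k).
have [l hl] := choice hk.
have Dth k : \sum_i D k i * th i = 2 * pi * (l k)%:~R.
  rewrite -hl /pair -sumrB; apply: eq_bigr => i _; rewrite mxE; ring.
(* By Cramer's rule, [a] = adj(DZ) l satisfies Del * theta = 2 pi a. *)
pose Del := \det DZ; pose a : 'I_d -> int := fun i => \sum_k \adj DZ i k * l k.
have detE : \det D = Del%:~R by rewrite DE det_map_mx.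
have Del0 : Del != 0.
  by move: uD; rewrite unitmxE detE unitfE intr_eq0.
have ath i : Del%:~R * th i = 2 * pi * (a i)%:~R.
  have := mul_adj_mx D; rewrite detE => hadj.
  have : ((\adj D *m D) *m (\col_i th i)) i 0 = Del%:~R * th i.
    by rewrite hadj mul_scalar_mx !mxE.
  move=> <-; rewrite -mulmxA mxE rmorph_sum mulr_sumr; apply: eq_bigr => k _.
  rewrite [(D *m _) k 0]mxE (eq_bigr (fun i => D k i * th i)) => [|i' _]; last by congr (_ * _); rewrite mxE.
  by rewrite Dth DE -map_mx_adj mxE rmorphM /=; ring.
(* Equality of phases now says that a pairs to 0 modulo Del with all differences of support
   points. *)
have cong m m' : p m != 0 -> p m' != 0 -> (Del %| \sum_i a i * ((m i)%:Z - (m' i)%:Z))%Z.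
  move=> pm0 pm'0; have [k hk'] := cexp_i_eq1 (al m m' pm0 pm'0); apply/dvdzP; exists k.
  apply/eqP; rewrite -(eqr_int R); apply/eqP; rewrite rmorphM rmorph_sum /=.
  have pi2 : 2 * pi != 0 :> R by rewrite mulf_neq0 // gt_eqF.
  apply: (mulfI pi2); rewrite mulrA -hk' mulr_sumr [RHS]mulrC /pair -sumrB mulr_sumr; apply: eq_bigr => i _.
  by rewrite rmorphM rmorphB /= mulrA -ath; ring.
have [m0 pm0] : exists m0, p m0 != 0.
  by exists (P j); case: (PQ j).
(* If Del divides a_j, then theta_j is a multiple of 2 pi, and |theta_j| <= pi leaves only 0. *)
suff dv i : (Del %| a i)%Z.
  have /dvdzP[k hk'] := dv j; have := ath j; rewrite hk' rmorphM /= => h.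
  have D0 : Del%:~R != 0 :> R by rewrite intr_eq0.
  have thj : th j = 2 * pi * k%:~R by apply: (mulfI D0); rewrite h; ring.
  have [k0|k0] := eqVneq k 0; first by rewrite thj k0 mulr0.
  have := thpi j; rewrite thj normrM gtr0_norm ?mulr_gt0 // -intr_norm.
  have k1 : 1 <= (`|k|)%:~R :> R by rewrite ler1z -gtz0_ge1 normr_gt0.
  by move=> h2; have := ler_wpM2l (ltW pi0) k1; lra.
apply/negPn/negP => ndv; apply: p_aper.
(* If some a_i is not divisible by Del, the modulus |Del| with the residues of a violates
   aperiodicity; passing to residues makes the multipliers nonnegative. *)
pose q := `|Del|%N; pose pp i : nat := `|(a i %% Del)%Z|%N.
have q0 : (0 < q)%N by rewrite absz_gt0.
have ppE i' : (pp i')%:Z = (a i' %% Del)%Z by rewrite /pp gez0_abs // modz_ge0.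
have cpp m : p m != 0 -> ((\sum_(i < d) pp i * m i)%N = (\sum_(i < d) pp i * m0 i)%N %[mod q])%N.
  move=> pm1.
  have h : (Del %| (\sum_(i < d) pp i * m i)%N%:Z - (\sum_(i < d) pp i * m0 i)%N%:Z)%Z.
    have -> : (\sum_(i < d) pp i * m i)%N%:Z - (\sum_(i < d) pp i * m0 i)%N%:Z =
       \sum_i a i * ((m i)%:Z - (m0 i)%:Z) - Del * \sum_i (a i %/ Del)%Z * ((m i)%:Z - (m0 i)%:Z).
      rewrite !(big_morph Posz PoszD (erefl 0%:Z)) -sumrB mulr_sumr -sumrB; apply: eq_bigr => i' _.
      rewrite !PoszM ppE; have := divz_eq (a i') Del; set k := (_ %/ _)%Z; set x := (_ %% _)%Z => ->.
      by ring.
    by rewrite rpredB ?cong // dvdz_mulr.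
  move: h; rewrite -eqz_mod_dvd -!(modz_abs _ Del) -/q !modz_nat => /eqP[].
  by [].
exists q, pp, ((\sum_(i < d) pp i * m0 i) %% q)%N%:Z; split.
- rewrite ltn_neqAle q0 andbT; apply/eqP => q1.
  by case/negP: ndv; rewrite dvdzE -/q -q1 dvd1n.
- apply/negP => /forallP/(_ i); rewrite /pp => h; case/negP: ndv.
  by rewrite (divz_eq (a i) Del) rpredD // dvdz_mull.
- move=> m /cpp h; exists ((\sum_(i < d) pp i * m i) %/ q)%N.
  by rewrite -PoszD; congr Posz; rewrite {1}(divn_eq (\sum_(i < d) pp i * m i)%N q) h addnC mulnC.
Qed.

(* Compactness: the limit along the ultrafilter of points where |charf| tends
   to 1 is a point where |charf| = 1. *)
Lemma charf_gap (eps : R) : 0 < eps -> exists2 g, 0 < g < 1 & forall th : 'I_d -> R,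
  (forall j, `|th j| <= pi) -> (exists j, eps < `|th j|) -> cn (charf (fun j => 'i * (th j)%:C)) <= g.
Proof.
move=> eps0; apply: contrapT => no.
(* The candidate gaps 1 - 1 / (n + 2) lie strictly between 0 and 1 and tend to 1; each of them fails
   at some point. *)
have ex n : exists th : 'I_d -> R, [/\ forall j, `|th j| <= pi, exists j, eps < `|th j| &
    1 - n.+2%:R^-1 < cn (charf (fun j => 'i * (th j)%:C))].
  apply: contrapT => no'; apply: no; exists (1 - n.+2%:R^-1).
    have i0 : 0 < n.+2%:R^-1 :> R by rewrite invr_gt0.
    have i1 : n.+2%:R^-1 < 1 :> R by rewrite invf_lt1 // ltr1n.
    by rewrite subr_gt0 i1 ltrBlDr ltrDl.
  move=> th h1 h2; rewrite leNgt; apply/negP => h3; apply: no'.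
  by exists th; split.
have [T hT] := choice ex.
pose l j := culim (fun n => (T n j)%:C : C).
have hl j : ucvg (fun n => (T n j)%:C : C) (l j).
  by apply: culimP; exists pi => n; rewrite cn_real; case: (hT n).
pose th j := complex.Re (l j).
have lj j : l j = (th j)%:C.
  have e1 : (l j)^* = l j.
    apply: ucvg_unique (hl j); apply: ucvg_ext (ucvg_conj (hl j)) => n.
    by apply: complex_eq; rewrite /= ?oppr0.
  move: e1; rewrite /th; move: (l j) => [x y] [e1].
  by apply: complex_eq => //=; lra.
have thpi j : `|th j| <= pi.
  rewrite -cn_real -lj; apply: (@ucvg_norm_le _ _ _ _ 0 (hl j)) => n _.
  by rewrite cn_real; case: (hT n).
have UU : UltraFilter ultra := ultra_ultra.
have close del N : 0 < del -> exists2 n, (N <= n)%N & forall j, `|T n j - th j| <= del.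
  move=> del0; have h1 : ultra (fun n => forall j, cn ((T n j)%:C - l j) < del).
    by apply: filter_forall => j; exact: (hl j del del0).
  have [n /= [a b]] := filter_ex (filterI h1 (@ultra_eventually (fun n => (N <= n)%N) N (fun n => id))).
  exists n => // j; have := a j; rewrite lj -rmorphB /= cn_real; exact: ltW.
have [K K0 hK] := charf_lipschitz.
have th1 : 1 <= cn (charf (fun j => 'i * (th j)%:C)).
  rewrite leNgt; apply/negP => lt1; set c := cn _ in lt1.
  have del0 : 0 < Num.min (e / 2) ((1 - c) / (4 * (K + 1))).
    by rewrite lt_min !divr_gt0 ?mulr_gt0 ?subr_gt0 // ltr_wpDl.
  have x0 : 0 < (1 - c) / 2 by rewrite divr_gt0 // subr_gt0.
  have [N hN] := small_invS 1 x0; have [n Nn hn] := close _ N del0.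
  have [_ _ hT3] := hT n; have := hN n.+1 (leq_trans Nn (leqnSn n)); rewrite mul1r => hN1.
  have dd : 0 <= Num.min (e / 2) ((1 - c) / (4 * (K + 1))) <= e / 2 by rewrite (ltW del0) ge_min lexx.
  have r0 (t : 'I_d -> R) j : complex.Re ('i * (t j)%:C : C) <= 0 by rewrite Re_iM.
  have dj j : cn ('i * (T n j)%:C - 'i * (th j)%:C) <= Num.min (e / 2) ((1 - c) / (4 * (K + 1))).
    by rewrite -mulrBr cnM cn_i mul1r -rmorphB /= cn_real.
  have := hK (fun j => 'i * (T n j)%:C) (fun j => 'i * (th j)%:C) _ dd (r0 th) dj => h4.
  have h5 : K * Num.min (e / 2) ((1 - c) / (4 * (K + 1))) <= (1 - c) / 4.
    apply: le_trans (_ : K * ((1 - c) / (4 * (K + 1))) <= _).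
      by rewrite ler_wpM2l // ge_min lexx orbT.
    have K1 : 0 < K + 1 by rewrite ltr_wpDl.
    rewrite (_ : K * _ = (1 - c) / 4 * (K / (K + 1))); last by field; rewrite gt_eqF.
    by rewrite ler_piMr // ?ler_pdivrMr // ?mul1r ?lerDl // divr_ge0 // subr_ge0 ltW.
  have tri := cnD (charf (fun j => 'i * (T n j)%:C) - charf (fun j => 'i * (th j)%:C)) (charf (fun j => 'i * (th j)%:C)).
  rewrite subrK -/c in tri.
  by have := modulus_squeeze hT3 hN1 tri (le_trans h4 h5); rewrite leNgt lt1.
have z0 := aligned_eq0 thpi (charf_modulus1 th1).
have e2 : 0 < eps / 2 by rewrite divr_gt0.
have [n _ hn] := close _ 0%N e2; have [_ [j hj] _] := hT n.
by have := hn j; rewrite z0 subr0; lra.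
Qed.

Variable v : 'I_d -> R.
Hypothesis v01 : forall j, 0 <= v j <= 1.

Lemma psi_charf n s : psi lam pC v n s =
  charf (fun j => (un R n)%:C * ypt v s j) * cexp (- \sum_j (lam j)%:C * ((un R n)%:C * ypt v s j)).
Proof.
have r0 j : complex.Re ((un R n)%:C * ypt v s j) <= 0.
  have /andP[v0 _] := v01 j; rewrite (_ : complex.Re _ = - (un R n * v j)).
    by rewrite oppr_le0 mulr_ge0 ?un_ge0.
  by rewrite /ypt /=; ring.
rewrite mulrC /psi /charf /evls -(csumZ _ (charf_summable r0)); congr csum; apply: funext => m.
rewrite mulrCA -cexpD; congr (_ * cexp _).
by rewrite /linl -sumrN -big_split; apply: eq_bigr => j _ /=; rewrite (rmorph0 (real_complex R)); ring.
Qed.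

(** The gap g is known at the imaginary points i theta, and the contour lies at distance at most u
    from them. This costs K u by the Lipschitz bound, and the centring factor costs e^{u L}; for
    small u the bound is still (1 + g) / 2. *)
Lemma psi_far (eps : R) : 0 < eps -> exists gam N, 0 < gam < 1 /\
  forall n s, (N <= n)%N -> inbox (un R n)^-1 s -> ~ near_origin eps n s -> cn (psi lam pC v n s) <= gam.
Proof.
move=> eps0; have [g /andP[g0 g1] hg] := charf_gap eps0; have [K K0 hK] := charf_lipschitz.
pose L := \sum_j `|lam j|; have L0 : 0 <= L by apply: sumr_ge0.
pose eta := Num.min eps (Num.min (e / 2) ((1 - g) / (4 * (K + L + 1)))).
have KL : 0 < 4 * (K + L + 1) by rewrite mulr_gt0 // ltr_wpDl // addr_ge0.
have eta0 : 0 < eta by rewrite !lt_min eps0 !divr_gt0 // subr_gt0.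
have [N hN] := un_small eta0; exists ((1 + g) / 2), N; split; first by lra.
move=> n s Nn si ns; have [n0] := hN n Nn; rewrite !le_min => /and3P[u1 u2 u3].
have u0 := un_gt0 R n0; set u := un R n in u0 u1 u2 u3 *.
pose th j := u * s j.
have thpi j : `|th j| <= pi.
  by have /forallP/(_ j) := si; rewrite /th normrM gtr0_norm // -ler_pdivlMl // [_^-1 * _]mulrC.
(* For n >= N the condition u <= eps holds, so what fails is the bound on some u |s_j|. *)
have thfar : exists j, eps < `|th j|.
  apply/existsP; rewrite -[X in is_true X]negbK negb_exists; apply/negP => /forallP h.
  by apply: ns; split=> // j; have := h j; rewrite -leNgt /th normrM gtr0_norm.
have r0 j : complex.Re ('i * (th j)%:C : C) <= 0 by rewrite Re_iM.
have ud : 0 <= u <= e / 2 by rewrite ltW.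
have dj j : cn (u%:C * ypt v s j - 'i * (th j)%:C) <= u.
  have -> : u%:C * ypt v s j - 'i * (th j)%:C = - (u * v j)%:C.
    by rewrite /ypt /th !rmorphM; ring.
  have /andP[v0 v1] := v01 j; rewrite cnN cn_real ger0_norm ?mulr_ge0 ?(ltW u0) //.
  by rewrite ler_piMr // ltW.
have h1 := hK _ _ _ ud r0 dj; have h2 := hg th thpi thfar.
have h3 : cn (charf (fun j => u%:C * ypt v s j)) <= g + K * u.
  rewrite -[charf _](subrK (charf (fun j => 'i * (th j)%:C))).
  by apply: le_trans (cnD _ _) _; rewrite addrC; exact: lerD.
have h4 : cn (cexp (- \sum_j (lam j)%:C * (u%:C * ypt v s j))) <= expR (u * L).
  rewrite cn_cexp ler_expR ReN Re_sum -sumrN /L mulr_sumr; apply: ler_sum => j _.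
  rewrite Re_realM Re_realM (_ : complex.Re _ = - v j); last by rewrite /ypt /=; ring.
  have /andP[v0 v1] := v01 j; rewrite !mulrN opprK mulrCA ler_wpM2l ?(ltW u0) //.
  apply: le_trans (ler_norm _) _; rewrite normrM (ger0_norm v0) ler_piMr //.
rewrite psi_charf cnM -/u; apply: le_trans (ler_pM (cn_ge0 _) (cn_ge0 _) h3 h4) _.
move: u3; rewrite ler_pdivlMr // => u3.
have [uL uK] : u * L < 1 /\ g + K * u <= (1 + g) / 2 * (1 - u * L).
  have uK0 : 0 <= K * u by rewrite mulr_ge0 // ltW.
  have uL0 : 0 <= u * L by rewrite mulr_ge0 // ltW.
  by apply: (tilted_gap g0 g1 uK0 uL0 (ltW u0)); rewrite (le_trans _ u3) // le_eqVlt; apply/orP; left; apply/eqP; ring.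
have e1 : expR (u * L) <= (1 - u * L)^-1.
  rewrite -[expR _]invrK -expRN lef_pV2 ?posrE ?expR_gt0 ?subr_gt0 //.
  exact: expR_ge1Dx.
apply: le_trans (ler_wpM2l _ e1) _; first by rewrite addr_ge0 ?mulr_ge0 ?(ltW u0) ?(ltW g0).
by rewrite ler_pdivrMr ?subr_gt0.
Qed.

End CharacteristicFunction.

(** * Poles as integrals over an orthant *)

Section PoleIntegral.
Variable R : realType.
Notation C := R[i].
Variables (d : nat) (H : 'M[R]_d) (v : 'I_d -> R).
Hypothesis gH : gform H.
Hypothesis uH : H \in unitmx.
Notation y s := (ypt v s).
Notation Zr := (complex.Re (gaussZ H)).

Lemma yptE s : y s = fun j => 'i * (s j)%:C + (- v j)%:C.
Proof. by apply: funext => j; rewrite /ypt addrC rmorphN. Qed.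

Lemma qexp_bound x0 : exists2 K, 0 <= K & exists2 c, 0 < c & forall s,
  expR (complex.Re (qexp H x0 (y s))) <= K * expR (- (c * nsq s)).
Proof.
have [Hs [c c0 hc]] := gH.
exists (expR (quadf H (fun j => - v j) / 2 + \sum_j x0 j * - v j)); first exact: expR_ge0.
exists (c / 2); first by rewrite divr_gt0.
move=> s; rewrite yptE qexp_iE // -expRD ler_expR ReD Re_iM addr0 /=.
by have := hc s; lra.
Qed.

Definition growth (g : ('I_d -> C) -> C) := exists K M, 0 <= K /\ forall s, cn (g (y s)) <= K * norm1 s ^+ M.
(** The integrand with an extra factor e^{x y_k}, of modulus e^{-x} when v_k = 1. *)
Definition tiltf x0 (k : 'I_d) (g : ('I_d -> C) -> C) (x : R) (s : 'I_d -> R) : C :=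
  cexp (qexp H x0 (y s) + x%:C * y s k) * g (y s).

Lemma Re_tilt x0 (k : 'I_d) (x : R) s : v k = 1 ->
  complex.Re (qexp H x0 (y s) + x%:C * y s k) = complex.Re (qexp H x0 (y s)) - x.
Proof.
move=> v1; rewrite ReD Re_realM (_ : complex.Re (y s k) = -1) ?mulrN1 //.
by rewrite /ypt v1 /=; ring.
Qed.

Lemma growth_dominated x0 g q : growth g -> exists2 K, 0 <= K & forall s,
  expR (complex.Re (qexp H x0 (y s))) * (norm1 s ^+ q * cn (g (y s))) <= K * W s.
Proof.
move=> [Kg [M [Kg0 hg]]]; have [K K0 [c c0 hK]] := qexp_bound x0.
have [K1 K10 h1] := @gauss_weight R d c (q + M) c0.
exists (K * Kg * K1); first by rewrite !mulr_ge0.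
move=> s; have [h2 _] := h1 s; have N0 := norm1_ge0 s.
apply: le_trans (_ : K * expR (- (c * nsq s)) * (norm1 s ^+ q * (Kg * norm1 s ^+ M)) <= _).
  by apply: ler_pM; rewrite ?expR_ge0 ?mulr_ge0 ?exprn_ge0 ?cn_ge0 // ler_wpM2l ?exprn_ge0.
rewrite [X in X <= _](_ : _ = K * Kg * (norm1 s ^+ (q + M) * expR (- (c * nsq s)))); last by rewrite exprD; ring.
by rewrite -[X in _ <= X]mulrA ler_wpM2l // mulr_ge0.
Qed.

Lemma tilt_dominated x0 k g : v k = 1 -> growth g ->
  exists2 K, 0 <= K & forall x, dominated (K * expR (- x)) (tiltf x0 k g x).
Proof.
move=> v1 hg; have [K K0 hK] := growth_dominated x0 0 hg; exists K => // x s.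
rewrite /tiltf cnM cn_cexp Re_tilt // expRD mulrAC [X in _ <= X]mulrAC ler_wpM2r ?expR_ge0 //.
by apply: le_trans (hK s); rewrite expr0 mul1r.
Qed.

Hypothesis v01 : forall j, 0 <= v j <= 1.

Lemma growthM_coord k g : growth g -> growth (fun w => w k * g w).
Proof.
move=> [K [M [K0 h]]]; exists K, M.+1; split=> // s; rewrite cnM exprS mulrCA.
by apply: ler_pM; rewrite ?cn_ge0 ?cn_ypt.
Qed.

(** Differentiation in x brings down y_k; the second-order error of the exponential is integrated
    against the Gaussian weight. *)
Lemma tilt_is_derive x0 k g x : v k = 1 -> growth g ->
  is_derive x (1 : R) (fun x => complex.Re (integ (tiltf x0 k g x)))
    (complex.Re (integ (tiltf x0 k (fun w => w k * g w) x))).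
Proof.
move=> v1 hg; have [K K0 hK] := growth_dominated x0 2 hg.
have [K1 K10 h1] := tilt_dominated x0 v1 hg.
have [K2 K20 h2] := tilt_dominated x0 v1 (growthM_coord k hg).
apply: (@is_derive_quadratic_at _ _ _ _ (12 * expR (- x) * K * 4 ^+ d) 1) => // h h_1.
rewrite -Re_realM -!ReN -!ReD; apply: le_trans (cn_Re _) _.
have dZ := dominatedZ h%:C (h2 x).
have dB : dominated (K1 * expR (- (x + h)) + cn (-1) * (K1 * expR (- x))) (fun s => tiltf x0 k g (x + h) s - tiltf x0 k g x s).
  move=> s; have := dominatedD (h1 (x + h)) (dominatedZ (-1) (h1 x)) s.
  by rewrite mulN1r.
rewrite -(integZ _ (h2 x)) -(integB (h1 (x + h)) (h1 x)) -(integB dB dZ).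
rewrite [X in _ <= X](_ : _ = 12 * expR (- x) * K * h ^+ 2 * 4 ^+ d); last by ring.
apply: integ_bound => s; rewrite /tiltf.
set a := qexp H x0 (y s) + x%:C * y s k; pose b := h%:C * y s k.
have -> : qexp H x0 (y s) + (x + h)%:C * y s k = a + b.
  by rewrite /a /b rmorphD /=; ring.
have -> : cexp (a + b) * g (y s) - cexp a * g (y s) - h%:C * (cexp a * (y s k * g (y s))) =
    (cexp (a + b) - cexp a - b * cexp a) * g (y s) by rewrite /b; ring.
rewrite cnM; set G := cn (g (y s)); have G0 : 0 <= G by exact: cn_ge0.
apply: le_trans (ler_wpM2r G0 (cexp_quadratic a b)) _.
have ra : complex.Re a = complex.Re (qexp H x0 (y s)) - x by exact: Re_tilt.
have rab : complex.Re (a + b) = complex.Re (qexp H x0 (y s)) - x - h.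
  rewrite ReD ra /b Re_realM (_ : complex.Re (y s k) = -1) ?mulrN1 //.
  by rewrite /ypt v1 /=; ring.
rewrite rab ra !expRD; set E := expR (complex.Re _); set X := expR (- x).
have E0 : 0 <= E by exact: expR_ge0. have X0 : 0 <= X by exact: expR_ge0.
have EX := mulr_ge0 E0 X0; have EXh : 0 <= E * X * expR (- h) by rewrite mulr_ge0 ?expR_ge0.
have e3 : expR (- h) <= 3.
  by apply: le_trans (expR1_le3 R); rewrite ler_expR; have := ler_norm (- h); rewrite normrN; lra.
have bb : cn b ^+ 2 <= h ^+ 2 * norm1 s ^+ 2.
  rewrite /b cnM cn_real exprMn real_normK ?num_real // ler_wpM2l ?sqr_ge0 //.
  by rewrite lerXn2r ?nnegrE ?cn_ge0 ?norm1_ge0 ?cn_ypt.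
apply: le_trans (_ : 3 * (h ^+ 2 * norm1 s ^+ 2) * (E * X * 4) * G <= _).
  rewrite ler_wpM2r //; apply: ler_pM; rewrite ?mulr_ge0 ?addr_ge0 ?exprn_ge0 ?cn_ge0 ?expR_ge0 //.
    by rewrite ler_wpM2l.
  by have := ler_wpM2l EX e3; lra.
rewrite [X in X <= _](_ : _ = 12 * X * h ^+ 2 * (E * (norm1 s ^+ 2 * G))); last by ring.
rewrite [X in _ <= X](_ : _ = 12 * X * h ^+ 2 * (K * W s)); last by ring.
apply: ler_wpM2l; last exact: (hK s).
by apply: mulr_ge0; [exact: mulr_ge0|exact: sqr_ge0].
Qed.

Lemma gaussZ_real : 0 < Zr /\ gaussZ H = Zr%:C.
Proof.
have [d0 e] := gaussZE gH; rewrite e /=; split=> //.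
by rewrite sqrtr_gt0 divr_gt0 // exprn_gt0 // mulr_gt0 // pi_gt0.
Qed.

Definition poles n (ev : 'I_n -> 'I_d) (w : 'I_d -> C) : C := \prod_k (- w (ev k))^-1.

Lemma poles_growth n (ev : 'I_n -> 'I_d) : (forall k, v (ev k) = 1) -> growth (poles ev).
Proof.
move=> v1; exists 1, 0%N; split=> // s; rewrite expr0 mulr1 /poles cn_prod.
apply: prodr_ile1 => k _; rewrite cn_ge0 cnV cnN.
have h : 1 <= cn (y s (ev k)).
  apply: le_trans (cn_Re _); rewrite (_ : complex.Re _ = -1) ?normrN ?normr1 //.
  by rewrite /ypt v1 /=; ring.
by rewrite invf_le1 // (lt_le_trans ltr01 h).
Qed.

(** Induction on the number of poles. As a function of x, the integral with one pole removed is, up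
    to sign, the derivative of the integral with that pole kept, so the Lebesgue integral over x is
    evaluated by an antiderivative. The linear term [x0] is arbitrary because each x is added to it;
    nonnegativity is carried along since the fundamental theorem on the half-line asks for it. *)
Lemma pole_integral n (ev : 'I_n -> 'I_d) x0 : (forall k, v (ev k) = 1) ->
  let I := integ (fun s => cexp (qexp H x0 (y s)) * poles ev (y s)) in
  int_pos_orthant (fun u : 'I_n -> R =>
    (expR (- (quadf (invmx H) (fun j => x0 j + \sum_k u k * (ev k == j)%:R) / 2)))%:E) = (complex.Re I / Zr)%:E /\
  0 <= complex.Re I / Zr.
Proof.
have [Z0 Ze] := gaussZ_real.
elim: n ev x0 => [|n IH] ev x0 v1 I.
  have IE : I = (expR (- (quadf (invmx H) x0 / 2)))%:C * gaussZ H.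
    rewrite -(gauss_linear x0 (fun j => - v j) gH uH) /I; congr integ; apply: funext => s.
    by rewrite /poles big_ord0 mulr1 yptE.
  rewrite IE Re_realM mulfK ?gt_eqF // expR_ge0; split=> //; congr ((expR (- (quadf _ _ / 2)))%:E).
  by apply: funext => j; rewrite big_ord0 addr0.
pose k0 := ev ord0; have vk0 : v k0 = 1 by exact: v1.
pose ev' := fun k => ev (lift ord0 k); have v1' k : v (ev' k) = 1 by exact: v1.
pose xx (x : R) j := x0 j + x * (k0 == j)%:R.
pose G x := complex.Re (integ (tiltf x0 k0 (poles ev') x)) / Zr.
(* The antiderivative of [G] that vanishes at infinity: the factor y_k brought down meets 1 / (-
   y_k), whence the sign. *)
pose F x := - (complex.Re (integ (tiltf x0 k0 (poles ev) x)) / Zr).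
have GE x : integ (fun s => cexp (qexp H (xx x) (y s)) * poles ev' (y s)) = integ (tiltf x0 k0 (poles ev') x).
  congr integ; apply: funext => s; rewrite /tiltf; congr (cexp _ * _).
  rewrite /qexp -addrA; congr (_ + _).
  transitivity (\sum_j ((x0 j)%:C * y s j + (if k0 == j then x%:C * y s j else 0))).
    apply: eq_bigr => j _; rewrite /xx rmorphD rmorphM /= mulrDl; congr (_ + _).
    by case: eqP => _; rewrite ?(rmorph1 (real_complex R)) ?(rmorph0 (real_complex R)) ?mulr1 ?mulr0 ?mul0r.
  rewrite big_split /=; congr (_ + _); rewrite -big_mkcond /= (bigD1 k0) //= big1 ?addr0 // => j /andP[/eqP -> ].
  by rewrite eqxx.
have inner x : int_pos_orthant (fun u : 'I_n -> R => (expR (- (quadf (invmx H)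
    (fun j => x0 j + \sum_(k < n.+1) ocons x u k * (ev k == j)%:R) / 2)))%:E) = (G x)%:E /\ 0 <= G x.
  have [h1 h2] := IH ev' (xx x) v1'; rewrite GE -/(G x) in h1 h2; split=> //.
  rewrite -h1.
  congr int_pos_orthant; apply: funext => u; congr ((expR (- (quadf _ _ / 2)))%:E).
  apply: funext => j; rewrite big_ord_recl /xx -addrA; congr (_ + (_ + _)).
    by rewrite /ocons unlift_none.
  by apply: eq_bigr => k _; rewrite /ocons liftK.
have G0 x : 0 <= G x by case: (inner x).
have gp := poles_growth v1; have gp' := poles_growth v1'.
have dF x : is_derive x (1 : R) F (G x).
  have h := is_deriveN (is_deriveZ Zr^-1 (tilt_is_derive x0 x vk0 gp)).
  have -> : F = - (Zr^-1 \*: (fun x => complex.Re (integ (tiltf x0 k0 (poles ev) x)))).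
    by apply: funext => t; exact: (congr1 -%R (mulrC _ _)).
  apply: (is_derive_eq h); rewrite /G.
  have [K _ hK] := tilt_dominated x0 vk0 gp'.
  have -> : tiltf x0 k0 (fun w => w k0 * poles ev w) x = fun s => (-1) * tiltf x0 k0 (poles ev') x s.
    apply: funext => s; rewrite /tiltf /poles big_ord_recl /= -/k0.
    by have y0 := ypt_neq0 s vk0; rewrite invrN; field.
  by rewrite (integZ _ (hK x)) mulN1r ReN scalerN opprK; exact: mulrC.
have cG : continuous G.
  move=> x; apply: differentiable_continuous; apply/derivable1_diffP.
  have h := is_deriveZ Zr^-1 (tilt_is_derive x0 x vk0 gp').
  have -> : G = Zr^-1 \*: (fun x => complex.Re (integ (tiltf x0 k0 (poles ev') x))).
    by apply: funext => t; exact: (mulrC _ _).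
  by case: h.
have Foo : F x @[x --> +oo%R] --> (0 : R).
  have [K K0 hK] := tilt_dominated x0 vk0 gp.
  have FK x : `|F x| <= K * 4 ^+ d / Zr * expR (- x).
    rewrite /F normrN normrM normfV (gtr0_norm Z0).
    rewrite [X in _ <= X](_ : _ = K * expR (- x) * 4 ^+ d / Zr); last by ring.
    rewrite ler_wpM2r ?invr_ge0 ?(ltW Z0) //.
    by apply: le_trans (cn_Re _) _; apply: integ_bound (hK x).
  have e0 : (fun x => K * 4 ^+ d / Zr * expR (- x)) @ +oo%R --> (0 : R).
    by rewrite -[X in _ --> X](mulr0 (K * 4 ^+ d / Zr)); apply: cvgMr; exact: cvgr_expR.
  apply/cvgrPdist_le => e ep; near=> x; rewrite sub0r normrN; apply: le_trans (FK x) _.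
  apply: le_trans (ler_norm _) _; near: x; exact: (@cvgr0_norm_le R R^o _ _ _ _ e0).
have F0 : F 0 = - (complex.Re (integ (fun s => cexp (qexp H x0 (y s)) * poles ev (y s))) / Zr).
  rewrite /F; congr (- (complex.Re (integ _) / _)); apply: funext => s.
  by rewrite /tiltf (rmorph0 (real_complex R)) mul0r addr0.
have FTC : (\int[lebesgue_measure]_(x in `[0%R : R, +oo[) (G x)%:E = (0 : R)%:E - (F 0)%:E)%E.
  apply: (@ge0_continuous_FTC2y R G F 0 0).
  - by move=> x _.
  - exact: continuous_subspaceT.
  - exact: Foo.
  - by move=> x _; case: (dF x).
  - apply: cvg_at_right_filter; apply: differentiable_continuous; apply/derivable1_diffP.
    by case: (dF 0).
  - by move=> x _; rewrite derive1E; case: (dF x).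
have res : (\int[lebesgue_measure]_(x in `]0%R : R, +oo[) int_pos_orthant (fun u : 'I_n -> R => (expR (- (quadf (invmx H)
    (fun j => x0 j + \sum_(k < n.+1) ocons x u k * (ev k == j)%:R) / 2)))%:E))%E =
  (complex.Re (integ (fun s => cexp (qexp H x0 (y s)) * poles ev (y s))) / Zr)%:E.
  under eq_integral do rewrite (inner _).1.
  rewrite integral_itv_obnd_cbnd; last first.
    by apply/measurable_realfun.measurable_EFinP; apply: measurable_funTS; exact: measurable_realfun.continuous_measurable_fun.
  by rewrite FTC F0 -EFinB sub0r opprK.
split; first exact: res.
rewrite -lee_fin -res; apply: integral_ge0 => x _; rewrite (inner x).1 lee_fin //.
Unshelve. all: by end_near.
Qed.

End PoleIntegral.

(** * Expansion of the normalised coefficient *)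

Section Assembly.
Variable R : realType.
Notation C := R[i].
Variables (d : nat) (lam : 'I_d -> R) (e0 : R).
Hypothesis e00 : 0 < e0.
Variables (p : mi d -> C) (Kp : R).
Hypothesis psumm : summable Kp (fun m => (expR (e0 * mabs R m))%:C * p m).
Hypothesis mom0 : csum p = 1.
Hypothesis mom1 : forall w, moment lam p 1 w = 0.
Variables (H : 'M[R]_d).
Hypothesis Hsym : forall i j, H i j = H j i.
Variable cH : R.
Hypothesis cH0 : 0 < cH.
Hypothesis Hpos : forall s, cH * nsq s <= quadf H s.
Hypothesis mom2 : forall w, moment lam p 2 w = 2^-1 * bilin H w w.
Variables (al : mi d -> C) (Ka : R).
Hypothesis asumm : summable Ka (fun m => (expR (e0 * mabs R m))%:C * al m).
Variables (D : {set 'I_d}) (z : 'I_d -> R).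
Hypothesis z1 : forall j, j \in D -> z j = 1.
Hypothesis z01 : forall j, j \notin D -> 0 <= z j < 1.
Notation v := (pole_shift R D).
Notation U n := (un R n)%:C.
Hypothesis far : forall eps, 0 < eps -> exists gam N, 0 < gam < 1 /\
  forall n s, (N <= n)%N -> inbox (un R n)^-1 s -> ~ near_origin eps n s -> cn (psi lam p v n s) <= gam.

Lemma quadf_subsq (M : 'M[R]_d) (u : 'I_#|D| -> R) :
  quadf (subsq M D) u = quadf M (fun j => \sum_k u k * (enum_val k == j)%:R).
Proof.
have sel (F : 'I_d -> R) (k : 'I_#|D|) : \sum_j (enum_val k == j)%:R * F j = F (enum_val k).
  rewrite (bigD1 (enum_val k)) //= eqxx mul1r big1 ?addr0 // => j jk.
  by rewrite eq_sym (negbTE jk) mul0r.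
rewrite /quadf; apply/esym.
transitivity (\sum_k \sum_i \sum_j u k * ((enum_val k == i)%:R * (M i j * \sum_l u l * (enum_val l == j)%:R))).
  rewrite [RHS]exchange_big; apply: eq_bigr => i _ /=; rewrite [RHS]exchange_big; apply: eq_bigr => j _ /=.
  by rewrite -[LHS]mulrA mulr_suml; apply: eq_bigr => k _; exact: (esym (mulrA _ _ _)).
apply: eq_bigr => k _; under eq_bigr do rewrite -mulr_sumr -mulr_sumr.
rewrite -mulr_sumr sel.
transitivity (u k * \sum_l u l * \sum_j (enum_val l == j)%:R * M (enum_val k) j).
  congr (_ * _); under [RHS]eq_bigr do rewrite mulr_sumr.
  by rewrite exchange_big; apply: eq_bigr => j _ /=; rewrite mulr_sumr; apply: eq_bigr => l _; ring.
by rewrite mulr_sumr; apply: eq_bigr => l _; rewrite sel mxE; ring.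
Qed.

Lemma gform_H : gform H.
Proof. by split=> //; exists cH. Qed.

Lemma det_H_gt0 : 0 < \det H.
Proof. by have [] := gaussZE gform_H. Qed.

Lemma unitmx_H : H \in unitmx.
Proof. by rewrite unitmxE unitfE gt_eqF // det_H_gt0. Qed.

Definition orthant_integral : R :=
  fine (int_pos_orthant (fun u : 'I_#|D| -> R => (expR (- quadf (subsq (invmx H) D) u / 2))%:E)).

Lemma kernelE w : kernel lam p D w = cexp (qexp H (fun _ => 0) w) * poles (fun k : 'I_#|D| => enum_val k) w.
Proof.
rewrite /kernel mom2 /qexp; congr (cexp _ * _); last exact: big_enum_val.
by rewrite [X in _ + X]big1 ?addr0 // => j _; rewrite mul0r.
Qed.

(** [pole_integral] speaks of the real part only. The reflection s -> - s conjugates y, hence the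
    integrand, so the integral is real. *)
Lemma kernel_integral : integ (fun s => kernel lam p D (ypt v s)) = orthant_integral%:C * gaussZ H.
Proof.
have v01 := pole_shift01 R D.
have v1 k : v (enum_val (k : 'I_#|D|)) = 1 by rewrite /pole_shift enum_valP.
have [h1 _] := pole_integral gform_H unitmx_H v01 (fun _ => 0) v1.
have [Z0 Ze] := gaussZ_real gform_H.
have -> : (fun s => kernel lam p D (ypt v s)) = fun s => cexp (qexp H (fun _ => 0) (ypt v s)) * poles (fun k : 'I_#|D| => enum_val k) (ypt v s).
  by apply: funext => s; rewrite kernelE.
set I := integ _ in h1 *.
have oE : orthant_integral = complex.Re I / complex.Re (gaussZ H).
  rewrite /orthant_integral -[RHS]/(fine (complex.Re I / complex.Re (gaussZ H))%:E) -h1.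
  congr (fine (int_pos_orthant _)); apply: funext => u; congr ((expR _)%:E).
  by rewrite quadf_subsq mulNr; congr (- (quadf _ _ / 2)); apply: funext => j; rewrite add0r.
have Ir : I^* = I.
  have [K K0 hK] := growth_dominated gform_H (fun _ => 0) 0 (poles_growth v1).
  have dI : dominated K (fun s => cexp (qexp H (fun _ => 0) (ypt v s)) * poles (fun k : 'I_#|D| => enum_val k) (ypt v s)).
    by move=> s; rewrite cnM cn_cexp; have := hK s; rewrite expr0 mul1r.
  rewrite /I -(integ_conj dI) -[RHS]integ_opp; congr integ; apply: funext => s.
  have yc j : ypt v (fun j => - s j) j = (ypt v s j)^*.
    by rewrite /ypt; apply: complex_eq; rewrite /=; ring.
  rewrite rmorphM /= -cexp_conj; congr (cexp _ * _).
    have q0 w : qexp H (fun _ => 0) w = 2^-1 * bilin H w w.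
      by rewrite /qexp big1 ?addr0 // => j _; rewrite mul0r.
    rewrite !q0 rmorphM fmorphV rmorph_nat; congr (_ * _).
    rewrite /bilin rmorph_sum; apply: eq_bigr => i _; rewrite rmorph_sum; apply: eq_bigr => j _.
    by rewrite !rmorphM /= !yc; congr (_ * _ * _); apply: complex_eq; rewrite /= ?oppr0.
  by rewrite /poles rmorph_prod; apply: eq_bigr => k _; rewrite fmorphV rmorphN /= yc.
have -> : I = (complex.Re I)%:C.
  by move: Ir; move: I {h1 oE} => [x y] [e1]; apply: complex_eq => //=; lra.
by rewrite oE Ze -rmorphM divfK // gt_eqF.
Qed.

Lemma gauss_constant : (2 * pi) ^- d * complex.Re (gaussZ H) = 1 / Num.sqrt ((2 * pi) ^+ d * \det H).
Proof.
have [d0 ->] := gaussZE gform_H; rewrite /=.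
have A0 : 0 < (2 * pi) ^+ d :> R by rewrite exprn_gt0 // mulr_gt0 // pi_gt0.
set A := (2 * pi) ^+ d in A0 *; have s0 : 0 < Num.sqrt (A * \det H) by rewrite sqrtr_gt0 mulr_gt0.
have e : Num.sqrt (A / \det H) * Num.sqrt (A * \det H) = A.
  rewrite -sqrtrM ?divr_ge0 ?(ltW A0) ?(ltW d0) // [X in Num.sqrt X](_ : _ = A ^+ 2); last by field; rewrite gt_eqF.
  by rewrite sqrtr_sqr gtr0_norm.
apply: (mulIf (lt0r_neq0 s0)); rewrite -mulrA e mulVf ?divfK ?gt_eqF //.
Qed.

(** The functions [f] depend on delta alone, and all bounds are uniform over |dl_j| <= b; this is
    what allows them to be chosen before [kappa]. *)
Lemma coefficient_expansion r : (0 < r)%N -> exists f : nat -> ('I_d -> R) -> C,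
  [/\ forall k b, exists c, forall dl, dbound b dl -> cn (f k dl) <= c,
      forall dl, f 0%N dl = csum al * \prod_j (if j \in D then 1 else (1 - (z j)%:C)^-1) *
        (1 / Num.sqrt ((2 * pi) ^+ d * \det H))%:C * orthant_integral%:C,
      D = finset.set0 -> forall k dl, odd k -> f k dl = 0 &
      forall b, exists K N, 0 <= K /\ forall n dl, (N <= n)%N -> dbound b dl ->
        cn (((2 * pi / un R n) ^- d)%:C * integ (onbox (un R n)^-1 (integrand lam p al D z n dl)) / U n ^+ #|~: D| -
            \sum_(k < r) f k dl * U n ^+ k) <= K * un R n ^+ r].
Proof.
move=> r0; have [P [P1 P2 P3 P4]] := integral_expansion e00 psumm mom0 mom1 Hsym cH0 Hpos mom2 asumm z1 z01 far r0.
pose g k dl := integ (fun s => P k dl (ypt v s) * kernel lam p D (ypt v s)).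
have A0 : 0 < (2 * pi) ^+ d :> R by rewrite exprn_gt0 // mulr_gt0 // pi_gt0.
have dk := dominated_kernel Hsym cH0 Hpos mom2.
have dl_bound (dl : 'I_d -> R) : dbound (\sum_j `|dl j|) dl.
  by move=> j; rewrite (bigD1 j) //= lerDl sumr_ge0.
exists (fun k dl => ((2 * pi) ^- d)%:C * g k dl); split.
- move=> k b; have [K hK] := dk _ _ b (P2 k).
  exists (cn ((2 * pi) ^- d)%:C * (K * 4 ^+ d)) => dl db; rewrite cnM ler_wpM2l ?cn_ge0 //.
  exact: integ_bound (hK dl db).
- move=> dl; rewrite /g; have [K hK] := dk _ _ 0 (pbound_cst v (1 : C)).
  have z0 : dbound 0 (fun _ : 'I_d => 0 : R) by move=> j; rewrite normr0.
  have dker : dominated K (fun s => kernel lam p D (ypt v s)).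
    by move=> s; have := hK _ z0 s; rewrite mul1r.
  have -> : (fun s => P 0%N dl (ypt v s) * kernel lam p D (ypt v s)) = fun s => lead al D z * kernel lam p D (ypt v s).
    by apply: funext => s; rewrite P3.
  rewrite (integZ _ dker) kernel_integral (gaussZ_real gform_H).2 -gauss_constant rmorphM /= /lead mulr1; ring.
- move=> D0 k dl ok; have [K /(_ dl (dl_bound dl)) hK] := dk _ _ (\sum_j `|dl j|) (P2 k).
  suff gz : g k dl = - g k dl.
    have : g k dl + g k dl = 0 by rewrite {1}gz addNr.
    by rewrite -mulr2n => /eqP; rewrite mulrn_eq0 /= => /eqP ->; rewrite mulr0.
  rewrite /g -[LHS]integ_opp -mulN1r -(integZ _ hK); congr integ; apply: funext => s.
  have v0 j : v j = 0 by rewrite /pole_shift D0 inE.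
  have -> : ypt v (fun j => - s j) = fun j => - ypt v s j.
    by apply: funext => j; rewrite /ypt v0 (rmorph0 (real_complex R)) rmorphN; ring.
  have ker_even : kernel lam p D (fun j => - ypt v s j) = kernel lam p D (ypt v s).
    have e1 : moment lam p 2 (fun j => - ypt v s j) = moment lam p 2 (ypt v s).
      by have := moment_parity lam e00 psumm 2 dl (ypt v s); rewrite sqrrN expr1n mul1r.
    by rewrite /kernel e1 !big_pred0 // => j; rewrite D0 inE.
  by rewrite ker_even P1 -signr_odd ok expr1 mulrA.
move=> b; have [K [N [K0 hK]]] := P4 b; exists ((2 * pi) ^- d * K), N.+1; split.
  by rewrite mulr_ge0 // invr_ge0 ltW.
move=> n dl Nn db; have n0 : (0 < n)%N by apply: leq_trans Nn.
have u0 := un_gt0 R n0; have uC := unC_neq0 R n0; have := hK n dl (ltnW Nn) db.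
set I := integ _; move=> h.
have card : (#|D| + #|~: D| = d)%N by rewrite cardsC card_ord.
(* The factor u^d of the substitution splits as u^{|D|} u^{|~D|}: the first power cancels the poles,
   the second is the n^{-|S|/2} of the statement. *)
have e1 : ((2 * pi / un R n) ^- d)%:C * I / U n ^+ #|~: D| = ((2 * pi) ^- d)%:C * (U n ^+ #|D| * I).
  have -> : ((2 * pi / un R n) ^- d)%:C = ((2 * pi) ^- d)%:C * (U n ^+ #|D| * U n ^+ #|~: D|).
    rewrite -exprD card -rmorphXn -rmorphM; congr _%:C.
    by rewrite expr_div_n invf_div mulrC.
  have cancel (k a c i : C) : c != 0 -> k * (a * c) * i / c = k * (a * i) by move=> c0; field.
  by rewrite cancel // expf_neq0.
rewrite e1 (_ : \sum_(k < r) _ = ((2 * pi) ^- d)%:C * \sum_(k < r) U n ^+ k * g k dl); last first.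
  by rewrite mulr_sumr; apply: eq_bigr => k _; ring.
rewrite -mulrBr cnM cn_real ger0_norm ?invr_ge0 ?(ltW A0) // -[X in _ <= X]mulrA ler_wpM2l //.
by rewrite invr_ge0 ltW.
Qed.

End Assembly.

(** * The degenerate case of the zero series *)

Section ZeroSeries.
Variable R : realType.
Notation C := R[i].

Lemma coef_zero_series d (a : mi d -> C) (b : mi d -> C) n kap : (forall m, b m = 0) -> (0 < n)%N ->
  coef_div_prod (ps_mul a (ps_pow b n)) kap = 0.
Proof.
move=> b0; case: n => // n _.
have e1 m : ps_pow b n.+1 m = 0.
  by rewrite /ps_pow iterS /ps_mul /msum_le big1 // => p _; rewrite b0 mul0r.
rewrite /coef_div_prod /msum_le big1 // => p _; rewrite /ps_mul /msum_le big1 // => p' _.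
by rewrite e1 mulr0.
Qed.

Lemma ps_val_nn_zero d (b : mi d -> R) x : (forall m, b m = 0) -> ps_val_nn b x = 0.
Proof.
by move=> b0; rewrite /ps_val_nn esum1 // => m _; rewrite b0 mul0r.
Qed.

End ZeroSeries.

Theorem theorem15 (R : realType) (d : nat)
  (b : mi d -> R) (Om : set 'rV[R]_d) (lam tau : 'rV[R]_d) (a : mi d -> R[i])
  (hb_nonneg : forall m, 0 <= b m)
  (hb_full : full_rank b)
  (hb_aper : aperiodic b)
  (hOm_open : open Om) (hOm0 : Om 0)
  (hb_conv : converges_on b Om)
  (hlam : forall j : 'I_d, 0 < lam 0 j)
  (htau : Psi Om tau)
  (htau_min : forall t, Psi Om t -> t != tau ->
      Kfun b tau - dotv lam tau < Kfun b t - dotv lam t)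
  (hbd : no_inf_on_boundary (fun t => Kfun b t - dotv lam t) (Psi Om))
  (hzeta1 : forall j : 'I_d, (vexp tau) 0 j <= 1)
  (hA : analytic_on_torus a (vexp tau))
  (hA0 : ps_val_C a (vexp tau) != 0) :
  let zeta := vexp tau in
  let S := [set j : 'I_d | zeta 0 j < 1]%SET in
  let C := [set j : 'I_d | zeta 0 j == 1]%SET in
  let H := hessian (Kfun b) tau in
  let M := subsq (invmx H) C in
  let a0 : R[i] :=
    ps_val_C a zeta / real_complex R (\prod_(j in S) (1 - zeta 0 j))
    * real_complex R (1 / Num.sqrt ((2 * pi) ^+ d * \det H))
    * real_complex R (fine (int_pos_orthant
          (fun u : 'I_#|C| -> R => (expR (- quadf M u / 2))%:E))) in
  forall r : nat, (1 <= r)%N ->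
  exists f : nat -> 'rV[R]_d -> R[i],
  forall kappa : nat -> mi d,
    (exists c : R, forall (n : nat) (j : 'I_d),
        `|(kappa n j)%:R - lam 0 j * n%:R| <= c) ->
    let delta := fun n : nat => \row_(j < d) ((kappa n j)%:R - lam 0 j * n%:R) in
    [/\ (* coefficients bounded in n *)
        forall k : nat, (k < r)%N ->
          exists c : R, forall n : nat, `|f k (delta n)| <= real_complex R c,
        (* a_{0,n} = a_0 *)
        forall n : nat, f 0%N (delta n) = a0,
        (* C empty => odd coefficients vanish *)
        C = finset.set0 -> forall k n : nat, odd k -> f k (delta n) = 0 &
        (* the expansion with O(n^{-r/2}) remainder *)
        exists (E : nat -> R[i]) (c : R) (N : nat),
          forall n : nat, (N <= n)%N ->
            `|E n| <= real_complex R (c / Num.sqrt (n%:R) ^+ r) /\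
            coef_div_prod (ps_mul a (ps_pow (fun m => real_complex R (b m)) n)) (kappa n)
            = real_complex R (ps_val_nn b zeta ^+ n / mono zeta (kappa n)
                              / Num.sqrt (n%:R) ^+ #|S|)
              * (\sum_(k < r) f k (delta n) * real_complex R (Num.sqrt (n%:R) ^- k)
                 + E n)].
Proof.
move=> zeta S D H M a0 r r1.
(* Full rank provides a nonzero coefficient when d > 0. For d = 0 the series may be zero, and then
   both sides vanish for n >= 1. *)
have [[ms bms]|no] := pselect (exists ms, b ms != 0); last first.
  have bz m : b m = 0 by apply/eqP/negPn/negP => bm; apply: no; exists m.
  exists (fun k _ => if k == 0%N then a0 else 0) => kappa _ delta; split=> //.
  - move=> k _; exists (cn a0) => n; rewrite cnE lecR.
    by case: eqP => _ //; rewrite cn0 cn_ge0.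
  - by move=> _ [|k] n.
  exists (fun _ => 0), 0, 1%N => n n1; split; first by rewrite normr0 mul0r.
  rewrite coef_zero_series // => [|m]; last by rewrite bz.
  have -> : ps_val_nn b zeta ^+ n = 0 by rewrite ps_val_nn_zero // expr0n gtn_eqF.
  by rewrite !mul0r.
pose z j := zeta 0 j; have z0 j : 0 < z j by exact: vexp_gt0.
have [e1 e10 [mb Hess]] := hessian_Kfun hb_nonneg hOm_open hb_conv htau bms.
have [ea' ea'0 hfin] := hA.
have [ea ea0 hea] := exp_margin z0 ea'0.
pose al m := wt (fun j => (z j)%:C) m * a m.
pose e0 : R := Num.min e1 ea.
have e00 : 0 < e0 by rewrite lt_min e10 ea0.
have asumm : exists Ka, summable Ka (fun m => (expR (e0 * mabs R m))%:C * al m).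
  have c0 m : 0 <= complex.Re `|a m| * \prod_(i < d) (zeta 0 i + ea') ^+ m i.
    rewrite mulr_ge0 ?cn_ge0 // prodr_ge0 // => i _; rewrite exprn_ge0 // addr_ge0 ?(ltW ea'0) //.
    exact: ltW (z0 i).
  have [hS _] := esum_csum c0 hfin.
  exists (fine (\esum_(m in [set: mi d]) (complex.Re `|a m| * \prod_(i < d) (zeta 0 i + ea') ^+ m i)%:E)%E) => N.
  apply: le_trans (hS N); apply: ler_sum => m _.
  have wz : cn (wt (fun j => (z j)%:C) m) = \prod_j z j ^+ m j.
    by rewrite -mono_wt cn_real gtr0_norm // mono_gt0.
  rewrite /al !cnM wz cn_real ger0_norm ?expR_ge0 // mulrA mulrC ler_wpM2l ?cn_ge0 //.
  apply: le_trans (hea m); rewrite mulrC ler_wpM2l ?prodr_ge0 // => [j _|].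
    by rewrite exprn_ge0 // ltW.
  by rewrite ler_expR ler_wpM2r ?mabs_ge0 // ge_min lexx orbT.
have [Ka {}asumm] := asumm.
pose wc := wcoef b tau; have wm : margin e0 wc.
  by apply: margin_le mb; rewrite ?(ltW e00) // ge_min lexx.
have z0e j : `|(fun _ : 'I_d => 0 : R) j| <= e1 by rewrite normr0 ltW.
pose B := csumR wc; have B0 : 0 < B.
  by have := mgf_gt0 hb_nonneg bms mb z0e; rewrite mgf0.
have BE : ps_val_nn b zeta = B.
  have := @ps_val_shift R d b Om tau hb_nonneg hb_conv (fun _ => 0).
  by rewrite shift0 mgf0; apply.
pose p m := B^-1 * wc m.
have p0 m : 0 <= p m by rewrite mulr_ge0 ?invr_ge0 ?(ltW B0) // wcoef_ge0.
have pm : margin e0 p.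
  have := summZ B^-1 wm; rewrite /margin; congr (summ _); apply: funext => m.
  by rewrite /p mulrCA.
have ws : summ wc := margin_summ e00 wm.
have p1 : csumR p = 1 by rewrite csumRZ // mulVf // gt_eqF.
have ts j : summ (tcoef j wc).
  by apply: (margin_summ _ (margin_tcoef j e00 wm)); rewrite divr_gt0.
have tts i j : summ (tcoef i (tcoef j wc)).
  have e2 : 0 < e0 / 2 by rewrite divr_gt0.
  by apply: (margin_summ _ (margin_tcoef i e2 (margin_tcoef j e00 wm))); rewrite divr_gt0.
have tp j : tcoef j p = fun m => B^-1 * tcoef j wc m.
  by apply: funext => m; rewrite /tcoef /p mulrCA.
have mean j : csumR (tcoef j wc) = lam 0 j * B.
  by have := mean_lam hb_nonneg hOm_open hb_conv htau bms htau_min j; rewrite !mgf0.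
have Bn : B != 0 by rewrite gt_eqF.
have pmean j : csumR (tcoef j p) = lam 0 j.
  by rewrite tp csumRZ // mean mulrCA mulVf // mulr1.
have HE i j : H i j = csumR (tcoef i (tcoef j p)) - lam 0 i * lam 0 j.
  have -> : tcoef i (tcoef j p) = fun m => B^-1 * tcoef i (tcoef j wc) m.
    by rewrite tp; apply: funext => m; rewrite /tcoef mulrCA.
  rewrite csumRZ // /H Hess !mgf0 -/B !mean; field; exact: Bn.
have pb m : (p m != 0) = (b m != 0).
  rewrite /p /wc /wcoef !mulf_eq0 invr_eq0 (negbTE Bn) /=.
  by rewrite (gt_eqF (mono_gt0 _ _)) orbF.
have p_full : full_rank p.
  by have [P [Q [PQ rD]]] := hb_full; exists P, Q; split=> // k; rewrite !pb.
have p_aper : aperiodic p.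
  move=> [q [pp [s [h1 h2 h3]]]]; apply: hb_aper; exists q, pp, s; split=> // n bn.
  by apply: h3; rewrite pb.
have Hsym := covariance_sym e00 pm p1 pmean HE.
have [cH cH0 Hpos] : exists2 c, 0 < c & forall s, c * nsq s <= quadf H s.
  have [P [Q [PQ rD]]] := p_full.
  exact: (covariance_coercive e00 p0 pm p1 pmean HE PQ rD).
have mom1 := moment1_eq0 e00 pm p1 pmean.
have mom2 := moment2_bilin e00 pm p1 pmean HE.
have mom0 : csum (fun m => (p m)%:C) = 1.
  by rewrite csumRE ?p1 ?(rmorph1 (real_complex R)) //; exact: margin_summ e00 pm.
have [Kp psumm] : exists K, summable K (fun m => (expR (e0 * mabs R m))%:C * (p m)%:C).
  have [K hK] := pm; exists K; move: hK; congr (summable K _); apply: funext => m.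
  exact: rmorphM.
have z1 j : j \in D -> z j = 1 by rewrite inE => /eqP.
have z01 j : j \notin D -> 0 <= z j < 1.
  rewrite inE => zj; rewrite (ltW (z0 j)) /= lt_neqAle zj; exact: hzeta1.
have v01 := pole_shift01 R D.
have far := psi_far (fun j => lam 0 j) e00 p0 pm p1 p_full p_aper v01.
have [f [f1 f2 f3 f4]] := coefficient_expansion e00 psumm mom0 mom1 Hsym cH0 Hpos mom2 asumm z1 z01 far r1.
exists (fun k dl => f k (fun j => dl 0 j)) => kappa [c kc] delta.
have db n : dbound c (fun j => delta n 0 j) by move=> j; rewrite mxE.
have SD : S = ~: D.
  by apply/setP => j; rewrite !inE lt_neqAle hzeta1 andbT.
split.
- by move=> k _; have [c' h] := f1 k c; exists c' => n; rewrite cnE lecR h.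
- move=> n; rewrite f2 /a0 (ps_val_C_csum (summable_expR_drop e00 asumm)).
  congr (_ * _ * _); congr (_ * _); rewrite -fmorphV rmorphV ?unitfE; last first.
    by rewrite gt_eqF // prodr_gt0 // => j; rewrite inE subr_gt0.
  rewrite rmorph_prod -prodfV [RHS]big_mkcond; apply: eq_bigr => j _.
  rewrite SD finset.in_setC; case: (j \in D) => //=.
  by rewrite rmorphB /= (rmorph1 (real_complex R)).
- by move=> D0 k n ok; apply: f3.
have [K [N [K0 hK]]] := f4 c.
(* The coefficient divided by its prefactor. The error term is defined as the difference between
   [X n] and the finite sum, so the claimed identity reduces to Cauchy's formula. *)
pose X n := ((2 * pi / un R n) ^- d)%:C * integ (onbox (un R n)^-1
  (integrand (fun j => lam 0 j) (fun m => (p m)%:C) al D z n (fun j => delta n 0 j))) / (un R n)%:C ^+ #|~: D|.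
(* [maxn N 1] excludes n = 0, where [un] is 0 by the convention for inverses. *)
exists (fun n => X n - \sum_(k < r) f k (fun j => delta n 0 j) * (un R n)%:C ^+ k), K, (maxn N 1).
move=> n; rewrite geq_max => /andP[Nn n0]; split.
  by rewrite cnE lecR; have := hK n _ Nn (db n); rewrite /un exprVn.
have u0 := un_gt0 R n0; have uC := unC_neq0 R n0.
have BC : B%:C != 0 :> R[i] by rewrite -cn_gt0 cn_real normr_gt0.
have pE m : B%:C^-1 * wt (fun j => (z j)%:C) m * (b m)%:C = (p m)%:C.
  by rewrite -mono_wt -fmorphV -!rmorphM; congr _%:C; rewrite /p /wc /wcoef; ring.
have bs : summable (csumR p) (fun m => B%:C^-1 * wt (fun j => (z j)%:C) m * (b m)%:C).
  move=> N'; apply: le_trans (csumR_ge N' p0 (margin_summ e00 pm)); apply: ler_sum => m _.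
  by rewrite pE cn_real ger0_norm.
have zu j : z j * expR (- (un R n * pole_shift R D j)) < 1.
  rewrite /pole_shift; case: (boolP (j \in D)) => jD /=.
    by rewrite z1 // mul1r mulr1 -expR0 ltr_expR oppr_lt0.
  by rewrite mulr0 oppr0 expR0 mulr1; case/andP: (z01 j jD).
have v0 j : 0 <= pole_shift R D j by case/andP: (v01 j).
have cf := coef_formula (kappa n) n u0 z0 zu v0 BC (summable_expR_drop e00 asumm) bs.
have XE : X n = wt (fun j => (z j)%:C) (kappa n) * B%:C ^- n *
    coef_div_prod (ps_mul a (ps_pow (fun m => (b m)%:C) n)) (kappa n) / (un R n)%:C ^+ #|~: D|.
  rewrite cf /X; apply: (congr1 (fun x => x / _)); apply: (congr1 (fun x => _ * x)).
  apply: (congr1 (fun h => integ (onbox _ h))); apply: funext => s; cbv beta zeta.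
  rewrite /integrand (psi_charf (fun j => lam 0 j) e00 p0 pm v01) exprMn.
  set w := fun j => (un R n)%:C * ypt (pole_shift R D) s j.
  have ev (F : mi d -> R[i]) : evls (fun _ => 0) F w = evl F w.
    by congr csum; apply: funext => m; rewrite linl0E.
  rewrite /charf !ev (_ : (fun m => _ * (b m)%:C) = fun m => (p m)%:C); last by apply: funext => m; exact: pE.
  set A1 := evl _ w; set A2 := evl _ w; set A3 := \prod_j _.
  (* kappa = n lam + delta: the first part centres the n-th power of the characteristic function,
     the second remains as a bounded factor. *)
  have -> : cexp (- lin w (kappa n)) = cexp (- \sum_j (lam 0 j)%:C * w j) ^+ n * cexp (- \sum_j (delta n 0 j)%:C * w j).
    rewrite -cexpM_natl -cexpD mulrN -opprD; congr (cexp (- _)).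
    rewrite mulr_sumr -big_split; apply: eq_bigr => j _ /=.
    by rewrite mxE rmorphB rmorphM /= !rmorph_nat; ring.
  ring.
have wk : wt (fun j => (z j)%:C) (kappa n) = (mono zeta (kappa n))%:C by rewrite mono_wt.
have mk0 : (mono zeta (kappa n))%:C != 0 :> R[i].
  by rewrite -cn_gt0 cn_real normr_gt0 gt_eqF // mono_gt0.
rewrite (_ : \sum_(k < r) _ = \sum_(k < r) f k (fun j => delta n 0 j) * (un R n)%:C ^+ k); last first.
  by apply: eq_bigr => k _; congr (_ * _); rewrite -rmorphXn /un exprVn.
rewrite addrC subrK XE wk BE SD.
have -> : Num.sqrt n%:R ^+ #|~: D| = un R n ^- #|~: D| by rewrite /un exprVn invrK.
rewrite invrK !rmorphM fmorphV !rmorphXn /=.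
move: (expf_neq0 #|~: D| uC) (expf_neq0 n BC) mk0.
move: (B%:C ^+ n) ((un R n)%:C ^+ _) (mono _ _)%:C (coef_div_prod _ _) => b1 b2 b3 b4 h1 h2 h3.
by field; rewrite h1 h2 h3.
Qed.
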